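(* Let $s>1/2$ and $r_1,r_2\ge 2$. Let $\beta_1,\beta_2$ be integrable kernels on $\mathbb{R}$ with $0\le\widehat{\beta_i}(\xi)\le C_i(1+\xi^2)^{-r_i/2}$ for all $\xi\in\mathbb{R}$ and some constants $C_i>0$ ($i=1,2$), and let $g_1,g_2\in C^\infty(\mathbb{R}^2)$ be real valued with $g_1(0)=g_2(0)=0$ and $\partial g_1/\partial u_2=\partial g_2/\partial u_1$. Then for initial data $\varphi_i,\psi_i\in H^s$ ($i=1,2$) there is some $T>0$ such that the Cauchy problem $$u_{1tt}=(\beta_1*(u_1+g_1(u_1,u_2)))_{xx},\qquad u_{2tt}=(\beta_2*(u_2+g_2(u_1,u_2)))_{xx},\qquad x\in\mathbb{R},\ t>0,$$ $$u_i(x,0)=\varphi_i(x),\qquad u_{it}(x,0)=\psi_i(x)\qquad(i=1,2)$$ is well posed with solution $u_1,u_2\in C^2([0,T],H^s)$.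
   Context: $H^s=H^s(\mathbb{R})$ is the $L^2$-based Sobolev space of real-valued functions with norm $\|u\|_s^2=\int_{\mathbb{R}}(1+\xi^2)^s|\hat u(\xi)|^2\,d\xi$, where the Fourier transform convention is $\hat v(\xi)=\int_{\mathbb{R}}e^{-i\xi x}v(x)\,dx$. The symbol $*$ denotes convolution in the spatial variable, $\beta*v=\int_{\mathbb{R}}\beta(x-y)v(y)\,dy$. Subscripts $x,t$ denote partial derivatives. The exponents $r_1,r_2$ are real, not necessarily integers. ''Well posed'' is meant in the usual (Hadamard) sense: existence and uniqueness of a solution in the indicated class, and continuous dependence on the initial data. *)

(* Defs.v *)
From HB Require Import structures.
From mathcomp Require Import all_boot all_order all_algebra.
From mathcomp Require Import all_classical all_reals all_analysis.
From mathcomp Require Import complex.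

Set Implicit Arguments.
Unset Strict Implicit.
Unset Printing Implicit Defensive.

Import Order.TTheory GRing.Theory Num.Theory.
Import numFieldNormedType.Exports.
Local Open Scope classical_set_scope.
Local Open Scope ring_scope.
Local Open Scope complex_scope.

Section Defs.
Context {R : realType}.
Local Notation mu := (@lebesgue_measure R).

(* [int exp(-i xi x) v(x) dx] for a real-valued integrable [v]. *)
Definition fourier (v : R -> R) (xi : R) : R[i] :=
  (\int[mu]_x (v x * cos (xi * x)))%R -i* (\int[mu]_x (v x * sin (xi * x)))%R.

Definition sqnormc (z : R[i]) : R := complex.Re z ^+ 2 + complex.Im z ^+ 2.

(* Plancherel's extension to L^2: [w] is the L^2-limit of the transforms of the
   truncations of [v] to [-n, n]. *)
Definition is_fourierL2 (v : R -> R) (w : R -> R[i]) : Prop :=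
  [/\ measurable_fun setT (fun xi => complex.Re (w xi)),
      measurable_fun setT (fun xi => complex.Im (w xi)) &
      (\int[mu]_xi
         (sqnormc (fourier (v \* \1_(`[- n%:R, n%:R])) xi - w xi))%:E)%E
        @[n --> \oo] --> 0%E].

(* For [v] in L^2 such a [w] exists and is unique up to a null set. *)
Definition fourierL2 (v : R -> R) : R -> R[i] :=
  xget (fun=> 0) [set w | is_fourierL2 v w].

Definition Hs_norm (s : R) (v : R -> R) : \bar R :=
  ((\int[mu]_xi ((1 + xi ^+ 2) `^ s * sqnormc (fourierL2 v xi))%:E) `^ 2^-1)%E.

(* Only meaningful for [s >= 0], when H^s is contained in L^2. Elements are
   representatives: equality in H^s is almost everywhere equality. *)
Definition Hs (s : R) : set (R -> R) :=
  [set v | v \in Lfun mu 2%:E /\ (Hs_norm s v < +oo)%E].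

(* A curve in H^s is a function [u t x] of time and space. *)
Definition Hs_continuous (s T : R) (u : R -> R -> R) : Prop :=
  forall t, t \in `[0, T] ->
    Hs_norm s (u t' \- u t) @[t' --> within `[0, T] (nbhs t)] --> 0%E.

Definition Hs_is_derive (s T : R) (u v : R -> R -> R) : Prop :=
  forall t, t \in `[0, T] ->
    Hs_norm s (fun x => (t' - t)^-1 * (u t' x - u t x) - v t x)
      @[t' --> within `[0, T] t^'] --> 0%E.

(* [u] is in C^2([0, T], H^s), with derivatives [ut] and [utt]; continuity of
   [u] and [ut] follows from their differentiability. *)
Definition C2_Hs (s T : R) (u ut utt : R -> R -> R) : Prop :=
  [/\ forall t, t \in `[0, T] -> [/\ Hs s (u t), Hs s (ut t) & Hs s (utt t)],
      Hs_is_derive s T u ut, Hs_is_derive s T ut utt &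
      Hs_continuous s T utt].

Definition C2_Hs_norm_le (s T : R) (u : R -> R -> R) (e : R) : Prop :=
  exists ut utt, C2_Hs s T u ut utt /\
    forall t, t \in `[0, T] ->
      (Hs_norm s (u t) + Hs_norm s (ut t) + Hs_norm s (utt t) <= e%:E)%E.

(* All partial derivatives of order at most [n] exist and are continuous. *)
Fixpoint Cn2 (n : nat) (g : R * R -> R) : Prop :=
  continuous g /\
  if n is m.+1 then
    [/\ forall p, derivable g p (1, 0), forall p, derivable g p (0, 1),
        Cn2 m ('D_(1, 0) g) & Cn2 m ('D_(0, 1) g)]
  else True.

Definition smooth2 (g : R * R -> R) : Prop := forall n, Cn2 n g.

Definition test_function (h : R -> R) : Prop :=
  (forall n x, derivable (derive1n n h) x 1) /\
  compact (closure [set x | h x != 0]).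

Definition is_weak_derive (n : nat) (f w : R -> R) : Prop :=
  [/\ locally_integrable setT f, locally_integrable setT w &
      forall h, test_function h ->
        (\int[mu]_x (f x * derive1n n h x))%R =
        (-1) ^+ n * (\int[mu]_x (w x * h x))%R].

Definition conv (b v : R -> R) (x : R) : R := (\int[mu]_y (b (x - y) * v y))%R.

(* The components 1 and 2 of the system are indexed by [0] and [1 : 'I_2]. *)
Definition is_solution (s T : R) (beta : 'I_2 -> R -> R)
    (g : 'I_2 -> R * R -> R) (phi psi : 'I_2 -> R -> R)
    (u : 'I_2 -> R -> R -> R) : Prop :=
  exists ut utt : 'I_2 -> R -> R -> R, forall i : 'I_2,
    [/\ C2_Hs s T (u i) (ut i) (utt i),
        ae_eq mu setT (u i 0) (phi i),
        ae_eq mu setT (ut i 0) (psi i) &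
        forall t, t \in `]0, T] ->
          is_weak_derive 2
            (conv (beta i) (fun x => u i t x + g i (u 0 t x, u 1 t x)))
            (utt i t)].

Definition Hs_data (s : R) (phi psi : 'I_2 -> R -> R) : Prop :=
  forall i, Hs s (phi i) /\ Hs s (psi i).

Definition data_dist (s : R) (phi psi phi' psi' : 'I_2 -> R -> R) : \bar R :=
  (\sum_(i < 2) (Hs_norm s (phi' i \- phi i)%R + Hs_norm s (psi' i \- psi i)%R))%E.

(* Hadamard well-posedness on [0, T] near the datum [(phi, psi)]: for all data
   in some H^s-ball around it there is a unique solution in C^2([0, T], H^s),
   and the solution map is continuous from this ball to C^2([0, T], H^s). *)
Definition well_posed (s T : R) (beta : 'I_2 -> R -> R)
    (g : 'I_2 -> R * R -> R) (phi psi : 'I_2 -> R -> R) : Prop :=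
  exists2 rho : R, 0 < rho & forall phi1 psi1,
    Hs_data s phi1 psi1 -> (data_dist s phi psi phi1 psi1 < rho%:E)%E ->
    [/\ exists u, is_solution s T beta g phi1 psi1 u,
        forall u v, is_solution s T beta g phi1 psi1 u ->
          is_solution s T beta g phi1 psi1 v ->
          forall i t, t \in `[0, T] -> ae_eq mu setT (u i t) (v i t) &
        forall eps : R, 0 < eps -> exists2 delta : R, 0 < delta &
          forall phi2 psi2 u v, Hs_data s phi2 psi2 ->
            (data_dist s phi1 psi1 phi2 psi2 < delta%:E)%E ->
            is_solution s T beta g phi1 psi1 u ->
            is_solution s T beta g phi2 psi2 v ->
            forall i, C2_Hs_norm_le s T (fun t => v i t \- u i t) eps].

End Defs.

(* Main.v *)
From HB Require Import structures.
Require Import Defs.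
From mathcomp Require Import all_boot all_order all_algebra.
From mathcomp Require Import all_classical all_reals all_analysis.
From mathcomp Require Import measurable_realfun complex.
From mathcomp Require Import ring lra.
Set Implicit Arguments.
Unset Strict Implicit.
Unset Printing Implicit Defensive.
Import Order.TTheory GRing.Theory Num.Theory.
Import numFieldNormedType.Exports.
Local Open Scope classical_set_scope.
Local Open Scope ring_scope.
Local Open Scope complex_scope.

(** The system is an ordinary differential equation in disguise. Since the transform of
    [beta_i] decays like [|xi|^-2] or faster, the operator [h |-> (beta_i * h)_xx] has a
    bounded Fourier multiplier and maps H^s to itself: the two derivatives cost nothing.
    So [(u, u_t)] solves a first-order equation in H^s whose right-hand side combines this
    bounded operator with the superposition operators [u |-> g_i(u_1, u_2)], and these
    are locally Lipschitz on H^s for [s > 1/2]. Picard-Lindelof and Gronwall give the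
    theorem.

    The analytic core is therefore the superposition operator (Lemmas [composition] and
    [comp_lipschitz_self]). For [s > 1/2] balls of H^s are bounded in the supremum norm
    ([embedding]), so a smooth [g] acts on them as a Lipschitz function, which gives the
    Lipschitz bound in L^2. A Lipschitz bound in H^t controls the differences
    [g(u(x + z)) - g(u(x))] in H^t, and these differences detect a further fraction
    [s - t] of a derivative ([besov_transfer]); so [g(u)] is bounded in H^s for
    [s < t + 1]. Applied to [g(x, y) = x y] this makes H^s an algebra, and writing
    [g(u) - g(v)] as an average of gradients of [g] times [u - v] turns boundedness in H^s
    into a Lipschitz bound in H^s. Alternating the two steps climbs from L^2 to any [s].

    On the Fourier side everything rests on Plancherel's identity ([plancherel_L1]), obtained
    by regularizing the power spectrum with [exp(-e |xi|)], whose transform is the Poisson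
    kernel, and on the closedness of the graph of the transform in L^2
    ([is_fourierL2_closed]). The multiplier is identified with the weak second derivative
    through second difference quotients ([second_derivative_conv]), and weak derivatives are
    unique by testing against bump functions ([weak_derive_unique]).

    Existence and uniqueness for the differential equation are proved for a field that is
    Lipschitz on balls of a complete seminormed space ([ode_existence], [gronwall]). For
    well-posedness the existence time must be uniform near a datum ([flow_exists]), and every
    solution in the sense of the statement must be an integral curve ([solution_flow]). *)

(** * Square-integrable functions *)

Section SquareIntegrable.
Context {R : realType}.
Local Notation mu := (@lebesgue_measure R).
Implicit Types f g : R -> R.

Lemma ae_impl (P Q : R -> Prop) :
  {ae mu, forall x, P x} -> (forall x, P x -> Q x) -> {ae mu, forall x, Q x}.
Proof. by move=> aP PQ; apply: filterS aP => //; exact: (ae_filter_ringOfSetsType mu). Qed.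

Lemma ae_impl2 (P Q S : R -> Prop) :
  {ae mu, forall x, P x} -> {ae mu, forall x, Q x} ->
  (forall x, P x -> Q x -> S x) -> {ae mu, forall x, S x}.
Proof. by move=> aP aQ PQS; apply: filterS2 aP aQ => //; exact: (ae_filter_ringOfSetsType mu). Qed.

(** Squared norms are kept in the extended reals, so that the estimates below carry no
    finiteness conditions. *)
Definition nsq f : \bar R := (\int[mu]_x ((f x) ^+ 2)%:E)%E.
Definition L2 f : Prop := measurable_fun setT f /\ (nsq f < +oo)%E.

Lemma nsq_ge0 f : (0 <= nsq f)%E.
Proof. by apply: integral_ge0 => x _; rewrite lee_fin sqr_ge0. Qed.

Lemma measurable_sqr_EFin f : measurable_fun setT f ->
  measurable_fun setT (fun x => ((f x) ^+ 2)%:E).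
Proof. by move=> mf; apply/measurable_EFinP; exact: measurable_funX. Qed.

Lemma nsq_le f g : measurable_fun setT f -> measurable_fun setT g ->
  (forall x, `|f x| <= `|g x|) -> (nsq f <= nsq g)%E.
Proof.
move=> mf mg fg; apply: ge0_le_integral => //.
- by move=> x _; rewrite lee_fin sqr_ge0.
- exact: measurable_sqr_EFin.
- exact: measurable_sqr_EFin.
- move=> x _; rewrite lee_fin -(real_normK (num_real (f x))).
  by rewrite -(real_normK (num_real (g x))) lerXn2r ?nnegrE.
Qed.

Lemma nsqZ (c : R) f : measurable_fun setT f ->
  nsq (fun x => c * f x) = ((c ^+ 2)%:E * nsq f)%E.
Proof.
move=> mf; rewrite /nsq -ge0_integralZl_EFin ?sqr_ge0//.
- by apply: eq_integral => x _; rewrite exprMn EFinM.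
- by move=> x _; rewrite lee_fin sqr_ge0.
- exact: measurable_sqr_EFin.
Qed.

Lemma nsqD_le f g : measurable_fun setT f -> measurable_fun setT g ->
  (nsq (fun x => f x + g x)%R <= 2%:E * nsq f + 2%:E * nsq g)%E.
Proof.
move=> mf mg; rewrite /nsq -!ge0_integralZl_EFin ?ler0n//; first last.
- exact: measurable_sqr_EFin.
- by move=> x _; rewrite lee_fin sqr_ge0.
- exact: measurable_sqr_EFin.
- by move=> x _; rewrite lee_fin sqr_ge0.
rewrite -ge0_integralD//; first last.
- by apply/measurable_EFinP; apply: measurable_funM => //; exact: measurable_funX.
- by move=> x _; rewrite lee_fin mulr_ge0// sqr_ge0.
- by apply/measurable_EFinP; apply: measurable_funM => //; exact: measurable_funX.
- by move=> x _; rewrite lee_fin mulr_ge0// sqr_ge0.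
apply: ge0_le_integral => //.
- by move=> x _; rewrite lee_fin sqr_ge0.
- by apply: measurable_sqr_EFin; exact: measurable_funD.
- by apply: emeasurable_funD; apply/measurable_EFinP; apply: measurable_funM => //;
     exact: measurable_funX.
- move=> x _; rewrite -!EFinM -EFinD lee_fin.
  have := sqr_ge0 (f x - g x); nra.
Qed.

Lemma L2D f g : L2 f -> L2 g -> L2 (fun x => f x + g x).
Proof.
move=> [mf ff] [mg gg]; split; first exact: measurable_funD.
apply: le_lt_trans (nsqD_le mf mg) _.
by rewrite lte_add_pinfty// lte_mul_pinfty// ?lee_fin.
Qed.

Lemma L2Z (c : R) f : L2 f -> L2 (fun x => c * f x).
Proof.
move=> [mf ff]; split; first exact: measurable_funM.
by rewrite nsqZ// lte_mul_pinfty// lee_fin sqr_ge0.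
Qed.

Lemma L2B f g : L2 f -> L2 g -> L2 (fun x => f x - g x).
Proof.
move=> ff gg; have := L2D ff (L2Z (-1) gg).
by under eq_fun do rewrite mulN1r.
Qed.

Lemma L2_0 : L2 (fun _ : R => 0).
Proof.
split => //; rewrite /nsq.
by under eq_integral do rewrite expr0n/=; rewrite integral0 ltry.
Qed.

Lemma L2_le f g : measurable_fun setT f -> L2 g ->
  (forall x, `|f x| <= `|g x|) -> L2 f.
Proof.
by move=> mf [mg gg] fg; split => //; exact: le_lt_trans (nsq_le mf mg fg) gg.
Qed.

Lemma nsqB f g : nsq (fun x => f x - g x) = nsq (fun x => g x - f x).
Proof. by apply: eq_integral => x _; rewrite -sqrrN opprB. Qed.

Lemma L2_integrableM f g : L2 f -> L2 g ->
  mu.-integrable setT (EFin \o (fun x => f x * g x)).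
Proof.
move=> [mf ff] [mg gg]; apply/integrableP; split.
  by apply/measurable_EFinP; exact: measurable_funM.
apply: (@le_lt_trans _ _ (nsq f + nsq g)%E); last exact: lte_add_pinfty.
rewrite /nsq -ge0_integralD//; first last.
- exact: measurable_sqr_EFin.
- by move=> x _; rewrite lee_fin sqr_ge0.
- exact: measurable_sqr_EFin.
- by move=> x _; rewrite lee_fin sqr_ge0.
apply: ge0_le_integral => //.
- by apply/measurableT_comp => //; apply/measurable_EFinP; exact: measurable_funM.
- by apply: emeasurable_funD; exact: measurable_sqr_EFin.
- move=> x _; rewrite /= lee_fin normrM.
  have := sqr_ge0 (`|f x| - `|g x|).
  rewrite -(real_normK (num_real (f x))) -(real_normK (num_real (g x))).
  have := sqr_ge0 (`|f x|); have := sqr_ge0 (`|g x|); nra.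
Qed.

Lemma L2_integrable_sqr f : L2 f -> mu.-integrable setT (EFin \o (fun x => f x ^+ 2)).
Proof. by move=> ff; under eq_fun do rewrite expr2; exact: L2_integrableM. Qed.

Lemma nsqE f : L2 f -> nsq f = (\int[mu]_x (f x ^+ 2))%:E.
Proof.
by move=> ff; rewrite /nsq /Rintegral fineK//; apply: integrable_fin_num => //; exact: L2_integrable_sqr.
Qed.

Lemma nsq_eq0 f : measurable_fun setT f -> nsq f = 0%E -> ae_eq mu setT f (cst 0).
Proof.
move=> mf h.
have /ae_eq_integral_abs : (\int[mu]_(x in setT) `| ((f x)^+2)%:E | = 0)%E.
  by rewrite -[RHS]h; apply: eq_integral => x _; rewrite gee0_abs// lee_fin sqr_ge0.
move=> /(_ measurableT (measurable_sqr_EFin mf)).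
apply: filterS => x /(_ I)/= [] /eqP; rewrite sqrf_eq0 => /eqP -> //.
Qed.

Lemma ae_eq_nsq f g : measurable_fun setT f -> measurable_fun setT g ->
  ae_eq mu setT f g -> nsq f = nsq g.
Proof.
move=> mf mg fg; apply: ae_eq_integral => //.
- exact: measurable_sqr_EFin.
- exact: measurable_sqr_EFin.
- by apply: filterS fg => x h /h /= ->.
Qed.

Lemma L2_ae_eq f g : measurable_fun setT g -> ae_eq mu setT f g -> L2 f -> L2 g.
Proof. by move=> mg fg [mf ff]; split => //; rewrite -(ae_eq_nsq mf mg fg). Qed.

End SquareIntegrable.


(** * Null sequences of extended reals and completeness of L^2 *)

Section NullSequences.
Context {R : realType}.
Local Open Scope ereal_scope.
Implicit Types u v : nat -> \bar R.

Lemma cvge0_eps u (e : R) : u n @[n --> \oo] --> 0 -> (0 < e)%R ->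
  exists N, forall n, (N <= n)%N -> u n <= e%:E.
Proof.
move=> /fine_cvgP[[N _ fu] /cvgrPdist_le cu] e0.
have [M _ hM] := cu e e0.
exists (maxn N M) => n; rewrite geq_max => /andP[Nn Mn].
have := hM n Mn; rewrite /= sub0r normrN => h.
rewrite -(fineK (fu n Nn)) lee_fin; exact: le_trans (ler_norm _) h.
Qed.

Lemma cvge0P u : (forall n, 0 <= u n) ->
  (u n @[n --> \oo] --> 0) <->
  (forall e : R, (0 < e)%R -> exists N, forall n, (N <= n)%N -> u n <= e%:E).
Proof.
move=> u0; split; first by move=> cu e; exact: cvge0_eps.
move=> h; apply/fine_cvgP; split.
  have [N hN] := h 1%R ltr01; exists N => // n /= Nn.
  by rewrite ge0_fin_numE//; apply: le_lt_trans (hN n Nn) _; rewrite ltry.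
apply/cvgrPdist_le => e e0; have [N hN] := h e e0.
exists N => // n /= Nn; rewrite sub0r normrN ger0_norm ?fine_ge0//.
by rewrite -lee_fin fineK ?hN// ge0_fin_numE//; apply: le_lt_trans (hN n Nn) _; rewrite ltry.
Qed.

Lemma cvge0_le u v : (forall n, 0 <= u n <= v n) ->
  v n @[n --> \oo] --> 0 -> u n @[n --> \oo] --> 0.
Proof.
move=> uv; apply: (@squeeze_cvge _ _ _ _ (fun=> 0) u v); last exact: cvg_cst.
by apply: nearW.
Qed.

Lemma cvge0_lin (a b : R) u v : u n @[n --> \oo] --> 0 -> v n @[n --> \oo] --> 0 ->
  a%:E * u n + b%:E * v n @[n --> \oo] --> 0.
Proof.
move=> cu cv; rewrite -[X in _ --> X]adde0; apply: cvgeD => //.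
  by rewrite -[X in _ --> X](mule0 a%:E); exact: cvgeZl.
by rewrite -[X in _ --> X](mule0 b%:E); exact: cvgeZl.
Qed.

Lemma cvge0Z (a : R) u : u n @[n --> \oo] --> 0 -> a%:E * u n @[n --> \oo] --> 0.
Proof. by move=> cu; rewrite -[X in _ --> X](mule0 a%:E); exact: cvgeZl. Qed.

Lemma cvge0_eq0 (x : \bar R) u : 0 <= x -> (forall n, x <= u n) ->
  u n @[n --> \oo] --> 0 -> x = 0.
Proof.
move=> x0 xu cu; apply/eqP; rewrite eq_le x0 andbT.
rewrite -(cvg_lim _ cu)//; apply: lime_ge; first by apply/cvg_ex; exists 0.
exact: nearW.
Qed.

Lemma nneseries_geo_half : (\sum_(0 <= k <oo) ((2^-1 ^+ k : R)%:E)) = 2%:E.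
Proof.
have h : (fun n => \sum_(0 <= k < n) ((2^-1 ^+ k : R)%:E)) = EFin \o series (geometric (1%R : R) (2^-1)).
  apply/funext => n; rewrite /= sumEFin; congr (_%:E).
  by apply: eq_bigr => i _; rewrite /geometric/= mul1r.
rewrite h EFin_lim; last by apply: is_cvg_geometric_series; rewrite ger0_norm// invf_lt1// ltr1n.
congr (_%:E); have h2 : (`|2^-1 : R| < 1)%R by rewrite ger0_norm// invf_lt1// ltr1n.
have /cvg_lim -> // := @cvg_geometric_series R 1%R _ h2; first by field.
Qed.

End NullSequences.

Section Completeness.
Context {R : realType}.
Local Notation mu := (@lebesgue_measure R).

(** Once [nsq (f n.+1 \- f n)] decays like [8^-n], the weighted sum of squares [G] is
    integrable, hence finite almost everywhere, and it bounds the tails pointwise. *)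
Lemma L2_fast_complete (f : nat -> R -> R) :
  (forall n, L2 (f n)) ->
  (forall n, nsq (fun x => f n.+1 x - f n x)%R <= ((8^-1) ^+ n)%:E)%E ->
  exists2 g, L2 g & forall n, (nsq (fun x => f n x - g x)%R <= (8 * (4^-1) ^+ n)%:E)%E.
Proof.
move=> fL hf.
pose d n x := f n.+1 x - f n x.
have md n : measurable_fun setT (d n) by apply: measurable_funB; [case: (fL n.+1)|case: (fL n)].
pose G x : \bar R := (\sum_(0 <= n <oo) (4 ^+ n * (d n x) ^+ 2)%:E)%E.
have mt n : measurable_fun setT (fun x => (4 ^+ n * (d n x) ^+ 2)%:E).
  by apply/measurable_EFinP; apply: measurable_funM => //; exact: measurable_funX.
have t0 n x : (0 <= (4 ^+ n * (d n x) ^+ 2)%:E)%E.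
  by rewrite lee_fin; apply: mulr_ge0; rewrite ?sqr_ge0// exprn_ge0.
have mG : measurable_fun setT G by apply: ge0_emeasurable_sum.
have G0 x : (0 <= G x)%E by apply: nneseries_ge0.
have iG : (\int[mu]_x G x <= 2%:E)%E.
  rewrite /G integral_nneseries//.
  rewrite -nneseries_geo_half; apply: lee_nneseries => [n _|n _].
    by move=> _; exact: integral_ge0.
  under eq_integral do rewrite EFinM.
  rewrite ge0_integralZl_EFin ?exprn_ge0//; first last.
  - exact: measurable_sqr_EFin.
  - by move=> x _; rewrite lee_fin sqr_ge0.
  apply: (@le_trans _ _ ((4 ^+ n)%:E * ((8^-1) ^+ n)%:E)%E).
    by apply: lee_wpmul2l; [rewrite lee_fin exprn_ge0|exact: hf].
  by rewrite -EFinM -exprMn lee_fin (_ : 4 * 8^-1 = 2^-1 :> R)//; lra.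
pose A := [set x | (G x < +oo)%E].
have mA : measurable A.
  rewrite -[A]setTI; exact: emeasurable_fun_infty_o.
have aeA : {ae mu, forall x, A x}.
  have : mu.-integrable setT G.
    apply/integrableP; split => //.
    under eq_integral do rewrite gee0_abs//.
    by apply: le_lt_trans iG _; rewrite ltry.
  move=> /(integrable_ae measurableT); apply: filterS => x /(_ I).
  by rewrite ge0_fin_numE.
have dG n x : A x -> `|d n x| <= Num.sqrt (fine (G x)) * 2^-1 ^+ n.
  move=> Ax; rewrite -[leLHS](@ger0_norm _ `|d n x|)//.
  rewrite -sqrtr_sqr real_normK ?num_real// -[X in _ * X](@ger0_norm _ (2^-1 ^+ n)) ?exprn_ge0//.
  rewrite -sqrtr_sqr -sqrtrM; last exact: fine_ge0.
  rewrite ler_sqrt; last by rewrite mulr_ge0 ?sqr_ge0// fine_ge0.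
  have : ((4 ^+ n * (d n x) ^+ 2)%:E <= G x)%E.
    rewrite /G (nneseries_split 0 n.+1)//= add0n.
    apply: (@le_trans _ _ (\sum_(0 <= k < n.+1) (4 ^+ k * d k x ^+ 2)%:E)%E); last first.
      by apply: leeDl; apply: nneseries_ge0.
    rewrite big_nat_recr//=; apply: leeDr; apply: sume_ge0 => k _; exact: t0.
  rewrite -(fineK (_ : G x \is a fin_num)); last by rewrite ge0_fin_numE.
  rewrite lee_fin -exprM mulnC exprM (_ : 2^-1 ^+ 2 = 4^-1 :> R); last by lra.
  by rewrite exprVn ler_pdivlMr ?exprn_gt0// mulrC.
have tail x n m : A x -> `|f (n + m)%N x - f n x| <= Num.sqrt (fine (G x)) * (2^-1 ^+ n * (2 - 2 * 2^-1 ^+ m)).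
  move=> Ax; elim: m => [|m IH].
    by rewrite addn0 subrr normr0 expr0 mulr1 subrr !mulr0.
  rewrite addnS (_ : _ - _ = d (n + m)%N x + (f (n + m)%N x - f n x)); last by rewrite /d; ring.
  apply: le_trans (ler_normD _ _) _.
  apply: le_trans (lerD (dG _ _ Ax) IH) _.
  rewrite exprD exprS -mulrDr le_eqVlt; apply/orP; left; apply/eqP; by field.
have Nto0 x : Num.sqrt (fine (G x)) * (2^-1 ^+ n * 2) @[n --> \oo] --> (0:R).
  rewrite -[X in _ --> X](mulr0 (Num.sqrt (fine (G x)))); apply: cvgM; first exact: cvg_cst.
  rewrite -[X in _ --> X](mul0r (2:R)); apply: cvgM; last exact: cvg_cst.
  by apply: cvg_expr; rewrite ger0_norm// invf_lt1// ltr1n.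
have tail2 x n m : A x -> (n <= m)%N -> `|f m x - f n x| <= Num.sqrt (fine (G x)) * (2^-1 ^+ n * 2).
  move=> Ax nm; rewrite -(subnKC nm); apply: le_trans (tail _ _ _ Ax) _.
  rewrite ler_wpM2l ?sqrtr_ge0// ler_wpM2l ?exprn_ge0//.
  by rewrite lerBlDr lerDl mulr_ge0// exprn_ge0.
have cvf x : A x -> cvgn (fun n => f n x).
  move=> Ax; apply/cauchy_cvgP; apply: cauchy_exP => e e0.
  have /cvgrPdist_lt/(_ e e0)[N _ hN] := Nto0 x.
  exists (f N x), N => // m /= Nm; rewrite /ball/= distrC.
  apply: le_lt_trans (tail2 _ _ _ Ax Nm) _.
  by have := hN N (leqnn N); rewrite /= sub0r normrN; apply: le_lt_trans; exact: ler_norm.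
pose h n x := f n x * \1_A x.
have mh n : measurable_fun setT (h n).
  by apply: measurable_funM; [case: (fL n)|exact: measurable_indic].
pose g x := limn (fun n => h n x).
have hg x : h n x @[n --> \oo] --> g x.
  rewrite /g /h; have [Ax|nAx] := pselect (A x).
    by under eq_fun do rewrite indicE mem_set// mulr1; exact: cvf.
  under eq_fun do rewrite indicE memNset// mulr0.
  by rewrite lim_cst//; exact: cvg_cst.
have mg : measurable_fun setT g.
  by apply: (@measurable_fun_cvg _ _ _ _ h) => // x _; exact: hg.
have gf n x : A x -> `|f n x - g x| <= Num.sqrt (fine (G x)) * (2^-1 ^+ n * 2).
  move=> Ax; rewrite distrC.
  have cg : `|f m x - f n x| @[m --> \oo] --> `|g x - f n x|.
    apply: cvg_norm; apply: cvgB; last exact: cvg_cst.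
    have := hg x; rewrite /h; under eq_fun do rewrite indicE mem_set// mulr1.
    exact.
  rewrite -(cvg_lim _ cg)//; apply: limr_le; first by apply/cvg_ex; eexists; exact: cg.
  by exists n => // m /= nm; exact: tail2.
have key n : (nsq (fun x => f n x - g x)%R <= (8 * (4^-1) ^+ n)%:E)%E.
  have m1 : measurable_fun setT (fun x => (4 * 4^-1 ^+ n)%:E * G x)%E.
    by apply: emeasurable_funM => //; exact: measurable_cst.
  apply: (@le_trans _ _ (\int[mu]_x ((4 * 4^-1 ^+ n)%:E * G x))%E).
    apply: ae_ge0_le_integral => //.
    - by move=> x _; rewrite lee_fin sqr_ge0.
    - by apply: measurable_sqr_EFin; apply: measurable_funB => //; case: (fL n).
    - by move=> x _; rewrite mule_ge0// lee_fin mulr_ge0// exprn_ge0.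
    apply: (ae_impl aeA) => x Ax _.
    rewrite -(fineK (_ : G x \is a fin_num)); last by rewrite ge0_fin_numE.
    rewrite -EFinM lee_fin -real_normK ?num_real//.
    have /(lerXn2r 2) := gf n x Ax.
    rewrite !nnegrE normr_ge0 mulr_ge0 ?sqrtr_ge0 ?mulr_ge0 ?exprn_ge0// => /(_ isT isT).
    move/le_trans; apply; rewrite exprMn sqr_sqrtr ?fine_ge0// exprMn -exprM mulnC exprM.
    rewrite (_ : 2^-1 ^+ 2 = 4^-1 :> R); last by lra.
    rewrite le_eqVlt; apply/orP; left; apply/eqP; ring.
  rewrite ge0_integralZl_EFin ?mulr_ge0 ?exprn_ge0//.
  apply: (@le_trans _ _ ((4 * 4^-1 ^+ n)%:E * 2%:E)%E).
    by apply: lee_wpmul2l => //; rewrite lee_fin mulr_ge0// exprn_ge0.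
  rewrite -EFinM lee_fin le_eqVlt; apply/orP; left; apply/eqP; ring.
exists g => //.
have fgL : L2 (fun x => f 0%N x - g x).
  split; last by apply: le_lt_trans (key 0%N) _; rewrite ltry.
  by apply: measurable_funB => //; case: (fL 0%N).
have := L2B (fL 0%N) fgL; congr L2; apply/funext => x; ring.
Qed.

(** Extract a subsequence to which [L2_fast_complete] applies; the Cauchy condition carries
    the convergence over to the whole sequence. *)
Lemma L2_complete (f : nat -> R -> R) :
  (forall n, L2 (f n)) ->
  (forall e : R, 0 < e -> exists N, forall m n, (N <= m)%N -> (N <= n)%N ->
     (nsq (fun x => f m x - f n x)%R <= e%:E)%E) ->
  exists2 g, L2 g & nsq (fun x => f n x - g x)%R @[n --> \oo] --> 0%E.
Proof.
move=> fL cf.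
have pos8 k : 0 < (8^-1 : R) ^+ k by rewrite exprn_gt0// invr_gt0.
have /choice[M hM] : forall k, exists N, forall m n, (N <= m)%N -> (N <= n)%N ->
     (nsq (fun x => f m x - f n x)%R <= ((8^-1) ^+ k)%:E)%E by move=> k; exact: cf.
pose N k := (\sum_(0 <= i < k.+1) M i)%N.
have NM k : (M k <= N k)%N by rewrite /N big_nat_recr//= leq_addl.
have NS k : (N k <= N k.+1)%N by rewrite /N [leqRHS]big_nat_recr//= leq_addr.
have [g gL hg] := @L2_fast_complete (fun k => f (N k)) (fun k => fL _)
  (fun k => hM k _ _ (leq_trans (NM k) (NS k)) (NM k)).
exists g => //; apply/cvge0P; first by move=> n; exact: nsq_ge0.
move=> e e0.
have c8 : (16 * (8^-1 ^+ k) + 16 * (4^-1 ^+ k)) @[k --> \oo] --> (0:R).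
  rewrite -[X in _ --> X](addr0 (0:R)); apply: cvgD.
    rewrite -[X in _ --> X](mulr0 (16:R)); apply: cvgM; first exact: cvg_cst.
    by apply: cvg_expr; rewrite ger0_norm// invf_lt1// ltr1n.
  rewrite -[X in _ --> X](mulr0 (16:R)); apply: cvgM; first exact: cvg_cst.
  by apply: cvg_expr; rewrite ger0_norm// invf_lt1// ltr1n.
have /cvgrPdist_le/(_ e e0)[k _ /(_ k (leqnn k))] := c8; rewrite /= sub0r normrN => hk.
have hk' := le_trans (ler_norm _) hk.
exists (M k) => n kn.
have mf m : measurable_fun setT (f m) by case: (fL m).
have mg : measurable_fun setT g by case: gL.
apply: (@le_trans _ _ (2%:E * nsq (fun x => f n x - f (N k) x)%R + 2%:E * nsq (fun x => f (N k) x - g x)%R)%E).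
  apply: le_trans (nsqD_le _ _).
  - by rewrite le_eqVlt; apply/orP; left; apply/eqP; apply: eq_integral => x _; congr (_ ^+ 2)%:E; ring.
  - exact: measurable_funB.
  - exact: measurable_funB.
apply: (@le_trans _ _ (2%:E * ((8^-1) ^+ k)%:E + 2%:E * (8 * (4^-1) ^+ k)%:E)%E).
  apply: leeD; apply: lee_pmul => //; try exact: nsq_ge0.
  exact: hM.
rewrite -!EFinM -EFinD lee_fin; apply: le_trans hk'.
have := pos8 k; lra.
Qed.

End Completeness.

(** * Change of variables and Fubini for real-valued integrals *)

Section ChangeOfVariable.
Context {R : realType}.
Local Notation mu := (@lebesgue_measure R).
Implicit Types (f : R -> \bar R) (a : R).

Lemma measurable_shift a : measurable_fun setT (fun x : R => x + a).
Proof. exact: measurable_funD. Qed.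

Lemma measurable_reflect a : measurable_fun setT (fun x : R => a - x).
Proof. exact: measurable_funB. Qed.

(** Half-open intervals form a pi-system generating the Borel sets. *)
Lemma lebesgue_measure_preserved (phi : R -> R) (mphi : measurable_fun setT phi) :
  (forall x y, mu (phi @^-1` `]x, y]%classic) = mu `]x, y]%classic) ->
  forall A, measurable A -> mu (phi @^-1` A) = mu A.
Proof.
move=> h A mA.
pose m := isMeasurableFun.Build _ _ (measurableTypeR R) (measurableTypeR R) phi mphi.
pose P : {mfun measurableTypeR R >-> measurableTypeR R} := HB.pack phi m.
apply/esym; apply: (@lebesgue_measure_unique R (pushforward mu P)) => //.
by move=> _ [[x y]] _ <-; rewrite /pushforward -h.
Qed.

Lemma lebesgue_measure_shift a (A : set R) : measurable A ->
  mu ((fun x : R => x + a) @^-1` A) = mu A.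
Proof.
apply: lebesgue_measure_preserved; first exact: measurable_shift.
move=> x y.
have -> : (fun z : R => z + a) @^-1` `]x, y] = `](x - a), (y - a)]%classic.
  by apply/seteqP; split => z /=; rewrite !in_itv/= ltrBlDr lerBrDr.
rewrite !lebesgue_measure_itv/= !lte_fin -!EFinB.
have -> : (x - a < y - a) = (x < y) by apply/idP/idP => h; lra.
by case: ifP => // _; congr (_%:E); ring.
Qed.

Lemma lebesgue_measure_reflect a (A : set R) : measurable A ->
  mu ((fun x : R => a - x) @^-1` A) = mu A.
Proof.
apply: lebesgue_measure_preserved; first exact: measurable_reflect.
move=> x y.
have -> : (fun z : R => a - z) @^-1` `]x, y] = `[(a - y), (a - x)[%classic.
  by apply/seteqP; split => z /=; rewrite !in_itv/= => /andP[h1 h2]; apply/andP; split; lra.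
rewrite !lebesgue_measure_itv/= !lte_fin -!EFinB.
have -> : (a - y < a - x) = (x < y) by apply/idP/idP => h; lra.
by case: ifP => // _; congr (_%:E); ring.
Qed.

Lemma integral_preserved (phi : R -> R) f :
  measurable_fun setT phi ->
  (forall A, measurable A -> mu (phi @^-1` A) = mu A) ->
  measurable_fun setT f ->
  (\int[mu]_x f (phi x) = \int[mu]_x f x)%E.
Proof.
move=> mphi hphi mf.
have pos (h : R -> \bar R) : measurable_fun setT h -> (forall x, 0 <= h x)%E ->
    (\int[mu]_x h (phi x) = \int[mu]_x h x)%E.
  move=> mh h0.
  have := @ge0_integral_pushforward _ _ (measurableTypeR R) (measurableTypeR R) R phi mphi mu setT h measurableT mh (fun x _ => h0 x).
  rewrite preimage_setT => <-.
  by apply: eq_measure_integral => A mA _; exact: hphi.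
rewrite [LHS]integralE [RHS]integralE; congr (_ - _)%E.
- transitivity (\int[mu]_x ((f^\+)%E (phi x)))%E; first by apply: eq_integral => x _; rewrite ?funeposE ?funenegE.
  by apply: pos => //; exact: measurable_funepos.
- transitivity (\int[mu]_x ((f^\-)%E (phi x)))%E; first by apply: eq_integral => x _; rewrite ?funeposE ?funenegE.
  by apply: pos => //; exact: measurable_funeneg.
Qed.

Lemma integral_shift a f : measurable_fun setT f ->
  (\int[mu]_x f (x + a)%R = \int[mu]_x f x)%E.
Proof.
move=> mf; apply: (@integral_preserved (fun x => x + a)) => //; first exact: measurable_shift.
exact: lebesgue_measure_shift.
Qed.

Lemma integral_reflect a f : measurable_fun setT f ->
  (\int[mu]_x f (a - x)%R = \int[mu]_x f x)%E.
Proof.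
move=> mf; apply: (@integral_preserved (fun x => a - x)) => //; first exact: measurable_reflect.
exact: lebesgue_measure_reflect.
Qed.

Lemma Rintegral_shift a (f : R -> R) : measurable_fun setT f ->
  \int[mu]_x f (x + a) = \int[mu]_x f x.
Proof.
move=> mf; congr fine; apply: (@integral_shift a (EFin \o f)).
exact/measurable_EFinP.
Qed.

Lemma Rintegral_reflect a (f : R -> R) : measurable_fun setT f ->
  \int[mu]_x f (a - x) = \int[mu]_x f x.
Proof.
move=> mf; congr fine; apply: (@integral_reflect a (EFin \o f)).
exact/measurable_EFinP.
Qed.

Lemma measurable_comp_shift a (f : R -> R) : measurable_fun setT f ->
  measurable_fun setT (fun x : R => f (x + a)).
Proof. by move=> mf; apply: measurableT_comp mf _; exact: measurable_shift. Qed.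

Lemma measurable_comp_reflect a (f : R -> R) : measurable_fun setT f ->
  measurable_fun setT (fun x : R => f (a - x)).
Proof. by move=> mf; apply: measurableT_comp mf _; exact: measurable_reflect. Qed.

Lemma nsq_shift a (f : R -> R) : measurable_fun setT f ->
  nsq (fun x => f (x + a))%R = nsq f.
Proof.
by move=> mf; apply: (integral_shift a (f := fun x => ((f x)^+2)%:E)); exact: measurable_sqr_EFin.
Qed.

Lemma L2_shift a (f : R -> R) : L2 f -> L2 (fun x => f (x + a)).
Proof.
move=> [mf ff]; split; first exact: measurable_comp_shift.
by rewrite nsq_shift.
Qed.

Definition L1 (f : R -> R) : Prop := mu.-integrable setT (EFin \o f).

Lemma L1_measurable (f : R -> R) : L1 f -> measurable_fun setT f.
Proof. by move=> /integrableP[/measurable_EFinP]. Qed.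

Lemma L1_le (f g : R -> R) : measurable_fun setT f -> L1 g ->
  (forall x, `|f x| <= `|g x|) -> L1 f.
Proof.
move=> mf ig fg; apply: le_integrable ig => //; first exact/measurable_EFinP.
by move=> x _; rewrite /= lee_fin.
Qed.

Lemma L1_shift a (f : R -> R) : L1 f -> L1 (fun x => f (x + a)).
Proof.
move=> /integrableP[/measurable_EFinP mf ff]; apply/integrableP; split.
  by apply/measurable_EFinP; exact: measurable_comp_shift.
rewrite (integral_shift a (f := fun x => `|(f x)%:E|%E))//.
by apply/measurableT_comp => //; exact/measurable_EFinP.
Qed.

Lemma L1_reflect a (f : R -> R) : L1 f -> L1 (fun x => f (a - x)).
Proof.
move=> /integrableP[/measurable_EFinP mf ff]; apply/integrableP; split.
  by apply/measurable_EFinP; exact: measurable_comp_reflect.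
rewrite (integral_reflect a (f := fun x => `|(f x)%:E|%E))//.
by apply/measurableT_comp => //; exact/measurable_EFinP.
Qed.

Lemma L1_norm (f : R -> R) : L1 f -> L1 (fun x => `|f x|).
Proof. by move=> /integrable_norm. Qed.

Lemma L1D (f g : R -> R) : L1 f -> L1 g -> L1 (fun x => f x + g x).
Proof. by move=> ff gg; exact: (integrableD measurableT ff gg). Qed.

Lemma L1Z c (f : R -> R) : L1 f -> L1 (fun x => c * f x).
Proof. by move=> ff; exact: (integrableZl measurableT c ff). Qed.

Lemma L1B (f g : R -> R) : L1 f -> L1 g -> L1 (fun x => f x - g x).
Proof.
by move=> ff gg; have := L1D ff (L1Z (-1) gg); under eq_fun do rewrite mulN1r.
Qed.

Lemma L1_mul_bounded (f k : R -> R) M : L1 f -> measurable_fun setT k ->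
  (forall x, `|k x| <= M) -> L1 (fun x => f x * k x).
Proof.
move=> ff mk kM.
apply: (L1_le (g := fun x => M * f x)); last first.
- by move=> x; rewrite !normrM mulrC ler_wpM2r// (le_trans (kM x))// ler_norm.
- exact: L1Z.
- by apply: measurable_funM => //; exact: L1_measurable.
Qed.

Lemma Rint_norm_le (f : R -> R) : L1 f -> `|\int[mu]_x f x| <= \int[mu]_x `|f x|.
Proof. by move=> ff; apply: le_normr_Rintegral. Qed.

Lemma EFin_Rint (f : R -> R) : L1 f -> (\int[mu]_x f x)%:E = (\int[mu]_x (f x)%:E)%E.
Proof. by move=> ff; rewrite /Rintegral fineK//; exact: integrable_fin_num. Qed.

Lemma Rint_le (f g : R -> R) : L1 f -> L1 g -> (forall x, f x <= g x) ->
  \int[mu]_x f x <= \int[mu]_x g x.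
Proof. by move=> ff gg fg; apply: le_Rintegral. Qed.

Lemma RintD (f g : R -> R) : L1 f -> L1 g ->
  \int[mu]_x (f x + g x) = \int[mu]_x f x + \int[mu]_x g x.
Proof. by move=> ff gg; rewrite RintegralD. Qed.

Lemma RintB (f g : R -> R) : L1 f -> L1 g ->
  \int[mu]_x (f x - g x) = \int[mu]_x f x - \int[mu]_x g x.
Proof. by move=> ff gg; rewrite RintegralB. Qed.

Lemma RintZ c (f : R -> R) : L1 f -> \int[mu]_x (c * f x) = c * \int[mu]_x f x.
Proof. by move=> ff; rewrite RintegralZl. Qed.

End ChangeOfVariable.

Section Fubini.
Context {R : realType}.
Local Notation mu := (@lebesgue_measure R).

Lemma ae_eq_L1 (f : R -> R) (g : R -> \bar R) : measurable_fun setT f ->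
  mu.-integrable setT g -> ae_eq mu setT g (EFin \o f) -> L1 f.
Proof.
move=> mf /integrableP[mg gy] fg; apply/integrableP; split; first exact/measurable_EFinP.
apply: le_lt_trans gy.
rewrite le_eqVlt; apply/orP; left; apply/eqP; apply: ge0_ae_eq_integral => //.
- by apply: measurableT_comp => //; exact/measurable_EFinP.
- exact: measurableT_comp.
- by apply: (ae_impl fg) => x hx _; rewrite hx.
Qed.

Lemma ae_eq_Rint (f g : R -> R) : measurable_fun setT f -> measurable_fun setT g ->
  ae_eq mu setT f g -> \int[mu]_x f x = \int[mu]_x g x.
Proof.
move=> mf mg fg; congr fine; apply: ae_eq_integral => //.
- exact/measurable_EFinP.
- exact/measurable_EFinP.
- by apply: (ae_impl fg) => x hx _; rewrite hx.
Qed.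

(** The inner integrals may diverge on a null set, where [Rintegral] takes a junk value. *)
Lemma Rintegral_Fubini (F : R * R -> R) : measurable_fun setT F ->
  (\int[mu]_x \int[mu]_y `|(F (x, y))%:E| < +oo)%E ->
  [/\ {ae mu, forall x, L1 (fun y => F (x, y))},
      {ae mu, forall y, L1 (fun x => F (x, y))},
      L1 (fun x => \int[mu]_y F (x, y)),
      L1 (fun y => \int[mu]_x F (x, y)) &
      \int[mu]_x (\int[mu]_y F (x, y)) = \int[mu]_y (\int[mu]_x F (x, y))].
Proof.
move=> mF hF.
have iF : (mu \x mu)%E.-integrable setT (EFin \o F).
  by apply/integrable12ltyP => //; exact/measurable_EFinP.
have ae1 := ae_integrable1 iF; have ae2 := ae_integrable2 iF.
have i1 := integrable_fubini_F iF; have mg2 := measurable_fubini_G iF.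
have i2 : mu.-integrable setT (fubini_G mu (EFin \o F)).
  apply/integrableP; split => //.
  have mFe : measurable_fun setT (fun z => `|(F z)%:E|%E).
    by apply: measurableT_comp => //; exact/measurable_EFinP.
  apply: le_lt_trans ((integrable21ltyP mu mu ((measurable_EFinP _ _).2 mF)).1 iF).
  apply: ge0_le_integral => //.
  - exact: measurableT_comp.
  - exact: (@measurable_fun_fubini_tonelli_G _ _ _ _ R mu _ mFe (fun z => abse_ge0 _)).
  - move=> y _; apply: le_abse_integral => //.
    by apply/measurable_EFinP; apply: measurableT_comp mF _.
have m1 : measurable_fun setT (fun x => \int[mu]_y F (x, y)).
  by apply: measurableT_comp; [exact: fine_measurable|exact: (measurable_int _ i1)].
have m2 : measurable_fun setT (fun y => \int[mu]_x F (x, y)).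
  by apply: measurableT_comp; [exact: fine_measurable|exact: (measurable_int _ i2)].
have e1 : ae_eq mu setT (fubini_F mu (EFin \o F)) (fun x => (\int[mu]_y F (x, y))%:E).
  by apply: (ae_impl ae1) => x hx _; rewrite EFin_Rint.
have e2 : ae_eq mu setT (fubini_G mu (EFin \o F)) (fun y => (\int[mu]_x F (x, y))%:E).
  by apply: (ae_impl ae2) => x hx _; rewrite EFin_Rint.
split; [exact: ae1|exact: ae2|exact: ae_eq_L1 m1 i1 e1|exact: ae_eq_L1 m2 i2 e2|].
have h1 : (\int[mu]_x fubini_F mu (EFin \o F) x = \int[mu]_x (\int[mu]_y F (x, y))%:E)%E.
  apply: ae_eq_integral e1; [by []| |exact/measurable_EFinP].
  by move/integrableP: i1 => [].
have h2 : (\int[mu]_y fubini_G mu (EFin \o F) y = \int[mu]_y (\int[mu]_x F (x, y))%:E)%E.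
  by apply: ae_eq_integral e2; [by []|exact: mg2|exact/measurable_EFinP].
rewrite [LHS]/Rintegral [RHS]/Rintegral -h1 -h2; congr fine.
exact: (Fubini iF).
Qed.

(** Supplies the integrability hypothesis of [Rintegral_Fubini]. *)
Lemma product_dominated (u v : R -> R) (F : R * R -> R) : measurable_fun setT F ->
  L1 u -> L1 v -> (forall x y, `|F (x, y)| <= `|u x| * `|v y|) ->
  (\int[mu]_x \int[mu]_y `|(F (x, y))%:E| < +oo)%E.
Proof.
move=> mF iu iv hF.
have mu1 := L1_measurable iu; have mv := L1_measurable iv.
apply: (@le_lt_trans _ _ (\int[mu]_x (`|u x|%:E * \int[mu]_y `|v y|%:E))%E); last first.
  rewrite ge0_integralZr//; first last.
  - exact: integral_ge0.
  - by apply/measurable_EFinP; exact: measurableT_comp.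
  by rewrite lte_mul_pinfty//; [exact: integral_ge0| rewrite ge0_fin_numE; [move/integrableP: iu => []|exact: integral_ge0]|move/integrableP: iv => []].
have mFe : measurable_fun setT (fun z => `|(F z)%:E|%E).
  by apply: measurableT_comp => //; exact/measurable_EFinP.
apply: ge0_le_integral => //.
- by move=> x _; exact: integral_ge0.
- exact: (@measurable_fun_fubini_tonelli_F _ _ _ _ R mu _ mFe (fun z => abse_ge0 _)).
- by apply: emeasurable_funM => //; apply/measurable_EFinP; exact: measurableT_comp.
move=> x _; rewrite -ge0_integralZl//; last by apply/measurable_EFinP; exact: measurableT_comp.
apply: ge0_le_integral => //.
- by apply: measurableT_comp => //; apply/measurable_EFinP; apply: measurableT_comp mF _.
- by apply: emeasurable_funM => //; apply/measurable_EFinP; exact: measurableT_comp.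
- by move=> y _; rewrite /= -EFinM lee_fin.
Qed.

End Fubini.

(** * The Poisson kernel *)

Section Poisson.
Context {R : realType}.
Local Notation mu := (@lebesgue_measure R).

Lemma is_derive_addf (f g : R -> R) (x df dg : R) : is_derive x 1 f df -> is_derive x 1 g dg ->
  is_derive x 1 (fun y => f y + g y) (df + dg).
Proof. by move=> hf hg; exact: is_deriveD. Qed.

Lemma is_derive_subf (f g : R -> R) (x df dg : R) : is_derive x 1 f df -> is_derive x 1 g dg ->
  is_derive x 1 (fun y => f y - g y) (df - dg).
Proof. by move=> hf hg; exact: is_deriveB. Qed.

Lemma is_derive_mulf (f g : R -> R) (x df dg : R) : is_derive x 1 f df -> is_derive x 1 g dg ->
  is_derive x 1 (fun y => f y * g y) (df * g x + f x * dg).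
Proof.
move=> hf hg; have := is_deriveM hf hg; congr is_derive.
by rewrite addrC /GRing.scale/= [g x * _]mulrC.
Qed.

Lemma is_derive_cmulf (f : R -> R) (x c df : R) : is_derive x 1 f df ->
  is_derive x 1 (fun y => c * f y) (c * df).
Proof. by move=> hf; exact: is_deriveZ. Qed.

Lemma is_derive_continuous (f : R -> R) (x df : R) : is_derive x 1 f df -> {for x, continuous f}.
Proof.
by move=> hf; apply: differentiable_continuous; apply/derivable1_diffP; exact: ex_derive.
Qed.

Lemma is_derive_derive1 (f : R -> R) (x df : R) : is_derive x 1 f df -> (f^`())%classic x = df.
Proof. by move=> hf; rewrite derive1E (@derive_val _ _ _ _ _ _ _ hf). Qed.

Lemma is_derive_dilate (a x df : R) (f : R -> R) :
  is_derive (a * x) 1 f df -> is_derive x 1 (fun y => f (a * y)) (a * df).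
Proof.
move=> hf.
have hg : is_derive x 1 (fun y : R => a * y) a.
  have := @is_deriveM R R (fun=> a) id x 1 0 1 (is_derive_cst _ _ _) (is_derive_id _ _).
  by rewrite /= scaler0 addr0 => /is_derive_eq; apply; rewrite -[RHS]mulr1.
have := @is_derive1_comp R f (fun y => a * y) x df a hf hg.
by rewrite mulrC.
Qed.

Lemma continuous_dilate (a : R) (f : R -> R) : continuous f -> continuous (fun y => f (a * y)).
Proof.
move=> cf x; apply: continuous_comp; last exact: cf.
by apply: cvgM; [exact: cvg_cst|exact: cvg_id].
Qed.

Lemma cvg_expR_dilate (e : R) : 0 < e -> expR (- e * x) @[x --> +oo] --> 0.
Proof.
move=> e0; rewrite (_ : (fun x => expR (- e * x)) = (fun z => expR (- z)) \o (fun z => e * z)); last first.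
  by apply: eq_fun => x; rewrite mulNr.
apply: (@cvg_comp _ _ _ _ _ _ (pinfty_nbhs R)); last exact: cvgr_expR.
exact: gt0_cvgMry.
Qed.

Definition poisson_primitive (e t x : R) : R :=
  - e^-1 * expR (- e * x) +
  (e ^+ 2 + t ^+ 2)^-1 * (expR (- e * x) * (t * sin (t * x) - e * cos (t * x))).

Lemma is_derive_poisson_primitive (e t x : R) : 0 < e ->
  is_derive x 1 (poisson_primitive e t) (expR (- e * x) * (1 + cos (t * x))).
Proof.
move=> e0.
have dE : is_derive x 1 (fun y => expR (- e * y)) (- e * expR (- e * x)).
  exact: is_derive_dilate.
have dS : is_derive x 1 (fun y => sin (t * y)) (t * cos (t * x)).
  exact: is_derive_dilate.
have dC : is_derive x 1 (fun y => cos (t * y)) (t * (- sin (t * x))).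
  exact: is_derive_dilate.
have := is_derive_addf (is_derive_cmulf (- e^-1) dE) (is_derive_cmulf (e ^+ 2 + t ^+ 2)^-1
  (is_derive_mulf dE (is_derive_subf (is_derive_cmulf t dS) (is_derive_cmulf e dC)))).
move/is_derive_eq; apply.
have h : e ^+ 2 + t ^+ 2 != 0 by rewrite gt_eqF// ltr_pwDl ?sqr_ge0// exprn_gt0.
field; by rewrite h gt_eqF.
Qed.

Lemma poisson_primitive0 (e t : R) : 0 < e ->
  poisson_primitive e t 0 = - (e^-1 + e / (e ^+ 2 + t ^+ 2)).
Proof.
move=> e0; rewrite /poisson_primitive !mulr0 expR0 sin0 cos0.
have h : e ^+ 2 + t ^+ 2 != 0 by rewrite gt_eqF// ltr_pwDl ?sqr_ge0// exprn_gt0.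
by field; rewrite h gt_eqF.
Qed.

Lemma cvg_poisson_primitive (e t : R) : 0 < e ->
  poisson_primitive e t x @[x --> +oo] --> 0.
Proof.
move=> e0.
have cE := cvg_expR_dilate e0.
rewrite -[X in _ --> X](addr0 (0:R)); apply: cvgD.
  by rewrite -[X in _ --> X](mulr0 (- e^-1)); apply: cvgM => //; exact: cvg_cst.
rewrite -[X in _ --> X](mulr0 (e ^+ 2 + t ^+ 2)^-1); apply: cvgM; first exact: cvg_cst.
have cE' : expR (- e * x) * (`|t| + e) @[x --> +oo] --> 0.
  by rewrite -[X in _ --> X](mul0r (`|t| + e)); apply: cvgM => //; exact: cvg_cst.
have cE'' : - (expR (- e * x) * (`|t| + e)) @[x --> +oo] --> 0.
  by rewrite -oppr0; exact: cvgN.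
have bd x : `|expR (- e * x) * (t * sin (t * x) - e * cos (t * x))| <= expR (- e * x) * (`|t| + e).
  rewrite normrM ger0_norm ?expR_ge0// ler_wpM2l ?expR_ge0//.
  apply: le_trans (ler_normB _ _) _; rewrite !normrM (ger0_norm (ltW e0)).
  rewrite lerD//.
    by rewrite ler_piMr// ler_norml sin_geN1 sin_le1.
  have c1 : `|cos (t * x)| <= 1 by rewrite ler_norml cos_geN1 cos_le1.
  by rewrite ler_piMr// ltW.
apply: squeeze_cvgr cE'' cE'.
by apply: nearW => x; rewrite -ler_norml.
Qed.

Lemma continuous_poisson_cos (e t : R) :
  continuous (fun x => expR (- e * `|x|) * (1 + cos (t * x))).
Proof.
move=> x; apply: cvgM.
  apply: (@continuous_comp _ _ _ (fun x => - e * `|x|) expR); last exact: continuous_expR.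
  by apply: cvgM; [exact: cvg_cst|exact: norm_continuous].
by apply: cvgD; [exact: cvg_cst|apply: (continuous_dilate (f := cos)); exact: continuous_cos].
Qed.

(** Adding 1 to the cosine makes the integrand nonnegative, so that the fundamental
    theorem of calculus on a half-line for nonnegative functions applies. *)
Lemma integral_poisson_1cos (e t : R) : 0 < e ->
  (\int[mu]_x (expR (- e * `|x|) * (1 + cos (t * x)))%:E =
   (2 * (e^-1 + e / (e ^+ 2 + t ^+ 2)))%:E)%E.
Proof.
move=> e0.
have c1 x : 0 <= 1 + cos (t * x) by rewrite -lerBlDl sub0r cos_geN1.
rewrite ge0_symfun_integralT; first last.
- by move=> x /=; rewrite normrN mulrN cosN.
- exact: continuous_poisson_cos.
- by move=> x; rewrite mulr_ge0 ?expR_ge0.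
rewrite (_ : [set x | (0 <= x)%R] = `[0, +oo[%classic); last first.
  by apply/seteqP; split => x /=; rewrite in_itv/= andbT.
rewrite (@ge0_continuous_FTC2y _ _ (poisson_primitive e t) _ 0).
- by rewrite poisson_primitive0// -EFinB sub0r opprK -EFinM.
- by move=> x _; rewrite mulr_ge0 ?expR_ge0.
- by apply: continuous_subspaceT; exact: continuous_poisson_cos.
- exact: cvg_poisson_primitive.
- by move=> x _; apply: ex_derive; exact: is_derive_poisson_primitive.
- apply: cvg_at_right_filter; apply: is_derive_continuous; exact: is_derive_poisson_primitive.
- move=> x; rewrite in_itv/= andbT => x0.
  by rewrite (is_derive_derive1 (is_derive_poisson_primitive t x e0)) gtr0_norm.
Qed.

Lemma L1_poisson (e : R) : 0 < e -> L1 (fun x : R => expR (- e * `|x|)).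
Proof.
move=> e0.
have h : L1 (fun x : R => expR (- e * `|x|) * (1 + cos (0 * x))).
  apply/integrableP; split.
    by apply/measurable_EFinP; apply: continuous_measurable_fun; exact: continuous_poisson_cos.
  under eq_integral => x _.
    rewrite /= ger0_norm; last first.
      by rewrite mulr_ge0 ?expR_ge0// -lerBlDl sub0r cos_geN1.
    over.
  by rewrite integral_poisson_1cos// ltry.
have := L1Z 2^-1 h; congr L1; apply/funext => x.
by rewrite mul0r cos0; field.
Qed.

Lemma measurable_cos_dilate (t : R) : measurable_fun setT (fun x : R => cos (t * x)).
Proof. by apply: continuous_measurable_fun; apply: continuous_dilate; exact: continuous_cos. Qed.

Lemma measurable_sin_dilate (t : R) : measurable_fun setT (fun x : R => sin (t * x)).
Proof. by apply: continuous_measurable_fun; apply: continuous_dilate; exact: continuous_sin. Qed.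

Lemma normr_cos_le1 (x : R) : `|cos x| <= 1.
Proof. by rewrite ler_norml cos_geN1 cos_le1. Qed.

Lemma normr_sin_le1 (x : R) : `|sin x| <= 1.
Proof. by rewrite ler_norml sin_geN1 sin_le1. Qed.

Definition poisson (e z : R) : R := 2 * e / (e ^+ 2 + z ^+ 2).

Lemma Rintegral_poisson_cos (e t : R) : 0 < e ->
  \int[mu]_x (expR (- e * `|x|) * cos (t * x)) = poisson e t.
Proof.
move=> e0.
have dbl (a b : R) : a + a = 4 * b -> a = 2 * b by lra.
have i0 := L1_poisson e0.
have ic u : L1 (fun x => expR (- e * `|x|) * cos (u * x)).
  apply: (L1_mul_bounded (M := 1) i0); first exact: measurable_cos_dilate.
  by move=> x; exact: normr_cos_le1.
have E u : \int[mu]_x (expR (- e * `|x|)) + \int[mu]_x (expR (- e * `|x|) * cos (u * x)) =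
    2 * (e^-1 + e / (e ^+ 2 + u ^+ 2)).
  rewrite -RintegralD//; [|exact: ic].
  rewrite /Rintegral -[RHS]/(fine (2 * (e^-1 + e / (e ^+ 2 + u ^+ 2)))%:E) -integral_poisson_1cos//.
  by congr fine; apply: eq_integral => x _; rewrite mulrDr mulr1.
have E0 := E 0.
have e00 : \int[mu]_x (expR (- e * `|x|) * cos (0 * x)) = \int[mu]_x (expR (- e * `|x|)).
  by apply: eq_Rintegral => x _; rewrite mul0r cos0 mulr1.
rewrite e00 in E0.
have Et := E t.
have : \int[mu]_x expR (- e * `|x|) = 2 * e^-1.
  by apply: dbl; rewrite E0 expr0n addr0; field; rewrite gt_eqF.
move=> E1; rewrite E1 in Et.
rewrite /poisson; move: Et; rewrite mulrDr => /addrI ->.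
by rewrite mulrA.
Qed.

Lemma poisson_ge0 (e z : R) : 0 <= e -> 0 <= poisson e z.
Proof. by move=> e0; rewrite divr_ge0 ?mulr_ge0// addr_ge0 ?sqr_ge0. Qed.

Lemma continuous_poisson (e : R) : 0 < e -> continuous (poisson e).
Proof.
move=> e0 z; apply: cvgM; first exact: cvg_cst.
apply: cvgV; first by rewrite gt_eqF// ltr_pwDl ?sqr_ge0// exprn_gt0.
by apply: cvgD; [exact: cvg_cst|apply: exprn_continuous].
Qed.

Lemma integral_poisson (e : R) : 0 < e -> (\int[mu]_z (poisson e z)%:E = (2 * pi)%:E)%E.
Proof.
move=> e0.
rewrite ge0_symfun_integralT; first last.
- by move=> x /=; rewrite /poisson sqrrN.
- exact: continuous_poisson.
- by move=> x; rewrite poisson_ge0// ltW.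
rewrite (_ : [set x | (0 <= x)%R] = `[0, +oo[%classic); last first.
  by apply/seteqP; split => x /=; rewrite in_itv/= andbT.
have dF (x : R) : is_derive x 1 (fun z => 2 * atan (e^-1 * z)) (poisson e x).
  have d1 : is_derive x 1 (fun z => atan (e^-1 * z)) (e^-1 * (1 + (e^-1 * x) ^+ 2)^-1).
    exact: is_derive_dilate.
  have := is_derive_cmulf 2 d1; move/is_derive_eq; apply; rewrite /poisson.
  have h : e ^+ 2 + x ^+ 2 != 0 by rewrite gt_eqF// ltr_pwDl ?sqr_ge0// exprn_gt0.
  have h2 : 1 + (e^-1 * x) ^+ 2 != 0 by rewrite gt_eqF// ltr_pwDl ?sqr_ge0.
  have -> : 1 + (e^-1 * x) ^+ 2 = e ^- 2 * (e ^+ 2 + x ^+ 2) by field; rewrite gt_eqF.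
  by field; rewrite h gt_eqF.
rewrite (@ge0_continuous_FTC2y _ _ (fun z => 2 * atan (e^-1 * z)) _ pi).
- by rewrite mulr0 atan0 mulr0 sube0 -EFinM.
- by move=> x _; rewrite poisson_ge0// ltW.
- by apply: continuous_subspaceT; exact: continuous_poisson.
- rewrite (_ : pi = 2 * (pi / 2)); last by field.
  apply: cvgM; first exact: cvg_cst.
  apply: (@cvg_comp _ _ _ (fun z => e^-1 * z) atan _ (pinfty_nbhs R)); last exact: cvgy_atan.
  by apply: gt0_cvgMry => //; rewrite invr_gt0.
- by move=> x _; exact: ex_derive.
- apply: cvg_at_right_filter; apply: is_derive_continuous; exact: dF.
- by move=> x _; rewrite (is_derive_derive1 (dF x)).
Qed.

Lemma L1_poisson_kernel (e : R) : 0 < e -> L1 (poisson e).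
Proof.
move=> e0; apply/integrableP; split.
  by apply/measurable_EFinP; apply: continuous_measurable_fun; exact: continuous_poisson.
under eq_integral => x _ do rewrite /= ger0_norm ?poisson_ge0 ?ltW//.
by rewrite integral_poisson// ltry.
Qed.

Lemma Rintegral_poisson (e : R) : 0 < e -> \int[mu]_z poisson e z = 2 * pi.
Proof. by move=> e0; rewrite /Rintegral integral_poisson. Qed.

End Poisson.

(** * Continuity of translations in L^2 *)

Section Translation.
Context {R : realType}.
Local Notation mu := (@lebesgue_measure R).

(** Clear for continuous functions by dominated convergence, and these are dense in L^1
    on a bounded interval. *)
Lemma shift_L1_cvg (f : R -> R) (M N : R) (z : nat -> R) : 0 <= N ->
  measurable_fun setT f -> (forall x, `|f x| <= M) -> (forall x, N < `|x| -> f x = 0) ->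
  z n @[n --> \oo] --> 0 ->
  (\int[mu]_x `|f (x + z n) - f x|%:E)%E @[n --> \oo] --> 0%E.
Proof.
move=> N0 mf fM fN cz.
have z1 : exists n0, forall n, (n0 <= n)%N -> `|z n| <= 1.
  by have /cvgrPdist_le/(_ 1 ltr01)[n0 _ h] := cz; exists n0 => n /h /=; rewrite sub0r normrN.
have [n0 hn0] := z1.
pose E : set R := `[- (N + 1), N + 1]%classic.
pose E' : set R := `[- (N + 2), N + 2]%classic.
have mE : measurable E by exact: measurable_itv.
have mE' : measurable E' by exact: measurable_itv.
have fE' : (mu E' < +oo)%E by rewrite /E' lebesgue_measure_itv/=; case: ifP => // _; rewrite -EFinB ltry.
have fE : (mu E < +oo)%E by rewrite /E lebesgue_measure_itv/=; case: ifP => // _; rewrite -EFinB ltry.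
have iF : mu.-integrable E' (EFin \o f).
  apply: measurable_bounded_integrable => //; first exact: measurable_funTS.
  exists M; split; first exact: num_real.
  by move=> M' MM' x _ /=; apply: le_trans (fM x) _; exact: ltW.
have [g_ [cg_ ig_ hg_]] := approximation_continuous_integrable mE' fE' iF.
apply/cvge0P; first by move=> n; apply: integral_ge0 => x _; rewrite lee_fin.
move=> e e0.
have e4 : 0 < e / 4 by rewrite divr_gt0.
have [m /(_ m (leqnn m))] := cvge0_eps hg_ e4.
set g := g_ m => hg.
have cg : continuous g by exact: cg_.
have mg : measurable_fun setT g by exact: continuous_measurable_fun.
pose h (x : R) : R := `|f x - g x| * \1_E' x.
have mh : measurable_fun setT h.
  by apply: measurable_funM; [apply: measurableT_comp => //; exact: measurable_funB|exact: measurable_indic].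
have h0 x : 0 <= h x by rewrite mulr_ge0.
have ih : (\int[mu]_x (h x)%:E <= (e / 4)%:E)%E.
  apply: le_trans hg; rewrite [leRHS]integral_mkcond/=.
  rewrite le_eqVlt; apply/orP; left; apply/eqP; apply: eq_integral => x _.
  rewrite /h patchE indicE; case: ifP => _; last by rewrite mulr0.
  by rewrite mulr1.
pose k (n : nat) (x : R) : R := `|g (x + z n) - g x| * \1_E x.
have mk n : measurable_fun setT (k n).
  apply: measurable_funM; last exact: measurable_indic.
  by apply: measurableT_comp => //; apply: measurable_funB => //; exact: measurable_comp_shift.
have [B hB] : exists B, forall x, E' x -> `|g x| <= B.
  have cng : {within `[- (N + 2), N + 2], continuous (fun x => `|g x|)}.
    apply: continuous_subspaceT => x.
    by apply: (continuous_comp (cg x)); exact: norm_continuous.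
  have ab : - (N + 2) <= N + 2 by lra.
  have [c cin hc] := EVT_max ab cng.
  by exists `|g c| => x Ex; exact: hc.
have EE' x u : E x -> `|u| <= 1 -> E' (x + u).
  rewrite /E /E' /= !in_itv/= => /andP[a b]; rewrite ler_norml => /andP[c d]; apply/andP; split; lra.
have ck : (\int[mu]_x (k (n + n0)%N x)%:E)%E @[n --> \oo] --> 0%E.
  have -> : 0%E = (\int[mu]_x (cst 0%R x)%:E)%E.
    by rewrite integral0.
  apply: (@dominated_cvg _ _ _ mu setT _ _ _ (fun x => (2 * B * \1_E x)%:E)) => //.
  - by move=> n; apply/measurable_EFinP; exact: mk.
  - move=> x _ /=; apply/fine_cvgP; split; first by apply: nearW.
    rewrite /comp /=.
    rewrite /k; have -> : (0:R) = `|g (x + 0) - g x| * \1_E x by rewrite addr0 subrr normr0 mul0r.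
    apply: cvgM; last exact: cvg_cst.
    apply: cvg_norm; apply: cvgB; last exact: cvg_cst.
    apply: (@cvg_comp _ _ _ (fun n => x + z (n + n0)%N) g _ (nbhs (x + 0))); last exact: cg.
    by apply: cvgD; [exact: cvg_cst|rewrite cvg_shiftn].
  - have := @integrable_indic_itv R (- (N + 1)) (N + 1) true false.
    move=> /(integrableZl measurableT (2 * B)); apply: eq_integrable => //.
  - move=> n x _; rewrite /= lee_fin ger0_norm ?mulr_ge0//.
    rewrite /k indicE; case: (boolP (x \in E)); last by rewrite !mulr0.
    rewrite inE => Ex; rewrite !mulr1.
    apply: le_trans (ler_normB _ _) _.
    have h1 := hB _ (EE' _ _ Ex (hn0 _ (leq_addl n n0))).
    have h2 : `|g x| <= B by apply: hB; rewrite -[x]addr0; apply: EE' => //; rewrite normr0.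
    lra.
have [n1 hn1] := cvge0_eps ck e4.
exists (n1 + n0)%N => n nn.
have zn : `|z n| <= 1 by apply: hn0; apply: leq_trans nn; exact: leq_addl.
have hk : (\int[mu]_x (k n x)%:E <= (e / 4)%:E)%E.
  have := hn1 (n - n0)%N; rewrite subnK; last by apply: leq_trans nn; exact: leq_addl.
  by apply; rewrite leq_subRL ?(leq_trans (leq_addl n1 n0) nn)// addnC.
apply: (@le_trans _ _ (\int[mu]_x ((h (x + z n))%:E + (h x)%:E + (k n x)%:E))%E).
  apply: ge0_le_integral => //.
  - apply/measurable_EFinP; apply: measurableT_comp => //; apply: measurable_funB => //.
    exact: measurable_comp_shift.
  - apply: emeasurable_funD; last by apply/measurable_EFinP; exact: mk.
    by apply: emeasurable_funD; apply/measurable_EFinP => //; exact: measurable_comp_shift.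
  move=> x _; rewrite -!EFinD lee_fin.
  have [Ex|nEx] := pselect (E x).
    have Ex' := EE' _ _ Ex zn.
    have Ex'' : E' x by rewrite -[x]addr0; apply: EE' => //; rewrite normr0.
    rewrite /h /k !indicE !mem_set// !mulr1.
    rewrite (_ : _ - _ = (f (x + z n) - g (x + z n)) - (f x - g x) + (g (x + z n) - g x)); last by ring.
    by apply: le_trans (ler_normD _ _) _; rewrite lerD2r; exact: ler_normB.
  have xN : N + 1 < `|x|.
    rewrite ltNge; apply/negP => h'; apply: nEx; rewrite /E /= in_itv/=.
    by rewrite -ler_norml.
  rewrite !fN ?subrr ?normr0 ?addr_ge0 ?mulr_ge0//; first by lra.
  have := ler_normB (x + z n) (z n); rewrite addrK; lra.
rewrite ge0_integralD//; first last.
- by apply/measurable_EFinP; exact: mk.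
- by move=> x _; rewrite lee_fin mulr_ge0.
- by apply: emeasurable_funD; apply/measurable_EFinP => //; exact: measurable_comp_shift.
- by move=> x _; rewrite -EFinD lee_fin addr_ge0.
rewrite ge0_integralD//; first last.
- exact/measurable_EFinP.
- by move=> x _; rewrite lee_fin.
- by apply/measurable_EFinP => //; exact: measurable_comp_shift.
- by move=> x _; rewrite lee_fin.
rewrite (integral_shift (z n) (f := fun x => (h x)%:E)); last exact/measurable_EFinP.
apply: (@le_trans _ _ ((e / 4)%:E + (e / 4)%:E + (e / 4)%:E)%E).
  by apply: leeD => //; apply: leeD.
by rewrite -!EFinD lee_fin; lra.
Qed.

(** Truncation in both size and space reduces L^2 statements to bounded functions of
    bounded support. *)
Definition clip (n : R) (y : R) : R := Num.max (- n) (Num.min y n).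
Definition trunc (v : R -> R) (n : nat) (x : R) : R := clip n%:R (v x) * \1_(`[- n%:R, n%:R]) x.

Lemma clip_le (n y : R) : 0 <= n -> `|clip n y| <= n.
Proof.
move=> n0; rewrite /clip ler_norml le_max lexx/= ge_max ge_min lexx orbT andbT; lra.
Qed.

Lemma clip_id (n y : R) : `|y| <= n -> clip n y = y.
Proof.
rewrite ler_norml => /andP[h1 h2]; rewrite /clip.
by rewrite (min_idPl h2) (max_idPr h1).
Qed.

Lemma clip_sub_le (n y : R) : 0 <= n -> `|y - clip n y| <= `|y|.
Proof.
move=> n0; have [h|h] := lerP `|y| n; first by rewrite clip_id// subrr normr0.
have [y0|y0] := lerP 0 y.
  rewrite ger0_norm// in h *; rewrite /clip (min_idPr (ltW h)) (max_idPr _); last lra.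
  by rewrite ger0_norm; lra.
rewrite ltr0_norm// in h *; rewrite /clip (min_idPl _); last lra.
rewrite (max_idPl _); last lra.
by rewrite ler0_norm; lra.
Qed.

Lemma measurable_trunc (v : R -> R) n : measurable_fun setT v -> measurable_fun setT (trunc v n).
Proof.
move=> mv; apply: measurable_funM; last exact: measurable_indic.
by apply: measurable_maxr => //; exact: measurable_minr.
Qed.

Lemma trunc_le (v : R -> R) n x : `|trunc v n x| <= n%:R.
Proof.
rewrite /trunc indicE; case: (_ \in _); rewrite ?mulr1 ?mulr0 ?normr0//.
exact: clip_le.
Qed.

Lemma trunc_supp (v : R -> R) n x : n%:R < `|x| -> trunc v n x = 0.
Proof.
move=> h; rewrite /trunc indicE memNset ?mulr0//= in_itv/= -ler_norml.
by apply/negP; rewrite -ltNge.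
Qed.

Lemma trunc_sub_le (v : R -> R) n x : `|v x - trunc v n x| <= `|v x|.
Proof.
rewrite /trunc indicE; case: (_ \in _); rewrite ?mulr1 ?mulr0 ?subr0//.
exact: clip_sub_le.
Qed.

Lemma trunc_eq (v : R -> R) n x : `|v x| <= n%:R -> `|x| <= n%:R -> trunc v n x = v x.
Proof.
move=> h1 h2; rewrite /trunc clip_id// indicE mem_set ?mulr1//=.
by rewrite in_itv/= -ler_norml.
Qed.

Lemma nsq_dominated_cvg (v : R -> R) (w : nat -> R -> R) : L2 v ->
  (forall n, measurable_fun setT (w n)) -> (forall n x, `|w n x| <= `|v x|) ->
  (forall x, w n x @[n --> \oo] --> 0) ->
  nsq (w n) @[n --> \oo] --> 0%E.
Proof.
move=> vL mw wv cw; rewrite /nsq.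
have -> : 0%E = (\int[mu]_x (cst 0%R x)%:E)%E by rewrite integral0.
apply: (@dominated_cvg _ _ _ mu setT measurableT (fun n x => ((w n x) ^+ 2)%:E) (fun x => (cst 0%R x)%:E) (fun x => (v x ^+ 2)%:E)) => //.
- by move=> n; exact: measurable_sqr_EFin.
- move=> x _; apply/fine_cvgP; split; first by apply: nearW.
  have -> : fine \o (fun n => (w n x ^+ 2)%:E) = (fun n => w n x * w n x).
    by apply/funext => n /=; rewrite expr2.
  by rewrite /cst -[X in _ --> X](mulr0 (0:R)); apply: cvgM; exact: cw.
- exact: L2_integrable_sqr.
- move=> n x _; rewrite /= lee_fin ger0_norm ?sqr_ge0//.
  rewrite -(real_normK (num_real (w n x))) -(real_normK (num_real (v x))).
  by rewrite lerXn2r ?nnegrE.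
Qed.

Lemma nsq_trunc_cvg (v : R -> R) : L2 v -> nsq (fun x => v x - trunc v n x)%R @[n --> \oo] --> 0%E.
Proof.
move=> vL; have mv : measurable_fun setT v by case: vL.
apply: (nsq_dominated_cvg vL).
- by move=> n; apply: measurable_funB => //; exact: measurable_trunc.
- by move=> n x; exact: trunc_sub_le.
- move=> x; pose n0 := (Num.trunc `|v x| + Num.trunc `|x|).+1.
  apply: cvg_near_cst; exists n0 => // n /= nn.
  have b (y : R) : `|y| <= (Num.trunc `|y|).+1%:R by exact/ltW/truncnS_gt.
  rewrite trunc_eq ?subrr//.
    by apply: le_trans (b _) _; rewrite ler_nat (leq_trans _ nn)// ltnS leq_addr.
  by apply: le_trans (b _) _; rewrite ler_nat (leq_trans _ nn)// ltnS leq_addl.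
Qed.

(** For a truncation [h] of [f], bounded by [m], the square of [h (x + z) - h x] is at
    most [2 m] times its absolute value, which is small in L^1. *)
Lemma nsq_shift_cvg (f : R -> R) (z : nat -> R) : L2 f -> z n @[n --> \oo] --> 0 ->
  nsq (fun x => f (x + z n) - f x)%R @[n --> \oo] --> 0%E.
Proof.
move=> fL cz; have mf : measurable_fun setT f by case: fL.
apply/cvge0P; first by move=> n; exact: nsq_ge0.
move=> e e0.
have e16 : 0 < e / 16 by rewrite divr_gt0.
have [m /(_ m (leqnn m))] := cvge0_eps (nsq_trunc_cvg fL) e16.
set h := trunc f m => hm.
have mh : measurable_fun setT h by exact: measurable_trunc.
have := @shift_L1_cvg h m%:R m%:R z (ler0n _ _) mh (trunc_le f m) (@trunc_supp f m) cz.
have em : 0 < e / (16 * (m.+1)%:R) by rewrite divr_gt0// mulr_gt0.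
move=> /cvge0_eps/(_ em)[N hN]; exists N => n Nn.
have mhs : measurable_fun setT (fun x : R => h (x + z n)) by exact: measurable_comp_shift.
have mfs : measurable_fun setT (fun x : R => f (x + z n)) by exact: measurable_comp_shift.
have key : (nsq (fun x => h (x + z n) - h x)%R <= (e / 8)%:E)%E.
  apply: (@le_trans _ _ ((2 * (m.+1)%:R)%:E * \int[mu]_x `|h (x + z n) - h x|%:E)%E).
    rewrite -ge0_integralZl_EFin//.
    - apply: ge0_le_integral => //.
      + by move=> x _; rewrite lee_fin sqr_ge0.
      + by apply: measurable_sqr_EFin; exact: measurable_funB.
      + apply: emeasurable_funM => //; apply/measurable_EFinP; apply: measurableT_comp => //.
        exact: measurable_funB.
      + move=> x _; rewrite -EFinM lee_fin -(real_normK (num_real (_ - _))) expr2 ler_wpM2r//.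
        apply: le_trans (ler_normB _ _) _.
        have := trunc_le f m (x + z n); have := trunc_le f m x.
        rewrite -/h -natr1; lra.
    - by apply/measurable_EFinP; apply: measurableT_comp => //; exact: measurable_funB.
  apply: (@le_trans _ _ ((2 * (m.+1)%:R)%:E * (e / (16 * m.+1%:R))%:E)%E).
    by apply: lee_wpmul2l; [rewrite lee_fin|exact: hN].
  rewrite -EFinM lee_fin le_eqVlt; apply/orP; left; apply/eqP; field.
  by rewrite addrC natr1 pnatr_eq0.
pose d x := f x - h x.
have md : measurable_fun setT d by exact: measurable_funB.
have mds : measurable_fun setT (fun x : R => d (x + z n)) by exact: measurable_comp_shift.
apply: (@le_trans _ _ (2%:E * (2%:E * nsq (fun x => d (x + z n))%R + 2%:E * nsq (fun x => (-1) * d x)%R) + 2%:E * nsq (fun x => h (x + z n) - h x)%R)%E).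
  apply: (@le_trans _ _ (2%:E * nsq (fun x => d (x + z n) + (-1) * d x)%R + 2%:E * nsq (fun x => h (x + z n) - h x)%R)%E).
    apply: le_trans (nsqD_le _ _).
    - rewrite le_eqVlt; apply/orP; left; apply/eqP; apply: eq_integral => x _.
      by congr (_ ^+ 2)%:E; rewrite /d; ring.
    - by apply: measurable_funD => //; exact: measurable_funM.
    - exact: measurable_funB.
  apply: leeD => //; apply: lee_wpmul2l => //.
  by apply: nsqD_le => //; exact: measurable_funM.
rewrite nsqZ// nsq_shift//.
have -> : ((-1 : R) ^+ 2)%:E = 1%E by congr (_%:E); ring.
rewrite mul1e.
apply: (@le_trans _ _ (2%:E * (2%:E * (e / 16)%:E + 2%:E * (e / 16)%:E) + 2%:E * (e / 8)%:E)%E).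
  apply: leeD; apply: lee_wpmul2l => //.
  by apply: leeD; apply: lee_wpmul2l.
by rewrite -!(EFinM, EFinD) lee_fin; lra.
Qed.

Lemma nsq_shift_small (f : R -> R) (e : R) : L2 f -> 0 < e ->
  exists2 d : R, 0 < d & forall z, `|z| <= d -> (nsq (fun x => f (x + z) - f x)%R <= e%:E)%E.
Proof.
move=> fL e0; apply: contrapT => H.
have /choice[z hz] : forall n : nat, exists z : R,
    `|z| <= n.+1%:R^-1 /\ (e%:E < nsq (fun x => f (x + z) - f x)%R)%E.
  move=> n; apply: contrapT => H'; apply: H; exists n.+1%:R^-1; first by rewrite invr_gt0.
  by move=> z zn; rewrite leNgt; apply/negP => lt; apply: H'; exists z.
have cz : z n @[n --> \oo] --> 0.
  apply/norm_cvg0P; apply: (@squeeze_cvgr _ _ _ _ (fun=> 0) (fun n => n.+1%:R^-1)).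
  - by apply: nearW => n /=; rewrite normr_ge0; case: (hz n).
  - exact: cvg_cst.
  - exact: cvg_harmonic.
have := nsq_shift_cvg fL cz.
move=> /cvge0_eps/(_ e0)[N /(_ N (leqnn N))].
by case: (hz N) => _; rewrite ltNge => /negP.
Qed.

End Translation.

(** * Plancherel's identity on the intersection of L^1 and L^2 *)

Section FourierL1.
Context {R : realType}.
Local Notation mu := (@lebesgue_measure R).
Implicit Types f g : R -> R.

Definition fcos f (xi : R) : R := \int[mu]_x (f x * cos (xi * x)).
Definition fsin f (xi : R) : R := \int[mu]_x (f x * sin (xi * x)).

Lemma fourierE f xi : fourier f xi = Complex (fcos f xi) (- fsin f xi).
Proof. by []. Qed.

Lemma L1_cos f xi : L1 f -> L1 (fun x => f x * cos (xi * x)).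
Proof.
move=> ff; apply: (L1_mul_bounded (M := 1) ff); first exact: measurable_cos_dilate.
by move=> x; exact: normr_cos_le1.
Qed.

Lemma L1_sin f xi : L1 f -> L1 (fun x => f x * sin (xi * x)).
Proof.
move=> ff; apply: (L1_mul_bounded (M := 1) ff); first exact: measurable_sin_dilate.
by move=> x; exact: normr_sin_le1.
Qed.

Lemma fcos_le f xi : L1 f -> `|fcos f xi| <= \int[mu]_x `|f x|.
Proof.
move=> ff; apply: le_trans (Rint_norm_le (L1_cos xi ff)) _.
apply: Rint_le; [exact: L1_norm (L1_cos xi ff)|exact: L1_norm|].
by move=> x; rewrite normrM ler_piMr// normr_cos_le1.
Qed.

Lemma fsin_le f xi : L1 f -> `|fsin f xi| <= \int[mu]_x `|f x|.
Proof.
move=> ff; apply: le_trans (Rint_norm_le (L1_sin xi ff)) _.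
apply: Rint_le; [exact: L1_norm (L1_sin xi ff)|exact: L1_norm|].
by move=> x; rewrite normrM ler_piMr// normr_sin_le1.
Qed.

Lemma fcosD f g xi : L1 f -> L1 g -> fcos (fun x => f x + g x) xi = fcos f xi + fcos g xi.
Proof.
move=> ff gg; rewrite /fcos -RintegralD//; [|exact: L1_cos|exact: L1_cos].
by apply: eq_Rintegral => x _; rewrite mulrDl.
Qed.

Lemma fsinD f g xi : L1 f -> L1 g -> fsin (fun x => f x + g x) xi = fsin f xi + fsin g xi.
Proof.
move=> ff gg; rewrite /fsin -RintegralD//; [|exact: L1_sin|exact: L1_sin].
by apply: eq_Rintegral => x _; rewrite mulrDl.
Qed.

Lemma fcosZ c f xi : L1 f -> fcos (fun x => c * f x) xi = c * fcos f xi.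
Proof.
move=> ff; rewrite /fcos -RintegralZl//; last exact: L1_cos.
by apply: eq_Rintegral => x _; rewrite mulrA.
Qed.

Lemma fsinZ c f xi : L1 f -> fsin (fun x => c * f x) xi = c * fsin f xi.
Proof.
move=> ff; rewrite /fsin -RintegralZl//; last exact: L1_sin.
by apply: eq_Rintegral => x _; rewrite mulrA.
Qed.

Lemma continuous_fourier_aux f (k : R -> R) : L1 f -> continuous k -> (forall x, `|k x| <= 1) ->
  continuous (fun xi : R => \int[mu]_x (f x * k (xi * x))).
Proof.
move=> ff ck k1 xi.
have mk (z : R) : measurable_fun setT (fun x : R => k (z * x)).
  by apply: continuous_measurable_fun; exact: continuous_dilate.
have ck' (x : R) : continuous (fun z : R => k (z * x)).
  by under eq_fun do rewrite mulrC; exact: continuous_dilate.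
apply: (@continuity_under_integral R _ _ mu (fun z x => f x * k (z * x)) setT measurableT
  (xi - 1) (xi + 1) _ _ (fun x => `|f x|)).
- by move=> z _; apply: (L1_mul_bounded (M := 1) ff).
- apply: aeW => x _ z _.
  apply: cvgM; first exact: cvg_cst.
  exact: ck'.
- exact: L1_norm.
- by move=> z _; apply: aeW => x _; rewrite normrM ler_piMr.
- by rewrite inE/= in_itv/=; apply/andP; split; lra.
Qed.

Lemma continuous_fcos f : L1 f -> continuous (fcos f).
Proof.
by move=> ff; apply: continuous_fourier_aux => //; [exact: continuous_cos|exact: normr_cos_le1].
Qed.

Lemma continuous_fsin f : L1 f -> continuous (fsin f).
Proof.
by move=> ff; apply: continuous_fourier_aux => //; [exact: continuous_sin|exact: normr_sin_le1].
Qed.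

Lemma measurable_fcos f : L1 f -> measurable_fun setT (fcos f).
Proof. by move=> ff; apply: continuous_measurable_fun; exact: continuous_fcos. Qed.

Lemma measurable_fsin f : L1 f -> measurable_fun setT (fsin f).
Proof. by move=> ff; apply: continuous_measurable_fun; exact: continuous_fsin. Qed.

Lemma fcos_shift f a xi : L1 f ->
  fcos (fun x => f (x + a)) xi = cos (xi * a) * fcos f xi + sin (xi * a) * fsin f xi.
Proof.
move=> ff; rewrite /fcos /fsin -!RintegralZl//; [|exact: L1_sin|exact: L1_cos].
rewrite -RintegralD//; [|exact: L1Z (L1_cos xi ff)|exact: L1Z (L1_sin xi ff)].
rewrite -(Rintegral_shift a (f := fun x => cos (xi * a) * (f x * cos (xi * x)) + sin (xi * a) * (f x * sin (xi * x)))).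
  apply: eq_Rintegral => x _.
  have {1}-> : xi * x = xi * (x + a) - xi * a by ring.
  by rewrite cosB; ring.
apply: measurable_funD; apply: measurable_funM => //; apply: measurable_funM => //.
- exact: L1_measurable. - exact: measurable_cos_dilate.
- exact: L1_measurable. - exact: measurable_sin_dilate.
Qed.

Lemma fsin_shift f a xi : L1 f ->
  fsin (fun x => f (x + a)) xi = cos (xi * a) * fsin f xi - sin (xi * a) * fcos f xi.
Proof.
move=> ff; rewrite /fcos /fsin -!RintegralZl//; [|exact: L1_cos|exact: L1_sin].
rewrite -RintegralB//; [|exact: L1Z (L1_sin xi ff)|exact: L1Z (L1_cos xi ff)].
rewrite -(Rintegral_shift a (f := fun x => cos (xi * a) * (f x * sin (xi * x)) - sin (xi * a) * (f x * cos (xi * x)))).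
  apply: eq_Rintegral => x _.
  have {1}-> : xi * x = xi * (x + a) - xi * a by ring.
  by rewrite sinB; ring.
apply: measurable_funB; apply: measurable_funM => //; apply: measurable_funM => //.
- exact: L1_measurable. - exact: measurable_sin_dilate.
- exact: L1_measurable. - exact: measurable_cos_dilate.
Qed.

End FourierL1.

Section Plancherel.
Context {R : realType}.
Local Notation mu := (@lebesgue_measure R).
Variable f : R -> R.
Hypotheses (f1 : L1 f) (f2 : L2 f).

Definition autocorr (z : R) : R := \int[mu]_x (f x * f (x + z)).

Let mf : measurable_fun setT f. Proof. exact: L1_measurable. Qed.

Let mff (xi : R) : measurable_fun setT (fun p : R * R => f p.1 * f (p.1 + p.2) * cos (xi * p.2)).
Proof.
apply: measurable_funM; last first.
  by apply: (measurableT_comp (measurable_cos_dilate xi)); exact: measurable_snd.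
apply: measurable_funM; first by apply: (measurableT_comp mf); exact: measurable_fst.
apply: (measurableT_comp mf); apply: measurable_funD; [exact: measurable_fst|exact: measurable_snd].
Qed.

Let fubini_autocorr (xi : R) :
  (\int[mu]_x \int[mu]_z `|(f x * f (x + z) * cos (xi * z))%:E| < +oo)%E.
Proof.
apply: (@le_lt_trans _ _ (\int[mu]_x (`|f x|%:E * \int[mu]_y `|f y|%:E))%E); last first.
  rewrite ge0_integralZr//; first last.
  - exact: integral_ge0.
  - by apply/measurable_EFinP; exact: measurableT_comp.
  by rewrite lte_mul_pinfty//; [exact: integral_ge0| rewrite ge0_fin_numE; [move/integrableP: f1 => []|exact: integral_ge0]|move/integrableP: f1 => []].
have mFe : measurable_fun setT (fun p : R * R => `|(f p.1 * f (p.1 + p.2) * cos (xi * p.2))%:E|%E).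
  by apply: measurableT_comp => //; apply/measurable_EFinP; exact: mff.
apply: ge0_le_integral => //.
- by move=> x _; exact: integral_ge0.
- exact: (@measurable_fun_fubini_tonelli_F _ _ _ _ R mu _ mFe (fun z => abse_ge0 _)).
- by apply: emeasurable_funM => //; apply/measurable_EFinP; exact: measurableT_comp.
move=> x _.
rewrite -(integral_shift x (f := fun y => `|f y|%:E)); last by apply/measurable_EFinP; exact: measurableT_comp.
have ms : measurable_fun setT (fun y : R => `|f (y + x)|%:E).
  by apply/measurable_EFinP; apply: measurableT_comp => //; exact: measurable_comp_shift.
rewrite -ge0_integralZl//.
apply: ge0_le_integral => //.
- have := measurableT_comp mFe (measurable_pair1 x); exact.
- exact: emeasurable_funM.
- move=> y _; rewrite /= -EFinM lee_fin !normrM [y + x]addrC ler_piMr ?mulr_ge0//.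
  exact: normr_cos_le1.
Qed.

Lemma L1_autocorr : L1 autocorr.
Proof.
have [_ _ _ + _] := Rintegral_Fubini (mff 0) (fubini_autocorr 0).
congr L1; apply/funext => z; apply: eq_Rintegral => x _ /=.
by rewrite mul0r cos0 mulr1.
Qed.

(** The power spectrum is the transform of the autocorrelation (Wiener-Khinchin): Fubini
    and a translation of the inner integral. *)
Lemma power_spectrum (xi : R) :
  fcos f xi ^+ 2 + fsin f xi ^+ 2 = \int[mu]_z (autocorr z * cos (xi * z)).
Proof.
have [_ _ _ _] := Rintegral_Fubini (mff xi) (fubini_autocorr xi).
have -> : \int[mu]_z (\int[mu]_x (f x * f (x + z) * cos (xi * z))) = \int[mu]_z (autocorr z * cos (xi * z)).
  apply: eq_Rintegral => z _ /=; rewrite /autocorr -RintegralZr//.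
  exact: L2_integrableM f2 (L2_shift z f2).
move=> <-.
have E x : \int[mu]_z (f x * f (x + z) * cos (xi * z)) =
    fcos f xi * (f x * cos (xi * x)) + fsin f xi * (f x * sin (xi * x)).
  transitivity (f x * fcos (fun z => f (z + x)) xi).
    rewrite /fcos -RintegralZl//; last by apply: L1_cos; exact: L1_shift.
    by apply: eq_Rintegral => z _; rewrite [x + z]addrC mulrA.
  by rewrite fcos_shift//; ring.
under eq_Rintegral do rewrite E.
rewrite (RintD (L1Z (fcos f xi) (L1_cos xi f1)) (L1Z (fsin f xi) (L1_sin xi f1))).
rewrite (RintZ _ (L1_cos xi f1)) (RintZ _ (L1_sin xi f1)).
by rewrite !expr2.
Qed.

(** Integrability of the power spectrum is not known yet; the exponential makes Fubini
    legitimate, and the inner integral becomes the Poisson kernel. *)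
Lemma poisson_regularized (e : R) : 0 < e ->
  L1 (fun xi => expR (- e * `|xi|) * (fcos f xi ^+ 2 + fsin f xi ^+ 2)) /\
  \int[mu]_xi (expR (- e * `|xi|) * (fcos f xi ^+ 2 + fsin f xi ^+ 2)) =
  \int[mu]_z (autocorr z * poisson e z).
Proof.
move=> e0.
have mA := L1_measurable L1_autocorr.
have mF : measurable_fun setT (fun p : R * R => expR (- e * `|p.1|) * autocorr p.2 * cos (p.1 * p.2)).
  apply: measurable_funM.
    apply: measurable_funM.
      by apply: (measurableT_comp (L1_measurable (L1_poisson e0))); exact: measurable_fst.
    by apply: (measurableT_comp mA); exact: measurable_snd.
  apply: (@measurableT_comp _ _ _ _ _ _ cos).
    by apply: continuous_measurable_fun; exact: continuous_cos.
  by apply: measurable_funM; [exact: measurable_fst|exact: measurable_snd].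
have hF := @product_dominated R _ _ _ mF (L1_poisson e0) L1_autocorr _.
have [|_ _ i1 _ E] := Rintegral_Fubini mF (hF _).
  by move=> x y /=; rewrite !normrM ler_piMr ?mulr_ge0// normr_cos_le1.
have E1 (xi : R) : \int[mu]_z (expR (- e * `|xi|) * autocorr z * cos (xi * z)) =
    expR (- e * `|xi|) * (fcos f xi ^+ 2 + fsin f xi ^+ 2).
  rewrite power_spectrum -(RintZ _ (L1_cos xi L1_autocorr)).
  by apply: eq_Rintegral => z _; rewrite mulrA.
split.
  by move: i1; congr L1; apply/funext => xi; rewrite /= E1.
transitivity (\int[mu]_xi \int[mu]_z (expR (- e * `|xi|) * autocorr z * cos (xi * z))).
  by apply: eq_Rintegral => xi _; rewrite E1.
rewrite E; apply: eq_Rintegral => z _ /=.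
have ic : L1 (fun x => expR (- e * `|x|) * cos (z * x)) by exact: L1_cos (L1_poisson e0).
rewrite -(Rintegral_poisson_cos z e0) -(RintZ _ ic).
by apply: eq_Rintegral => x _; rewrite [z * x]mulrC; ring.
Qed.

Let a0 := \int[mu]_x (f x ^+ 2).

Let a0_ge0 : 0 <= a0. Proof. by apply: Rintegral_ge0 => x _; exact: sqr_ge0. Qed.

(** Polarization; with the continuity of translations in L^2 it makes [autocorr]
    continuous at 0. *)
Lemma autocorr_defect z : (2 * (a0 - autocorr z))%:E = nsq (fun x => f (x + z) - f x)%R.
Proof.
have fz := L2_shift z f2.
rewrite nsqE; last exact: L2B.
congr (_%:E).
have i1 := L2_integrable_sqr f2; have i2 := L2_integrable_sqr fz; have i3 := L2_integrableM f2 fz.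
have Ez : \int[mu]_x (f (x + z) ^+ 2) = a0.
  by apply: (Rintegral_shift z (f := fun x => f x ^+ 2)); exact: measurable_funX.
transitivity (\int[mu]_x ((f (x + z) ^+ 2 + f x ^+ 2) - 2 * (f x * f (x + z)))); last first.
  by apply: eq_Rintegral => x _; ring.
rewrite (RintB (L1D i2 i1) (L1Z 2 i3)) (RintD i2 i1) (RintZ 2 i3) Ez -/a0 -/(autocorr z); ring.
Qed.

Lemma autocorr_le z : autocorr z <= a0.
Proof.
have := nsq_ge0 (fun x => f (x + z) - f x); rewrite -autocorr_defect lee_fin; lra.
Qed.

Lemma autocorr_ge z : - a0 <= autocorr z.
Proof.
have fz := L2_shift z f2.
have i1 := L2_integrable_sqr f2; have i2 := L2_integrable_sqr fz; have i3 := L2_integrableM f2 fz.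
have Ez : \int[mu]_x (f (x + z) ^+ 2) = a0.
  by apply: (Rintegral_shift z (f := fun x => f x ^+ 2)); exact: measurable_funX.
have : 0 <= \int[mu]_x ((f (x + z) ^+ 2 + f x ^+ 2) + 2 * (f x * f (x + z))).
  by apply: Rintegral_ge0 => x _; have := sqr_ge0 (f (x + z) + f x); rewrite sqrrD; lra.
rewrite (RintD (L1D i2 i1) (L1Z 2 i3)) (RintD i2 i1) (RintZ 2 i3) Ez -/a0 -/(autocorr z).
move: (a0) (autocorr z) => u v; lra.
Qed.

Lemma L1_autocorr_poisson e : 0 < e -> L1 (fun z => autocorr z * poisson e z).
Proof.
move=> e0.
have := @L1_mul_bounded R (poisson e) autocorr a0 (L1_poisson_kernel e0) (L1_measurable L1_autocorr).
have h x : `|autocorr x| <= a0 by rewrite ler_norml autocorr_ge autocorr_le.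
by move=> /(_ h); congr L1; apply/funext => z; rewrite mulrC.
Qed.

(** The autocorrelation is continuous at 0 and the Poisson kernels, of total mass [2 pi],
    concentrate there: away from 0 the kernel of parameter [e] is at most a multiple
    of [e] times the kernel of parameter 1. *)
Lemma cvg_autocorr_poisson :
  \int[mu]_z (autocorr z * poisson (n.+1%:R^-1) z) @[n --> \oo] --> 2 * pi * a0.
Proof.
apply/cvgrPdist_le => eta eta0.
have pi0 : 0 < pi :> R by exact: pi_gt0.
pose t := eta / (4 * pi).
have t0 : 0 < t by rewrite divr_gt0// mulr_gt0.
have t20 : 0 < 2 * t by rewrite mulr_gt0.
have [d d0 hd] := nsq_shift_small f2 t20.
have hd' z : `|z| <= d -> a0 - autocorr z <= t.
  by move=> /hd; rewrite -autocorr_defect lee_fin ler_pM2l.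
pose K := 4 * pi * a0 * (1 + d ^- 2).
have bound e : 0 < e -> e <= 1 ->
    `|2 * pi * a0 - \int[mu]_z (autocorr z * poisson e z)| <= eta / 2 + e * K.
  move=> e0 e1.
  have iP := L1_poisson_kernel e0; have iP1 := L1_poisson_kernel (ltr01 : 0 < 1 :> R).
  have iA := L1_autocorr_poisson e0.
  have Edef : 2 * pi * a0 - \int[mu]_z (autocorr z * poisson e z) =
      \int[mu]_z ((a0 - autocorr z) * poisson e z).
    rewrite -(Rintegral_poisson e0) mulrC -(RintZ _ iP) -(RintB (L1Z a0 iP) iA).
    by apply: eq_Rintegral => z _; rewrite mulrBl.
  have iD : L1 (fun z => (a0 - autocorr z) * poisson e z).
    by have := L1B (L1Z a0 iP) iA; congr L1; apply/funext => z; rewrite mulrBl.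
  rewrite Edef ger0_norm; last first.
    apply: Rintegral_ge0 => z _; apply: mulr_ge0; first by rewrite subr_ge0 autocorr_le.
    by rewrite poisson_ge0// ltW.
  have -> : eta / 2 + e * K = \int[mu]_z (t * poisson e z + (2 * a0 * e * (1 + d ^- 2)) * poisson 1 z).
    rewrite (RintD (L1Z t iP) (L1Z _ iP1)) (RintZ _ iP) (RintZ _ iP1) !Rintegral_poisson// /K /t.
    by move: pi pi0 => p p0; field; rewrite !gt_eqF.
  apply: Rint_le => //; first exact: L1D (L1Z t iP) (L1Z _ iP1).
  move=> z.
  have P0 : 0 <= poisson e z by rewrite poisson_ge0// ltW.
  have P10 : 0 <= poisson 1 z by rewrite poisson_ge0.
  have [zd|dz] := lerP `|z| d.
    apply: (@le_trans _ _ (t * poisson e z)); first by rewrite ler_wpM2r// hd'.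
    rewrite lerDl mulr_ge0// mulr_ge0//; last by rewrite addr_ge0// invr_ge0 exprn_ge0// ltW.
    by apply: mulr_ge0; [exact: mulr_ge0|exact: ltW].
  apply: (@le_trans _ _ (2 * a0 * e * (1 + d ^- 2) * poisson 1 z)); last first.
    by rewrite lerDr mulr_ge0// ltW.
  apply: (@le_trans _ _ (2 * a0 * poisson e z)).
    by rewrite ler_wpM2r//; have := autocorr_ge z; move: (a0) (autocorr z) => u v; lra.
  rewrite -!mulrA; apply: ler_wpM2l => //; apply: ler_wpM2l => //.
  have z0 : 0 < z ^+ 2 by rewrite -real_normK ?num_real// exprn_gt0// (lt_trans d0).
  have d20 : 0 < d ^+ 2 by rewrite exprn_gt0.
  have zd2 : d ^+ 2 <= z ^+ 2.
    by rewrite -[leRHS]real_normK ?num_real// lerXn2r ?nnegrE// ltW.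
  rewrite /poisson expr1n mulr1.
  have -> : e * ((1 + d ^- 2) * (2 / (1 + z ^+ 2))) = 2 * e * ((1 + d ^- 2) / (1 + z ^+ 2)) by ring.
  apply: ler_wpM2l; first by rewrite mulr_ge0// ltW.
  rewrite ler_pdivlMr; last by rewrite ltr_pwDl// sqr_ge0.
  rewrite mulrC ler_pdivrMr; last by rewrite ltr_pwDr// sqr_ge0.
  apply: (@le_trans _ _ ((1 + d ^- 2) * z ^+ 2)); last first.
    apply: ler_wpM2l; last by rewrite lerDr sqr_ge0.
    by rewrite addr_ge0// invr_ge0 ltW.
  rewrite mulrDl mul1r addrC lerD2l mulrC ler_pdivlMr ?mul1r//.
have K0 : 0 <= K.
  apply: mulr_ge0; last by rewrite addr_ge0// invr_ge0 exprn_ge0// ltW.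
  by rewrite mulr_ge0// mulr_ge0// ltW.
have /cvgrPdist_le/(_ (eta / 2)) : (n.+1%:R^-1 : R) * K @[n --> \oo] --> 0.
  rewrite -[X in _ --> X](mul0r K); apply: cvgM; [exact: cvg_harmonic|exact: cvg_cst].
rewrite divr_gt0// => /(_ isT)[N _ hN]; exists N => // n Nn.
have := hN n Nn; rewrite /= sub0r normrN ger0_norm; last by rewrite mulr_ge0.
have := bound n.+1%:R^-1; rewrite invr_gt0 ltr0n => /(_ isT).
rewrite invf_le1// ler1n => /(_ isT).
move: (`|_|) (n.+1%:R^-1 * K) => u v; lra.
Qed.

(** Let the regularization go to 0: monotone convergence on the frequency side, the Poisson
    kernels as an approximate identity on the other. *)
Lemma plancherel_L1 :
  (\int[mu]_xi (fcos f xi ^+ 2 + fsin f xi ^+ 2)%:E = (2 * pi)%:E * nsq f)%E.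
Proof.
have mc := measurable_fcos f1; have ms := measurable_fsin f1.
pose S xi := fcos f xi ^+ 2 + fsin f xi ^+ 2.
have S0 xi : 0 <= S xi by rewrite addr_ge0 ?sqr_ge0.
have mS : measurable_fun setT S by apply: measurable_funD; exact: measurable_funX.
pose w n xi : \bar R := (expR (- n.+1%:R^-1 * `|xi|) * S xi)%:E.
have en n : 0 < n.+1%:R^-1 :> R by rewrite invr_gt0.
have mw n : measurable_fun setT (w n).
  apply/measurable_EFinP; apply: measurable_funM => //.
  exact: L1_measurable (L1_poisson (en n)).
have w0 n xi : setT xi -> (0 <= w n xi)%E by rewrite lee_fin mulr_ge0 ?expR_ge0.
have ndw xi : setT xi -> nondecreasing_seq (w^~ xi).
  move=> _ m n mn; rewrite lee_fin ler_wpM2r// ler_expR !mulNr lerN2 ler_wpM2r//.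
  by rewrite lef_pV2 ?posrE// ler_nat.
have cw xi : w n xi @[n --> \oo] --> (S xi)%:E.
  apply: cvg_EFin; first by apply: nearW.
  rewrite /comp/=.
  have {2}-> : S xi = expR 0 * S xi by rewrite expR0 mul1r.
  apply: cvgM; last exact: cvg_cst.
  apply: (@cvg_comp _ _ _ (fun n => - n.+1%:R^-1 * `|xi|) expR _ (nbhs 0)); last exact: continuous_expR.
  have := @cvgM R nat \oo _ _ _ _ _ (cvgN (@cvg_harmonic R)) (cvg_cst `|xi|).
  by rewrite oppr0 mul0r; exact.
have := @cvg_monotone_convergence _ _ R mu setT measurableT w mw w0 ndw.
have -> : (fun n => \int[mu]_(x in setT) w n x)%E = (fun n => (\int[mu]_z (autocorr z * poisson (n.+1%:R^-1) z))%:E).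
  apply/funext => n; have [i1 <-] := poisson_regularized (en n).
  by rewrite EFin_Rint.
have -> : (\int[mu]_(x in setT) limn (w^~ x) = \int[mu]_x (S x)%:E)%E.
  by apply: eq_integral => x _; apply/cvg_lim => //; exact: cw.
move=> c1.
have c2 : (\int[mu]_z (autocorr z * poisson (n.+1%:R^-1) z))%:E @[n --> \oo] --> (2 * pi * a0)%:E.
  by apply: cvg_EFin; [apply: nearW|exact: cvg_autocorr_poisson].
have := cvg_unique _ c1 c2; rewrite nsqE// => ->//.
Qed.

End Plancherel.

(** * The Fourier transform on L^2 *)

Section ComplexL2.
Context {R : realType}.
Local Notation mu := (@lebesgue_measure R).
Implicit Types (a b : R[i]) (w : R -> R[i]) (m : R -> R).

Lemma ReD a b : complex.Re (a + b) = complex.Re a + complex.Re b.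
Proof. by case: a b => [? ?] [? ?]. Qed.
Lemma ImD a b : complex.Im (a + b) = complex.Im a + complex.Im b.
Proof. by case: a b => [? ?] [? ?]. Qed.
Lemma ReN a : complex.Re (- a) = - complex.Re a.
Proof. by case: a. Qed.
Lemma ImN a : complex.Im (- a) = - complex.Im a.
Proof. by case: a. Qed.
Lemma ReM a b : complex.Re (a * b) = complex.Re a * complex.Re b - complex.Im a * complex.Im b.
Proof. by case: a b => [? ?] [? ?]. Qed.
Lemma ImM a b : complex.Im (a * b) = complex.Re a * complex.Im b + complex.Im a * complex.Re b.
Proof. by case: a b => [? ?] [? ?]. Qed.

Lemma sqnormc_ge0 a : 0 <= sqnormc a.
Proof. by rewrite addr_ge0 ?sqr_ge0. Qed.

Lemma sqnormcN a : sqnormc (- a) = sqnormc a.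
Proof. by rewrite /sqnormc ReN ImN !sqrrN. Qed.

Lemma sqnormcM a b : sqnormc (a * b) = sqnormc a * sqnormc b.
Proof. by rewrite /sqnormc ReM ImM; ring. Qed.

Lemma sqnormcC (c : R) : sqnormc (c%:C) = c ^+ 2.
Proof. by rewrite /sqnormc /= expr0n addr0. Qed.

Lemma sqnormcD_le a b : sqnormc (a + b) <= 2 * sqnormc a + 2 * sqnormc b.
Proof.
rewrite /sqnormc ReD ImD.
have := sqr_ge0 (complex.Re a - complex.Re b); have := sqr_ge0 (complex.Im a - complex.Im b); nra.
Qed.

Definition mC w : Prop := measurable_fun setT (fun xi => complex.Re (w xi)) /\
  measurable_fun setT (fun xi => complex.Im (w xi)).

Lemma mCD w w' : mC w -> mC w' -> mC (fun xi => w xi + w' xi).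
Proof.
move=> [m1 m2] [m3 m4]; split; [under eq_fun do rewrite ReD|under eq_fun do rewrite ImD];
  exact: measurable_funD.
Qed.

Lemma mCN w : mC w -> mC (fun xi => - w xi).
Proof.
move=> [m1 m2]; split; [under eq_fun do rewrite ReN|under eq_fun do rewrite ImN];
  exact: measurableT_comp.
Qed.

Lemma mCB w w' : mC w -> mC w' -> mC (fun xi => w xi - w' xi).
Proof. by move=> h h'; apply: mCD => //; exact: mCN. Qed.

Lemma mCM w w' : mC w -> mC w' -> mC (fun xi => w xi * w' xi).
Proof.
move=> [m1 m2] [m3 m4]; split; [under eq_fun do rewrite ReM|under eq_fun do rewrite ImM].
  by apply: measurable_funB; exact: measurable_funM.
by apply: measurable_funD; exact: measurable_funM.
Qed.

Lemma mC_real (k : R -> R) : measurable_fun setT k -> mC (fun xi => (k xi)%:C).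
Proof. by move=> mk; split => //=. Qed.

Lemma mC_sqnormc w : mC w -> measurable_fun setT (fun xi => sqnormc (w xi)).
Proof. by move=> [m1 m2]; apply: measurable_funD; exact: measurable_funX. Qed.

Definition wsq m w : \bar R := (\int[mu]_xi (m xi * sqnormc (w xi))%:E)%E.
Definition csq w : \bar R := (\int[mu]_xi (sqnormc (w xi))%:E)%E.

Definition weight m : Prop := measurable_fun setT m /\ forall x, 0 <= m x.

Lemma weight1 : weight (fun=> 1).
Proof. by split. Qed.

Lemma csqE w : csq w = wsq (fun=> 1) w.
Proof. by apply: eq_integral => x _; rewrite mul1r. Qed.

Lemma measurable_wsq m w : weight m -> mC w ->
  measurable_fun setT (fun xi => (m xi * sqnormc (w xi))%:E).
Proof.
by move=> [mm _] mw; apply/measurable_EFinP; apply: measurable_funM => //; exact: mC_sqnormc.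
Qed.

Lemma wsq_ge0 m w : weight m -> (0 <= wsq m w)%E.
Proof.
by move=> [_ m0]; apply: integral_ge0 => x _; rewrite lee_fin mulr_ge0// sqnormc_ge0.
Qed.

Lemma csq_ge0 w : (0 <= csq w)%E.
Proof. by rewrite csqE; apply: wsq_ge0; exact: weight1. Qed.

Lemma wsq_le (c : R) m m' w w' : weight m -> weight m' -> mC w -> mC w' -> 0 <= c ->
  {ae mu, forall xi, m xi * sqnormc (w xi) <= c * (m' xi * sqnormc (w' xi))} ->
  (wsq m w <= c%:E * wsq m' w')%E.
Proof.
move=> wm wm' mw mw' c0 h; rewrite /wsq -ge0_integralZl_EFin//; first last.
- exact: measurable_wsq.
- by move=> x _; rewrite lee_fin mulr_ge0 ?sqnormc_ge0//; case: wm'.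
apply: ae_ge0_le_integral => //.
- by move=> x _; rewrite lee_fin mulr_ge0 ?sqnormc_ge0//; case: wm.
- exact: measurable_wsq.
- by move=> x _; rewrite mule_ge0// lee_fin mulr_ge0 ?sqnormc_ge0//; case: wm'.
- by apply: emeasurable_funM => //; exact: measurable_wsq.
by apply: (ae_impl h) => x hx _; rewrite -EFinM lee_fin.
Qed.

Lemma wsqD_le m w w' : weight m -> mC w -> mC w' ->
  (wsq m (fun xi => w xi + w' xi)%R <= 2%:E * wsq m w + 2%:E * wsq m w')%E.
Proof.
move=> wm mw mw'; have [mm m0] := wm.
have g0 v x : (0 <= (m x * sqnormc (v x))%:E)%E by rewrite lee_fin mulr_ge0// sqnormc_ge0.
rewrite /wsq -!ge0_integralZl_EFin ?ler0n//; [|exact: measurable_wsq|exact: measurable_wsq].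
rewrite -ge0_integralD//; first last.
- by apply: emeasurable_funM => //; exact: measurable_wsq.
- by move=> x _; rewrite mule_ge0.
- by apply: emeasurable_funM => //; exact: measurable_wsq.
- by move=> x _; rewrite mule_ge0.
apply: ge0_le_integral => //.
- by move=> x _; exact: (g0 (fun x => w x + w' x)).
- by apply: measurable_wsq => //; exact: mCD.
- by apply: emeasurable_funD; apply: emeasurable_funM => //; exact: measurable_wsq.
- move=> x _; rewrite -!EFinM -EFinD lee_fin.
  have := sqnormcD_le (w x) (w' x); have := m0 x; have := sqnormc_ge0 (w x).
  have := sqnormc_ge0 (w' x); nra.
Qed.

Lemma csqD_le w w' : mC w -> mC w' ->
  (csq (fun xi => w xi + w' xi)%R <= 2%:E * csq w + 2%:E * csq w')%E.
Proof. by move=> mw mw'; rewrite !csqE; apply: wsqD_le => //; exact: weight1. Qed.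

Lemma csqB_sym w w' : csq (fun xi => w xi - w' xi) = csq (fun xi => w' xi - w xi).
Proof. by apply: eq_integral => x _; rewrite -sqnormcN opprB. Qed.

Lemma csq_tri w w' w'' : mC w -> mC w' -> mC w'' ->
  (csq (fun xi => w xi - w'' xi)%R <=
   2%:E * csq (fun xi => w xi - w' xi)%R + 2%:E * csq (fun xi => w' xi - w'' xi)%R)%E.
Proof.
move=> m1 m2 m3; apply: le_trans (csqD_le (mCB m1 m2) (mCB m2 m3)).
by rewrite le_eqVlt; apply/orP; left; apply/eqP; apply: eq_integral => x _; rewrite addrA subrK.
Qed.

Lemma csq_split w : mC w ->
  csq w = (nsq (fun xi => complex.Re (w xi)) + nsq (fun xi => complex.Im (w xi)))%E.
Proof.
move=> [m1 m2]; rewrite /nsq -ge0_integralD//.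
- by move=> x _; rewrite lee_fin sqr_ge0.
- exact: measurable_sqr_EFin.
- by move=> x _; rewrite lee_fin sqr_ge0.
- exact: measurable_sqr_EFin.
Qed.

Lemma L2_ReIm w : mC w -> (csq w < +oo)%E ->
  L2 (fun x => complex.Re (w x)) /\ L2 (fun x => complex.Im (w x)).
Proof.
move=> mw; rewrite csq_split// => h; case: mw => m1 m2; split; split => //.
  by apply: le_lt_trans h; rewrite leeDl// nsq_ge0.
by apply: le_lt_trans h; rewrite leeDr// nsq_ge0.
Qed.

Definition aeC w w' : Prop := {ae mu, forall xi, w xi = w' xi}.

Lemma csq_eq0 w w' : mC w -> mC w' -> csq (fun xi => w xi - w' xi) = 0%E -> aeC w w'.
Proof.
move=> mw mw' /eqP; have mB := mCB mw mw'; rewrite csq_split// padde_eq0 ?nsq_ge0//.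
move=> /andP[/eqP h1 /eqP h2]; case: mB => mB1 mB2.
have a1 := nsq_eq0 mB1 h1; have a2 := nsq_eq0 mB2 h2.
apply: (ae_impl2 a1 a2) => x /(_ I) + /(_ I).
case: (w x) (w' x) => [p q] [p' q'] /= /eqP + /eqP.
by rewrite !subr_eq0 => /eqP -> /eqP ->.
Qed.

Lemma aeC_wsq m w w' : weight m -> mC w -> mC w' -> aeC w w' -> wsq m w = wsq m w'.
Proof.
move=> wm mw mw' h; apply: ae_eq_integral => //.
- exact: measurable_wsq.
- exact: measurable_wsq.
- by apply: (ae_impl h) => x hx _; rewrite hx.
Qed.

End ComplexL2.

Section NormContinuity.
Context {R : realType}.
Local Notation mu := (@lebesgue_measure R).

Lemma nsq_continuous (f : R -> R) (fn : nat -> R -> R) : L2 f -> (forall n, L2 (fn n)) ->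
  nsq (fun x => fn n x - f x)%R @[n --> \oo] --> 0%E -> nsq (fn n) @[n --> \oo] --> nsq f.
Proof.
move=> fL fnL cf.
rewrite (nsqE fL); set a := \int[mu]_x (f x ^+ 2).
have -> : (fun n => nsq (fn n)) = EFin \o (fun n => \int[mu]_x (fn n x ^+ 2)).
  by apply/funext => n /=; rewrite nsqE.
apply: cvg_EFin; first by apply: nearW.
rewrite /comp /=; apply/cvgrPdist_le => e e0.
have a0 : 0 <= a by apply: Rintegral_ge0 => x _; exact: sqr_ge0.
pose t := e / (2 * (a + 1)).
have t0 : 0 < t by rewrite divr_gt0// mulr_gt0// ltr_wpDl.
pose eta := (e / 2) / (1 + t^-1).
have t1 : 0 < 1 + t^-1 by rewrite addr_gt0// invr_gt0.
have eta0 : 0 < eta by rewrite divr_gt0// divr_gt0.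
have [N hN] := cvge0_eps cf eta0; exists N => // n /hN.
have dL : L2 (fun x => fn n x - f x) by exact: L2B.
rewrite nsqE// lee_fin; set d := \int[mu]_x _ => dn.
have i1 := L2_integrable_sqr dL; have i2 := L2_integrableM fL dL; have i3 := L2_integrable_sqr fL.
have E : \int[mu]_x (fn n x ^+ 2) = d + (2 * \int[mu]_x (f x * (fn n x - f x)) + a).
  rewrite -(RintZ 2 i2) -(RintD (L1Z 2 i2) i3) -(RintD i1 (L1D (L1Z 2 i2) i3)).
  by apply: eq_Rintegral => x _; ring.
have d0 : 0 <= d by apply: Rintegral_ge0 => x _; exact: sqr_ge0.
have B : `|2 * \int[mu]_x (f x * (fn n x - f x))| <= t * a + t^-1 * d.
  rewrite -(RintZ 2 i2) -(RintZ t i3) -(RintZ t^-1 i1) -(RintD (L1Z t i3) (L1Z t^-1 i1)).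
  apply: le_trans (Rint_norm_le (L1Z 2 i2)) _.
  apply: Rint_le; [exact: L1_norm (L1Z 2 i2)|exact: L1D (L1Z t i3) (L1Z t^-1 i1)|].
  move=> x; rewrite ler_norml; set p := f x; set q := fn n x - f x.
  have h1 : 0 <= t^-1 * (t * p - q) ^+ 2 by rewrite mulr_ge0 ?sqr_ge0// invr_ge0 ltW.
  have h2 : 0 <= t^-1 * (t * p + q) ^+ 2 by rewrite mulr_ge0 ?sqr_ge0// invr_ge0 ltW.
  have e1 : t^-1 * (t * p - q) ^+ 2 = t * p ^+ 2 + t^-1 * q ^+ 2 - 2 * (p * q) by field; rewrite gt_eqF.
  have e2 : t^-1 * (t * p + q) ^+ 2 = t * p ^+ 2 + t^-1 * q ^+ 2 + 2 * (p * q) by field; rewrite gt_eqF.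
  rewrite e1 in h1; rewrite e2 in h2; apply/andP; split; lra.
rewrite E; have -> : a - (d + (2 * \int[mu]_x (f x * (fn n x - f x)) + a)) =
  - d - 2 * \int[mu]_x (f x * (fn n x - f x)) by ring.
apply: le_trans (ler_normB _ _) _; rewrite normrN (ger0_norm d0).
have ta : t * a <= e / 2.
  have -> : e / 2 = t * (a + 1) by rewrite /t; field; rewrite gt_eqF// ltr_wpDl.
  by apply: ler_wpM2l; [exact: ltW|rewrite lerDl].
have td : (1 + t^-1) * d <= e / 2 by rewrite mulrC -ler_pdivlMr.
rewrite mulrDl mul1r in td; move: B ta td; move: (`|_|) => z; lra.
Qed.

Lemma csq_continuous (w : R -> R[i]) (wn : nat -> R -> R[i]) : mC w -> (forall n, mC (wn n)) ->
  (csq w < +oo)%E -> (forall n, csq (wn n) < +oo)%E ->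
  csq (fun x => wn n x - w x)%R @[n --> \oo] --> 0%E -> csq (wn n) @[n --> \oo] --> csq w.
Proof.
move=> mw mwn fw fwn cw.
have [L1w L2w] := L2_ReIm mw fw.
have Ln n := L2_ReIm (mwn n) (fwn n).
rewrite csq_split//; under eq_fun do rewrite (csq_split (mwn _)).
have B n := csq_split (mCB (mwn n) mw).
apply: cvgeD.
- by rewrite ge0_adde_def// inE nsq_ge0.
- apply: nsq_continuous => //; first by move=> n; case: (Ln n).
  apply: cvge0_le cw => n; rewrite nsq_ge0/= B; under eq_fun do rewrite -ReN -ReD.
  by rewrite leeDl// nsq_ge0.
- apply: nsq_continuous => //; first by move=> n; case: (Ln n).
  apply: cvge0_le cw => n; rewrite nsq_ge0/= B; under eq_fun do rewrite -ImN -ImD.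
  by rewrite leeDr// nsq_ge0.
Qed.

End NormContinuity.

Section FourierL2.
Context {R : realType}.
Local Notation mu := (@lebesgue_measure R).
Implicit Types (v u f : R -> R) (w : R -> R[i]).

Definition cut v (n : nat) : R -> R := v \* \1_(`[- n%:R, n%:R]).

Lemma measurable_cut v n : measurable_fun setT v -> measurable_fun setT (cut v n).
Proof. by move=> mv; apply: measurable_funM => //; exact: measurable_indic. Qed.

Lemma cut_le v n x : `|cut v n x| <= `|v x|.
Proof. by rewrite /cut/= indicE; case: (_ \in _); rewrite ?mulr1 ?mulr0 ?normr0. Qed.

Lemma L2_cut v n : L2 v -> L2 (cut v n).
Proof.
move=> vL; have mv : measurable_fun setT v by case: vL.
by apply: (L2_le (measurable_cut n mv) vL) => x; exact: cut_le.
Qed.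

Lemma L2_indic_itv (n : nat) : L2 (\1_(`[- n%:R, n%:R]%classic : set R) : R -> R).
Proof.
split; first exact: measurable_indic.
have /integrableP[_] := @integrable_indic_itv R (- n%:R) n%:R true false.
apply: le_lt_trans; rewrite le_eqVlt; apply/orP; left; apply/eqP; apply: eq_integral => x _.
by rewrite /= indicE; case: (_ \in _); rewrite ?expr1n ?expr0n ?normr1 ?normr0.
Qed.

Lemma L1_cut v n : L2 v -> L1 (cut v n).
Proof. by move=> vL; exact: (L2_integrableM vL (L2_indic_itv n)). Qed.

Lemma nsq_cut_cvg v : L2 v -> nsq (fun x => cut v n x - v x)%R @[n --> \oo] --> 0%E.
Proof.
move=> vL; have mv : measurable_fun setT v by case: vL.
apply: (nsq_dominated_cvg vL).
- by move=> n; apply: measurable_funB => //; exact: measurable_cut.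
- move=> n x; rewrite /cut/= indicE; case: (_ \in _); rewrite ?mulr1 ?mulr0 ?subrr ?normr0//.
  by rewrite sub0r normrN.
- move=> x; apply: cvg_near_cst; exists (Num.trunc `|x|).+1 => // n /= nn.
  rewrite /cut/= indicE mem_set ?mulr1 ?subrr//= in_itv/= -ler_norml.
  by apply: le_trans (ltW (truncnS_gt _)) _; rewrite ler_nat.
Qed.

Lemma mC_fourier f : L1 f -> mC (fourier f).
Proof.
move=> ff; split; first exact: measurable_fcos.
by apply: measurableT_comp => //; exact: measurable_fsin.
Qed.

Lemma csq_fourier f : L1 f -> L2 f -> csq (fourier f) = ((2 * pi)%:E * nsq f)%E.
Proof.
move=> f1 f2; rewrite -plancherel_L1//; apply: eq_integral => xi _.
by rewrite fourierE /sqnormc/= sqrrN.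
Qed.

Lemma fourierD f g xi : L1 f -> L1 g ->
  fourier (fun x => f x + g x) xi = fourier f xi + fourier g xi.
Proof. by move=> ff gg; rewrite !fourierE fcosD// fsinD// opprD. Qed.

Lemma fourierZ c f xi : L1 f -> fourier (fun x => c * f x) xi = c%:C * fourier f xi.
Proof.
move=> ff; rewrite !fourierE fcosZ// fsinZ//.
by apply/eqP; rewrite eq_complex/= !mul0r subr0 addr0 mulrN !eqxx.
Qed.

Lemma fourierB f g xi : L1 f -> L1 g ->
  fourier (fun x => f x - g x) xi = fourier f xi - fourier g xi.
Proof.
move=> ff gg; have -> : (fun x => f x - g x) = (fun x => f x + (-1) * g x).
  by apply/funext => x; rewrite mulN1r.
rewrite fourierD//; last exact: L1Z.
by rewrite fourierZ// rmorphN1 mulN1r.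
Qed.

Lemma nsq_tri (f g h : R -> R) : measurable_fun setT f -> measurable_fun setT g -> measurable_fun setT h ->
  (nsq (fun x => f x - h x)%R <= 2%:E * nsq (fun x => f x - g x)%R + 2%:E * nsq (fun x => g x - h x)%R)%E.
Proof.
move=> mf mg mh; apply: le_trans (nsqD_le (measurable_funB mf mg) (measurable_funB mg mh)).
by rewrite le_eqVlt; apply/orP; left; apply/eqP; apply: eq_integral => x _; rewrite addrA subrK.
Qed.

Lemma is_fourierL2_mC v w : is_fourierL2 v w -> mC w.
Proof. by case. Qed.

Lemma is_fourierL2_cvg v w : is_fourierL2 v w ->
  csq (fun xi => fourier (cut v n) xi - w xi)%R @[n --> \oo] --> 0%E.
Proof. by case. Qed.

(** By Plancherel the transforms of the truncations form a Cauchy sequence in L^2. *)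
Lemma is_fourierL2_exists v : L2 v -> exists w, is_fourierL2 v w.
Proof.
move=> vL; have mv : measurable_fun setT v by case: vL.
have mcut n := measurable_cut n mv.
have c1 n := L1_cut n vL; have c2 n := L2_cut n vL.
have dif m n : csq (fun xi => fourier (cut v m) xi - fourier (cut v n) xi) =
    ((2 * pi)%:E * nsq (fun x => cut v m x - cut v n x)%R)%E.
  rewrite -csq_fourier; [|exact: L1B|exact: L2B].
  by apply: eq_integral => xi _; rewrite fourierB.
have cau (e : R) : 0 < e -> exists N, forall m n, (N <= m)%N -> (N <= n)%N ->
    (csq (fun xi => fourier (cut v m) xi - fourier (cut v n) xi)%R <= e%:E)%E.
  move=> e0; have e' : 0 < e / (8 * pi) by rewrite divr_gt0// mulr_gt0// pi_gt0.
  have [N hN] := cvge0_eps (nsq_cut_cvg vL) e'; exists N => m n /hN Nm /hN Nn.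
  rewrite dif; apply: (@le_trans _ _ ((2 * pi)%:E * (2%:E * (e / (8 * pi))%:E + 2%:E * (e / (8 * pi))%:E))%E).
    apply: lee_wpmul2l; first by rewrite lee_fin mulr_ge0// pi_ge0.
    apply: le_trans (nsq_tri (mcut m) mv (mcut n)) _.
    by apply: leeD; apply: lee_wpmul2l => //; rewrite nsqB.
  rewrite -!(EFinM, EFinD) lee_fin le_eqVlt; apply/orP; left; apply/eqP.
  by have := @pi_gt0 R; move: pi => p p0; field; rewrite gt_eqF.
have mF n := mC_fourier (c1 n).
have finF n : (csq (fourier (cut v n)) < +oo)%E.
  by rewrite csq_fourier// lte_mul_pinfty// ?lee_fin ?mulr_ge0 ?pi_ge0//; case: (c2 n).
have ReL n := (L2_ReIm (mF n) (finF n)).1; have ImL n := (L2_ReIm (mF n) (finF n)).2.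
have [p pL cp] : exists2 p, L2 p & nsq (fun xi => complex.Re (fourier (cut v n) xi) - p xi)%R @[n --> \oo] --> 0%E.
  apply: L2_complete => // e /cau[N hN]; exists N => m n Nm Nn.
  apply: le_trans (hN m n Nm Nn); rewrite csq_split; last exact: mCB.
  by under [X in (_ <= nsq X + _)%E]eq_fun do rewrite ReD ReN; rewrite leeDl// nsq_ge0.
have [q qL cq] : exists2 q, L2 q & nsq (fun xi => complex.Im (fourier (cut v n) xi) - q xi)%R @[n --> \oo] --> 0%E.
  apply: L2_complete => // e /cau[N hN]; exists N => m n Nm Nn.
  apply: le_trans (hN m n Nm Nn); rewrite csq_split; last exact: mCB.
  by under [X in (_ <= _ + nsq X)%E]eq_fun do rewrite ImD ImN; rewrite leeDr// nsq_ge0.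
have mw : mC (fun xi => Complex (p xi) (q xi)) by split; [case: pL|case: qL].
exists (fun xi => Complex (p xi) (q xi)); split; [by case: pL|by case: qL|].
have := cvge0_lin 1 1 cp cq; apply: cvge0_le => n.
rewrite -/(csq (fun xi => fourier (cut v n) xi - Complex (p xi) (q xi))).
rewrite csq_ge0/= csq_split; last exact: mCB.
by rewrite !mul1e.
Qed.

Lemma fourierL2P v : L2 v -> is_fourierL2 v (fourierL2 v).
Proof. by move=> /is_fourierL2_exists[w hw]; rewrite /fourierL2; apply: (xgetI (fun=> 0) hw). Qed.

Lemma mC_cut v n : L2 v -> mC (fourier (cut v n)).
Proof. by move=> vL; apply: mC_fourier; exact: L1_cut. Qed.

Lemma is_fourierL2_unique v w w' : L2 v -> is_fourierL2 v w -> is_fourierL2 v w' -> aeC w w'.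
Proof.
move=> vL h h'; have mw := is_fourierL2_mC h; have mw' := is_fourierL2_mC h'.
apply: csq_eq0 => //.
apply: (cvge0_eq0 (csq_ge0 _) (u := fun n => (2%:E * csq (fun xi => fourier (cut v n) xi - w xi)%R + 2%:E * csq (fun xi => fourier (cut v n) xi - w' xi)%R)%E)).
  move=> n; rewrite [X in (2%:E * X + _)%E]csqB_sym; apply: csq_tri => //; exact: mC_cut.
by apply: cvge0_lin; exact: is_fourierL2_cvg.
Qed.

Lemma is_fourierL2_ae v w w' : L2 v -> is_fourierL2 v w -> mC w' -> aeC w w' -> is_fourierL2 v w'.
Proof.
move=> vL h mw' ww'; have mw := is_fourierL2_mC h.
case: (mw') => m1 m2; split => //.
rewrite (_ : (fun n => _) = (fun n => csq (fun xi => fourier (cut v n) xi - w xi))); first exact: is_fourierL2_cvg.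
apply/funext => n; rewrite /csq.
have mB1 := mC_sqnormc (mCB (mC_cut n vL) mw); have mB2 := mC_sqnormc (mCB (mC_cut n vL) mw').
apply: ae_eq_integral => //; [exact/measurable_EFinP|exact/measurable_EFinP|].
by apply: (ae_impl ww') => x hx _; rewrite hx.
Qed.

Lemma is_fourierL2_fin v w : L2 v -> is_fourierL2 v w -> (csq w < +oo)%E.
Proof.
move=> vL h; have mw := is_fourierL2_mC h.
have [N hN] := cvge0_eps (is_fourierL2_cvg h) (ltr01 : 0 < 1 :> R).
have b := hN N (leqnn N).
have mB := mCB (mC_cut N vL) mw.
have : (csq w <= 2%:E * csq (fourier (cut v N)) + 2%:E * csq (fun xi => fourier (cut v N) xi - w xi)%R)%E.
  rewrite [X in (_ + 2%:E * X)%E]csqB_sym; apply: le_trans (csqD_le (mC_cut N vL) (mCB mw (mC_cut N vL))).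
  by rewrite le_eqVlt; apply/orP; left; apply/eqP; apply: eq_integral => x _; rewrite addrC subrK.
move/le_lt_trans; apply; rewrite lte_add_pinfty// lte_mul_pinfty//.
- rewrite csq_fourier; [|exact: L1_cut|exact: L2_cut].
  by rewrite lte_mul_pinfty// ?lee_fin ?mulr_ge0 ?pi_ge0//; case: (L2_cut N vL).
- by apply: le_lt_trans b _; rewrite ltry.
Qed.

Lemma plancherel v w : L2 v -> is_fourierL2 v w -> csq w = ((2 * pi)%:E * nsq v)%E.
Proof.
move=> vL h; have mw := is_fourierL2_mC h.
have c1 n := L1_cut n vL; have c2 n := L2_cut n vL.
have finF n : (csq (fourier (cut v n)) < +oo)%E.
  by rewrite csq_fourier// lte_mul_pinfty// ?lee_fin ?mulr_ge0 ?pi_ge0//; case: (c2 n).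
have l1 := csq_continuous mw (fun n => mC_cut n vL) (is_fourierL2_fin vL h) finF (is_fourierL2_cvg h).
have l2 := nsq_continuous vL c2 (nsq_cut_cvg vL).
have l3 : csq (fourier (cut v n)) @[n --> \oo] --> ((2 * pi)%:E * nsq v)%E.
  under eq_fun do rewrite csq_fourier//.
  by apply: cvgeZl.
exact: cvg_unique l1 l3.
Qed.

Lemma is_fourierL2D v v' w w' : L2 v -> L2 v' -> is_fourierL2 v w -> is_fourierL2 v' w' ->
  is_fourierL2 (fun x => v x + v' x) (fun xi => w xi + w' xi).
Proof.
move=> vL vL' h h'; have mw := is_fourierL2_mC h; have mw' := is_fourierL2_mC h'.
case: (mCD mw mw') => m1 m2; split => //.
have := cvge0_lin 2 2 (is_fourierL2_cvg h) (is_fourierL2_cvg h'); apply: cvge0_le => n.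
rewrite -/(csq _) csq_ge0/=.
apply: le_trans (csqD_le (mCB (mC_cut n vL) mw) (mCB (mC_cut n vL') mw')).
rewrite le_eqVlt; apply/orP; left; apply/eqP; apply: eq_integral => xi _; congr (sqnormc _)%:E.
rewrite [X in fourier X](_ : _ = (fun x => cut v n x + cut v' n x)); last first.
  by apply/funext => x; rewrite /cut/= mulrDl.
rewrite fourierD; [|exact: L1_cut|exact: L1_cut]; ring.
Qed.

Lemma is_fourierL2Z (c : R) v w : L2 v -> is_fourierL2 v w ->
  is_fourierL2 (fun x => c * v x) (fun xi => c%:C * w xi).
Proof.
move=> vL h; have mw := is_fourierL2_mC h.
have mcw : mC (fun xi => c%:C * w xi) by apply: mCM => //; exact: mC_real.
case: (mcw) => m1 m2; split => //.
have := cvge0Z (c ^+ 2) (is_fourierL2_cvg h); apply: cvge0_le => n.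
rewrite -/(csq _) csq_ge0/= !csqE.
apply: wsq_le; [exact: weight1|exact: weight1| |exact: mCB (mC_cut n vL) mw|exact: sqr_ge0|].
  by apply: mCB => //; apply: mC_cut; exact: L2Z.
apply: aeW => xi; rewrite !mul1r.
rewrite [X in fourier X](_ : _ = (fun x => c * cut v n x)); last first.
  by apply/funext => x; rewrite /cut/= mulrA.
by rewrite fourierZ; [rewrite -mulrBr sqnormcM sqnormcC|exact: L1_cut].
Qed.

Lemma is_fourierL2B v v' w w' : L2 v -> L2 v' -> is_fourierL2 v w -> is_fourierL2 v' w' ->
  is_fourierL2 (fun x => v x - v' x) (fun xi => w xi - w' xi).
Proof.
move=> vL vL' h h'.
have -> : (fun x => v x - v' x) = (fun x => v x + (-1) * v' x).
  by apply/funext => x; rewrite mulN1r.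
have -> : (fun xi => w xi - w' xi) = (fun xi => w xi + (-1)%:C * w' xi).
  by apply/funext => x; rewrite rmorphN1 mulN1r.
exact: is_fourierL2D vL (L2Z (-1) vL') h (is_fourierL2Z (-1) vL' h').
Qed.

(** By Plancherel [wn n] also converges to the transform of [v]. *)
Lemma is_fourierL2_closed v w (vn : nat -> R -> R) (wn : nat -> R -> R[i]) : L2 v ->
  (forall n, L2 (vn n)) -> (forall n, is_fourierL2 (vn n) (wn n)) -> mC w ->
  nsq (fun x => vn n x - v x)%R @[n --> \oo] --> 0%E ->
  csq (fun xi => wn n xi - w xi)%R @[n --> \oo] --> 0%E -> is_fourierL2 v w.
Proof.
move=> vL vnL hn mw cv cw; have hv := fourierL2P vL.
apply: (is_fourierL2_ae vL hv mw); have mv := is_fourierL2_mC hv.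
apply: csq_eq0 => //.
apply: (cvge0_eq0 (csq_ge0 _) (u := fun n => (2%:E * csq (fun xi => wn n xi - fourierL2 v xi)%R + 2%:E * csq (fun xi => wn n xi - w xi)%R)%E)).
  move=> n; rewrite [X in (2%:E * X + _)%E]csqB_sym; apply: csq_tri => //.
  exact: is_fourierL2_mC (hn n).
apply: cvge0_lin => //.
under eq_fun => n.
  rewrite (plancherel (L2B (vnL n) vL) (is_fourierL2B (vnL n) vL (hn n) hv)).
  over.
exact: cvge0Z.
Qed.

Lemma is_fourierL2_L1 f : L1 f -> L2 f -> is_fourierL2 f (fourier f).
Proof.
move=> f1 f2; have mf := mC_fourier f1; case: (mf) => m1 m2; split => //.
have := cvge0Z (2 * pi) (nsq_cut_cvg f2); apply: cvge0_le => n.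
rewrite -/(csq _) csq_ge0/=.
rewrite -csq_fourier; [|exact: L1B (L1_cut n f2) f1|exact: L2B (L2_cut n f2) f2].
rewrite le_eqVlt; apply/orP; left; apply/eqP; apply: eq_integral => xi _; congr (sqnormc _)%:E.
by rewrite (fourierB _ (L1_cut n f2) f1).
Qed.

Definition cis (t : R) : R[i] := Complex (cos t) (sin t).

Lemma sqnormc_cis t : sqnormc (cis t) = 1.
Proof. by rewrite /sqnormc/= cos2Dsin2. Qed.

Lemma mC_cis (z : R) : mC (fun xi : R => cis (z * xi)).
Proof. by split; [exact: measurable_cos_dilate|exact: measurable_sin_dilate]. Qed.

Lemma fourier_shift f z xi : L1 f -> fourier (fun x => f (x + z)) xi = cis (z * xi) * fourier f xi.
Proof.
move=> ff; rewrite !fourierE fcos_shift// fsin_shift// [xi * z]mulrC.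
by apply/eqP; rewrite eq_complex/=; apply/andP; split; apply/eqP; ring.
Qed.

(** Truncation does not commute with translation, but the translated truncations converge
    as well, and the graph is closed. *)
Lemma is_fourierL2_shift v w z : L2 v -> is_fourierL2 v w ->
  is_fourierL2 (fun x => v (x + z)) (fun xi => cis (z * xi) * w xi).
Proof.
move=> vL h; have mw := is_fourierL2_mC h; have mv : measurable_fun setT v by case: vL.
apply: (is_fourierL2_closed (L2_shift z vL) (vn := fun n x => cut v n (x + z))
  (wn := fun n xi => cis (z * xi) * fourier (cut v n) xi)).
- by move=> n; apply: L2_shift; exact: L2_cut.
- move=> n; have := is_fourierL2_L1 (L1_shift z (L1_cut n vL)) (L2_shift z (L2_cut n vL)).
  rewrite (_ : fourier (fun x => cut v n (x + z)) = (fun xi => cis (z * xi) * fourier (cut v n) xi))//.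
  by apply/funext => xi; rewrite fourier_shift//; exact: L1_cut.
- by apply: mCM => //; exact: mC_cis.
- rewrite (_ : (fun n => _) = (fun n => nsq (fun x => cut v n x - v x)%R)); first exact: nsq_cut_cvg.
  apply/funext => n; rewrite -(nsq_shift z (f := fun x => cut v n x - v x))//.
  by apply: measurable_funB => //; exact: measurable_cut.
- rewrite (_ : (fun n => _) = (fun n => csq (fun xi => fourier (cut v n) xi - w xi)%R)); first exact: is_fourierL2_cvg.
  apply/funext => n; by apply: eq_integral => xi _; rewrite -mulrBr sqnormcM sqnormc_cis mul1r.
Qed.

(** Parseval's identity, by polarization. *)
Lemma parseval u v wu wv : L2 u -> L2 v -> is_fourierL2 u wu -> is_fourierL2 v wv ->
  L1 (fun xi => complex.Re (wu xi) * complex.Re (wv xi) + complex.Im (wu xi) * complex.Im (wv xi)) /\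
  2 * pi * \int[mu]_x (u x * v x) =
  \int[mu]_xi (complex.Re (wu xi) * complex.Re (wv xi) + complex.Im (wu xi) * complex.Im (wv xi)).
Proof.
move=> uL vL hu hv.
have [u1 u2] := L2_ReIm (is_fourierL2_mC hu) (is_fourierL2_fin uL hu).
have [v1 v2] := L2_ReIm (is_fourierL2_mC hv) (is_fourierL2_fin vL hv).
have i12 := L1D (L2_integrableM u1 v1) (L2_integrableM u2 v2).
split; first exact: i12.
have P := plancherel (L2D uL vL) (is_fourierL2D uL vL hu hv).
have Pu := plancherel uL hu; have Pv := plancherel vL hv.
have mCs := mCD (is_fourierL2_mC hu) (is_fourierL2_mC hv).
rewrite csq_split// !nsqE in P; [|exact: L2D|by under eq_fun do rewrite ImD; exact: L2D|by under eq_fun do rewrite ReD; exact: L2D].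
rewrite csq_split ?nsqE// in Pu; last exact: is_fourierL2_mC hu.
rewrite csq_split ?nsqE// in Pv; last exact: is_fourierL2_mC hv.
move: P Pu Pv; rewrite -!EFinD -!EFinM => -[P] [Pu] [Pv].
have X (f g : R -> R) : L2 f -> L2 g ->
    \int[mu]_x ((f x + g x) ^+ 2) = \int[mu]_x (f x ^+ 2) + (\int[mu]_x (g x ^+ 2) + 2 * \int[mu]_x (f x * g x)).
  move=> fL gL; have i1 := L2_integrable_sqr fL; have i2 := L2_integrable_sqr gL.
  have i3 := L2_integrableM fL gL.
  rewrite -(RintZ 2 i3) -(RintD i2 (L1Z 2 i3)) -(RintD i1 (L1D i2 (L1Z 2 i3))).
  by apply: eq_Rintegral => x _; ring.
rewrite (X _ _ uL vL) in P.
have XR := X _ _ u1 v1; have XI := X _ _ u2 v2.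
have e1 : \int[mu]_x (complex.Re (wu x + wv x) ^+ 2) = \int[mu]_x ((complex.Re (wu x) + complex.Re (wv x)) ^+ 2).
  by apply: eq_Rintegral => x _; rewrite ReD.
have e2 : \int[mu]_x (complex.Im (wu x + wv x) ^+ 2) = \int[mu]_x ((complex.Im (wu x) + complex.Im (wv x)) ^+ 2).
  by apply: eq_Rintegral => x _; rewrite ImD.
rewrite e1 e2 XR XI in P.
rewrite (RintD (L2_integrableM u1 v1) (L2_integrableM u2 v2)).
move: P Pu Pv.
move: (\int[mu]_x (u x ^+ 2)) (\int[mu]_x (v x ^+ 2)) (\int[mu]_x (u x * v x)) => a b c.
move: (\int[mu]_x (complex.Re (wu x) ^+ 2)) (\int[mu]_x (complex.Re (wv x) ^+ 2)) => a1 b1.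
move: (\int[mu]_x (complex.Im (wu x) ^+ 2)) (\int[mu]_x (complex.Im (wv x) ^+ 2)) => a2 b2.
move: (\int[mu]_x (complex.Re (wu x) * complex.Re (wv x))) (\int[mu]_x (complex.Im (wu x) * complex.Im (wv x))) => c1 c2.
clear; move: pi => p; rewrite !mulrDr; lra.
Qed.

End FourierL2.

(** * Weighted norms on the Fourier side *)

Section WeightedNorms.
Context {R : realType}.
Local Notation mu := (@lebesgue_measure R).
Implicit Types (m : R -> R) (u v : R -> R) (w : R -> R[i]).

(** The weight [(1 + xi^2)^s] gives the squared H^s norm; others arise from differences. *)
Definition hsq m v : \bar R := wsq m (fourierL2 v).

Lemma hsqE m v w : weight m -> L2 v -> is_fourierL2 v w -> hsq m v = wsq m w.
Proof.
move=> wm vL h; have hv := fourierL2P vL.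
by apply: aeC_wsq => //; [exact: is_fourierL2_mC hv|exact: is_fourierL2_mC h|exact: is_fourierL2_unique hv h].
Qed.

Lemma hsq_ge0 m v : weight m -> (0 <= hsq m v)%E.
Proof. exact: wsq_ge0. Qed.

Lemma mC_fourierL2 v : L2 v -> mC (fourierL2 v).
Proof. by move=> /fourierL2P/is_fourierL2_mC. Qed.

Lemma hsqD_le m u v : weight m -> L2 u -> L2 v ->
  (hsq m (fun x => u x + v x)%R <= 2%:E * hsq m u + 2%:E * hsq m v)%E.
Proof.
move=> wm uL vL.
rewrite (hsqE wm (L2D uL vL) (is_fourierL2D uL vL (fourierL2P uL) (fourierL2P vL))).
by apply: wsqD_le => //; exact: mC_fourierL2.
Qed.

Lemma hsqZ m c v : weight m -> L2 v -> hsq m (fun x => c * v x)%R = ((c ^+ 2)%:E * hsq m v)%E.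
Proof.
move=> wm vL; rewrite (hsqE wm (L2Z c vL) (is_fourierL2Z c vL (fourierL2P vL))).
rewrite /hsq /wsq -ge0_integralZl_EFin ?sqr_ge0//; first last.
- by apply: measurable_wsq => //; exact: mC_fourierL2.
- by move=> x _; rewrite lee_fin mulr_ge0 ?sqnormc_ge0//; case: wm.
by apply: eq_integral => x _; rewrite sqnormcM sqnormcC -EFinM mulrCA.
Qed.

Lemma hsqB_le m u v : weight m -> L2 u -> L2 v ->
  (hsq m (fun x => u x - v x)%R <= 2%:E * hsq m u + 2%:E * hsq m v)%E.
Proof.
move=> wm uL vL; have := hsqD_le wm uL (L2Z (-1) vL).
rewrite hsqZ// (_ : (-1) ^+ 2 = 1 :> R); last by ring.
by rewrite mul1e; under [X in (hsq m X <= _)%E -> _]eq_fun do rewrite mulN1r.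
Qed.

Lemma hsqB_sym m u v : weight m -> L2 u -> L2 v ->
  hsq m (fun x => u x - v x) = hsq m (fun x => v x - u x).
Proof.
move=> wm uL vL; have := hsqZ (-1) wm (L2B vL uL).
rewrite (_ : (-1) ^+ 2 = 1 :> R); last by ring.
by rewrite mul1e => <-; congr hsq; apply/funext => x; ring.
Qed.

Lemma hsq_weight_le c m m' v : weight m -> weight m' -> L2 v -> 0 <= c ->
  (forall xi, m xi <= c * m' xi) -> (hsq m v <= c%:E * hsq m' v)%E.
Proof.
move=> wm wm' vL c0 h; apply: wsq_le => //; [exact: mC_fourierL2|exact: mC_fourierL2|].
by apply: aeW => xi; rewrite mulrA ler_wpM2r// sqnormc_ge0.
Qed.

Lemma hsq1 v : L2 v -> hsq (fun=> 1) v = ((2 * pi)%:E * nsq v)%E.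
Proof. by move=> vL; rewrite -(plancherel vL (fourierL2P vL)) csqE. Qed.

Lemma hsq_ae m u v : weight m -> L2 u -> L2 v -> ae_eq mu setT u v -> hsq m u = hsq m v.
Proof.
move=> wm uL vL uv; apply: (hsqE wm uL).
apply: (is_fourierL2_closed uL (vn := fun=> v) (wn := fun=> fourierL2 v)).
- by [].
- by move=> _; exact: fourierL2P.
- exact: mC_fourierL2.
- rewrite (_ : nsq _ = 0%E); first exact: cvg_cst.
  case: uL vL => mu1 _ [mv _].
  rewrite (@ae_eq_nsq _ (fun x => v x - u x) (fun=> 0))//.
  + by rewrite /nsq; under eq_integral do rewrite expr0n/=; rewrite integral0.
  + exact: measurable_funB.
  + by apply: (ae_impl uv) => x hx _; rewrite hx// subrr.
- rewrite (_ : csq _ = 0%E); first exact: cvg_cst.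
  by rewrite /csq; under eq_integral do rewrite subrr /sqnormc/= expr0n/= addr0; rewrite integral0.
Qed.

Lemma hsq_shift m v z : weight m -> L2 v -> hsq m (fun x => v (x + z)) = hsq m v.
Proof.
move=> wm vL; rewrite (hsqE wm (L2_shift z vL) (is_fourierL2_shift z vL (fourierL2P vL))).
by apply: eq_integral => x _; rewrite sqnormcM sqnormc_cis mul1r.
Qed.

(** A difference [v(x+z) - v(x)] has transform [(exp(i z xi) - 1) v^]. *)
Lemma hsq_diff m v z : weight m -> L2 v ->
  hsq m (fun x => v (x + z) - v x) = hsq (fun xi => m xi * (2 - 2 * cos (z * xi))) v.
Proof.
move=> wm vL; have h := fourierL2P vL.
rewrite (hsqE wm (L2B (L2_shift z vL) vL) (is_fourierL2B (L2_shift z vL) vL (is_fourierL2_shift z vL h) h)).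
apply: eq_integral => x _; congr (_%:E); rewrite -mulrA; congr (_ * _).
rewrite -[X in _ - X]mul1r -mulrBl sqnormcM; congr (_ * _).
have H := cos2Dsin2 (z * x); rewrite /sqnormc/= subr0.
transitivity ((cos (z * x) ^+ 2 + sin (z * x) ^+ 2) + (1 - 2 * cos (z * x))); first by ring.
by rewrite H; ring.
Qed.

Lemma weight_diff m z : weight m -> weight (fun xi => m xi * (2 - 2 * cos (z * xi))).
Proof.
move=> [mm m0]; split.
  apply: measurable_funM => //; apply: measurable_funB => //; apply: measurable_funM => //.
  exact: measurable_cos_dilate.
by move=> x; rewrite mulr_ge0//; have := cos_le1 (z * x); lra.
Qed.

Lemma wsq_trunc_cvg m w : weight m -> mC w ->
  wsq (fun xi => Num.min (m xi) n%:R) w @[n --> \oo] --> wsq m w.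
Proof.
move=> [mm m0] mw.
have mmin (n : nat) : measurable_fun setT (fun xi => Num.min (m xi) n%:R) by exact: measurable_minr.
have min0 (n : nat) xi : 0 <= Num.min (m xi) n%:R by rewrite le_min m0/=.
have := @cvg_monotone_convergence _ _ R mu setT measurableT
  (fun n xi => (Num.min (m xi) n%:R * sqnormc (w xi))%:E).
have -> : (\int[mu]_(x in setT) limn ((fun n xi => (Num.min (m xi) n%:R * sqnormc (w xi))%:E)^~ x) = wsq m w)%E.
  apply: eq_integral => x _; apply/cvg_lim => //; apply: cvg_near_cst.
  exists (Num.trunc (m x)).+1 => // n /= nn; rewrite min_l//.
  by apply: le_trans (ltW (truncnS_gt _)) _; rewrite ler_nat.
apply.
- by move=> n; apply: measurable_wsq.
- by move=> n x _; rewrite lee_fin mulr_ge0// sqnormc_ge0.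
- move=> x _ a b ab; rewrite lee_fin ler_wpM2r ?sqnormc_ge0//.
  by rewrite le_min ge_min lexx/= ge_min ler_nat ab orbT.
Qed.

(** The weighted norms are lower semicontinuous for convergence in L^2. For a bounded
    weight they are even continuous, and any weight is an increasing limit of such. *)
Lemma hsq_lsc m v (vn : nat -> R -> R) (A : \bar R) : weight m -> L2 v -> (forall n, L2 (vn n)) ->
  nsq (fun x => vn n x - v x)%R @[n --> \oo] --> 0%E ->
  (forall n, (hsq m (vn n) <= A)%E) -> (hsq m v <= A)%E.
Proof.
move=> wm vL vnL cv hA; have [mm m0] := wm.
have mw := mC_fourierL2 vL; have mwn n := mC_fourierL2 (vnL n).
have step (K : nat) : (wsq (fun xi => Num.min (m xi) K%:R) (fourierL2 v) <= A)%E.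
  pose k xi := Num.sqrt (Num.min (m xi) K%:R).
  have min0 xi : 0 <= Num.min (m xi) K%:R by rewrite le_min m0/=.
  have mk : measurable_fun setT k.
    apply: (@measurableT_comp _ _ _ _ _ _ (@Num.sqrt R)); last exact: measurable_minr.
    by apply: continuous_measurable_fun; exact: sqrt_continuous.
  have E w : wsq (fun xi => Num.min (m xi) K%:R) w = csq (fun xi => (k xi)%:C * w xi).
    by apply: eq_integral => xi _; rewrite sqnormcM sqnormcC sqr_sqrtr.
  have mkw w : mC w -> mC (fun xi => (k xi)%:C * w xi) by move=> h; apply: mCM => //; exact: mC_real.
  have kK w : mC w -> (csq (fun xi => (k xi)%:C * w xi)%R <= K%:R%:E * csq w)%E.
    move=> h; rewrite !csqE; apply: wsq_le; [exact: weight1|exact: weight1|exact: mkw|by []|by []|].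
    apply: aeW => xi; rewrite !mul1r sqnormcM sqnormcC sqr_sqrtr// ler_wpM2r ?sqnormc_ge0//.
    by rewrite ge_min lexx orbT.
  have fin u : L2 u -> (csq (fun xi => (k xi)%:C * fourierL2 u xi)%R < +oo)%E.
    move=> uL; apply: le_lt_trans (kK _ (mC_fourierL2 uL)) _.
    by rewrite lte_mul_pinfty// ?lee_fin//; exact: is_fourierL2_fin uL (fourierL2P uL).
  rewrite E; have cc := csq_continuous (mkw _ mw) (fun n => mkw _ (mwn n)) (fin _ vL) (fun n => fin _ (vnL n)).
  have {}cc : csq (fun xi => (k xi)%:C * fourierL2 (vn n) xi)%R @[n --> \oo] --> csq (fun xi => (k xi)%:C * fourierL2 v xi)%R.
    apply: cc; have := cvge0Z (K%:R * (2 * pi)) cv; apply: cvge0_le => n.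
    rewrite csq_ge0/= EFinM -muleA.
    rewrite -(plancherel (L2B (vnL n) vL) (is_fourierL2B (vnL n) vL (fourierL2P (vnL n)) (fourierL2P vL))).
    apply: le_trans (kK _ (mCB (mwn n) mw)).
    by rewrite le_eqVlt; apply/orP; left; apply/eqP; apply: eq_integral => xi _; rewrite mulrBr.
  rewrite -(cvg_lim _ cc)//; apply: lime_le; first by apply/cvg_ex; eexists; exact: cc.
  apply: nearW => n; rewrite -E; apply: le_trans (hA n).
  have wmin : weight (fun xi => Num.min (m xi) K%:R) by split => //; exact: measurable_minr.
  rewrite -[leRHS]mul1e; apply: hsq_weight_le => // xi.
  by rewrite mul1r ge_min lexx.
have c := wsq_trunc_cvg wm mw.
rewrite /hsq -(cvg_lim _ c)//; apply: lime_le; first by apply/cvg_ex; eexists; exact: c.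
exact: nearW.
Qed.

Lemma sqnormc_triangle (a b : R[i]) :
  Num.sqrt (sqnormc (a + b)) <= Num.sqrt (sqnormc a) + Num.sqrt (sqnormc b).
Proof.
rewrite -[leRHS]ger0_norm ?addr_ge0 ?sqrtr_ge0// -sqrtr_sqr ler_sqrt ?sqr_ge0//.
rewrite sqrrD !sqr_sqrtr ?sqnormc_ge0// -sqrtrM ?sqnormc_ge0//.
rewrite /sqnormc ReD ImD; case: a b => [a1 a2] [b1 b2] /=.
have h : a1 * b1 + a2 * b2 <= Num.sqrt ((a1 ^+ 2 + a2 ^+ 2) * (b1 ^+ 2 + b2 ^+ 2)).
  apply: le_trans (ler_norm _) _; rewrite -sqrtr_sqr ler_sqrt ?mulr_ge0 ?addr_ge0 ?sqr_ge0//.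
  by have := sqr_ge0 (a1 * b2 - a2 * b1); nra.
move: (Num.sqrt _) h => S h; nra.
Qed.

Lemma wsq_Lnorm m w : weight m -> mC w ->
  (wsq m w `^ 2^-1 = 'N[mu]_(2%:E)[EFin \o (fun xi => Num.sqrt (m xi * sqnormc (w xi)))])%E.
Proof.
move=> [mm m0] mw; rewrite unlock; congr poweR; apply: eq_integral => xi _ /=.
rewrite ger0_norm ?sqrtr_ge0// powR_mulrn ?sqrtr_ge0// sqr_sqrtr//.
by rewrite mulr_ge0// sqnormc_ge0.
Qed.

Lemma measurable_sqrt_wsq m w : weight m -> mC w ->
  measurable_fun setT (fun xi => Num.sqrt (m xi * sqnormc (w xi))).
Proof.
move=> [mm m0] mw; apply: (@measurableT_comp _ _ _ _ _ _ (@Num.sqrt R)).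
  by apply: continuous_measurable_fun; exact: sqrt_continuous.
by apply: measurable_funM => //; exact: mC_sqnormc.
Qed.

(** Minkowski for the modulus weighted by the square root of [m]. *)
Lemma wsq_triangle m w w' : weight m -> mC w -> mC w' ->
  (wsq m (fun xi => w xi + w' xi)%R `^ 2^-1 <= wsq m w `^ 2^-1 + wsq m w' `^ 2^-1)%E.
Proof.
move=> wm mw mw'; have [mm m0] := wm.
rewrite [in leRHS](wsq_Lnorm wm mw) (wsq_Lnorm wm mw').
have M1 := measurable_sqrt_wsq wm mw; have M2 := measurable_sqrt_wsq wm mw'.
have := minkowski_EFin mu M1 M2 (ler1n R 2).
apply: le_trans; rewrite unlock.
apply: gt0_ler_poweR; rewrite ?in_itv/= ?andbT ?leey ?wsq_ge0 ?integral_ge0//.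
apply: ge0_le_integral => //.
- by move=> x _; rewrite lee_fin mulr_ge0// sqnormc_ge0.
- by apply: measurable_wsq => //; exact: mCD.
- apply/measurable_EFinP; apply: (@measurableT_comp _ _ _ _ _ _ (@powR R ^~ 2)).
    exact: measurable_powR.
  by apply: measurableT_comp => //; exact: measurable_funD.
- move=> x _; rewrite lee_fin ger0_norm ?addr_ge0 ?sqrtr_ge0// powR_mulrn ?addr_ge0 ?sqrtr_ge0//.
  rewrite !sqrtrM// -mulrDr exprMn sqr_sqrtr// ler_wpM2l//.
  rewrite -[leLHS]sqr_sqrtr ?sqnormc_ge0// lerXn2r ?nnegrE ?addr_ge0 ?sqrtr_ge0//.
  exact: sqnormc_triangle.
Qed.

Definition ws (s xi : R) : R := (1 + xi ^+ 2) `^ s.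

Lemma one_le_1sqr (xi : R) : 1 <= 1 + xi ^+ 2.
Proof. by rewrite lerDl sqr_ge0. Qed.

Lemma weight_ws s : weight (ws s).
Proof.
split; last by move=> xi; exact: powR_ge0.
apply: (@measurableT_comp _ _ _ _ _ _ (@powR R ^~ s)); first exact: measurable_powR.
by apply: measurable_funD => //; exact: measurable_funX.
Qed.
Hint Resolve weight_ws : core.

Lemma ws_ge1 s xi : 0 <= s -> 1 <= ws s xi.
Proof. by move=> s0; rewrite -(powRr0 (1 + xi ^+ 2)) ler_powR// one_le_1sqr. Qed.

Lemma ws_le s t xi : s <= t -> ws s xi <= ws t xi.
Proof. by move=> st; rewrite ler_powR// one_le_1sqr. Qed.

Lemma wsD s t xi : ws (s + t) xi = ws s xi * ws t xi.
Proof. rewrite /ws powRD//; apply/implyP => _.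
by rewrite gt_eqF// (lt_le_trans ltr01)// one_le_1sqr. Qed.

Lemma ws0 : ws 0 = fun=> 1.
Proof. by apply/funext => xi; rewrite /ws powRr0. Qed.

Notation hs s := (hsq (ws s)).

Lemma hs_le s t v : s <= t -> L2 v -> (hs s v <= hs t v)%E.
Proof.
move=> st vL; rewrite -[leRHS]mul1e; apply: hsq_weight_le => // xi.
by rewrite mul1r; exact: ws_le.
Qed.

Lemma Hs_normE s v : Hs_norm s v = (hs s v `^ 2^-1)%E.
Proof. by []. Qed.

Lemma LfunL2 v : v \in Lfun mu 2%:E <-> L2 v.
Proof.
have E : ('N[mu]_(2%:E)[EFin \o v] = nsq v `^ 2^-1)%E.
  rewrite unlock; congr poweR; apply: eq_integral => xi _ /=.
  by rewrite powR_mulrn// real_normK// num_real.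
split.
  move=> h; have := sub_Lfun_mfun h; rewrite inE => mv; split; first exact: mv.
  have := sub_Lfun_finLfun h; rewrite inE /= /finite_norm E; exact: lty_poweRy.
move=> [mv fv]; rewrite inE; apply/andP; split; rewrite inE /=; first exact: mv.
by rewrite /finite_norm E; exact: poweR_lty.
Qed.

Lemma HsP s v : Hs s v <-> L2 v /\ (hs s v < +oo)%E.
Proof.
rewrite /Hs /=; split => -[h1 h2]; split.
- exact/LfunL2.
- by move: h2; rewrite Hs_normE; exact: lty_poweRy.
- exact/LfunL2.
- by rewrite Hs_normE; exact: poweR_lty.
Qed.

End WeightedNorms.

#[export] Hint Resolve weight_ws : core.
Notation hs s := (hsq (ws s)).

(** * The embedding of H^s into bounded functions *)

Section Embedding.
Context {R : realType}.
Local Notation mu := (@lebesgue_measure R).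
Implicit Types (u v h : R -> R).

Lemma cvg_powR_pinfty0 (p : R) : 0 < p -> (1 + x) `^ (- p) @[x --> +oo] --> 0.
Proof.
move=> p0; apply/cvgrPdist_le => e e0; near=> x.
have x0 : 0 < 1 + x by rewrite ltr_pwDl//; near: x; apply: nbhs_pinfty_ge; exact: num_real.
rewrite sub0r normrN ger0_norm ?powR_ge0// powRN.
rewrite -[leRHS]invrK lef_pV2 ?posrE ?powR_gt0 ?invr_gt0//.
have xe : e^-1 `^ p^-1 <= 1 + x.
  by rewrite -lerBlDl; near: x; apply: nbhs_pinfty_ge; exact: num_real.
have -> : e^-1 = (e^-1 `^ p^-1) `^ p.
  by rewrite -powRrM mulVf ?gt_eqF// powRr1// invr_ge0 ltW.
apply: ge0_ler_powR => //; first exact: ltW.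
- by rewrite nnegrE powR_ge0.
- by rewrite nnegrE ltW.
Unshelve. all: by end_near. Qed.

Lemma continuous_abs_powR (p : R) : continuous (fun x : R => (1 + `|x|) `^ p).
Proof.
move=> x; have x0 : 0 < 1 + `|x| by rewrite ltr_pwDl.
have c1 : {for x, continuous (fun x : R => 1 + `|x|)}.
  by apply: cvgD; [exact: cvg_cst|exact: norm_continuous].
have c2 : {for 1 + `|x|, continuous (fun y : R => y `^ p)}.
  exact: (is_derive_continuous (is_derive1_powR p x0)).
exact: (continuous_comp c1 c2).
Qed.

Lemma L1_abs_powR (p : R) : 1 < p -> L1 (fun x : R => (1 + `|x|) `^ (- p)).
Proof.
move=> p1; have pm : 0 < p - 1 by rewrite subr_gt0.
apply/integrableP; split.
  by apply/measurable_EFinP; apply: continuous_measurable_fun; exact: continuous_abs_powR.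
under eq_integral => x _ do rewrite /= ger0_norm ?powR_ge0//.
rewrite ge0_symfun_integralT; first last.
- by move=> x /=; rewrite normrN.
- exact: continuous_abs_powR.
- by move=> x; exact: powR_ge0.
rewrite (_ : [set x | (0 <= x)%R] = `[0, +oo[%classic); last first.
  by apply/seteqP; split => x /=; rewrite in_itv/= andbT.
pose F (x : R) : R := - (p - 1)^-1 * (1 + x) `^ (- (p - 1)).
have dF (x : R) : 0 <= x -> is_derive x 1 F ((1 + x) `^ (- p)).
  move=> x0; have x1 : 0 < 1 + x by rewrite ltr_pwDl.
  have d1 : is_derive x 1 (fun y : R => 1 + y) 1.
    have := is_derive_addf (is_derive_cst (1:R) x 1) (is_derive_id x (1:R)).
    by rewrite add0r.
  have := @is_derive1_comp R (fun y : R => y `^ (- (p - 1))) (fun y : R => 1 + y) x _ _ (is_derive1_powR (- (p - 1)) x1) d1.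
  move=> /(is_derive_cmulf (- (p - 1)^-1))/is_derive_eq; apply.
  rewrite mulr1 mulrA mulNr mulrN opprK mulVf ?gt_eqF// mul1r; congr (_ `^ _); ring.
rewrite (@ge0_continuous_FTC2y _ _ F _ 0).
- by rewrite sub0e lte_mul_pinfty// ?lte_fin// -EFinN ltry.
- by move=> x _; exact: powR_ge0.
- by apply: continuous_subspaceT; exact: continuous_abs_powR.
- rewrite -[X in _ --> X](mulr0 (- (p - 1)^-1)); apply: cvgM; first exact: cvg_cst.
  exact: cvg_powR_pinfty0.
- by move=> x x0; apply: ex_derive; apply: dF; exact: ltW.
- by apply: cvg_at_right_filter; apply: is_derive_continuous; exact: dF.
- move=> x; rewrite in_itv/= andbT => x0.
  by rewrite (is_derive_derive1 (dF x (ltW x0))) gtr0_norm.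
Qed.

Lemma L1_ws (s : R) : 2^-1 < s -> L1 (ws (- s)).
Proof.
move=> s2; have s0 : 0 < s by rewrite (lt_trans _ s2).
have p1 : 1 < 2 * s by lra.
apply: (L1_le _ (L1Z (2 `^ s) (L1_abs_powR p1))); first by case: (weight_ws (R := R) (- s)).
move=> x; rewrite ger0_norm ?powR_ge0// ger0_norm ?mulr_ge0 ?powR_ge0//.
have q1 : 0 < 1 + x ^+ 2 by rewrite (lt_le_trans ltr01)// one_le_1sqr.
have q2 : 0 < 1 + `|x| by rewrite ltr_pwDl.
rewrite /ws !powRN ler_pdivlMr ?powR_gt0// mulrC ler_pdivrMr ?powR_gt0//.
have -> : (1 + `|x|) `^ (2 * s) = ((1 + `|x|) ^+ 2) `^ s.
  by rewrite powRrM -(powR_mulrn 2 (ltW q2)).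
rewrite -powRM//; last exact: ltW.
apply: ge0_ler_powR; [exact: ltW|by rewrite nnegrE sqr_ge0|by rewrite nnegrE mulr_ge0// ltW|].
rewrite -[x ^+ 2]real_normK ?num_real//.
by have := sqr_ge0 (1 - `|x|); nra.
Qed.

(** Testing [u] by Parseval against [h = max(u - K, 0)] bounds [u] from above: the
    transform of [h] is at most the L^1 norm of [h], and that of [u] is integrable. *)
Lemma embedding_upper (s A : R) u : 2^-1 < s -> L2 u -> (hs s u <= A%:E)%E ->
  {ae mu, forall x, u x <= \int[mu]_xi (ws (- s) xi) + A + 1}.
Proof.
move=> s2 uL hA; set K := _ + A + 1.
have iw := L1_ws s2.
have A0 : 0 <= A by rewrite -lee_fin; apply: le_trans hA; exact: hsq_ge0.
have I0 : 0 <= \int[mu]_xi (ws (- s) xi) by apply: Rintegral_ge0 => x _; exact: powR_ge0.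
have K0 : 0 < K by rewrite /K ltr_wpDl// addr_ge0.
have mu1 : measurable_fun setT u by case: uL.
pose h x := Num.max (u x - K) 0.
have mh : measurable_fun setT h.
  by apply: measurable_maxr => //; exact: measurable_funB.
have h0 x : 0 <= h x by rewrite le_max lexx orbT.
have h_le x : `|h x| <= `|K^-1 * u x ^+ 2|.
  have q0 : 0 <= K^-1 * u x ^+ 2 by rewrite mulr_ge0 ?sqr_ge0// invr_ge0 ltW.
  rewrite (ger0_norm q0) (ger0_norm (h0 x)).
  rewrite /h; have [uK|Ku] := lerP (u x - K) 0; first exact: q0.
  by rewrite ler_pdivlMl//; nra.
have h_le2 x : `|h x| <= `|u x|.
  rewrite (ger0_norm (h0 x)) /h; have [uK|Ku] := lerP (u x - K) 0; first exact: normr_ge0.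
  by apply: le_trans (ler_norm _); lra.
have hL1 : L1 h by apply: (L1_le mh _ h_le); apply: L1Z; exact: L2_integrable_sqr.
have hL2 : L2 h by exact: (L2_le mh uL h_le2).
have hw := fourierL2P uL; have mw := mC_fourierL2 uL.
have [iP P] := parseval uL hL2 hw (is_fourierL2_L1 hL1 hL2).
set I := \int[mu]_xi (ws (- s) xi) in K K0 h mh h0 h_le h_le2 hL1 hL2 iP P I0 *.
set S := \int[mu]_x `|h x|.
have S0 : 0 <= S by apply: Rintegral_ge0 => x _; exact: normr_ge0.
have iH : L1 (fun xi => ws s xi * sqnormc (fourierL2 u xi)).
  apply/integrableP; split; first exact: (measurable_wsq (weight_ws s) mw).
  under eq_integral => x _ do rewrite /= ger0_norm ?mulr_ge0 ?powR_ge0 ?sqnormc_ge0//.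
  by apply: le_lt_trans hA _; rewrite ltry.
have HA : \int[mu]_xi (ws s xi * sqnormc (fourierL2 u xi)) <= A.
  by rewrite -lee_fin EFin_Rint.
have bnd : 2 * pi * \int[mu]_x (u x * h x) <= S * (I + A).
  rewrite P; apply: (@le_trans _ _ (\int[mu]_xi (S * (ws (- s) xi + ws s xi * sqnormc (fourierL2 u xi))))).
    apply: Rint_le => //; first exact: L1Z (L1D iw iH).
    move=> xi; rewrite fourierE/=.
    have b1 := fcos_le xi hL1; have b2 := fsin_le xi hL1; rewrite -/S in b1 b2.
    set p := complex.Re _; set q := complex.Im _.
    have w0 : 0 < ws s xi by rewrite powR_gt0// (lt_le_trans ltr01)// one_le_1sqr.
    have wE : ws (- s) xi = (ws s xi)^-1 by rewrite /ws powRN.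
    have amgm (z : R) : `|z| <= 2^-1 * (ws (- s) xi + ws s xi * z ^+ 2).
      rewrite wE; have -> : 2^-1 * ((ws s xi)^-1 + ws s xi * z ^+ 2) =
          `|z| + 2^-1 * ((ws s xi)^-1 * (1 - ws s xi * `|z|) ^+ 2).
        by rewrite -[z ^+ 2]real_normK ?num_real//; field; rewrite gt_eqF.
      by rewrite lerDl mulr_ge0// mulr_ge0 ?sqr_ge0// invr_ge0 ltW.
    have a1 := amgm p; have a2 := amgm q.
    apply: (@le_trans _ _ (`|p| * S + `|q| * S)).
      apply: lerD; apply: le_trans (ler_norm _) _; rewrite normrM ?normrN; exact: ler_wpM2l.
    rewrite -mulrDl mulrC; apply: ler_wpM2l => //.
    rewrite -[sqnormc _]/(p ^+ 2 + q ^+ 2) mulrDr.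
    have n1 : 0 <= ws s xi * p ^+ 2 by rewrite mulr_ge0 ?sqr_ge0// ltW.
    have n2 : 0 <= ws s xi * q ^+ 2 by rewrite mulr_ge0 ?sqr_ge0// ltW.
    move: a1 a2 n1 n2; clear.
    by move: (ws (- s) xi) (_ * p ^+ 2) (_ * q ^+ 2) (`|p|) (`|q|) => W P1 Q1 P2 Q2; lra.
  rewrite (RintZ _ (L1D iw iH)) (RintD iw iH); apply: ler_wpM2l => //.
  by rewrite lerD2l.
have S_eq : S = \int[mu]_x h x by apply: eq_Rintegral => x _; rewrite ger0_norm.
(* [u * h = h ^+ 2 + K * h], and [bnd] says that the left side integrates to at most [K * S]. *)
have hh : \int[mu]_x (h x ^+ 2) <= 0.
  have -> : \int[mu]_x (h x ^+ 2) = \int[mu]_x (u x * h x) - K * S.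
    rewrite S_eq -(RintZ K hL1) -(RintB (L2_integrableM uL hL2) (L1Z K hL1)).
    apply: eq_Rintegral => x _; rewrite /h.
    by have [uK|Ku] := lerP (u x - K) 0; ring.
  have pi2 : 2 <= pi :> R by exact: pi_ge2.
  have UH0 : 0 <= \int[mu]_x (u x * h x).
    apply: Rintegral_ge0 => x _; rewrite /h; have [uK|Ku] := lerP (u x - K) 0; first by rewrite mulr0.
    by rewrite mulr_ge0//; lra.
  have : \int[mu]_x (u x * h x) <= S * (I + A).
    apply: le_trans bnd; rewrite ler_peMl//; move: pi pi2 => p p2; lra.
  move=> UH; rewrite subr_le0; apply: (le_trans UH); rewrite mulrC; apply: ler_wpM2r => //.
  by rewrite /K lerDl.
have hz : nsq h = 0%E.
  apply/eqP; rewrite eq_le nsq_ge0 andbT nsqE// lee_fin.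
apply: (ae_impl (nsq_eq0 mh hz)) => x /(_ Logic.I); rewrite /h /=.
by have [uK|Ku] := lerP (u x - K) 0; lra.
Qed.

(** Affine in the squared norm [A] rather than of order of its root: only boundedness
    matters below. *)
Definition sup_bound (s A : R) : R := \int[mu]_xi (ws (- s) xi) + A + 1.

Lemma embedding (s A : R) u : 2^-1 < s -> L2 u -> (hs s u <= A%:E)%E ->
  {ae mu, forall x, `|u x| <= sup_bound s A}.
Proof.
move=> s2 uL hA.
have hAN : (hs s (fun x => (-1) * u x)%R <= A%:E)%E.
  by rewrite hsqZ// (_ : (-1) ^+ 2 = 1 :> R) ?mul1e//; ring.
have a1 := embedding_upper s2 uL hA; have a2 := embedding_upper s2 (L2Z (-1) uL) hAN.
apply: (ae_impl2 a1 a2) => x h1 h2; rewrite ler_norml /sup_bound; apply/andP; split; last exact: h1.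
by rewrite lerNl -mulN1r.
Qed.

End Embedding.

(** * A difference characterization of fractional smoothness *)

Section Besov.
Context {R : realType}.
Local Notation mu := (@lebesgue_measure R).
Implicit Types (u v : R -> R) (xi : R).

Lemma sin_le_id (x : R) : 0 <= x -> `|sin x| <= x.
Proof.
move=> x0; have mvt : exists2 c : R, c \in `[0, x] & sin x - sin 0 = cos c * (x - 0).
  by apply: MVT_segment => //; apply: continuous_subspaceT => c; exact: continuous_sin.
have [c _] := mvt; rewrite sin0 !subr0 => ->.
by rewrite normrM (ger0_norm x0); apply: ler_piMl => //; exact: cos_max.
Qed.

Lemma diff_symbol (t : R) : 2 - 2 * cos t = 4 * sin (t / 2) ^+ 2.
Proof.
have -> : cos t = cos ((t / 2) *+ 2) by rewrite -mulr_natr divfK.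
by rewrite cos_mulr2n mulr2n sin2cos2; ring.
Qed.

Lemma diff_symbol_ge0 (t : R) : 0 <= 2 - 2 * cos t.
Proof. by rewrite diff_symbol mulr_ge0// sqr_ge0. Qed.

Lemma diff_symbol_le4 (t : R) : 2 - 2 * cos t <= 4.
Proof. by have := cos_geN1 t; lra. Qed.

Lemma diff_symbol_le_sqr (t : R) : 2 - 2 * cos t <= t ^+ 2.
Proof.
rewrite diff_symbol.
suff : sin (t / 2) ^+ 2 <= (t / 2) ^+ 2 by nra.
rewrite -[X in X <= _]real_normK ?num_real// -[leRHS]real_normK ?num_real//.
rewrite ler_sqr ?nnegrE//.
have [t0|t0] := lerP 0 (t / 2); first by rewrite [leRHS]ger0_norm// sin_le_id.
by rewrite -normrN -sinN [leRHS]ltr0_norm// sin_le_id// oppr_ge0 ltW.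
Qed.

Lemma diff_symbol_gt0 : 0 < 2 - 2 * cos 1 :> R.
Proof.
have : cos 1 < cos 0 :> R.
  by rewrite ltr_cos ?ltr01// in_itv/= ?lexx ?ler01 ?pi_ge0//= (le_trans _ (pi_ge2 R))// ler1n.
by rewrite cos0; lra.
Qed.

Lemma diff_symbol_ge (t : R) : 1 <= `|t| -> `|t| <= 2 -> 2 - 2 * cos 1 <= 2 - 2 * cos t.
Proof.
move=> t1 t2; have -> : cos t = cos `|t|.
  by have [_|_] := ger0P t; rewrite ?cosN.
suff : cos `|t| <= cos 1 by lra.
have p2 := pi_ge2 R.
rewrite leNgt ltr_cos -?leNgt// in_itv/= ?ler01 ?normr_ge0//=; first exact: le_trans p2.
by apply: le_trans p2; rewrite ler1n.
Qed.

Lemma dyadic_shell xi : 1 <= `|xi| -> exists k, 2 ^+ k <= `|xi| < 2 ^+ k.+1.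
Proof.
move=> x1; have ex : exists n, `|xi| < 2 ^+ n.
  exists (Num.trunc `|xi|).+1; apply: (lt_le_trans (truncnS_gt _)).
  by rewrite -natrX ler_nat ltnW// ltn_expl.
have := ex_minnP ex; case=> -[|k] hk hmin; first by rewrite expr0 in hk; lra.
exists k; rewrite hk andbT leNgt; apply/negP => /hmin; by rewrite ltnn.
Qed.

Section Exponent.
Variable s : R.
Hypothesis s0 : 0 < s.
Hypothesis s1 : s < 1.
Let a : R := 4 `^ s.

Let gt1 (t : R) : 0 < t -> 1 < 4 `^ t.
Proof. by move=> t0; rewrite /powR gt_eqF// expR_gt1 mulr_gt0// ln_gt0// ltr1n. Qed.

Let a1 : 1 < a.
Proof. exact: gt1. Qed.

Let a4 : a < 4.
Proof.
have t1 : 1 < 4 `^ (1 - s) by apply: gt1; rewrite subr_gt0.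
have : a * 4 `^ (1 - s) = 4.
  rewrite /a -powRD; last by apply/implyP => _; rewrite gt_eqF.
  by rewrite addrC subrK powRr1.
by move: (4 `^ (1 - s)) t1 => b b1; have := a1; nra.
Qed.

Let aX (k : nat) : (4 ^+ k) `^ s = a ^+ k.
Proof. by rewrite -powR_mulrn// -powRrM mulrC powRrM powR_mulrn// powR_ge0. Qed.

(** For [0 < s < 1] the weight [(1 + xi^2)^s] is comparable to 1 plus the sum over [k] of
    [4^(ks) |exp(i xi / 2^k) - 1|^2], with these constants. The second expression only
    involves differences, which behave well under composition with nonlinear functions. *)
Definition besov_low : R := 2 + 8 / (2 - 2 * cos 1).
Definition besov_up : R := 4 * (4 / (4 - a) + 4 / (a - 1)).

Lemma besov_low_ge0 : 0 <= besov_low.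
Proof. by rewrite addr_ge0// divr_ge0// diff_symbol_ge0. Qed.

Let D : R := 4 / (4 - a) + 4 / (a - 1).

Lemma besov_up_ge0 : 0 <= besov_up.
Proof. by rewrite mulr_ge0// addr_ge0// divr_ge0// subr_ge0 ltW ?a1 ?a4. Qed.

(** One term is enough, the one for which [xi / 2^k] has modulus between 1 and 2. *)
Lemma ws_low xi : exists k : nat, ws s xi <= besov_low * (1 + a ^+ k * (2 - 2 * cos (2^-1 ^+ k * xi))).
Proof.
have c0 := diff_symbol_gt0.
have [x1|x1] := ltrP `|xi| 1.
  exists 0%N; apply: (@le_trans _ _ 2).
    rewrite -[leRHS](@powRr1 R 2)//; apply: (@le_trans _ _ (2 `^ s)); last first.
      by rewrite ler_powR ?ltW// ltr1n.
    apply: ge0_ler_powR; rewrite ?nnegrE ?addr_ge0 ?sqr_ge0//; first exact: ltW.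
    by rewrite -[xi ^+ 2]real_normK ?num_real//; have := normr_ge0 xi; nra.
  have d0 := diff_symbol_ge0 (2^-1 ^+ 0 * xi).
  have e0 : 0 <= 8 / (2 - 2 * cos 1) :> R by rewrite divr_ge0// ltW.
  rewrite expr0 mul1r /besov_low; nra.
have [k /andP[k1 k2]] := dyadic_shell x1; exists k.
have p0 : 0 < 2 ^+ k :> R by rewrite exprn_gt0.
have tE : `|2^-1 ^+ k * xi| = `|xi| / 2 ^+ k.
  by rewrite normrM ger0_norm ?exprn_ge0 ?invr_ge0// exprVn mulrC.
have lo : 2 - 2 * cos 1 <= 2 - 2 * cos (2^-1 ^+ k * xi).
  apply: diff_symbol_ge; rewrite tE.
    by rewrite ler_pdivlMr// mul1r.
  by rewrite ler_pdivrMr// -exprS ltW.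
have up : ws s xi <= 8 * a ^+ k.
  apply: (@le_trans _ _ ((8 * 4 ^+ k) `^ s)).
    apply: ge0_ler_powR; rewrite ?nnegrE ?addr_ge0 ?sqr_ge0 ?mulr_ge0 ?exprn_ge0//; first exact: ltW.
    have p1 : 1 <= 2 ^+ k :> R by rewrite exprn_ege1// ler1n.
    have -> : 4 ^+ k = 2 ^+ k * 2 ^+ k :> R by rewrite -exprMn_comm; [congr (_ ^+ _); ring|exact: mulrC].
    rewrite -[xi ^+ 2]real_normK ?num_real//; move: k2; rewrite exprS; have := normr_ge0 xi.
    by move: (2 ^+ k) p0 p1 => p p0 p1; nra.
  rewrite powRM ?exprn_ge0// aX ler_wpM2r ?exprn_ge0 ?powR_ge0//.
  rewrite -[leRHS](@powRr1 R 8)//; by rewrite ler_powR ?ltW// ltr1n.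
apply: (le_trans up); rewrite /besov_low.
have ak : 0 <= a ^+ k by rewrite exprn_ge0// powR_ge0.
apply: (@le_trans _ _ (8 / (2 - 2 * cos 1) * (a ^+ k * (2 - 2 * cos 1)))).
  by rewrite le_eqVlt; apply/orP; left; apply/eqP; field; rewrite gt_eqF.
have e0 : 0 <= 8 / (2 - 2 * cos 1) :> R by rewrite divr_ge0// ltW.
have f0 : 0 <= a ^+ k * (2 - 2 * cos (2^-1 ^+ k * xi)).
  by rewrite mulr_ge0// diff_symbol_ge0.
apply: (@le_trans _ _ (8 / (2 - 2 * cos 1) * (a ^+ k * (2 - 2 * cos (2^-1 ^+ k * xi))))).
  by apply: ler_wpM2l => //; exact: ler_wpM2l.
move: (8 / _) (a ^+ k * _) e0 f0 => p q p0' q0; nra.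
Qed.

(** Majorant of the sum of symbols, from [2 - 2 cos t <= min 4 t^2]. Replacing [xi] by
    [2 xi] shifts the sum by one term, hence the induction on dyadic shells below. *)
Let phi (n : nat) xi : R := \sum_(k < n) a ^+ k * Num.min 4 (xi ^+ 2 / 4 ^+ k).

Let phi_double n xi : phi n.+1 (2 * xi) = Num.min 4 (4 * xi ^+ 2) + a * phi n xi.
Proof.
rewrite /phi big_ord_recl expr0 mul1r divr1; congr (Num.min _ _ + _); first by ring.
rewrite mulr_sumr; apply: eq_bigr => k _; rewrite lift0 exprS -mulrA; congr (_ * (_ * Num.min _ _)).
have : 4 ^+ k != 0 :> R by rewrite expf_neq0.
by rewrite [4 ^+ k.+1]exprS; move: (4 ^+ k) => p p0; field.
Qed.

Let phi_le N : forall n xi, `|xi| <= 2 ^+ N -> phi n xi <= D * a ^+ N - 4 / (a - 1).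
Proof.
have d1 : 0 < a - 1 by rewrite subr_gt0.
have d4 : 0 < 4 - a by rewrite subr_gt0.
have q1 : 0 <= 4 / (a - 1) by rewrite divr_ge0// ltW.
have q4 : 0 <= 4 / (4 - a) by rewrite divr_ge0// ltW.
have apos : 0 < a by lra.
elim: N => [|N IH] n xi.
  rewrite !expr0 mulr1 => x1; rewrite /D addrK.
  have geo : forall m : nat, \sum_(k < m) (a / 4) ^+ k <= 4 / (4 - a) - 4 / (4 - a) * (a / 4) ^+ m.
    elim=> [|m IHm]; first by rewrite big_ord0 expr0 mulr1 subrr.
    rewrite big_ord_recr/=; apply: (le_trans (lerD IHm (lexx _))).
    rewrite exprS le_eqVlt; apply/orP; left; apply/eqP; field; rewrite gt_eqF//.
  apply: (@le_trans _ _ (\sum_(k < n) (a / 4) ^+ k)).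
    apply: ler_sum => k _; rewrite expr_div_n; apply: ler_wpM2l; first by rewrite exprn_ge0// ltW.
    rewrite ge_min; apply/orP; right; rewrite ler_pdivrMr ?exprn_gt0// mulVf ?expf_neq0//.
    by rewrite -real_normK ?num_real// exprn_ile1.
  apply: (le_trans (geo n)); rewrite gerBl; apply: mulr_ge0 => //; apply: exprn_ge0; apply: divr_ge0 => //; exact: ltW.
rewrite exprS => xN.
have yN : `|xi / 2| <= 2 ^+ N by rewrite normrM normfV (ger0_norm (_ : 0 <= 2 :> R))// ler_pdivrMr// mulrC.
have Da : a <= a * a ^+ N by rewrite ler_peMr ?exprn_ege1 ?ltW.
case: n => [|n].
  have aN : 1 <= a * a ^+ N by apply: le_trans Da; exact: ltW.
  rewrite /phi big_ord0 subr_ge0 exprS /D; move: (4 / (4 - a)) (4 / (a - 1)) (a * a ^+ N) q1 q4 aN.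
  by move=> p q b p0 q0 b1; nra.
have -> : xi = 2 * (xi / 2) by field.
rewrite phi_double; have := IH n _ yN; rewrite exprS => h.
apply: (@le_trans _ _ (4 + a * (D * a ^+ N - 4 / (a - 1)))).
  by apply: lerD; [rewrite ge_min lexx|rewrite ler_wpM2l// ltW].
rewrite le_eqVlt; apply/orP; left; apply/eqP.
by rewrite exprS; move: (a ^+ N) => b; field; rewrite gt_eqF.
Qed.

Lemma ws_up (n : nat) xi :
  \sum_(k < n) a ^+ k * (2 - 2 * cos (2^-1 ^+ k * xi)) <= besov_up * ws s xi.
Proof.
have d1 : 0 < a - 1 by rewrite subr_gt0.
have d4 : 0 < 4 - a by rewrite subr_gt0.
have q1 : 0 <= 4 / (a - 1) by rewrite divr_ge0// ltW.
have q4 : 0 <= 4 / (4 - a) by rewrite divr_ge0// ltW.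
have apos : 0 < a by lra.
have D0 : 0 <= D by rewrite addr_ge0.
apply: (@le_trans _ _ (phi n xi)).
  apply: ler_sum => k _; apply: ler_wpM2l; first by rewrite exprn_ge0// ltW.
  rewrite le_min diff_symbol_le4/=.
  apply: (le_trans (diff_symbol_le_sqr _)); rewrite exprMn mulrC exprAC exprVn -exprVn.
  by rewrite le_eqVlt; apply/orP; left; apply/eqP; congr (_ * _); rewrite -exprVn; congr (_ ^+ _); field.
have [x1|x1] := ltrP `|xi| 1.
  have := @phi_le 0 n xi; rewrite expr0 => /(_ (ltW x1)); rewrite expr0 mulr1 => h.
  have w1 : 1 <= ws s xi by rewrite ws_ge1// ltW.
  by rewrite /besov_up -/D; nra.
have [k /andP[k1 k2]] := dyadic_shell x1.
apply: (le_trans (phi_le n (ltW k2))).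
have ak : 0 <= a ^+ k by rewrite exprn_ge0// ltW.
have wk : a ^+ k <= ws s xi.
  rewrite -aX; apply: ge0_ler_powR; rewrite ?nnegrE ?addr_ge0 ?sqr_ge0 ?exprn_ge0//; first exact: ltW.
  have -> : 4 ^+ k = 2 ^+ k * 2 ^+ k :> R by rewrite -exprMn_comm; [congr (_ ^+ _); ring|exact: mulrC].
  have p0 : 0 < 2 ^+ k :> R by rewrite exprn_gt0.
  rewrite -[xi ^+ 2]real_normK ?num_real//.
  by move: (2 ^+ k) p0 k1 => p p0 k1; nra.
rewrite exprS /besov_up -/D; apply: (@le_trans _ _ (D * (a * a ^+ k))); first by lra.
by rewrite [4 * D]mulrC -[leRHS]mulrA ler_wpM2l//; apply: ler_pM => //; lra.
Qed.

Variable s' : R.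

Let m k xi : R := a ^+ k * (ws s' xi * (2 - 2 * cos (2^-1 ^+ k * xi))).

Let wm k : weight (m k).
Proof.
have [h1 h2] := weight_diff (2^-1 ^+ k) (weight_ws (R := R) s').
split; first exact: measurable_funM.
by move=> xi; rewrite mulr_ge0// exprn_ge0// powR_ge0.
Qed.

Let hsq_m k v : L2 v ->
  hsq (m k) v = ((a ^+ k)%:E * hs s' (fun x => v (x + 2^-1 ^+ k) - v x)%R)%E.
Proof.
move=> vL; rewrite (hsq_diff _ (weight_ws s') vL).
have wd := weight_diff (2^-1 ^+ k) (weight_ws (R := R) s').
rewrite /hsq /wsq -ge0_integralZl_EFin//; first last.
- by rewrite exprn_ge0// powR_ge0.
- exact: (measurable_wsq wd (mC_fourierL2 vL)).
- by move=> x _; rewrite lee_fin mulr_ge0 ?sqnormc_ge0//; case: wd.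
by apply: eq_integral => x _; rewrite -EFinM /m !mulrA.
Qed.

Lemma besov_lower v : L2 v ->
  (hs (s' + s) v <= besov_low%:E * (hs s' v + \sum_(0 <= k <oo)
     (a ^+ k)%:E * hs s' (fun x => v (x + 2^-1 ^+ k) - v x)%R))%E.
Proof.
move=> vL; have mv := mC_fourierL2 vL.
pose q xi := sqnormc (fourierL2 v xi).
have q0 xi : 0 <= q xi by exact: sqnormc_ge0.
have m0 k xi : 0 <= m k xi by case: (wm k).
under eq_eseriesr => k _ do rewrite -hsq_m//.
rewrite /hsq /wsq -integral_nneseries//; first last.
- by move=> k x _; rewrite lee_fin mulr_ge0 ?sqnormc_ge0.
- by move=> k; exact: measurable_wsq.
have mser : measurable_fun setT (fun xi => \sum_(0 <= k <oo) (m k xi * q xi)%:E)%E.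
  apply: ge0_emeasurable_sum => [k x _|k _]; first by rewrite lee_fin mulr_ge0.
  exact: measurable_wsq.
have ser0 xi : (0 <= \sum_(0 <= k <oo) (m k xi * q xi)%:E)%E.
  by apply: nneseries_ge0 => k _ _; rewrite lee_fin mulr_ge0.
have w0 xi : (0 <= (ws s' xi * q xi)%:E)%E by rewrite lee_fin mulr_ge0// powR_ge0.
have mw := measurable_wsq (weight_ws (R := R) s') mv.
rewrite -ge0_integralD// -ge0_integralZl_EFin//; first last.
- exact: besov_low_ge0.
- exact: emeasurable_funD.
- by move=> x _; exact: adde_ge0.
apply: ge0_le_integral => //.
- by move=> x _; rewrite lee_fin mulr_ge0 ?sqnormc_ge0 ?powR_ge0.
- exact: (measurable_wsq (weight_ws (R := R) (s' + s)) mv).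
- by apply: emeasurable_funM => //; exact: emeasurable_funD.
move=> xi _; have [k hk] := ws_low xi.
have term : ((m k xi * q xi)%:E <= \sum_(0 <= k <oo) (m k xi * q xi)%:E)%E.
  apply: le_trans (nneseries_lim_ge k.+1 _); last by move=> i _ _; rewrite lee_fin mulr_ge0.
  rewrite big_nat_recr//= leeDr//; apply: sume_ge0 => i _; by rewrite lee_fin mulr_ge0.
apply: (@le_trans _ _ (besov_low%:E * ((ws s' xi * q xi)%:E + (m k xi * q xi)%:E))%E); last first.
  by apply: lee_wpmul2l; [rewrite lee_fin besov_low_ge0|exact: leeD].
rewrite -EFinD -EFinM lee_fin wsD -/(q xi) /m.
have -> : besov_low * (ws s' xi * q xi + a ^+ k * (ws s' xi * (2 - 2 * cos (2^-1 ^+ k * xi))) * q xi) =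
   ws s' xi * q xi * (besov_low * (1 + a ^+ k * (2 - 2 * cos (2^-1 ^+ k * xi)))) by ring.
by rewrite mulrAC ler_wpM2l// mulr_ge0// powR_ge0.
Qed.

Lemma besov_upper v : L2 v ->
  (\sum_(0 <= k <oo) (a ^+ k)%:E * hs s' (fun x => v (x + 2^-1 ^+ k) - v x)%R <=
   besov_up%:E * hs (s' + s) v)%E.
Proof.
move=> vL; have mv := mC_fourierL2 vL.
pose q xi := sqnormc (fourierL2 v xi).
have q0 xi : 0 <= q xi by exact: sqnormc_ge0.
have m0 k xi : 0 <= m k xi by case: (wm k).
under eq_eseriesr => k _ do rewrite -hsq_m//.
rewrite /hsq /wsq -integral_nneseries//; first last.
- by move=> k x _; rewrite lee_fin mulr_ge0 ?sqnormc_ge0.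
- by move=> k; exact: measurable_wsq.
rewrite -ge0_integralZl_EFin//; first last.
- exact: besov_up_ge0.
- exact: (measurable_wsq (weight_ws (R := R) (s' + s)) mv).
- by move=> x _; rewrite lee_fin mulr_ge0 ?sqnormc_ge0 ?powR_ge0.
apply: ge0_le_integral => //.
- by move=> x _; apply: nneseries_ge0 => k _ _; rewrite lee_fin mulr_ge0 ?sqnormc_ge0.
- apply: ge0_emeasurable_sum => [k x _|k _]; first by rewrite lee_fin mulr_ge0 ?sqnormc_ge0.
  exact: measurable_wsq.
- apply: emeasurable_funM => //; exact: (measurable_wsq (weight_ws (R := R) (s' + s)) mv).
move=> xi _; apply: lime_le.
  by apply: is_cvg_nneseries => k _ _; rewrite lee_fin mulr_ge0 ?sqnormc_ge0.
apply: nearW => n; rewrite sumEFin -EFinM lee_fin wsD -/(q xi) -mulr_suml mulrA ler_wpM2r//.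
rewrite big_mkord; have -> : \sum_(i < n) m i xi =
    ws s' xi * \sum_(k < n) a ^+ k * (2 - 2 * cos (2^-1 ^+ k * xi)).
  by rewrite mulr_sumr; apply: eq_bigr => k _; rewrite /m mulrCA.
by rewrite mulrCA ler_wpM2l ?powR_ge0// ws_up.
Qed.

(** If the increments of [G] are controlled in H^s' by those of [u] and [v], then
    the remaining [s] derivatives of [G] are controlled by those of [u] and [v]. *)
Lemma besov_transfer G u v (L : R) : L2 G -> L2 u -> L2 v -> 0 <= L ->
  (forall z, (hs s' (fun x => G (x + z) - G x)%R <=
     L%:E * (hs s' (fun x => u (x + z) - u x)%R + hs s' (fun x => v (x + z) - v x)%R))%E) ->
  (hs (s' + s) G <= besov_low%:E *
     (hs s' G + (L * besov_up)%:E * (hs (s' + s) u + hs (s' + s) v)))%E.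
Proof.
move=> GL uL vL L0 hG; apply: (le_trans (besov_lower GL)).
have ge0 f k : L2 f -> (0 <= (a ^+ k)%:E * hs s' (fun x => f (x + 2^-1 ^+ k) - f x)%R)%E.
  move=> fL; apply: mule_ge0; first by rewrite lee_fin exprn_ge0// powR_ge0.
  by apply: hsq_ge0; exact: weight_ws.
apply: lee_wpmul2l; first by rewrite lee_fin besov_low_ge0.
apply: leeD => //.
apply: (@le_trans _ _ (L%:E * (\sum_(0 <= k <oo) ((a ^+ k)%:E * hs s' (fun x => u (x + 2^-1 ^+ k) - u x)%R +
   (a ^+ k)%:E * hs s' (fun x => v (x + 2^-1 ^+ k) - v x)%R)))%E).
  rewrite -nneseriesZl; last by move=> i _; apply: adde_ge0; exact: ge0.
  apply: lee_nneseries => [i _ _|k _]; first exact: ge0.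
  rewrite -ge0_muleDr; try by apply: hsq_ge0; exact: weight_ws.
  rewrite muleCA; apply: lee_wpmul2l; first by rewrite lee_fin exprn_ge0// powR_ge0.
  exact: hG.
rewrite nneseriesD; try by move=> i _ _; exact: ge0.
rewrite EFinM -muleA; apply: lee_wpmul2l => //.
rewrite ge0_muleDr; try by apply: hsq_ge0; exact: weight_ws.
by apply: leeD; exact: besov_upper.
Qed.

End Exponent.
End Besov.

(** * Smooth functions of two variables *)

Section SmoothTwo.
Context {R : realType}.
Implicit Types (g : R * R -> R).

Lemma smooth2_continuous g : smooth2 g -> continuous g.
Proof. by move=> /(_ 0%N)[]. Qed.

Lemma smooth2_D1 g : smooth2 g -> smooth2 ('D_(1, 0) g).
Proof. by move=> h n; have [_ []] := h n.+1. Qed.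

Lemma smooth2_D2 g : smooth2 g -> smooth2 ('D_(0, 1) g).
Proof. by move=> h n; have [_ []] := h n.+1. Qed.

Lemma smooth2_is_derive1 g (t y : R) : smooth2 g ->
  is_derive t 1 (fun t : R => g (t, y)) ('D_(1, 0) g (t, y)).
Proof.
move=> /(_ 1%N)[_ [/(_ (t, y)) d _ _ _]].
have E : (fun h : R => h^-1 *: ((g \o shift (t, y)) (h *: (1, 0)) - g (t, y))) =
         (fun h : R => h^-1 *: (((fun t : R => g (t, y)) \o shift t) (h *: 1) - g (t, y))).
  apply/funext => h /=; congr (_ *: (g _ - _)).
  have -> : h *: (1, 0) + (t, y) = (h * 1 + t, h * 0 + y) by [].
  by rewrite mulr0 add0r.
by split; rewrite /derivable /derive -E.
Qed.

Lemma smooth2_is_derive2 g (x t : R) : smooth2 g ->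
  is_derive t 1 (fun t : R => g (x, t)) ('D_(0, 1) g (x, t)).
Proof.
move=> /(_ 1%N)[_ [_ /(_ (x, t)) d _ _]].
have E : (fun h : R => h^-1 *: ((g \o shift (x, t)) (h *: (0, 1)) - g (x, t))) =
         (fun h : R => h^-1 *: (((fun t : R => g (x, t)) \o shift t) (h *: 1) - g (x, t))).
  apply/funext => h /=; congr (_ *: (g _ - _)).
  have -> : h *: (0, 1) + (x, t) = (h * 0 + x, h * 1 + t) by [].
  by rewrite mulr0 add0r.
by split; rewrite /derivable /derive -E.
Qed.

(** The last clause keeps the intermediate point in any centered interval that contains
    the endpoints, whatever their order. *)
Lemma mean_value (f df : R -> R) (a b : R) : (forall t : R, is_derive t 1 f (df t)) ->
  exists c, [/\ f b - f a = df c * (b - a), `|c - a| <= `|b - a| &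
    forall M, `|a| <= M -> `|b| <= M -> `|c| <= M].
Proof.
move=> d; have cf : continuous f.
  by move=> t; apply: differentiable_continuous; apply/derivable1_diffP; exact: ex_derive.
have [ab|/ltW ba] := lerP a b.
  have [|c] := @MVT_segment R f df a b ab (fun x _ => d x); first exact: continuous_subspaceT.
  rewrite in_itv/= => /andP[ac cb] E; exists c; split=> //.
    by rewrite !ger0_norm ?subr_ge0// lerD2r.
  move=> M; rewrite !ler_norml => /andP[h1 h2] /andP[h3 h4]; apply/andP; split; lra.
have [|c] := @MVT_segment R f df b a ba (fun x _ => d x); first exact: continuous_subspaceT.
rewrite in_itv/= => /andP[bc ca] E; exists c; split.
- by rewrite -[LHS]opprB E; ring.
- by rewrite distrC ger0_norm ?subr_ge0// lerD2l lerN2.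
- move=> M; rewrite !ler_norml => /andP[h1 h2] /andP[h3 h4]; apply/andP; split; lra.
Qed.

Lemma mean_value2 g (a b c d : R) : smooth2 g -> exists x y,
  [/\ g (a, b) - g (c, d) = 'D_(1, 0) g (x, b) * (a - c) + 'D_(0, 1) g (c, y) * (b - d),
     `|x - c| <= `|a - c|, `|y - d| <= `|b - d|,
     (forall M, `|c| <= M -> `|a| <= M -> `|x| <= M) &
     (forall M, `|d| <= M -> `|b| <= M -> `|y| <= M)].
Proof.
move=> sg.
have [x [Ex x1 x2]] := mean_value c a (fun t => smooth2_is_derive1 t b sg).
have [y [Ey y1 y2]] := mean_value d b (fun t => smooth2_is_derive2 c t sg).
by exists x, y; split => //; rewrite -Ex -Ey; ring.
Qed.

Lemma bounded_on_square g (M : R) : continuous g ->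
  exists2 L, 0 <= L & forall a b, `|a| <= M -> `|b| <= M -> `|g (a, b)| <= L.
Proof.
move=> cg; have [M0|M0] := ltrP M 0.
  by exists 0 => // a b aM; have := le_lt_trans aM M0; rewrite normr_lt0.
pose A : set (R * R) := (`[-M, M]%classic `*` `[-M, M]%classic).
have cA : compact A by apply: compact_setX; exact: segment_compact.
have A0 : A !=set0 by exists (0, 0); rewrite /A/=; split; rewrite /= in_itv/= oppr_le0 M0.
have cn : {within A, continuous (fun p => `|g p|)}.
  apply: continuous_subspaceT => p; apply: (@continuous_comp _ _ _ g Num.norm); first exact: cg.
  exact: norm_continuous.
have [p _ hp] := compact_EVT_max A0 cA cn.
exists `|g p| => // a b aM bM; apply: hp; rewrite inE /A; split; rewrite /= in_itv/= -ler_norml//.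
Qed.

Lemma lipschitz_on_square g (M : R) : smooth2 g ->
  exists2 L, 0 <= L & forall a b c d, `|a| <= M -> `|b| <= M -> `|c| <= M -> `|d| <= M ->
    `|g (a, b) - g (c, d)| <= L * (`|a - c| + `|b - d|).
Proof.
move=> sg; have [L1 L10 h1] := bounded_on_square M (smooth2_continuous (smooth2_D1 sg)).
have [L2 L20 h2] := bounded_on_square M (smooth2_continuous (smooth2_D2 sg)).
exists (L1 + L2); first exact: addr_ge0.
move=> a b c d aM bM cM dM; have [x [y [-> _ _ xM yM]]] := mean_value2 a b c d sg.
apply: (le_trans (ler_normD _ _)); rewrite !normrM mulrDr; apply: lerD; apply: ler_wpM2r => //.
  by apply: (le_trans (h1 _ _ (xM _ cM aM) bM)); rewrite lerDl.
by apply: (le_trans (h2 _ _ cM (yM _ dM bM))); rewrite lerDr.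
Qed.

Lemma taylor_on_square g (M : R) : smooth2 g ->
  exists2 L, 0 <= L & forall a b c d, `|a| <= M -> `|b| <= M -> `|c| <= M -> `|d| <= M ->
    `|g (a, b) - g (c, d) - ('D_(1, 0) g (c, d) * (a - c) + 'D_(0, 1) g (c, d) * (b - d))|
      <= L * (`|a - c| + `|b - d|) ^+ 2.
Proof.
move=> sg; have [L1 L10 h1] := lipschitz_on_square M (smooth2_D1 sg).
have [L2 L20 h2] := lipschitz_on_square M (smooth2_D2 sg).
exists (L1 + L2); first exact: addr_ge0.
move=> a b c d aM bM cM dM; have [x [y [-> x1 y1 xM yM]]] := mean_value2 a b c d sg.
have e1 := h1 _ _ _ _ (xM _ cM aM) bM cM dM; have e2 := h2 _ _ _ _ cM (yM _ dM bM) cM dM.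
have -> : 'D_(1, 0) g (x, b) * (a - c) + 'D_(0, 1) g (c, y) * (b - d) -
    ('D_(1, 0) g (c, d) * (a - c) + 'D_(0, 1) g (c, d) * (b - d)) =
    ('D_(1, 0) g (x, b) - 'D_(1, 0) g (c, d)) * (a - c) +
    ('D_(0, 1) g (c, y) - 'D_(0, 1) g (c, d)) * (b - d) by ring.
apply: (le_trans (ler_normD _ _)); rewrite !normrM.
rewrite subrr normr0 add0r in e2.
have {}e1 : `|'D_(1, 0) g (x, b) - 'D_(1, 0) g (c, d)| <= L1 * (`|a - c| + `|b - d|).
  by apply: (le_trans e1); apply: ler_wpM2l => //; apply: lerD.
have {}e2 : `|'D_(0, 1) g (c, y) - 'D_(0, 1) g (c, d)| <= L2 * (`|a - c| + `|b - d|).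
  by apply: (le_trans e2); apply: ler_wpM2l => //; apply: (le_trans y1); rewrite lerDr.
apply: (le_trans (lerD (ler_wpM2r (normr_ge0 _) e1) (ler_wpM2r (normr_ge0 _) e2))).
rewrite -subr_ge0.
have -> : (L1 + L2) * (`|a - c| + `|b - d|) ^+ 2 -
    (L1 * (`|a - c| + `|b - d|) * `|a - c| + L2 * (`|a - c| + `|b - d|) * `|b - d|) =
    (`|a - c| + `|b - d|) * (L1 * `|b - d| + L2 * `|a - c|) by ring.
by rewrite mulr_ge0 ?addr_ge0// mulr_ge0.
Qed.

(* Difference quotients of the functions below are constant in [h]. *)
Let derive_exact g (p v : R * R) (l : R) :
  (forall h : R, g (h *: v + p) - g p = h * l) -> derivable g p v /\ 'D_v g p = l.
Proof.
move=> E; suff : (fun h : R => h^-1 *: ((g \o shift p) (h *: v) - g p)) @ 0^' --> l.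
  move=> c; split; first by apply/cvg_ex; exists l.
  exact: cvg_lim c.
apply: (@cvg_trans _ (cst l @ (0 : R)^')); last exact: cvg_cst.
apply: near_eq_cvg; near=> h; have h0 : h != 0 by near: h; exact: nbhs_dnbhs_neq.
by rewrite /= E /GRing.scale/= mulrA mulVf// mul1r.
Unshelve. all: by end_near. Qed.

Let smooth2_of_partials g (d1 d2 : R * R -> R) : continuous g ->
  (forall (p : R * R) (h : R), g (h *: (1, 0) + p) - g p = h * d1 p) ->
  (forall (p : R * R) (h : R), g (h *: (0, 1) + p) - g p = h * d2 p) ->
  smooth2 d1 -> smooth2 d2 -> smooth2 g.
Proof.
move=> cg h1 h2 s1 s2 [|n]; split => //.
have E1 p := derive_exact (h1 p); have E2 p := derive_exact (h2 p).
split.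
- by move=> p; case: (E1 p).
- by move=> p; case: (E2 p).
- by rewrite (_ : 'D_(1, 0) g = d1)//; apply/funext => p; case: (E1 p).
- by rewrite (_ : 'D_(0, 1) g = d2)//; apply/funext => p; case: (E2 p).
Qed.

Lemma smooth2_cst (c : R) : smooth2 (fun=> c).
Proof.
move=> n; elim: n c => [|n IH] c; first by split => //; exact: cst_continuous.
split; first exact: cst_continuous.
have E p v : derivable (fun=> c : R) (p : R * R) v /\ 'D_v (fun=> c : R) p = 0.
  by apply: derive_exact => h; rewrite subrr mulr0.
split.
- by move=> p; case: (E p (1, 0)).
- by move=> p; case: (E p (0, 1)).
- have -> : 'D_((1, 0) : R * R) (fun=> c) = (fun=> 0 : R); last exact: IH.
  by apply/funext => p; case: (E p (1, 0)).
- have -> : 'D_((0, 1) : R * R) (fun=> c) = (fun=> 0 : R); last exact: IH.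
  by apply/funext => p; case: (E p (0, 1)).
Qed.

Lemma smooth2_fst : smooth2 (@fst R R).
Proof.
apply: (smooth2_of_partials (d1 := fun=> 1) (d2 := fun=> 0)).
- by move=> p; exact: cvg_fst.
- by move=> [x y] h /=; rewrite /GRing.scale/=; ring.
- by move=> [x y] h /=; rewrite /GRing.scale/=; ring.
- exact: smooth2_cst.
- exact: smooth2_cst.
Qed.

Lemma smooth2_snd : smooth2 (@snd R R).
Proof.
apply: (smooth2_of_partials (d1 := fun=> 0) (d2 := fun=> 1)).
- by move=> p; exact: cvg_snd.
- by move=> [x y] h /=; rewrite /GRing.scale/=; ring.
- by move=> [x y] h /=; rewrite /GRing.scale/=; ring.
- exact: smooth2_cst.
- exact: smooth2_cst.
Qed.

Lemma smooth2_mul : smooth2 (fun p : R * R => p.1 * p.2).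
Proof.
apply: (smooth2_of_partials (d1 := @snd R R) (d2 := @fst R R)).
- by move=> p; apply: cvgM; [exact: cvg_fst|exact: cvg_snd].
- by move=> [x y] h /=; rewrite /GRing.scale/=; ring.
- by move=> [x y] h /=; rewrite /GRing.scale/=; ring.
- exact: smooth2_snd.
- exact: smooth2_fst.
Qed.

Lemma cvg_comp2 {T} (F : set_system T) {FF : Filter F} g (f h : T -> R) (a b : R) :
  continuous g -> f @ F --> a -> h @ F --> b -> (fun x => g (f x, h x)) @ F --> g (a, b).
Proof.
move=> cg fa hb; apply: (@continuous2_cvg _ _ _ _ _ FF f h (fun a b => g (a, b))) => //.
have -> : (fun z : R * R => g (z.1, z.2)) = g by apply/funext => -[].
exact: cg.
Qed.

(** Freezing the first variable on a mesh of width [1/n] reduces measurability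
    to one variable; continuity lets the mesh be refined. *)
Lemma measurable_comp2 g (u v : R -> R) : continuous g ->
  measurable_fun setT u -> measurable_fun setT v ->
  measurable_fun setT (fun x : R => g (u x, v x)).
Proof.
move=> cg mu mv.
pose q (n : nat) (y : R) : R := (Num.floor (n.+1%:R * y))%:~R / n.+1%:R.
have mesh (n : nat) y : `|q n y - y| <= n.+1%:R^-1.
  have /andP[f1 f2] := floor_itv (n.+1%:R * y).
  have n0 : 0 < n.+1%:R :> R by rewrite ltr0n.
  have -> : q n y - y = - ((n.+1%:R * y - (Num.floor (n.+1%:R * y))%:~R) / n.+1%:R).
    by rewrite /q; field; rewrite gt_eqF.
  rewrite normrN normrM normfV (gtr0_norm n0) ger0_norm ?subr_ge0//.
  rewrite ler_pdivrMr// mulVf ?gt_eqF//.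
  by move: f2; rewrite intrD; lra.
apply: (@measurable_fun_cvg _ _ _ _ (fun (n : nat) (x : R) => g (q n (u x), v x))); last first.
  move=> x _; apply: (cvg_comp2 cg); last exact: cvg_cst.
  apply/cvgrPdist_le => e e0; near=> n; rewrite distrC; apply: (le_trans (mesh n _)).
  near: n; have := @cvg_harmonic R => /cvgrPdist_le/(_ _ e0); apply: filterS => n.
  by rewrite sub0r normrN ger0_norm// invr_ge0.
move=> n; move=> _ B mB; rewrite setTI.
have -> : (fun x => g (q n (u x), v x)) @^-1` B =
    \bigcup_(k : int) ([set x | Num.floor (n.+1%:R * u x) = k] `&`
      ((fun x => g (k%:~R / n.+1%:R, v x)) @^-1` B)).
  apply/seteqP; split => x /=.
    by move=> h; exists (Num.floor (n.+1%:R * u x)).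
  by case=> k _ [/= <-].
apply: countable_bigcupT_measurable => [|k]; first exact: countableP.
apply: measurableI.
  have -> : [set x | Num.floor (n.+1%:R * u x) = k] =
      (fun x => n.+1%:R * u x) @^-1` `[k%:~R, (k + 1)%:~R[%classic.
    apply/seteqP; split => x /=.
      by move=> <-; rewrite in_itv/=; exact: floor_itv.
    by rewrite in_itv/= => /floor_def.
  rewrite -[X in measurable X]setTI.
  have mm : measurable_fun setT (fun x => n.+1%:R * u x) by exact: measurable_funM.
  by apply: mm => //; exact: measurable_itv.
have mgv : measurable_fun setT (fun x => g (k%:~R / n.+1%:R, v x)).
  apply: (@measurableT_comp _ _ _ _ _ _ (fun y : R => g (k%:~R / n.+1%:R, y))) => //.
  apply: continuous_measurable_fun => y.
  by apply: (cvg_comp2 cg); [exact: cvg_cst|exact: cvg_id].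
by rewrite -[X in measurable X]setTI; exact: mgv.
Unshelve. all: by end_near. Qed.

End SmoothTwo.

(** * Composition with smooth functions in H^s *)

Section Composition.
Context {R : realType}.
Local Notation mu := (@lebesgue_measure R).
Implicit Types (g : R * R -> R) (u v w : R -> R).

Lemma lee_scale (c A : R) (x : \bar R) : 0 <= c -> (x <= A%:E)%E -> (c%:E * x <= (c * A)%:E)%E.
Proof. by move=> c0 xA; rewrite EFinM; apply: lee_wpmul2l; rewrite ?lee_fin. Qed.

Lemma lee_sum2 (A B : R) (x y : \bar R) :
  (x <= A%:E)%E -> (y <= B%:E)%E -> (x + y <= (A + B)%:E)%E.
Proof. by move=> xA yB; rewrite EFinD; exact: leeD. Qed.

Lemma fin_numD_fine (x y : \bar R) : x \is a fin_num -> y \is a fin_num ->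
  (fine x + fine y)%:E = (x + y)%E.
Proof. by move=> xf yf; rewrite EFinD !fineK. Qed.

Lemma nsq_ae_le (c : R) u v : 0 <= c -> measurable_fun setT u -> measurable_fun setT v ->
  {ae mu, forall x, `|u x| <= c * `|v x|} -> (nsq u <= (c ^+ 2)%:E * nsq v)%E.
Proof.
move=> c0 mu1 mv h; rewrite -nsqZ//; apply: ae_ge0_le_integral => //.
- by move=> x _; rewrite lee_fin sqr_ge0.
- exact: measurable_sqr_EFin.
- by move=> x _; rewrite lee_fin sqr_ge0.
- by apply: measurable_sqr_EFin; exact: measurable_funM.
apply: (ae_impl h) => x hx _; rewrite lee_fin.
rewrite -[leLHS]real_normK ?num_real// -[leRHS]real_normK ?num_real//.
by rewrite lerXn2r ?nnegrE// normrM (ger0_norm c0).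
Qed.

Lemma hs0E v : L2 v -> hs 0 v = ((2 * pi)%:E * nsq v)%E.
Proof. by move=> vL; rewrite ws0 hsq1. Qed.

Lemma hs0_nsq v : L2 v -> (nsq v <= hs 0 v)%E.
Proof.
move=> vL; rewrite hs0E// -[leLHS]mul1e; apply: lee_wpmul2r; first exact: nsq_ge0.
by rewrite lee_fin; have := pi_ge2 R; lra.
Qed.

Lemma hsq_zero m : weight m -> hsq m (fun=> 0 : R) = 0%E.
Proof.
move=> wm; have := hsqZ 0 wm (L2_0 (R := R)); rewrite expr0n mul0e.
by under [X in hsq m X]eq_fun do rewrite mul0r.
Qed.

Definition hs_ball (s M : R) u := L2 u /\ (hs s u <= M%:E)%E.

Lemma hs_ball0 s M : 0 <= M -> hs_ball s M (fun=> 0).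
Proof. by move=> M0; split; [exact: L2_0|rewrite hsq_zero ?lee_fin//; exact: weight_ws]. Qed.

Lemma hs_ball_shift s M u z : hs_ball s M u -> hs_ball s M (fun x => u (x + z)).
Proof. by move=> [uL h]; split; [exact: L2_shift|rewrite hsq_shift//; exact: weight_ws]. Qed.

Lemma hs_ball_mid s M u v : hs_ball s M u -> hs_ball s M v ->
  hs_ball s M (fun x => 2^-1 * (u x + v x)).
Proof.
move=> [uL hu] [vL hv]; have ww := weight_ws (R := R) s; have L := L2D uL vL.
split; first exact: L2Z.
have -> : M = 2^-1 ^+ 2 * (2 * M + 2 * M) by field.
rewrite hsqZ//; apply: lee_scale; first exact: sqr_ge0.
by apply: (le_trans (hsqD_le ww uL vL)); apply: lee_sum2; exact: lee_scale.
Qed.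

Lemma hs_ball_le s t M u : s <= t -> hs_ball t M u -> hs_ball s M u.
Proof. by move=> st [uL h]; split => //; exact: (le_trans (hs_le st uL) h). Qed.

Section Bounded.
Variable s : R.
Hypothesis s2 : 2^-1 < s.

Let K (M : R) := sup_bound s M.

(** By the embedding the functions take values in a fixed square, where [g] is Lipschitz. *)
Lemma comp_lipschitz_ae M g : smooth2 g -> exists2 L : R, 0 <= L & forall u1 u2 v1 v2,
  hs_ball s M u1 -> hs_ball s M u2 -> hs_ball s M v1 -> hs_ball s M v2 ->
  {ae mu, forall x, `|g (u1 x, u2 x) - g (v1 x, v2 x)| <=
     L * `| `|u1 x - v1 x| + `|u2 x - v2 x| |}.
Proof.
move=> sg; have [L L0 h] := lipschitz_on_square (K M) sg; exists L => //.
move=> u1 u2 v1 v2 [a1 b1] [a2 b2] [c1 d1] [c2 d2].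
have e1 := embedding s2 a1 b1; have e2 := embedding s2 a2 b2.
have f1 := embedding s2 c1 d1; have f2 := embedding s2 c2 d2.
have e12 := ae_impl2 e1 e2 (fun x h1 h2 => conj h1 h2).
have f12 := ae_impl2 f1 f2 (fun x h1 h2 => conj h1 h2).
apply: (ae_impl2 e12 f12) => x [p1 p2] [q1 q2].
by rewrite [X in _ <= L * X]ger0_norm ?addr_ge0//; exact: h.
Qed.

Lemma measurable_comp2B g u1 u2 v1 v2 : smooth2 g -> L2 u1 -> L2 u2 -> L2 v1 -> L2 v2 ->
  measurable_fun setT (fun x => g (u1 x, u2 x) - g (v1 x, v2 x)).
Proof.
move=> /smooth2_continuous cg [? _] [? _] [? _] [? _].
by apply: measurable_funB; exact: measurable_comp2.
Qed.

Lemma L2_sum_abs u v : L2 u -> L2 v -> L2 (fun x => `|u x| + `|v x|).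
Proof.
move=> uL vL; apply: L2D; [apply: (L2_le _ uL)|apply: (L2_le _ vL)].
- by case: uL => ? _; exact: measurableT_comp.
- by move=> x; rewrite normr_id.
- by case: vL => ? _; exact: measurableT_comp.
- by move=> x; rewrite normr_id.
Qed.

Lemma nsq_sum_abs u v : L2 u -> L2 v ->
  (nsq (fun x => `|u x| + `|v x|)%R <= 2%:E * (nsq u + nsq v))%E.
Proof.
move=> [mu1 _] [mv _].
have E w : nsq (fun x => `|w x|) = nsq w by apply: eq_integral => x _; rewrite real_normK ?num_real.
rewrite ge0_muleDr ?nsq_ge0// -(E u) -(E v).
by apply: nsqD_le; exact: measurableT_comp.
Qed.

Lemma comp_L2_lip M g : smooth2 g -> exists2 L : R, 0 <= L & forall u1 u2 v1 v2,
  hs_ball s M u1 -> hs_ball s M u2 -> hs_ball s M v1 -> hs_ball s M v2 ->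
  L2 (fun x => g (u1 x, u2 x) - g (v1 x, v2 x)) /\
  (nsq (fun x => g (u1 x, u2 x) - g (v1 x, v2 x))%R <=
     L%:E * (nsq (fun x => u1 x - v1 x)%R + nsq (fun x => u2 x - v2 x)%R))%E.
Proof.
move=> sg; have [L L0 h] := comp_lipschitz_ae M sg; exists (L ^+ 2 * 2); first by rewrite mulr_ge0// sqr_ge0.
move=> u1 u2 v1 v2 b1 b2 c1 c2; have hx := h _ _ _ _ b1 b2 c1 c2.
case: b1 b2 c1 c2 => [? _] [? _] [? _] [? _].
have mg := @measurable_comp2B g u1 u2 v1 v2 sg.
have La : L2 (fun x => `|u1 x - v1 x| + `|u2 x - v2 x|).
  by apply: (@L2_sum_abs (fun x => u1 x - v1 x) (fun x => u2 x - v2 x)); exact: L2B.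
have le1 : (nsq (fun x => g (u1 x, u2 x) - g (v1 x, v2 x))%R <=
    (L ^+ 2)%:E * nsq (fun x => `|u1 x - v1 x| + `|u2 x - v2 x|)%R)%E.
  by apply: nsq_ae_le => //; [exact: mg|case: La].
split.
  split; first exact: mg.
  by apply: (le_lt_trans le1); apply: lte_mul_pinfty => //; [rewrite lee_fin sqr_ge0|case: La].
apply: (le_trans le1); rewrite [(L ^+ 2 * 2)%:E]EFinM -muleA.
apply: lee_wpmul2l; first by rewrite lee_fin sqr_ge0.
by apply: (@nsq_sum_abs (fun x => u1 x - v1 x) (fun x => u2 x - v2 x)); exact: L2B.
Qed.

Lemma comp_L2 M g u1 u2 v1 v2 : smooth2 g ->
  hs_ball s M u1 -> hs_ball s M u2 -> hs_ball s M v1 -> hs_ball s M v2 ->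
  L2 (fun x => g (u1 x, u2 x) - g (v1 x, v2 x)).
Proof. by move=> sg b1 b2 c1 c2; have [L _ h] := comp_L2_lip M sg; case: (h _ _ _ _ b1 b2 c1 c2). Qed.

(** The balls are those of H^s, where functions are bounded, but the estimate is in the
    weaker norm of H^t. *)
Definition comp_lipschitz (t : R) := forall g (M : R), smooth2 g -> 0 <= M ->
  exists2 L : R, 0 <= L & forall u1 u2 v1 v2,
  hs_ball s M u1 -> hs_ball s M u2 -> hs_ball s M v1 -> hs_ball s M v2 ->
  (hs t (fun x => g (u1 x, u2 x) - g (v1 x, v2 x))%R <=
     L%:E * (hs t (fun x => u1 x - v1 x)%R + hs t (fun x => u2 x - v2 x)%R))%E.

Definition comp_bounded := forall g (M : R), smooth2 g -> 0 <= M ->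
  exists2 C : R, 0 <= C & forall u1 u2, hs_ball s M u1 -> hs_ball s M u2 ->
  (hs s (fun x => g (u1 x, u2 x) - g (0, 0))%R <= C%:E)%E.

Lemma comp_lipschitz0 : comp_lipschitz 0.
Proof.
move=> g M sg M0; have [L L0 h] := comp_L2_lip M sg; exists L => //.
move=> u1 u2 v1 v2 b1 b2 c1 c2; have [hL hle] := h _ _ _ _ b1 b2 c1 c2.
case: b1 b2 c1 c2 => [? _] [? _] [? _] [? _].
rewrite !hs0E//; try exact: L2B.
have p0 : (0 <= (2 * pi)%:E :> \bar R)%E by rewrite lee_fin mulr_ge0// pi_ge0.
rewrite -ge0_muleDr ?nsq_ge0// muleCA; exact: lee_wpmul2l.
Qed.

(** The increments [g (u (x + z)) - g (u x)] are of the form handled by the Lipschitz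
    bound, so any fraction of a derivative can be gained. *)
Lemma comp_bounded_of_lipschitz t : t < s -> s < t + 1 -> comp_lipschitz t -> comp_bounded.
Proof.
move=> ts st lip g M sg M0; have [L L0 h] := lip g M sg M0.
pose r := s - t; have r0 : 0 < r by rewrite subr_gt0.
have r1 : r < 1 by rewrite /r; lra.
have sE : t + r = s by rewrite /r; ring.
have low0 := besov_low_ge0 (R := R); have up0 := besov_up_ge0 r0 r1.
exists (besov_low * (L * (M + M) + L * besov_up r * (M + M))).
  have MM : 0 <= M + M by rewrite addr_ge0.
  apply: mulr_ge0 => //; apply: addr_ge0; apply: mulr_ge0 => //; exact: mulr_ge0.
move=> u1 u2 b1 b2; have z := hs_ball0 s M0; have wt := weight_ws (R := R) t.
have GL := comp_L2 sg b1 b2 z z.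
have [[uL hu1] [vL hu2]] := (b1, b2).
have sub0 w : (fun x => w x - 0) = w by apply/funext => x; rewrite subr0.
have tle w : hs_ball s M w -> (hs t w <= M%:E)%E.
  by move=> [wL hw]; apply: le_trans hw; apply: hs_le => //; exact: ltW.
have transfer := @besov_transfer R r r0 r1 t (fun x => g (u1 x, u2 x) - g (0, 0)) u1 u2 L GL uL vL L0.
rewrite sE in transfer; apply: (le_trans (transfer _)).
  move=> x0; have := h _ _ _ _ (hs_ball_shift x0 b1) (hs_ball_shift x0 b2) b1 b2.
  apply: le_trans; rewrite le_eqVlt; apply/orP; left; apply/eqP; congr (hsq _ _).
  by apply/funext => x; ring.
apply: lee_scale => //; apply: lee_sum2.
  have := h _ _ _ _ b1 b2 z z; rewrite !sub0 => /le_trans; apply.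
  by apply: lee_scale => //; apply: lee_sum2; exact: tle.
by apply: lee_scale; [exact: mulr_ge0|exact: lee_sum2].
Qed.

Section FromBounded.
Hypothesis cb : comp_bounded.
Let wS := weight_ws (R := R) s.

(** Boundedness of composition with [(x, y) |-> x y] on the unit ball is, after scaling,
    the algebra property of H^s. *)
Lemma hs_mul : exists2 C : R, 0 < C & forall u v (A B : R), 0 < A -> 0 <= B ->
  hs_ball s A u -> hs_ball s B v ->
  L2 (fun x => u x * v x) /\ (hs s (fun x => u x * v x)%R <= (C * A * B)%:E)%E.
Proof.
have [C0 C00 h] := cb smooth2_mul (ler01 : 0 <= 1 :> R).
exists (C0 + 1); first by rewrite ltr_wpDl.
have main u v (A B : R) : 0 < A -> 0 < B -> hs_ball s A u -> hs_ball s B v ->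
    L2 (fun x => u x * v x) /\ (hs s (fun x => u x * v x)%R <= (C0 * A * B)%:E)%E.
  move=> A0 B0 [uL hu] [vL hv].
  have bu w (D : R) : 0 < D -> L2 w -> (hs s w <= D%:E)%E -> hs_ball s 1 (fun x => (Num.sqrt D)^-1 * w x).
    move=> D0 wL hw; split; first exact: L2Z.
    rewrite hsqZ// (_ : 1 = (Num.sqrt D)^-1 ^+ 2 * D); first by apply: lee_scale => //; exact: sqr_ge0.
    by rewrite exprVn (sqr_sqrtr (ltW D0)) mulVf ?gt_eqF.
  have b1 := bu u A A0 uL hu; have b2 := bu v B B0 vL hv; have z := hs_ball0 s (ler01 : 0 <= 1 :> R).
  set a : R := Num.sqrt A in b1; set b : R := Num.sqrt B in b2.
  have a0 : a != 0 by rewrite gt_eqF// sqrtr_gt0.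
  have b0 : b != 0 by rewrite gt_eqF// sqrtr_gt0.
  have PL : L2 (fun x => a^-1 * u x * (b^-1 * v x) - (0 : R) * 0) := comp_L2 smooth2_mul b1 b2 z z.
  have E : (fun x => u x * v x) = (fun x => a * b * (a^-1 * u x * (b^-1 * v x) - (0 : R) * 0)).
    by apply: funext => x; field; rewrite a0 b0.
  rewrite E; split; first exact: L2Z.
  have -> : C0 * A * B = (a * b) ^+ 2 * C0.
    by rewrite exprMn (sqr_sqrtr (ltW A0)) (sqr_sqrtr (ltW B0)); ring.
  rewrite (hsqZ (a * b) wS PL); apply: lee_scale; first exact: sqr_ge0.
  exact: (h _ _ b1 b2).
move=> u v A B A0 B0 bu [vL hv].
have big (B' : R) : B < B' -> (hs s v <= B'%:E)%E.
  by move=> BB'; apply: (le_trans hv); rewrite lee_fin ltW.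
have B1 : B < B + 1 by rewrite ltrDl.
have [PL _] := main u v A (B + 1) A0 (le_lt_trans B0 B1) bu (conj vL (big _ B1)).
split => //; apply/lee_addgt0Pr => e e0.
pose d := e / ((C0 + 1) * A).
have CA : 0 < (C0 + 1) * A by rewrite mulr_gt0// ltr_wpDl.
have d0 : 0 < d by rewrite divr_gt0.
have Bd : B < B + d by rewrite ltrDl.
have [_ hle] := main u v A (B + d) A0 (le_lt_trans B0 Bd) bu (conj vL (big _ Bd)).
apply: (le_trans hle); rewrite -EFinD lee_fin.
have -> : e = (C0 + 1) * A * d by rewrite /d; field; rewrite !gt_eqF// ltr_wpDl.
rewrite -mulrDr; apply: ler_wpM2r; first by rewrite addr_ge0// ltW.
by apply: ler_wpM2r; [exact: ltW|rewrite lerDl].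
Qed.

(** Split off the constant [g (0, 0)]: the rest of [g (w1, w2)] is bounded in H^s, and
    [hs_mul] applies to it. *)
Lemma hs_multiplier g M : smooth2 g -> 0 <= M ->
  exists2 L : R, 0 <= L & forall w1 w2 d (B : R), 0 <= B -> hs_ball s M w1 -> hs_ball s M w2 ->
    hs_ball s B d -> hs_ball s (L * B) (fun x => g (w1 x, w2 x) * d x).
Proof.
move=> sg M0; have [C C0 h] := cb sg M0; have [Cm Cm0 hm] := hs_mul.
exists (2 * (Cm * (C + 1)) + 2 * g (0, 0) ^+ 2).
  have C1 : 0 <= C + 1 by rewrite addr_ge0.
  by rewrite addr_ge0// mulr_ge0 ?sqr_ge0// mulr_ge0// ltW.
move=> w1 w2 d B B0 b1 b2 [dL hd]; have z := hs_ball0 s M0.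
have bg : hs_ball s (C + 1) (fun x => g (w1 x, w2 x) - g (0, 0)).
  split; first exact: (comp_L2 sg b1 b2 z z).
  by apply: (le_trans (h _ _ b1 b2)); rewrite lee_fin lerDl.
have [PL hP] := hm _ d _ B (ltr_wpDl C0 ltr01) B0 bg (conj dL hd).
have E : (fun x => g (w1 x, w2 x) * d x) =
    (fun x => (g (w1 x, w2 x) - g (0, 0)) * d x + g (0, 0) * d x) by apply/funext => x; ring.
rewrite E; split; first by apply: L2D => //; exact: L2Z.
apply: (le_trans (hsqD_le wS PL (L2Z _ dL))); rewrite hsqZ// mulrDl.
apply: lee_sum2; rewrite -mulrA; apply: lee_scale => //.
by apply: lee_scale => //; exact: sqr_ge0.
Qed.

(** Approximation of [g (a, b) - g (c, d)] by the gradient of [g] along [2 ^ j]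
    successive subsegments. *)
Fixpoint bisect g j (a b c d : R) : R :=
  if j is i.+1 then
    bisect g i a b (2^-1 * (a + c)) (2^-1 * (b + d)) +
    bisect g i (2^-1 * (a + c)) (2^-1 * (b + d)) c d
  else 'D_(1, 0) g (c, d) * (a - c) + 'D_(0, 1) g (c, d) * (b - d).

(** The Taylor error is quadratic in the length of the segment, so each halving divides the
    total error by 2. *)
Lemma bisect_error g M : smooth2 g -> exists2 L : R, 0 <= L & forall j a b c d,
  `|a| <= M -> `|b| <= M -> `|c| <= M -> `|d| <= M ->
  `|g (a, b) - g (c, d) - bisect g j a b c d| <= L * (`|a - c| + `|b - d|) ^+ 2 / 2 ^+ j.
Proof.
move=> sg; have [L L0 h] := taylor_on_square M sg; exists L => //.
elim=> [|j IH] a b c d aM bM cM dM; first by rewrite expr0 divr1; exact: h.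
have mid (x y : R) : `|x| <= M -> `|y| <= M -> `|2^-1 * (x + y)| <= M.
  by rewrite !ler_norml => /andP[? ?] /andP[? ?]; apply/andP; split; lra.
have h1 := IH a b _ _ aM bM (mid _ _ aM cM) (mid _ _ bM dM).
have h2 := IH _ _ c d (mid _ _ aM cM) (mid _ _ bM dM) cM dM.
have n1 (x y : R) : `|x - 2^-1 * (x + y)| = 2^-1 * `|x - y|.
  have -> : x - 2^-1 * (x + y) = 2^-1 * (x - y) by field.
  by rewrite normrM ger0_norm// invr_ge0.
have n2 (x y : R) : `|2^-1 * (x + y) - y| = 2^-1 * `|x - y|.
  have -> : 2^-1 * (x + y) - y = 2^-1 * (x - y) by field.
  by rewrite normrM ger0_norm// invr_ge0.
rewrite !n1 in h1; rewrite !n2 in h2.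
set m1 := 2^-1 * (a + c) in h1 h2 *; set m2 := 2^-1 * (b + d) in h1 h2 *.
rewrite /= -/m1 -/m2.
have -> : g (a, b) - g (c, d) - (bisect g j a b m1 m2 + bisect g j m1 m2 c d) =
  (g (a, b) - g (m1, m2) - bisect g j a b m1 m2) + (g (m1, m2) - g (c, d) - bisect g j m1 m2 c d) by ring.
apply: (le_trans (ler_normD _ _)); apply: (le_trans (lerD h1 h2)).
rewrite [2 ^+ j.+1]exprS -mulrDr; have p0 : 2 ^+ j != 0 :> R by rewrite expf_neq0.
by move: (2 ^+ j) p0 => p p0; rewrite le_eqVlt; apply/orP; left; apply/eqP; field.
Qed.

(** A segment of half the length has a difference of a quarter of the squared norm; adding
    two pieces with [|a + b|^2 <= 2 |a|^2 + 2 |b|^2] exactly restores it. Hence the bound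
    does not depend on [j]. *)
Lemma hs_bisect g M : smooth2 g -> 0 <= M -> exists2 L : R, 0 <= L &
  forall j u1 u2 v1 v2 (B : R), hs_ball s M u1 -> hs_ball s M u2 -> hs_ball s M v1 -> hs_ball s M v2 ->
    0 <= B -> (hs s (fun x => u1 x - v1 x)%R <= B%:E)%E -> (hs s (fun x => u2 x - v2 x)%R <= B%:E)%E ->
    hs_ball s (L * B) (fun x => bisect g j (u1 x) (u2 x) (v1 x) (v2 x)).
Proof.
move=> sg M0; have [L1 L10 h1] := hs_multiplier (smooth2_D1 sg) M0.
have [L2' L20 h2] := hs_multiplier (smooth2_D2 sg) M0.
have twice w w' A A' : hs_ball s A w -> hs_ball s A' w' ->
    hs_ball s (2 * A + 2 * A') (fun x => w x + w' x).
  move=> [wL hw] [wL' hw']; split; first exact: L2D.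
  by apply: (le_trans (hsqD_le wS wL wL')); apply: lee_sum2; exact: lee_scale.
exists (2 * L1 + 2 * L2'); first by rewrite addr_ge0// mulr_ge0.
elim=> [|j IH] u1 u2 v1 v2 B b1 b2 c1 c2 B0 e1 e2.
  have [[u1L _] [u2L _] [v1L _] [v2L _]] := And4 b1 b2 c1 c2.
  have := twice _ _ _ _ (h1 v1 v2 _ B B0 c1 c2 (conj (L2B u1L v1L) e1))
    (h2 v1 v2 _ B B0 c1 c2 (conj (L2B u2L v2L) e2)).
  by rewrite [X in _ -> hs_ball _ X _]mulrDl !mulrA.
have [[u1L _] [u2L _] [v1L _] [v2L _]] := And4 b1 b2 c1 c2.
have quarter u v : L2 u -> L2 v -> (hs s (fun x => u x - v x)%R <= B%:E)%E ->
    (hs s (fun x => u x - 2^-1 * (u x + v x))%R <= (4^-1 * B)%:E)%E /\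
    (hs s (fun x => 2^-1 * (u x + v x) - v x)%R <= (4^-1 * B)%:E)%E.
  move=> uL vL hB.
  have -> : (fun x => u x - 2^-1 * (u x + v x)) = (fun x => 2^-1 * (u x - v x)).
    by apply/funext => x; field.
  have -> : (fun x => 2^-1 * (u x + v x) - v x) = (fun x => 2^-1 * (u x - v x)).
    by apply/funext => x; field.
  rewrite (hsqZ _ wS (L2B uL vL)) (_ : 2^-1 ^+ 2 = 4^-1 :> R); last by field.
  by split; apply: lee_scale => //; rewrite invr_ge0.
have [q1 q1'] := quarter u1 v1 u1L v1L e1; have [q2 q2'] := quarter u2 v2 u2L v2L e2.
have B4 : 0 <= 4^-1 * B by rewrite mulr_ge0// invr_ge0.
have := twice _ _ _ _ (IH _ _ _ _ _ b1 b2 (hs_ball_mid b1 c1) (hs_ball_mid b2 c2) B4 q1 q2)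
  (IH _ _ _ _ _ (hs_ball_mid b1 c1) (hs_ball_mid b2 c2) c1 c2 B4 q1' q2').
rewrite (_ : 2 * ((2 * L1 + 2 * L2') * (4^-1 * B)) + 2 * ((2 * L1 + 2 * L2') * (4^-1 * B)) =
  (2 * L1 + 2 * L2') * B)//; by field.
Qed.

(** The averaged gradients [bisect] converge to [g (u1, u2) - g (v1, v2)] in L^2 and are
    bounded in H^s uniformly in [j]; the H^s norm is lower semicontinuous. *)
Lemma comp_lipschitz_self : comp_lipschitz s.
Proof.
move=> g M sg M0; have [L L0 h] := hs_bisect sg M0; exists L => //.
move=> u1 u2 v1 v2 b1 b2 c1 c2.
have [[u1L hu1] [u2L hu2] [v1L hv1] [v2L hv2]] := And4 b1 b2 c1 c2.
have fin u v : hs_ball s M u -> hs_ball s M v ->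
    hs s (fun x => u x - v x) \is a fin_num.
  move=> [uL hu] [vL hv]; rewrite ge0_fin_numE; last exact: hsq_ge0.
  apply: (le_lt_trans (hsqB_le wS uL vL)); apply: lte_add_pinfty; apply: lte_mul_pinfty => //.
    by apply: (le_lt_trans hu); rewrite ltry.
  by apply: (le_lt_trans hv); rewrite ltry.
have f1 := fin _ _ b1 c1; have f2 := fin _ _ b2 c2.
pose B := fine (hs s (fun x => u1 x - v1 x)) + fine (hs s (fun x => u2 x - v2 x)).
have BE : B%:E = (hs s (fun x => u1 x - v1 x)%R + hs s (fun x => u2 x - v2 x)%R)%E.
  exact: fin_numD_fine.
have B0 : 0 <= B by rewrite addr_ge0// fine_ge0//; exact: hsq_ge0.
have B1 : (hs s (fun x => u1 x - v1 x)%R <= B%:E)%E by rewrite BE leeDl//; exact: hsq_ge0.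
have B2 : (hs s (fun x => u2 x - v2 x)%R <= B%:E)%E by rewrite BE leeDr//; exact: hsq_ge0.
have hb j := h j _ _ _ _ B b1 b2 c1 c2 B0 B1 B2.
rewrite -BE -EFinM.
have GL := comp_L2 sg b1 b2 c1 c2.
apply: (hsq_lsc (vn := fun j x => bisect g j (u1 x) (u2 x) (v1 x) (v2 x)) wS GL).
- by move=> j; case: (hb j).
- have [L' L'0 he] := bisect_error (K M) sg.
  have N : 0 <= K M.
    by rewrite /K /sup_bound !addr_ge0//; apply: Rintegral_ge0 => x _; exact: powR_ge0.
  have e1 := embedding s2 u1L hu1; have e2 := embedding s2 u2L hu2.
  have e3 := embedding s2 v1L hv1; have e4 := embedding s2 v2L hv2.
  have e12 := ae_impl2 e1 e2 (fun x p q => conj p q).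
  have e34 := ae_impl2 e3 e4 (fun x p q => conj p q).
  have SL : L2 (fun x => `|u1 x - v1 x| + `|u2 x - v2 x|).
    by apply: (@L2_sum_abs (fun x => u1 x - v1 x) (fun x => u2 x - v2 x)); exact: L2B.
  pose c := L' * (4 * K M).
  have c0 : 0 <= c by rewrite !mulr_ge0.
  have bnd j : (nsq (fun x => bisect g j (u1 x) (u2 x) (v1 x) (v2 x) - (g (u1 x, u2 x) - g (v1 x, v2 x)))%R <=
      ((c / 2 ^+ j) ^+ 2)%:E * nsq (fun x => `|u1 x - v1 x| + `|u2 x - v2 x|)%R)%E.
    apply: nsq_ae_le.
    - by rewrite divr_ge0// exprn_ge0.
    - by case: (L2B (proj1 (hb j)) GL).
    - by case: SL.
    apply: (ae_impl2 e12 e34) => x [p1 p2] [p3 p4].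
    rewrite distrC; apply: (le_trans (he j _ _ _ _ p1 p2 p3 p4)).
    have t0 : 0 <= `|u1 x - v1 x| + `|u2 x - v2 x| by rewrite addr_ge0.
    have t4 : `|u1 x - v1 x| + `|u2 x - v2 x| <= 4 * K M.
      have := ler_normB (u1 x) (v1 x); have := ler_normB (u2 x) (v2 x).
      move: p1 p2 p3 p4; rewrite -/(K M); lra.
    rewrite (ger0_norm t0) mulrAC; move: (_ + _) t0 t4 => t t0 t4.
    rewrite mulrAC [c / _ * t]mulrAC; apply: ler_wpM2r; first by rewrite invr_ge0 exprn_ge0.
    by rewrite /c -!mulrA; apply: ler_wpM2l => //; rewrite expr2 [X in _ <= X]mulrA; apply: ler_wpM2r.
  have NE : nsq (fun x => `|u1 x - v1 x| + `|u2 x - v2 x|) \is a fin_num.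
    by rewrite ge0_fin_numE ?nsq_ge0//; case: SL.
  set n := nsq _ in bnd NE; rewrite -(fineK NE) in bnd.
  apply: (cvge0_le (v := fun j => ((c / 2 ^+ j) ^+ 2 * fine n)%:E)).
    by move=> j; rewrite nsq_ge0 bnd.
  apply: cvg_EFin; first exact: nearW.
  rewrite (_ : fine \o _ = (fun j => (c * (2^-1) ^+ j) ^+ 2 * fine n)); last first.
    by apply/funext => j /=; rewrite exprVn.
  have cj : c * (2^-1) ^+ j @[j --> \oo] --> (0 : R).
    rewrite -[X in _ --> X](mulr0 c); apply: cvgM; first exact: cvg_cst.
    by apply: cvg_expr; rewrite ger0_norm ?invr_ge0// invf_lt1// ltr1n.
  rewrite -[X in _ --> X](mul0r (fine n)); apply: cvgM; last exact: cvg_cst.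
  rewrite -[X in _ --> X](mulr0 0).
  under eq_fun do rewrite expr2.
  exact: cvgM.
- by move=> j; case: (hb j).
Qed.

End FromBounded.
End Bounded.

Lemma comp_lipschitz_weaken s s' t : s <= s' -> comp_lipschitz s t -> comp_lipschitz s' t.
Proof.
move=> ss h g M sg M0; have [L L0 hL] := h g M sg M0; exists L; first exact: L0.
by move=> u1 u2 v1 v2 b1 b2 c1 c2; apply: hL; exact: (hs_ball_le ss).
Qed.

(** For [s < 1] all derivatives are gained at once from the Lipschitz bound in L^2. For larger
    [s], boundedness in H^(s - 1/4) gives the Lipschitz bound there, and
    [comp_bounded_of_lipschitz] gains the missing quarter: induction in steps of 1/4. *)
Theorem composition s : 2^-1 < s -> comp_bounded s.
Proof.
have main (n : nat) : forall t : R, 2^-1 < t -> t < 1 + n%:R / 4 -> comp_bounded t.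
  elim: n => [|n IH] t t2 tn.
    apply: (@comp_bounded_of_lipschitz t t2 0); [lra|lra|exact: comp_lipschitz0].
  have [lt|ge] := ltrP t (1 + n%:R / 4); first exact: IH.
  have n0 : 0 <= n%:R / 4 :> R by rewrite divr_ge0.
  have tn' : t < 1 + n%:R / 4 + 4^-1 by move: tn; rewrite -natr1 mulrDl mul1r addrA.
  have q2 : 2^-1 < t - 4^-1 by lra.
  apply: (@comp_bounded_of_lipschitz t t2 (t - 4^-1)); [lra|lra|].
  apply: (@comp_lipschitz_weaken (t - 4^-1)); first by lra.
  by apply: comp_lipschitz_self => //; apply: IH => //; lra.
move=> s2; apply: (main (Num.trunc (4 * s)).+1 s s2).
have := truncnS_gt (4 * s); lra.
Qed.

End Composition.

(** * Convolution with an integrable kernel *)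

Section Convolution.
Context {R : realType}.
Local Notation mu := (@lebesgue_measure R).
Local Notation conv := (@Defs.conv R).
Implicit Types (b f g : R -> R).

Lemma Rint_dominated_cvg (fn : nat -> R -> R) f g : (forall n, measurable_fun setT (fn n)) ->
  (forall x : R, fn n x @[n --> \oo] --> f x) -> L1 g -> (forall n x, `|fn n x| <= g x) ->
  (\int[mu]_x fn n x) @[n --> \oo] --> \int[mu]_x f x.
Proof.
move=> mfn cf ig dom.
have mf : measurable_fun setT f.
  by apply: (@measurable_fun_cvg _ _ _ _ fn) => // x _; exact: cf.
have g0 x : 0 <= g x by apply: le_trans (dom 0%N x).
have L1f : L1 f.
  apply: (L1_le mf ig) => x; rewrite (ger0_norm (g0 x)).
  have cn : `|fn n x| @[n --> \oo] --> `|f x| by apply: cvg_norm; exact: cf.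
  apply: (cvgr_to_le cn).
  by apply: nearW => n; exact: dom.
suff /fine_cvgP[_ //] : (\int[mu]_x (fn n x)%:E)%E @[n --> \oo] --> (\int[mu]_x f x)%:E.
rewrite EFin_Rint//.
apply: (@dominated_cvg _ _ _ mu setT measurableT (fun n x => (fn n x)%:E) (EFin \o f) (EFin \o g)) => //.
- by move=> n; apply/measurable_EFinP; exact: mfn.
- by move=> x _; apply: cvg_EFin; [exact: nearW|exact: cf].
- by move=> n x _; rewrite /= lee_fin.
Qed.

(** A pointwise limit which is also an L^2 limit: by Fatou the two limits agree. *)
Lemma nsq_cvg_pointwise (fn : nat -> R -> R) f g : (forall n, measurable_fun setT (fn n)) ->
  measurable_fun setT g -> (forall x : R, fn n x @[n --> \oo] --> f x) ->
  nsq (fun x => fn n x - g x)%R @[n --> \oo] --> 0%E -> ae_eq mu setT f g.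
Proof.
move=> mfn mg cf cg.
have mf : measurable_fun setT f.
  by apply: (@measurable_fun_cvg _ _ _ _ fn) => // x _; exact: cf.
have mfg : measurable_fun setT (fun x => f x - g x) by exact: measurable_funB.
suff z : nsq (fun x => f x - g x) = 0%E.
  by apply: (ae_impl (nsq_eq0 mfg z)) => x hx _; apply/eqP; rewrite -subr_eq0; apply/eqP; exact: hx.
apply/eqP; rewrite eq_le nsq_ge0 andbT.
have F := @fatou _ _ _ mu setT measurableT (fun n x => ((fn n x - g x) ^+ 2)%:E) _ _.
have := F (fun n => measurable_sqr_EFin (measurable_funB (mfn n) mg)) (fun n x _ => _).
rewrite (is_cvg_limn_einfE (_ : cvgn (fun n => nsq (fun x => fn n x - g x)))); last by apply/cvg_ex; exists 0%E.
rewrite (cvg_lim _ cg)//= => /(_ _)/le_trans => H.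
rewrite /nsq (_ : (fun x => ((f x - g x) ^+ 2)%:E) = (fun x => limn_einf (fun n => ((fn n x - g x) ^+ 2)%:E))).
  by apply: H => // n x; rewrite lee_fin sqr_ge0.
apply/funext => x.
have c : (fun n => ((fn n x - g x) ^+ 2)%:E) @ \oo --> ((f x - g x) ^+ 2)%:E.
  apply: cvg_EFin; first exact: nearW.
  rewrite /comp/= expr2; under eq_fun do rewrite expr2.
  by apply: cvgM; apply: cvgB; (exact: cf || exact: cvg_cst).
rewrite is_cvg_limn_einfE; first by rewrite (cvg_lim _ c).
by apply/cvg_ex; eexists; exact: c.
Qed.

Lemma L2_of_L1_bounded f (K : R) : L1 f -> (forall x, `|f x| <= K) -> L2 f.
Proof.
move=> f1 fK; have mf := L1_measurable f1; split => //.
have /integrableP[_] := L1_mul_bounded f1 mf fK.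
apply: le_lt_trans; rewrite le_eqVlt; apply/orP; left; apply/eqP; apply: eq_integral => x _.
by rewrite /= ger0_norm -?expr2 ?sqr_ge0.
Qed.

Section Kernel.
Variable b : R -> R.
Hypothesis b1 : L1 b.
Let mb : measurable_fun setT b. Proof. exact: L1_measurable. Qed.
Let B := \int[mu]_x `|b x|.
Let B0 : 0 <= B. Proof. by apply: Rintegral_ge0. Qed.

Lemma L1_conv_integrand f (K x : R) : measurable_fun setT f -> (forall y, `|f y| <= K) ->
  L1 (fun y => b (x - y) * f y).
Proof. by move=> mf fK; apply: (L1_mul_bounded (M := K)) => //; exact: L1_reflect. Qed.

Lemma conv_bounded f (K x : R) : measurable_fun setT f -> (forall y, `|f y| <= K) ->
  `|conv b f x| <= K * B.
Proof.
move=> mf fK; have i := L1_conv_integrand x mf fK.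
apply: (le_trans (Rint_norm_le i)).
have ib : L1 (fun y => `|b (x - y)|) by apply: L1_norm; exact: L1_reflect.
rewrite -[B](Rintegral_reflect x (f := fun y => `|b y|)); last exact: measurableT_comp.
rewrite -(RintZ K ib); apply: Rint_le; [exact: L1_norm|exact: L1Z|].
by move=> y; rewrite normrM mulrC ler_wpM2r.
Qed.

Lemma conv_ae f g : measurable_fun setT f -> measurable_fun setT g -> ae_eq mu setT f g ->
  conv b f = conv b g.
Proof.
move=> mf mg fg; apply/funext => x; apply: ae_eq_Rint.
- by apply: measurable_funM => //; exact: measurable_comp_reflect.
- by apply: measurable_funM => //; exact: measurable_comp_reflect.
- by apply: (ae_impl fg) => y hy _; rewrite hy.
Qed.

Section Integrable.
Variables (f : R -> R) (k : R -> R).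
Hypotheses (f1 : L1 f) (ck : continuous k) (k1 : forall x, `|k x| <= 1).
Let mf : measurable_fun setT f. Proof. exact: L1_measurable. Qed.

Let mF : measurable_fun setT (fun p : R * R => f p.1 * b (p.2 - p.1) * k p.2).
Proof.
have mk : measurable_fun setT k by exact: continuous_measurable_fun.
apply: measurable_funM; last by apply: (measurableT_comp mk); exact: measurable_snd.
apply: measurable_funM; first by apply: (measurableT_comp mf); exact: measurable_fst.
by apply: (measurableT_comp mb); apply: measurable_funB; [exact: measurable_snd|exact: measurable_fst].
Qed.

Let mG : measurable_fun setT (fun p : R * R => f p.1 * b p.2).
Proof.
apply: measurable_funM; first by apply: (measurableT_comp mf); exact: measurable_fst.
by apply: (measurableT_comp mb); exact: measurable_snd.
Qed.

Let hF : (\int[mu]_y \int[mu]_x `|(f y * b (x - y) * k x)%:E| < +oo)%E.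
Proof.
have hG := @product_dominated R f b _ mG f1 b1 (fun x y => eq_ind_r (fun z => z <= _) (lexx _) (normrM _ _)).
apply: le_lt_trans hG.
have mFe : measurable_fun setT (fun p : R * R => `|(f p.1 * b (p.2 - p.1) * k p.2)%:E|%E).
  by apply: measurableT_comp => //; exact/measurable_EFinP.
have mGe : measurable_fun setT (fun p : R * R => `|(f p.1 * b p.2)%:E|%E).
  by apply: measurableT_comp => //; exact/measurable_EFinP.
apply: ge0_le_integral => //.
- by move=> x _; exact: integral_ge0.
- exact: (@measurable_fun_fubini_tonelli_F _ _ _ _ R mu _ mFe (fun z => abse_ge0 _)).
- exact: (@measurable_fun_fubini_tonelli_F _ _ _ _ R mu _ mGe (fun z => abse_ge0 _)).
move=> y _.
rewrite -(integral_shift (- y) (f := fun z => `|(f y * b z)%:E|%E)); last first.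
  by have := measurableT_comp mGe (measurable_pair1 y); exact.
apply: ge0_le_integral => //.
- by have := measurableT_comp mFe (measurable_pair1 y); exact.
- apply: measurableT_comp => //; apply/measurable_EFinP; apply: measurable_funM => //.
  exact: measurable_comp_shift.
- by move=> x _; rewrite /= lee_fin [X in X <= _]normrM ler_piMr.
Qed.

Lemma conv_fubini_aux :
  [/\ {ae mu, forall x, L1 (fun y => f y * b (x - y) * k x)},
      L1 (fun x => \int[mu]_y (f y * b (x - y) * k x)) &
      \int[mu]_x (\int[mu]_y (f y * b (x - y) * k x)) = \int[mu]_y (f y * \int[mu]_x (b (x - y) * k x))].
Proof.
have mk : measurable_fun setT k by exact: continuous_measurable_fun.
have [_ a2 _ i2 E] := Rintegral_Fubini mF hF; split => //.
rewrite -E; apply: eq_Rintegral => y _ /=.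
rewrite -(RintZ (f y)); last by apply: (L1_mul_bounded (M := 1)) => //; exact: L1_shift.
by apply: eq_Rintegral => x _; rewrite mulrA.
Qed.

End Integrable.

Section IntegrableFourier.
Variable f : R -> R.
Hypothesis f1 : L1 f.
Let mf : measurable_fun setT f. Proof. exact: L1_measurable. Qed.

Lemma conv_L1 : {ae mu, forall x, L1 (fun y => b (x - y) * f y)} /\ L1 (conv b f).
Proof.
have [|a i _] := @conv_fubini_aux f (fun=> 1) f1 (fun=> cvg_cst _); first by move=> x; rewrite normr1.
split.
  by apply: (ae_impl a) => x; under eq_fun do rewrite mulr1 mulrC.
by move: i; congr L1; apply: funext => x; apply: eq_Rintegral => y _; rewrite mulr1 mulrC.
Qed.

Lemma conv_fubini (k : R -> R) : continuous k -> (forall x, `|k x| <= 1) ->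
  \int[mu]_x (conv b f x * k x) = \int[mu]_y (f y * \int[mu]_x (b (x - y) * k x)).
Proof.
move=> ck k1; have mk : measurable_fun setT k by exact: continuous_measurable_fun.
have [a i <-] := conv_fubini_aux f1 ck k1; have [a' i'] := conv_L1.
apply: ae_eq_Rint.
- by apply: measurable_funM => //; exact: L1_measurable.
- exact: L1_measurable.
- apply: (ae_impl a') => x hx _; rewrite /Defs.conv mulrC -(RintZ _ hx).
  by apply: eq_Rintegral => y _; ring.
Qed.

Lemma fourier_conv xi : fourier (conv b f) xi = fourier b xi * fourier f xi.
Proof.
rewrite !fourierE; have cE : fcos (conv b f) xi = fcos b xi * fcos f xi - fsin b xi * fsin f xi.
  rewrite /fcos conv_fubini; last 2 first.
  - by apply: continuous_dilate; exact: continuous_cos.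
  - by move=> x; exact: normr_cos_le1.
  transitivity (\int[mu]_y (fcos b xi * (f y * cos (xi * y)) - fsin b xi * (f y * sin (xi * y)))).
    apply: eq_Rintegral => y _; rewrite -[\int[mu]_x _]/(fcos (fun x => b (x + - y)) xi) fcos_shift//.
    by rewrite mulrN cosN sinN; ring.
  rewrite RintB; [|by apply: L1Z; exact: L1_cos|by apply: L1Z; exact: L1_sin].
  by rewrite !RintZ; [|exact: L1_sin|exact: L1_cos].
have sE : fsin (conv b f) xi = fsin b xi * fcos f xi + fcos b xi * fsin f xi.
  rewrite /fsin conv_fubini; last 2 first.
  - by apply: continuous_dilate; exact: continuous_sin.
  - by move=> x; exact: normr_sin_le1.
  transitivity (\int[mu]_y (fsin b xi * (f y * cos (xi * y)) + fcos b xi * (f y * sin (xi * y)))).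
    apply: eq_Rintegral => y _; rewrite -[\int[mu]_x _]/(fsin (fun x => b (x + - y)) xi) fsin_shift//.
    by rewrite mulrN cosN sinN; ring.
  rewrite RintD; [|by apply: L1Z; exact: L1_cos|by apply: L1Z; exact: L1_sin].
  by rewrite !RintZ; [|exact: L1_sin|exact: L1_cos].
rewrite cE sE; apply/eqP; rewrite eq_complex/=; apply/andP; split; apply/eqP; ring.
Qed.

End IntegrableFourier.

Lemma sqnormc_fourier_le xi : sqnormc (fourier b xi) <= 2 * B ^+ 2.
Proof.
have c := fcos_le xi b1; have s := fsin_le xi b1; rewrite -/B in c s.
rewrite fourierE /sqnormc/= sqrrN -[X in X + _ <= _]real_normK ?num_real// -[X in _ + X <= _]real_normK ?num_real//.
by rewrite mulr2n mulrDl mul1r; apply: lerD; rewrite lerXn2r ?nnegrE.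
Qed.

Lemma csq_fourier_mul_le w : mC w ->
  (csq (fun xi => fourier b xi * w xi)%R <= (2 * B ^+ 2)%:E * csq w)%E.
Proof.
move=> mw; rewrite !csqE; have mbf := mC_fourier b1.
apply: (wsq_le (weight1 (R := R)) (weight1 (R := R)) (mCM mbf mw) mw); first by rewrite mulr_ge0// sqr_ge0.
apply: aeW => xi; rewrite !mul1r sqnormcM ler_wpM2r ?sqnormc_ge0//; exact: sqnormc_fourier_le.
Qed.

Lemma nsq_conv_le f : L1 f -> L2 f -> L2 (conv b f) ->
  (nsq (conv b f) <= (2 * B ^+ 2)%:E * nsq f)%E.
Proof.
move=> f1 f2 c2; have [_ c1] := conv_L1 f1.
have P : (0 < (2 * pi)%:E :> \bar R)%E by rewrite lte_fin mulr_gt0// pi_gt0.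
rewrite -(lee_pmul2l _ P)// -csq_fourier// muleCA -csq_fourier//.
have -> : fourier (conv b f) = (fun xi => fourier b xi * fourier f xi).
  by apply: funext => xi; exact: fourier_conv.
by apply: csq_fourier_mul_le; exact: mC_fourier.
Qed.

Section SquareIntegrable.
Variables (f : R -> R) (K : R).
Hypotheses (f2 : L2 f) (fK : forall x, `|f x| <= K).
Let mf : measurable_fun setT f. Proof. by case: f2. Qed.
Let cn n := conv b (cut f n).


Let cutK n x : `|cut f n x| <= K.
Proof. by apply: le_trans (cut_le f n x) _. Qed.

Let cn1 n : L1 (cn n). Proof. by case: (conv_L1 (L1_cut n f2)). Qed.

Let cnL n : L2 (cn n).
Proof.
apply: (L2_of_L1_bounded (K := K * B) (cn1 n)) => x.
by apply: conv_bounded => //; exact: measurable_cut.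
Qed.

Let cn_cvg (x : R) : cn n x @[n --> \oo] --> conv b f x.
Proof.
apply: (Rint_dominated_cvg (g := fun y => K * `|b (x - y)|)).
- move=> n; apply: measurable_funM; first exact: measurable_comp_reflect.
  exact: measurable_cut.
- move=> y; apply: cvgM; first exact: cvg_cst.
  apply: cvg_near_cst; exists (Num.trunc `|y|).+1 => // n /= nn.
  rewrite /cut/= indicE mem_set ?mulr1//= in_itv/= -ler_norml.
  by apply: (le_trans (ltW (truncnS_gt _))); rewrite ler_nat.
- by apply: L1Z; apply: L1_norm; exact: L1_reflect.
- by move=> n y; rewrite normrM mulrC ler_wpM2r.
Qed.

Let cnB m n : (fun x => cn m x - cn n x) = conv b (fun x => cut f m x - cut f n x).
Proof.
apply: funext => x.
have i j : L1 (fun y => b (x - y) * cut f j y).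
  by apply: (L1_conv_integrand x (K := K)) => //; exact: measurable_cut.
by rewrite -(RintB (i m) (i n)); apply: eq_Rintegral => y _; rewrite mulrBr.
Qed.

Let cn_cauchy m n : (nsq (fun x => cn m x - cn n x)%R <=
  (2 * B ^+ 2)%:E * nsq (fun x => cut f m x - cut f n x)%R)%E.
Proof.
have c1 := L1B (L1_cut m f2) (L1_cut n f2); have c2 := L2B (L2_cut m f2) (L2_cut n f2).
have cL : L2 (fun x => cn m x - cn n x) by exact: L2B.
by rewrite cnB in cL *; exact: nsq_conv_le.
Qed.

Let c_lim : L2 (conv b f) /\ nsq (fun x => cn n x - conv b f x)%R @[n --> \oo] --> 0%E.
Proof.
have [e e0|G GL cG] := L2_complete cnL.
  pose q : R := 8 * B ^+ 2 + 1; have q0 : 0 < q by rewrite ltr_wpDl// mulr_ge0// sqr_ge0.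
  have [N hN] := cvge0_eps (nsq_cut_cvg f2) (divr_gt0 e0 q0).
  exists N => m n Nm Nn; apply: (le_trans (cn_cauchy m n)).
  have mc j : measurable_fun setT (cut f j) by exact: measurable_cut.
  have := nsq_tri (mc m) mf (mc n); rewrite [X in (_ + _ * X)%E]nsqB => h.
  apply: (@le_trans _ _ ((2 * B ^+ 2)%:E * (2%:E * (e / q)%:E + 2%:E * (e / q)%:E))%E).
    apply: lee_wpmul2l; first by rewrite lee_fin mulr_ge0// sqr_ge0.
    apply: (le_trans h); apply: leeD; apply: lee_wpmul2l => //; exact: hN.
  rewrite -!(EFinM, EFinD) lee_fin.
  have -> : 2 * B ^+ 2 * (2 * (e / q) + 2 * (e / q)) = 8 * B ^+ 2 / q * e by field; rewrite gt_eqF.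
  by apply: ler_piMl; [exact: ltW|rewrite ler_pdivrMr// mul1r lerDl].
have mcn n : measurable_fun setT (cn n) by case: (cnL n).
have mc : measurable_fun setT (conv b f).
  by apply: (@measurable_fun_cvg _ _ _ _ cn) => // x _; exact: cn_cvg.
have mG : measurable_fun setT G by case: GL.
have E := nsq_cvg_pointwise mcn mG cn_cvg cG.
split; first by apply: (L2_ae_eq mc _ GL); apply: (ae_impl E) => x hx _; rewrite hx.
move: cG; rewrite (_ : (fun n => _) = (fun n => nsq (fun x => cn n x - conv b f x)))//.
apply: funext => n; apply: ae_eq_nsq; [exact: measurable_funB|exact: measurable_funB|].
by apply: (ae_impl E) => x hx _; rewrite hx.
Qed.

(** For truncations of [f] the product formula is Fubini. The convolutions of the truncations
    converge pointwise, by domination, and in L^2, since the transform of [b] is bounded. *)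
Lemma is_fourierL2_conv_bounded :
  L2 (conv b f) /\ is_fourierL2 (conv b f) (fun xi => fourier b xi * fourierL2 f xi).
Proof.
have [cL cc] := c_lim; have mb' := mC_fourier b1; have mw := mC_fourierL2 f2; split => //.
apply: (is_fourierL2_closed cL cnL (fun n => is_fourierL2_L1 (cn1 n) (cnL n))) => //.
  exact: mCM.
have := cvge0Z (2 * B ^+ 2) (is_fourierL2_cvg (fourierL2P f2)); apply: cvge0_le => n.
rewrite csq_ge0/=.
rewrite (_ : (fun xi => _) = (fun xi => fourier b xi * (fourier (cut f n) xi - fourierL2 f xi))).
  by apply: csq_fourier_mul_le; apply: mCB => //; exact: mC_cut.
by apply: funext => xi; rewrite /cn (fourier_conv (L1_cut n f2)) mulrBr.
Qed.

End SquareIntegrable.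

Lemma is_fourierL2_ae_eq f g w : L2 f -> L2 g -> ae_eq mu setT f g -> is_fourierL2 g w -> is_fourierL2 f w.
Proof.
move=> fL gL fg h.
apply: (is_fourierL2_closed fL (vn := fun=> g) (wn := fun=> w)) => //.
- exact: is_fourierL2_mC h.
- rewrite (_ : nsq _ = 0%E); first exact: cvg_cst.
  case: fL gL => mf _ [mg _].
  rewrite (@ae_eq_nsq _ (fun x => g x - f x) (fun=> 0))//.
  + by rewrite /nsq; under eq_integral do rewrite expr0n/=; rewrite integral0.
  + exact: measurable_funB.
  + by apply: (ae_impl fg) => x hx _; rewrite hx// subrr.
- rewrite (_ : csq _ = 0%E); first exact: cvg_cst.
  by rewrite /csq; under eq_integral do rewrite subrr /sqnormc/= expr0n/= addr0; rewrite integral0.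
Qed.

(** Convolution ignores null sets, so [f] may be clipped. *)
Lemma is_fourierL2_conv f (K : R) : 0 <= K -> L2 f -> {ae mu, forall x, `|f x| <= K} ->
  [/\ L2 (conv b f), is_fourierL2 (conv b f) (fun xi => fourier b xi * fourierL2 f xi) &
    forall x, `|conv b f x| <= K * B].
Proof.
move=> K0 fL fK; have mf : measurable_fun setT f by case: fL.
pose h x := clip K (f x).
have mh : measurable_fun setT h by apply: measurable_maxr => //; exact: measurable_minr.
have fh : ae_eq mu setT f h by apply: (ae_impl fK) => x hx _; rewrite /h clip_id.
have hL : L2 h by exact: (L2_ae_eq mh fh fL).
have hK x : `|h x| <= K by exact: clip_le.
have -> : conv b f = conv b h by exact: conv_ae.
have [cL cF] := is_fourierL2_conv_bounded hL hK; split; [exact: cL| |by move=> x; exact: (conv_bounded x mh hK)].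
apply: (is_fourierL2_ae cL cF).
  by apply: mCM; [exact: mC_fourier|exact: mC_fourierL2].
have E := is_fourierL2_unique fL (is_fourierL2_ae_eq fL hL fh (fourierL2P hL)) (fourierL2P fL).
by apply: (ae_impl E) => xi ->.
Qed.

End Kernel.
End Convolution.

(** * The second derivative of a convolution *)

Section Calculus.
Context {R : realType}.
Local Notation mu := (@lebesgue_measure R).
Local Notation conv := (@Defs.conv R).
Implicit Types (f g h u v : R -> R) (w : R -> R[i]).

Lemma derivative_seq f (l : R) : is_derive (0 : R) 1 f l ->
  (n.+1%:R * (f n.+1%:R^-1 - f 0)) @[n --> \oo] --> l.
Proof.
move=> hf; have d : (fun h : R => h^-1 *: ((f \o shift (0 : R)) (h *: (1 : R)) - f 0)) @ 0^' --> l.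
  by have := @ex_derive _ _ _ _ _ _ _ hf; rewrite /derivable -(@derive_val _ _ _ _ _ _ _ hf).
have c : (n.+1%:R^-1 : R) @[n --> \oo] --> 0^'.
  move=> P /= [r /= r0 hP]; have /cvgrPdist_lt/(_ _ r0) := @cvg_harmonic R.
  by apply: filterS => n hn; apply: hP => //=; rewrite invr_neq0.
have := cvg_comp _ _ c d; apply: cvg_trans; apply: near_eq_cvg; apply: nearW => n /=.
by rewrite /GRing.scale/= invrK mulr1 addr0.
Qed.

Lemma sin_quotient_cvg (c : R) : (n.+1%:R * sin (n.+1%:R^-1 * c)) @[n --> \oo] --> c.
Proof.
have d : is_derive (0 : R) 1 (fun t : R => sin (c * t)) c.
  have := @is_derive_dilate R c 0 (cos (c * 0)) sin (is_derive_sin _).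
  by rewrite mulr0 cos0 mulr1.
have := derivative_seq d; apply: cvg_trans; apply: near_eq_cvg; apply: nearW => n /=.
by rewrite mulr0 sin0 subr0 [c * _]mulrC.
Qed.

Lemma csq_dominated_cvg w (wn : nat -> R -> R[i]) (C : R) : mC w -> (csq w < +oo)%E ->
  (forall n, mC (wn n)) -> 0 <= C -> (forall n xi, sqnormc (wn n xi) <= C * sqnormc (w xi)) ->
  (forall xi, sqnormc (wn n xi) @[n --> \oo] --> 0) -> csq (wn n) @[n --> \oo] --> 0%E.
Proof.
move=> mw fw mwn C0 dom cw; rewrite /csq.
have -> : 0%E = (\int[mu]_x (cst 0%R x)%:E)%E by rewrite integral0.
apply: (@dominated_cvg _ _ _ mu setT measurableT (fun n x => (sqnormc (wn n x))%:E)
   (fun x => (cst 0%R x)%:E) (fun x => (C * sqnormc (w x))%:E)) => //.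
- by move=> n; apply/measurable_EFinP; exact: mC_sqnormc.
- by move=> x _; apply: cvg_EFin; [exact: nearW|exact: cw].
- apply: (L1Z C (f := fun x => sqnormc (w x))); apply/integrableP; split.
    by apply/measurable_EFinP; exact: mC_sqnormc.
  apply: le_lt_trans fw; rewrite le_eqVlt; apply/orP; left; apply/eqP; apply: eq_integral => x _.
  by rewrite /= ger0_norm ?sqnormc_ge0.
- by move=> n x _; rewrite /= lee_fin ger0_norm ?sqnormc_ge0.
Qed.

(** Plancherel turns convergence of the transforms into a Cauchy sequence, and the graph of
    the transform is closed. *)
Lemma L2_of_fourier_cvg (vn : nat -> R -> R) (wn : nat -> R -> R[i]) w :
  (forall n, L2 (vn n)) -> (forall n, is_fourierL2 (vn n) (wn n)) -> mC w ->
  csq (fun xi => wn n xi - w xi)%R @[n --> \oo] --> 0%E ->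
  exists v, [/\ L2 v, nsq (fun x => vn n x - v x)%R @[n --> \oo] --> 0%E & is_fourierL2 v w].
Proof.
move=> vL hv mw cw; have mwn n := is_fourierL2_mC (hv n).
have pi2 := pi_ge2 R.
have le1 m n : (nsq (fun x => vn m x - vn n x)%R <= csq (fun xi => wn m xi - wn n xi)%R)%E.
  rewrite (plancherel (L2B (vL m) (vL n)) (is_fourierL2B (vL m) (vL n) (hv m) (hv n))).
  rewrite -[leLHS]mul1e; apply: lee_wpmul2r; first exact: nsq_ge0.
  by rewrite lee_fin; move: pi pi2 => p p2; lra.
have [e e0|v vL' cv] := L2_complete vL.
  have e4 : 0 < e / 4 by rewrite divr_gt0.
  have [N hN] := cvge0_eps cw e4; exists N => m n Nm Nn; apply: (le_trans (le1 m n)).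
  apply: (le_trans (csq_tri (mwn m) mw (mwn n))).
  rewrite [X in (_ + _ * X)%E]csqB_sym.
  have -> : e = 2 * (e / 4) + 2 * (e / 4) by field.
  by apply: lee_sum2; apply: lee_scale => //; exact: hN.
exists v; split => //; exact: (is_fourierL2_closed vL' vL hv).
Qed.

Lemma L2_pairing_cvg (vn : nat -> R -> R) v h : (forall n, L2 (vn n)) -> L2 v -> L2 h ->
  nsq (fun x => vn n x - v x)%R @[n --> \oo] --> 0%E ->
  \int[mu]_x (vn n x * h x) @[n --> \oo] --> \int[mu]_x (v x * h x).
Proof.
move=> vnL vL hL c; apply/cvgrPdist_le => e e0.
pose H := \int[mu]_x (h x ^+ 2); have H0 : 0 <= H by apply: Rintegral_ge0 => x _; exact: sqr_ge0.
pose t := e / (H + 1); have t0 : 0 < t by rewrite divr_gt0// ltr_wpDl.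
have [N hN] := cvge0_eps c (mulr_gt0 e0 t0).
exists N => // n /= Nn; have dL := L2B (vnL n) vL; have := hN n Nn; rewrite nsqE// lee_fin.
set Dn := \int[mu]_x _ => Dle.
rewrite distrC -(RintB (L2_integrableM (vnL n) hL) (L2_integrableM vL hL)).
rewrite (_ : \int[mu]_x _ = \int[mu]_x ((vn n x - v x) * h x)); last first.
  by apply: eq_Rintegral => x _; rewrite mulrBl.
have dh := L2_integrableM dL hL.
have i1 := L2_integrable_sqr dL; have i2 := L2_integrable_sqr hL.
apply: (le_trans (Rint_norm_le dh)).
apply: (@le_trans _ _ (\int[mu]_x (2^-1 * t^-1 * (vn n x - v x) ^+ 2 + 2^-1 * t * h x ^+ 2))).
  apply: Rint_le; [exact: L1_norm|exact: L1D (L1Z _ i1) (L1Z _ i2)|].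
  move=> x; set a := vn n x - v x.
  have -> : 2^-1 * t^-1 * a ^+ 2 + 2^-1 * t * h x ^+ 2 =
     `|a * h x| + 2^-1 * t^-1 * (`|a| - t * `|h x|) ^+ 2.
    rewrite normrM -[a ^+ 2]real_normK ?num_real// -[h x ^+ 2]real_normK ?num_real//.
    by move: (`|a|) (`|h x|) => p q; field; rewrite gt_eqF.
  by rewrite lerDl mulr_ge0 ?sqr_ge0// mulr_ge0// invr_ge0 ltW.
rewrite (RintD (L1Z _ i1) (L1Z _ i2)) (RintZ _ i1) (RintZ _ i2) -/H -/Dn.
have b1 : 2^-1 * t^-1 * Dn <= 2^-1 * e.
  apply: (@le_trans _ _ (2^-1 * t^-1 * (e * t))).
    by apply: ler_wpM2l => //; rewrite mulr_ge0// invr_ge0 ltW.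
  by rewrite le_eqVlt; apply/orP; left; apply/eqP; field; rewrite gt_eqF.
have b2 : 2^-1 * t * H <= 2^-1 * e.
  rewrite -mulrA; apply: ler_wpM2l => //; rewrite /t mulrAC ler_pdivrMr; last by rewrite ltr_wpDl.
  by apply: ler_wpM2l; [exact: ltW|rewrite lerDl].
by move: b1 b2; move: (_ * Dn) (_ * H) => p q b1 b2; lra.
Qed.

Lemma L2_locally_integrable f : L2 f -> locally_integrable setT f.
Proof.
move=> [mf ff]; split => //; first exact: openT.
move=> K _ cK; have mK : measurable K by apply: closed_measurable; apply: compact_closed => //; exact: Rhausdorff.
apply: (@le_lt_trans _ _ (\int[mu]_(x in K) (1 + ((f x) ^+ 2)%:E))%E).
  apply: ge0_le_integral => //.
  - by apply: measurable_funTS; apply/measurable_EFinP; exact: measurableT_comp.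
  - by apply: measurable_funTS; apply: emeasurable_funD => //; exact: measurable_sqr_EFin.
  move=> x _; rewrite -EFinD lee_fin -[f x ^+ 2]real_normK ?num_real//.
  by have := sqr_ge0 (1 - `|f x|); have := normr_ge0 (f x); nra.
rewrite ge0_integralD//; first last.
- by apply: measurable_funTS; exact: measurable_sqr_EFin.
- by move=> x _; rewrite lee_fin sqr_ge0.
apply: lte_add_pinfty.
  by rewrite integral_cst// mul1e; exact: compact_finite_measure.
apply: le_lt_trans ff; apply: ge0_subset_integral => //; first exact: measurable_sqr_EFin.
by move=> x _; rewrite lee_fin sqr_ge0.
Qed.

End Calculus.

Section SecondDifference.
Context {R : realType}.
Local Notation mu := (@lebesgue_measure R).
Local Notation conv := (@Defs.conv R).
Implicit Types (f g h u v : R -> R) (w : R -> R[i]).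

Definition diff2 (n : nat) u (x : R) : R :=
  n.+1%:R ^+ 2 * (u (x + n.+1%:R^-1) + u (x - n.+1%:R^-1) - 2 * u x).

Definition diff2_symbol (n : nat) (xi : R) : R :=
  - (n.+1%:R ^+ 2 * (2 - 2 * cos (n.+1%:R^-1 * xi))).

Lemma L2_diff2 n u : L2 u -> L2 (diff2 n u).
Proof. by move=> uL; apply: L2Z; apply: L2B; [apply: L2D; exact: L2_shift|exact: L2Z]. Qed.

Lemma is_fourierL2_diff2 n u w : L2 u -> is_fourierL2 u w ->
  is_fourierL2 (diff2 n u) (fun xi => (diff2_symbol n xi)%:C * w xi).
Proof.
move=> uL h; set d : R := n.+1%:R^-1.
have h1 := is_fourierL2_shift d uL h; have h2 := is_fourierL2_shift (- d) uL h.
have h3 := is_fourierL2D (L2_shift d uL) (L2_shift (- d) uL) h1 h2.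
have h4 := is_fourierL2B (L2D (L2_shift d uL) (L2_shift (- d) uL)) (L2Z 2 uL) h3 (is_fourierL2Z 2 uL h).
have := is_fourierL2Z (n.+1%:R ^+ 2) (L2B (L2D (L2_shift d uL) (L2_shift (- d) uL)) (L2Z 2 uL)) h4.
rewrite (_ : (fun xi => _) = (fun xi => (diff2_symbol n xi)%:C * w xi))//.
apply: funext => xi; rewrite /cis /diff2_symbol -/d mulNr cosN sinN.
case: (w xi) => p q; apply/eqP; rewrite eq_complex/=; apply/andP; split; apply/eqP; ring.
Qed.

Lemma diff2_symbol_bounds n xi : 0 <= diff2_symbol n xi + xi ^+ 2 <= xi ^+ 2.
Proof.
have n0 : n.+1%:R != 0 :> R by [].
have := diff_symbol_le_sqr (n.+1%:R^-1 * xi); have := diff_symbol_ge0 (n.+1%:R^-1 * xi).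
rewrite /diff2_symbol; set c := 2 - _ => c0 c1.
have m : n.+1%:R ^+ 2 * c <= xi ^+ 2.
  apply: (le_trans (ler_wpM2l (sqr_ge0 _) c1)); rewrite le_eqVlt; apply/orP; left; apply/eqP; by field.
have m0 : 0 <= n.+1%:R ^+ 2 * c by rewrite mulr_ge0// sqr_ge0.
by apply/andP; split; lra.
Qed.

Lemma diff2_symbol_cvg xi : diff2_symbol n xi @[n --> \oo] --> - xi ^+ 2.
Proof.
have E n : diff2_symbol n xi = - (4 * (n.+1%:R * sin (n.+1%:R^-1 * (xi / 2))) ^+ 2).
  by rewrite /diff2_symbol diff_symbol -(mulrA n.+1%:R^-1 xi 2^-1); ring.
under eq_fun do rewrite E.
have -> : - xi ^+ 2 = - (4 * (xi / 2) ^+ 2) by field.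
apply: cvgN; apply: cvgM; first exact: cvg_cst.
by under eq_fun do rewrite expr2; rewrite expr2; apply: cvgM; exact: sin_quotient_cvg.
Qed.

Lemma diff2_integral_swap n u h (K : R) : measurable_fun setT u -> (forall x, `|u x| <= K) -> L1 h ->
  \int[mu]_x (u x * diff2 n h x) = \int[mu]_x (diff2 n u x * h x).
Proof.
move=> mu1 uK h1; have mh := L1_measurable h1; set d : R := n.+1%:R^-1.
have i1 z : L1 (fun x => u x * h (x + z)).
  by under eq_fun do rewrite mulrC; apply: (L1_mul_bounded (L1_shift z h1) mu1 uK).
have i2 z : L1 (fun x => u (x + z) * h x).
  under eq_fun do rewrite mulrC; apply: (L1_mul_bounded (M := K) h1) => //; exact: measurable_comp_shift.
have sw z : \int[mu]_x (u x * h (x + z)) = \int[mu]_x (u (x - z) * h x).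
  rewrite -(Rintegral_shift z (f := fun x => u (x - z) * h x)); last exact: L1_measurable (i2 (- z)).
  by apply: eq_Rintegral => x _; rewrite addrK.
have i0 : L1 (fun x => u x * h x) by under eq_fun do rewrite mulrC; exact: (L1_mul_bounded h1 mu1 uK).
transitivity (n.+1%:R ^+ 2 * (\int[mu]_x (u x * h (x + d)) + \int[mu]_x (u x * h (x + - d)) - 2 * \int[mu]_x (u x * h x))).
  rewrite -(RintD (i1 d) (i1 (- d))) -(RintZ 2 i0) -(RintB (L1D (i1 d) (i1 (- d))) (L1Z 2 i0)).
  rewrite -(RintZ _ (L1B (L1D (i1 d) (i1 (- d))) (L1Z 2 i0))).
  by apply: eq_Rintegral => x _; rewrite /diff2 -/d; ring.
rewrite !sw opprK [X in _ * (X - _)]addrC.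
rewrite -(RintD (i2 d) (i2 (- d))) -(RintZ 2 i0) -(RintB (L1D (i2 d) (i2 (- d))) (L1Z 2 i0)).
rewrite -(RintZ _ (L1B (L1D (i2 d) (i2 (- d))) (L1Z 2 i0))).
by apply: eq_Rintegral => x _; rewrite /diff2 -/d; ring.
Qed.

Section TestFunction.
Variable h : R -> R.
Hypothesis th : test_function h.

Lemma test_derive n (x : R) : is_derive x 1 (derive1n n h) (derive1n n.+1 h x).
Proof.
case: th => d _; split; first exact: d.
by rewrite /derive1n iterS derive1E.
Qed.

Lemma test_continuous n : continuous (derive1n n h).
Proof. by move=> x; exact: is_derive_continuous (test_derive n x). Qed.

Lemma test_support : exists2 A : R, 0 <= A & forall x, A < `|x| -> h x = 0.
Proof.
case: th => _ /compact_bounded[M [Mr hM]].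
exists (`|M| + 1); first by rewrite addr_ge0.
move=> x xA; apply/eqP/negP => /negP hx.
have := hM (`|M| + 1) (le_lt_trans (ler_norm M) (ltr_pwDr ltr01 (lexx _))).
move=> /(_ x (@subset_closure _ _ x hx)) /= xl.
by move: (lt_le_trans xA xl); rewrite ltxx.
Qed.

Lemma continuous_bounded_itv (k : R -> R) (A : R) : continuous k ->
  exists2 S : R, 0 <= S & forall x, `|x| <= A -> `|k x| <= S.
Proof.
move=> ck; have cg : continuous (fun p : R * R => k p.1).
  by move=> p; apply: (@continuous_comp _ _ _ fst k); [exact: cvg_fst|exact: ck].
have [S S0 hS] := bounded_on_square A cg; exists S => // x xA; exact: (hS x x xA xA).
Qed.

Lemma diff2_mean_value n (x : R) : exists2 c, diff2 n h x = derive1n 2 h c & `|c - x| <= 3 * n.+1%:R^-1.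
Proof.
set d : R := n.+1%:R^-1; have d0 : 0 < d by rewrite invr_gt0.
have shift_derive (k : nat) (t : R) : is_derive t 1 (fun t => derive1n k h (t + d)) (derive1n k.+1 h (t + d)).
  have dt : is_derive t 1 (fun t : R => t + d) 1.
    by have := is_derive_addf (is_derive_id t (1:R)) (is_derive_cst d t 1); rewrite addr0.
  by have := @is_derive1_comp R (derive1n k h) (fun t : R => t + d) t _ _ (test_derive k (t + d)) dt; rewrite mulr1.
have [c [E1 c1 _]] := @mean_value R (fun t => h (t + d) - h t)
  (fun t => derive1n 1 h (t + d) - derive1n 1 h t) (x - d) x
  (fun t => is_derive_subf (shift_derive 0%N t) (test_derive 0%N t)).
have [e [E2 e1 _]] := @mean_value R (derive1n 1 h) (derive1n 2 h) c (c + d) (test_derive 1).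
exists e.
  rewrite /diff2 -/d; have -> : h (x + d) + h (x - d) - 2 * h x = h (x + d) - h x - (h (x - d + d) - h (x - d)).
    by rewrite subrK; ring.
  have NE : n.+1%:R = d^-1 by rewrite invrK.
  by rewrite E1 E2 NE; field; rewrite gt_eqF.
have -> : e - x = (e - c) + ((c - (x - d)) - d) by ring.
apply: (le_trans (ler_normD _ _)); have := ler_normB (c - (x - d)) d; move: e1 c1.
rewrite (_ : c + d - c = d); last by ring.
rewrite (_ : x - (x - d) = d); last by ring.
by rewrite (gtr0_norm d0); lra.
Qed.

Lemma diff2_cvg (x : R) : diff2 n h x @[n --> \oo] --> derive1n 2 h x.
Proof.
apply/cvgrPdist_lt => e e0.
have /cvgrPdist_lt/(_ _ e0)[r /= r0 hr] := @test_continuous 2 x.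
have c3 : 3 * n.+1%:R^-1 @[n --> \oo] --> (0 : R).
  by rewrite -[X in _ --> X](mulr0 3); apply: cvgM; [exact: cvg_cst|exact: cvg_harmonic].
have /cvgrPdist_lt/(_ _ r0) := c3; apply: filterS => n.
rewrite sub0r normrN ger0_norm; last by rewrite mulr_ge0// invr_ge0.
move=> nr; have [c -> hc] := diff2_mean_value n x; apply: hr.
by rewrite /ball/= distrC; exact: le_lt_trans nr.
Qed.

Lemma diff2_dominated : exists A S : R, forall n x,
  `|diff2 n h x| <= S * \1_(`[- A, A]%classic : set R) x.
Proof.
have [A A0 hA] := test_support.
have [S S0 hS] := continuous_bounded_itv (A + 4) (@test_continuous 2).
exists (A + 1), S => n x; rewrite indicE.
have n1 : n.+1%:R^-1 <= 1 :> R by rewrite invf_le1// ler1n.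
have n0 : 0 < n.+1%:R^-1 :> R by rewrite invr_gt0.
have [xA|xA] := lerP `|x| (A + 1).
  rewrite mem_set /= ?mulr1; last by rewrite in_itv/= -ler_norml.
  have [c -> hc] := diff2_mean_value n x; apply: hS.
  have {}hc : `|c - x| <= 3 by apply: (le_trans hc); rewrite -[leRHS]mulr1 ler_wpM2l.
  have := ler_normD (c - x) x; rewrite subrK => h1; lra.
rewrite memNset /= ?mulr0; last by rewrite in_itv/= -ler_norml; apply/negP; rewrite -ltNge.
have z (y : R) : `|y| <= 1 -> h (x + y) = 0.
  by move=> y1; apply: hA; have := ler_normB (x + y) y; rewrite addrK; lra.
rewrite /diff2 z ?(gtr0_norm n0)// z ?normrN ?(gtr0_norm n0)//.
by rewrite -[x]addr0 z ?normr0// mulr0 addr0 subrr mulr0 normr0.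
Qed.

Lemma test_L1 : L1 h.
Proof.
have [A A0 hA] := test_support.
have [S S0 hS] := continuous_bounded_itv A (@test_continuous 0).
have mh : measurable_fun setT h by apply: continuous_measurable_fun; exact: (@test_continuous 0).
apply: (L1_le mh (L1Z S (@integrable_indic_itv R (- A) A true false))) => x.
rewrite indicE; have [xA|xA] := lerP `|x| A.
  rewrite mem_set /= ?mulr1; last by rewrite in_itv/= -ler_norml.
  by rewrite (ger0_norm S0); exact: hS.
by rewrite hA// normr0.
Qed.

Lemma test_L2 : L2 h.
Proof.
have [A A0 hA] := test_support.
have [S S0 hS] := continuous_bounded_itv A (@test_continuous 0).
apply: (L2_of_L1_bounded (K := S) test_L1) => x.
by have [xA|xA] := lerP `|x| A; [exact: hS|rewrite hA// normr0].
Qed.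

End TestFunction.

Section Kernel.
Variables (b : R -> R) (C : R).
Hypothesis b1 : L1 b.
Hypothesis bC : forall xi, (xi ^+ 2) ^+ 2 * sqnormc (fourier b xi) <= C.
Let mb := mC_fourier b1.
Let C0 : 0 <= C. Proof. by apply: le_trans (bC 0); rewrite mulr_ge0 ?sqr_ge0 ?sqnormc_ge0. Qed.

(** The multiplier of [f |-> (b * f)_xx]; the decay of the transform of [b] makes it bounded. *)
Definition conv_symbol xi : R[i] := (- xi ^+ 2)%:C * fourier b xi.

Lemma mC_conv_symbol : mC conv_symbol.
Proof.
apply: mCM => //; apply: mC_real; apply: measurableT_comp => //; exact: measurable_funX.
Qed.

(** The symbols of the second difference quotients of [conv b f] are dominated by
    [conv_symbol] and converge to it, so the quotients converge in L^2. Against a test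
    function the quotient moves onto the test function, where it converges to the second
    derivative. *)
Lemma second_derivative_conv f (K : R) : 0 <= K -> L2 f -> {ae mu, forall x, `|f x| <= K} ->
  exists2 v, L2 v & is_fourierL2 v (fun xi => conv_symbol xi * fourierL2 f xi) /\
    is_weak_derive 2 (conv b f) v.
Proof.
move=> K0 fL fK; have [cL cF cK] := is_fourierL2_conv b1 K0 fL fK.
have mf := mC_fourierL2 fL; have mc : measurable_fun setT (conv b f) by case: cL.
have csqf := is_fourierL2_fin fL (fourierL2P fL).
have dF n := is_fourierL2_diff2 n cL cF.
have msym n : measurable_fun setT (diff2_symbol n).
  apply: measurableT_comp => //; apply: measurable_funM => //; apply: measurable_funB => //.
  by apply: measurable_funM => //; exact: measurable_cos_dilate.
have cw : csq (fun xi => (diff2_symbol n xi)%:C * (fourier b xi * fourierL2 f xi) -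
    conv_symbol xi * fourierL2 f xi)%R @[n --> \oo] --> 0%E.
  have E n : (fun xi => (diff2_symbol n xi)%:C * (fourier b xi * fourierL2 f xi) -
      conv_symbol xi * fourierL2 f xi) =
      (fun xi => (diff2_symbol n xi + xi ^+ 2)%:C * (fourier b xi * fourierL2 f xi)).
    apply: funext => xi; rewrite /conv_symbol; case: (fourier b xi) (fourierL2 f xi) => p q [p' q'].
    by apply/eqP; rewrite eq_complex/=; apply/andP; split; apply/eqP; ring.
  rewrite (_ : (fun n => _) = (fun n => csq (fun xi => (diff2_symbol n xi + xi ^+ 2)%:C * (fourier b xi * fourierL2 f xi)))); last first.
    by apply: funext => n; rewrite E.
  apply: (csq_dominated_cvg mf csqf _ C0).
  - move=> n; apply: mCM; last exact: mCM.
    by apply: mC_real; apply: measurable_funD => //; exact: measurable_funX.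
  - move=> n xi; rewrite !sqnormcM sqnormcC mulrA; apply: ler_wpM2r; first exact: sqnormc_ge0.
    apply: le_trans (bC xi); apply: ler_wpM2r; first exact: sqnormc_ge0.
    have /andP[s0 s1] := diff2_symbol_bounds n xi.
    by rewrite lerXn2r ?nnegrE ?sqr_ge0.
  - move=> xi; set q := fourier b xi * fourierL2 f xi.
    have c : diff2_symbol n xi + xi ^+ 2 @[n --> \oo] --> 0.
      rewrite -(addNr (xi ^+ 2)); apply: cvgD; [exact: diff2_symbol_cvg|exact: cvg_cst].
    have -> : (fun n => sqnormc ((diff2_symbol n xi + xi ^+ 2)%:C * q)) =
        (fun n => (diff2_symbol n xi + xi ^+ 2) * (diff2_symbol n xi + xi ^+ 2) * sqnormc q).
      by apply: funext => n; rewrite sqnormcM sqnormcC expr2.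
    rewrite -[X in _ --> X](mul0r (sqnormc q)); apply: cvgM; last exact: cvg_cst.
    by rewrite -[X in _ --> X](mulr0 (0 : R)); exact: cvgM.
have mw : mC (fun xi => conv_symbol xi * fourierL2 f xi) by apply: mCM => //; exact: mC_conv_symbol.
have [v [vL cv hv]] := L2_of_fourier_cvg (fun n => L2_diff2 n cL) dF mw cw.
exists v => //; split => //; split; [exact: L2_locally_integrable|exact: L2_locally_integrable|].
move=> h th; rewrite sqrrN expr1n mul1r.
have c1 : \int[mu]_x (conv b f x * diff2 n h x) @[n --> \oo] --> \int[mu]_x (conv b f x * derive1n 2 h x).
  have [A [S dom]] := diff2_dominated th.
  have md n : measurable_fun setT (diff2 n h).
    have := L1_measurable (test_L1 th) => mh.
    apply: measurable_funM => //; apply: measurable_funB; last exact: measurable_funM.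
    by apply: measurable_funD; exact: measurable_comp_shift.
  set KB := K * _ in cK.
  apply: (Rint_dominated_cvg (g := fun x => KB * (S * \1_(`[- A, A]%classic : set R) x))).
  - by move=> n; exact: measurable_funM.
  - by move=> x; apply: cvgM; [exact: cvg_cst|exact: diff2_cvg].
  - by apply: L1Z; apply: L1Z; exact: (@integrable_indic_itv R (- A) A true false).
  - by move=> n x; rewrite normrM; apply: ler_pM.
have c2 : \int[mu]_x (conv b f x * diff2 n h x) @[n --> \oo] --> \int[mu]_x (v x * h x).
  have := L2_pairing_cvg (fun n => L2_diff2 n cL) vL (test_L2 th) cv.
  rewrite (_ : (fun n => \int[mu]_x (diff2 n (conv b f) x * h x)) = (fun n => \int[mu]_x (conv b f x * diff2 n h x)))//.
  by apply: funext => n; rewrite (diff2_integral_swap n mc cK (test_L1 th)).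
exact: cvg_unique c1 c2.
Qed.

End Kernel.
End SecondDifference.

(** * Bump functions and uniqueness of weak derivatives *)

Section Bumps.
Context {R : realType}.
Local Notation mu := (@lebesgue_measure R).
Implicit Types (p q l : {poly R}).

(** The functions [p(1/x) exp(-1/x)] extended by zero; they are stable under differentiation. *)
Definition flat p (x : R) : R := if 0 < x then p.[x^-1] * expR (- x^-1) else 0.

Definition flat_next p : {poly R} := 'X^2 * (p - p^`()).

Lemma powX_expRN_bounded (k : nat) : exists C : R, forall y : R, 0 <= y -> y ^+ k * expR (- y) <= C.
Proof.
case: k => [|k].
  by exists 1 => y y0; rewrite expr0 mul1r expR_le1 oppr_le0.
exists (k.+1%:R ^+ k.+1) => y y0.
rewrite expRN ler_pdivrMr ?expR_gt0//.
have k0 : k.+1%:R != 0 :> R by [].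
have -> : expR y = expR (y / k.+1%:R) ^+ k.+1 by rewrite -expRM_natl mulrC divfK.
rewrite -exprMn lerXn2r ?nnegrE ?mulr_ge0 ?expR_ge0//.
have := expR_ge1Dx (y / k.+1%:R) => h.
apply: (@le_trans _ _ (k.+1%:R * (1 + y / k.+1%:R))); last by apply: ler_wpM2l.
by rewrite mulrDr mulr1 mulrC divfK// lerDr.
Qed.

Lemma poly_expRN_bounded p : forall k : nat,
  exists C : R, forall y : R, 0 <= y -> `|p.[y]| * y ^+ k * expR (- y) <= C.
Proof.
elim/poly_ind: p => [|p c IH] k.
  by exists 0 => y _; rewrite horner0 normr0 !mul0r.
have [C1 h1] := IH k.+1; have [C2 h2] := powX_expRN_bounded k.
exists (C1 + `|c| * C2) => y y0; rewrite !hornerE.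
have e0 : 0 <= y ^+ k * expR (- y) by rewrite mulr_ge0 ?exprn_ge0 ?expR_ge0.
rewrite -mulrA; apply: (@le_trans _ _ ((`|p.[y]| * y + `|c|) * (y ^+ k * expR (- y)))).
  apply: ler_wpM2r => //; apply: (le_trans (ler_normD _ _)).
  by rewrite normrM (ger0_norm y0).
rewrite mulrDl; apply: lerD; last by apply: ler_wpM2l => //; exact: h2.
by have := h1 y y0; rewrite exprS !mulrA.
Qed.

Lemma is_derive_flat p (x : R) : is_derive x 1 (flat p) (flat (flat_next p) x).
Proof.
have [x0|x0|->] := ltrgtP x 0.
- rewrite {2}/flat ltNge (ltW x0)/=.
  apply: (near_eq_is_derive _ (is_derive_cst (0 : R) x (1 : R))).
  by near=> y; rewrite /flat ltNge ltW//=; near: y; exact: lt_nbhsl.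
- rewrite {2}/flat x0.
  apply: (@near_eq_is_derive _ _ _ (fun y : R => p.[y^-1] * expR (- y^-1))).
    by near=> y; rewrite /flat ifT//; near: y; exact: lt_nbhsr.
  have dV : is_derive x 1 (fun y : R => y^-1) (- x ^- 2).
    have := @is_deriveV R id x 1 1 (lt0r_neq0 x0) (is_derive_id _ _).
    by rewrite /GRing.scale/= mulr1.
  have dp := @is_derive1_comp R (horner p) (fun y : R => y^-1) x _ _ (is_derive_poly p x^-1) dV.
  have dN : is_derive x 1 (fun y : R => - y^-1) (x ^- 2).
    by have := is_derive_cmulf (-1) dV; rewrite mulN1r opprK; under eq_fun do rewrite mulN1r.
  have de := @is_derive1_comp R expR (fun y : R => - y^-1) x _ _ (is_derive_expR _) dN.
  have := is_derive_mulf dp de => /is_derive_eq; apply.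
  have -> : (flat_next p).[x^-1] = x^-1 ^+ 2 * (p.[x^-1] - p^`().[x^-1]).
    by rewrite /flat_next hornerM hornerXn hornerD hornerN.
  rewrite exprVn /=; move: (x ^+ 2)^-1 p.[x^-1] p^`().[x^-1] (expR _) => A B C D; ring.
rewrite {2}/flat ltxx; have [C hC] := poly_expRN_bounded p 2.
have C0 : 0 <= C by apply: le_trans (hC 0 (lexx _)); rewrite expr0n/= mulr0 mul0r.
have bnd (y : R) : `|flat p y| <= C * y ^+ 2.
  rewrite /flat; case: ifP => [y0|_]; last by rewrite normr0 mulr_ge0 ?sqr_ge0.
  have := hC y^-1 (ltW (_ : 0 < y^-1)); rewrite invr_gt0 => /(_ y0) h.
  have y2 : 0 < y ^+ 2 by rewrite exprn_gt0.
  rewrite normrM (ger0_norm (expR_ge0 _)).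
  rewrite -ler_pdivrMr//; apply: le_trans h; rewrite exprVn mulrAC; exact: lexx.
suff c : (fun h : R => h^-1 *: ((flat p \o shift 0) (h *: (1 : R)) - flat p 0)) @ 0^' --> (0 : R).
  split; first by apply/cvg_ex; exists 0.
  exact: cvg_lim c.
have f0 : flat p 0 = 0 by rewrite /flat ltxx.
apply/cvgrPdist_lt => e e0; rewrite /= f0.
exists (e / (C + 1)) => /=; first by rewrite divr_gt0// ltr_wpDl.
move=> h; rewrite /= sub0r normrN => hh h0.
rewrite sub0r normrN subr0 /GRing.scale/= mulr1 addr0 normrM normfV.
have h1 : 0 < `|h| by rewrite normr_gt0.
rewrite mulrC ltr_pdivrMr//; apply: (le_lt_trans (bnd h)).
rewrite -[h ^+ 2]real_normK ?num_real// expr2 mulrA ltr_pM2r//.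
move: hh; rewrite ltr_pdivlMr ?ltr_wpDl// => hh.
by apply: le_lt_trans hh; rewrite mulrC ler_wpM2l// lerDl.
Unshelve. all: by end_near. Qed.

(** A class of functions containing [flat p] of a polynomial [l] and stable under
    differentiation, so that smoothness follows from one derivative. *)
Inductive bump_span l : (R -> R) -> Prop :=
| bump_base p q : bump_span l (fun x => flat p l.[x] * q.[x])
| bump_add f g : bump_span l f -> bump_span l g -> bump_span l (fun x => f x + g x).

Lemma bump_span_derive l f : bump_span l f ->
  exists2 g, bump_span l g & forall x : R, is_derive x 1 f (g x).
Proof.
elim=> [p q|f1 g1 _ [df df1 df2] _ [dg dg1 dg2]]; last first.
  by exists (fun x => df x + dg x); [exact: bump_add|move=> x; exact: is_derive_addf].
exists (fun x => flat (flat_next p) l.[x] * (l^`() * q).[x] + flat p l.[x] * q^`().[x]).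
  by apply: bump_add; exact: bump_base.
move=> x; have d1 := @is_derive1_comp R (flat p) (horner l) x _ _ (is_derive_flat p l.[x]) (is_derive_poly l x).
have := is_derive_mulf d1 (is_derive_poly q x) => /is_derive_eq; apply.
by rewrite hornerM mulrA.
Qed.

Lemma bump_span_derive1n l f n : bump_span l f -> bump_span l (derive1n n f).
Proof.
move=> hf; elim: n => [|n IH]; first exact: hf.
rewrite /derive1n iterS -/(derive1n n f); have [g hg dg] := bump_span_derive IH.
rewrite (_ : derive1 _ = g)//; apply: funext => x; exact: is_derive_derive1 (dg x).
Qed.

Definition bump_poly (a b : R) (n : nat) : {poly R} := n.+1%:R *: (('X - a%:P) * (b%:P - 'X)).

Definition bump (a b : R) (n : nat) (x : R) : R := flat 1 (bump_poly a b n).[x].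

Lemma bump_polyE a b n x : (bump_poly a b n).[x] = n.+1%:R * ((x - a) * (b - x)).
Proof. by rewrite /bump_poly !hornerE. Qed.

Lemma flat1_bounds (x : R) : 0 <= flat 1 x <= 1.
Proof.
rewrite /flat; case: ifP => [x0|_]; last by rewrite lexx ler01.
by rewrite hornerC mul1r expR_ge0 expR_le1 oppr_le0 invr_ge0 ltW.
Qed.

Lemma bump_outside a b n (x : R) : a < b -> x \notin `]a, b[ -> bump a b n x = 0.
Proof.
move=> ab xab; rewrite /bump /flat bump_polyE ifF//; apply/negbTE; rewrite -leNgt.
apply: mulr_ge0_le0 => //; move: xab; rewrite in_itv/= negb_and -!leNgt => /orP[h|h].
  by apply: mulr_le0_ge0; lra.
by apply: mulr_ge0_le0; lra.
Qed.

Lemma bump_cvg a b (x : R) : a < b ->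
  bump a b n x @[n --> \oo] --> (\1_(`]a, b[%classic : set R) x : R).
Proof.
move=> ab; rewrite indicE; case: (boolP (x \in `]a, b[)) => xab; last first.
  rewrite memNset/=; last by apply/negP.
  by under eq_fun do rewrite bump_outside//; exact: cvg_cst.
rewrite mem_set//=; move: xab; rewrite in_itv/= => /andP[ax xb].
set d := (x - a) * (b - x); have d0 : 0 < d by rewrite mulr_gt0 ?subr_gt0.
have E n : bump a b n x = expR (- d^-1 * n.+1%:R^-1).
  by rewrite /bump /flat bump_polyE -/d mulr_gt0// hornerC mul1r invfM mulNr mulrC.
have -> : (fun n => bump a b n x) = (fun n => expR (- d^-1 * n.+1%:R^-1)) by exact: funext.
rewrite -[X in _ --> X]expR0; apply: continuous_cvg; first exact: continuous_expR.
by rewrite -[X in _ --> X](mulr0 (- d^-1)); apply: cvgM; [exact: cvg_cst|exact: cvg_harmonic].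
Qed.

Lemma test_bump a b n : a < b -> test_function (bump a b n).
Proof.
move=> ab; have bs : bump_span (bump_poly a b n) (bump a b n).
  rewrite (_ : bump a b n = (fun x => flat 1 (bump_poly a b n).[x] * (1 : {poly R}).[x])); first exact: bump_base.
  by apply: funext => x; rewrite hornerC mulr1.
split.
  move=> k x; have [g _ dg] := bump_span_derive (bump_span_derive1n k bs).
  exact: (@ex_derive _ _ _ _ _ _ _ (dg x)).
apply: (@subclosed_compact _ _ `[a, b]%classic); [exact: closed_closure|exact: segment_compact|].
rewrite closureEbigcap => x; apply; split.
  exact: itv_closed.
move=> y /=; apply: contraNT => yab; apply/eqP; apply: bump_outside => //.
by apply: contra yab; exact: subset_itv_oo_cc.
Qed.

Lemma L2_indic a b : L2 (\1_(`[a, b]%classic : set R) : R -> R).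
Proof.
apply: (L2_of_L1_bounded (K := 1) (@integrable_indic_itv R a b true false)) => x.
by rewrite indicE; case: (_ \in _); rewrite ?normr1 ?normr0.
Qed.

Lemma null_integral_itv u a b : L2 u -> (forall h, test_function h -> \int[mu]_x (u x * h x) = 0) ->
  a < b -> \int[mu]_x (u x * \1_(`]a, b[%classic : set R) x) = 0.
Proof.
move=> uL hu ab; have mu1 : measurable_fun setT u by case: uL.
have c : \int[mu]_x (u x * bump a b n x) @[n --> \oo] --> \int[mu]_x (u x * \1_(`]a, b[%classic : set R) x).
  apply: (Rint_dominated_cvg (g := fun x => `|u x * \1_(`[a, b]%classic : set R) x|)).
  - move=> n; apply: measurable_funM => //.
    by apply: L1_measurable; exact: test_L1 (test_bump n ab).
  - by move=> x; apply: cvgM; [exact: cvg_cst|exact: bump_cvg].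
  - by apply: L1_norm; exact: L2_integrableM uL (L2_indic a b).
  - move=> n x; rewrite !normrM; apply: ler_wpM2l => //.
    rewrite indicE; case: (boolP (x \in `]a, b[)) => xab; last by rewrite bump_outside// normr0.
    rewrite mem_set /= ?normr1; last exact: subset_itv_oo_cc.
    by have /andP[h1 h2] := flat1_bounds (bump_poly a b n).[x]; rewrite ger0_norm.
have c0 : \int[mu]_x (u x * bump a b n x) @[n --> \oo] --> (0 : R).
  have -> : (fun n => \int[mu]_x (u x * bump a b n x)) = (fun=> 0).
    by apply: funext => n; apply: hu; exact: test_bump.
  exact: cvg_cst.
exact: cvg_unique c c0.
Qed.

(** The bumps increase to indicators of intervals, so [u] has zero integral over every
    interval, and Lebesgue differentiation applies. *)
Lemma null_distribution u : L2 u -> (forall h, test_function h -> \int[mu]_x (u x * h x) = 0) ->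
  {ae mu, forall x, u x = 0}.
Proof.
move=> uL hu; have lu := L2_locally_integrable uL.
apply: (ae_impl (lebesgue_differentiation lu)) => x hx.
have iab a b : mu.-integrable `[a, b]%classic (EFin \o u).
  apply/integrable_mkcond => //; have := L2_integrableM uL (L2_indic a b).
  apply: eq_integrable => // y _ /=; rewrite patchE indicE.
  by case: ifP; rewrite ?mulr1 ?mulr0.
have Iz a y : \int[mu]_(t in [set` Interval (BLeft a) (BRight y)]) u t = 0.
  have [ay|ya] := ltP a y; last first.
    have [ay|ny] := eqVneq a y.
      by rewrite ay set_itv1 Rintegral_set1.
    by rewrite set_itv_ge ?Rintegral_set0// -leNgt bnd_simp lt_neqAle eq_sym ny ya.
  have ioo : mu.-integrable `]a, y[%classic (EFin \o u).
    by apply: integrableS (iab a y) => //; exact: subset_itv_oo_cc.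
  have ico : mu.-integrable `[a, y[%classic (EFin \o u).
    by apply: integrableS (iab a y) => //; exact: subset_itv_co_cc.
  rewrite -(Rintegral_itv_bndo_bndc ico) -(Rintegral_itv_obnd_cbnd ioo).
  rewrite -(null_integral_itv uL hu ay) /Rintegral integral_mkcond; congr fine.
  by apply: eq_integral => z _; rewrite patchE indicE; case: ifP; rewrite ?mulr1 ?mulr0.
have [||_ <-] := @FTC1_lebesgue_pt R u (BLeft (x - 1)) x (x + 1) _ (iab _ _) _ hx.
- by rewrite ltrDl.
- by rewrite lte_fin gtrBl.
rewrite (_ : (fun y => _) = cst 0); last by apply: funext => y; exact: Iz.
by rewrite derive1_cst.
Qed.

Lemma weak_derive_unique n f v w : is_weak_derive n f v -> is_weak_derive n f w ->
  L2 v -> L2 w -> ae_eq mu setT v w.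
Proof.
move=> [_ _ hv] [_ _ hw] vL wL.
have h t : test_function t -> \int[mu]_x ((v x - w x) * t x) = 0.
  move=> tt; have tL := test_L2 tt.
  transitivity (\int[mu]_x (v x * t x) - \int[mu]_x (w x * t x)).
    rewrite -(RintB (L2_integrableM vL tL) (L2_integrableM wL tL)).
    by apply: eq_Rintegral => x _; rewrite mulrBl.
  have := hv _ tt; rewrite (hw _ tt) => /(congr1 (fun z => (-1) ^+ n * z)).
  by rewrite !mulrA -expr2 sqrr_sign !mul1r => ->; rewrite subrr.
by apply: (ae_impl (null_distribution (L2B vL wL) h)) => x hx _; apply/eqP; rewrite -subr_eq0 hx.
Qed.

End Bumps.

(** * Ordinary differential equations in a seminormed space *)

Section RealInduction.
Context {R : realType}.

(** A predicate on [0, T] that propagates a little to the right and passes to left limits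
    holds throughout: the supremum of the times up to which it holds is T. *)
Lemma real_induction (T : R) (P : R -> Prop) : 0 <= T -> P 0 ->
  (forall t, 0 <= t < T -> P t -> exists2 d, 0 < d & forall t', t <= t' <= t + d -> t' <= T -> P t') ->
  (forall t, 0 < t <= T -> (forall t', 0 <= t' < t -> P t') -> P t) ->
  forall t, 0 <= t <= T -> P t.
Proof.
move=> T0 P0 step lim.
pose A := [set t | 0 <= t <= T /\ forall t', 0 <= t' <= t -> P t'].
have A0 : A 0.
  split; first by rewrite lexx T0.
  by move=> t' h; have -> : t' = 0 by apply/eqP; rewrite eq_le andbC.
have ubA : ubound A T by move=> t [/andP[_ ? ] _].
have hsA : has_sup A by split; [exists 0|exists T].
set m := sup A; have m0 : 0 <= m by apply: ub_le_sup => //; exists T.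
have mT : m <= T by apply: ge_sup => //; exists 0.
have below t : 0 <= t -> t < m -> P t.
  move=> t0 tm; have [a [_ hP] ta] := sup_gt hsA.1 tm.
  by apply: hP; rewrite t0 ltW.
have Pm : P m.
  have [mz|mz] := eqVneq m 0; first by rewrite mz.
  apply: lim; first by rewrite lt_neqAle eq_sym mz m0.
  by move=> t /andP[t0 tm]; exact: below.
have Tm : T <= m.
  rewrite leNgt; apply/negP => mT'.
  have mr : 0 <= m < T by rewrite m0.
  have [d d0 hd] := step m mr Pm.
  pose t := Num.min (m + d) T.
  have tm : m < t by rewrite lt_min mT' ltrDl d0.
  have At : A t.
    split; first by rewrite (le_trans m0 (ltW tm))/= ge_min lexx orbT.
    move=> t' /andP[t'0 t't]; have [t'm|mt'] := ltP t' m; first exact: below.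
    move: t't; rewrite le_min => /andP[h1 h2].
    by apply: hd => //; rewrite mt'.
  have : t <= m by apply: ub_le_sup => //; exists T.
  by rewrite leNgt tm.
move=> t /andP[t0 tT]; have [tm|mt] := ltP t m; first exact: below.
have -> : t = m by apply/eqP; rewrite eq_le mt (le_trans tT Tm).
exact: Pm.
Qed.

End RealInduction.

(** Regroupings of sums in an abelian group, exposing the small differences
    that the estimates on Euler polygons and on pairs of curves bound. *)
Lemma add_shuffle1 (U : zmodType) (A a x B b y : U) :
  A + a + x - (B + b + y) = (x - y) + (a - b) + (A - B).
Proof. by rewrite !opprD [LHS](AC (3*3) ((3*6)*(2*5)*(1*4))). Qed.

Lemma add_shuffle2 (U : zmodType) (x a y b c : U) :
  x + a - y - (b + c) = (x - y - b) + (a - c).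
Proof. by rewrite opprD [LHS](AC (3*2) ((1*3*4)*(2*5))). Qed.

Lemma add_shuffle3 (U : zmodType) (a x y b z : U) :
  a + x + y - (b + (z + z)) = (a - b) + ((x - z) + (y - z)).
Proof. by rewrite !opprD [LHS](AC (3*(1*2)) ((1*4)*((2*5)*(3*6)))). Qed.

Lemma add_shuffle4 (U : zmodType) (x y x' y' a b c : U) :
  y - x - c = - (y' - y) + (x' - x) + ((y' - x' - a) + ((a - b) + (b - c))).
Proof.
rewrite opprB [a - b + _]addrA subrK [_ - a + _]addrA subrK.
by rewrite [RHS](AC ((2*2)*3) ((1*4*7)*((2*5)*(3*6)))) /= addNr subrr !addr0.
Qed.

Lemma add_shuffle5 (U : zmodType) (x y c d : U) : y - x + c = - (x - y - d) + (c - d).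
Proof. by rewrite !opprB [RHS](AC ((1*2)*2) ((2*3*4)*(1*5))) /= subrr addr0. Qed.

Lemma add_shuffle6 (U : zmodType) (x' x y' y : U) : x' - y' - (x - y) = (x' - x) - (y' - y).
Proof. by rewrite !opprB [LHS](AC (2*2) ((1*4)*(3*2))). Qed.

Lemma add_shuffle7 (U : zmodType) (x' x y' y a b : U) :
  x' - y' - (x - y) - (a - b) = (x' - x - a) - (y' - y - b).
Proof. by rewrite (add_shuffle6 x' x y' y) (add_shuffle6 (x' - x) a (y' - y) b). Qed.

Lemma dini_step (R : realType) (a b c k L : R) : 0 <= L -> a <= b -> 0 <= a -> 0 <= c -> k <= b ->
  a + c * (L * a) + k * c <= b * (1 + (L + 1) * c).
Proof.
move=> L0 ab a0 c0 kb; have cL := mulr_ge0 c0 L0.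
have h1 : c * L * a <= c * L * b by exact: ler_wpM2l.
have h2 : k * c <= b * c by exact: ler_wpM2r.
by nra.
Qed.

(** Elements of H^s are functions up to null sets. Instead of a quotient, a vector space
    of functions carries a subspace [E] and a seminorm [p] on it; solutions of an
    equation are then unique up to [p]-distance 0. *)
Section SeminormedODE.
Context {R : realType} {V : lmodType R}.
Variables (E : V -> Prop) (p : V -> R).
Hypotheses (ED : forall x y, E x -> E y -> E (x + y)) (EZ : forall (a : R) x, E x -> E (a *: x)).
Hypotheses (p_ge0 : forall x, 0 <= p x) (pD : forall x y, E x -> E y -> p (x + y) <= p x + p y).
Hypothesis pZ : forall (a : R) x, E x -> p (a *: x) = `|a| * p x.

Let EN x : E x -> E (- x). Proof. by rewrite -scaleN1r; exact: EZ. Qed.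
Let EB x y : E x -> E y -> E (x - y). Proof. by move=> hx hy; apply: ED => //; exact: EN. Qed.
Let pN x : E x -> p (- x) = p x. Proof. by move=> hx; rewrite -scaleN1r pZ// normrN1 mul1r. Qed.
Let pB x y : E x -> E y -> p (x - y) <= p x + p y.
Proof. by move=> hx hy; rewrite -(pN hy); apply: pD => //; exact: EN. Qed.
Lemma seminormBC x y : E x -> E y -> p (x - y) = p (y - x).
Proof. by move=> hx hy; rewrite -opprB pN//; exact: EB. Qed.
Lemma seminorm_tri x y z : E x -> E y -> E z -> p (x - z) <= p (x - y) + p (y - z).
Proof.
move=> hx hy hz; have -> : x - z = (x - y) + (y - z) by rewrite addrA subrK.
by apply: pD; exact: EB.
Qed.
Lemma seminorm_le_sub x y : E x -> E y -> p x <= p y + p (x - y).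
Proof.
by move=> hx hy; rewrite -{1}[x](subrK y) addrC; apply: pD => //; exact: EB.
Qed.

(** Differentiability at [t] relative to [0, T], with the difference quotient multiplied out
    so that [t' = t] is no exception. *)
Definition curve_derivative (T : R) (X : R -> V) (t : R) (z : V) := forall e, 0 < e ->
  exists2 d, 0 < d & forall t', 0 <= t' <= T -> `|t' - t| <= d ->
    p (X t' - X t - (t' - t) *: z) <= e * `|t' - t|.

Lemma curve_derivative_eq T X t z w : 0 <= t <= T -> (forall t, 0 <= t <= T -> E (X t)) ->
  E z -> E w -> p (z - w) = 0 -> curve_derivative T X t z -> curve_derivative T X t w.
Proof.
move=> tT hX hz hw zw h e e0; have [d d0 hd] := h e e0; exists d; first exact: d0.
move=> t' t'T t'd.
have -> : X t' - X t - (t' - t) *: w = (X t' - X t - (t' - t) *: z) + (t' - t) *: (z - w).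
  by rewrite scalerBr addrA subrK.
have hXX := EB (hX _ t'T) (hX _ tT); have hzw := EB hz hw.
apply: (le_trans (pD (EB hXX (EZ (t' - t) hz)) (EZ (t' - t) hzw))).
by rewrite (pZ _ hzw) zw mulr0 addr0; exact: hd.
Qed.

Lemma curve_derivativeB T X Y t z w : 0 <= t <= T ->
  (forall t, 0 <= t <= T -> E (X t)) -> (forall t, 0 <= t <= T -> E (Y t)) -> E z -> E w ->
  curve_derivative T X t z -> curve_derivative T Y t w ->
  curve_derivative T (fun t => X t - Y t) t (z - w).
Proof.
move=> tT hX hY hz hw dX dY e e0; have e2 : 0 < e / 2 by rewrite divr_gt0.
have [d1 d10 h1] := dX _ e2; have [d2 d20 h2] := dY _ e2.
exists (Num.min d1 d2); first by rewrite lt_min d10.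
move=> t' t'T; rewrite le_min => /andP[l1 l2].
have {}h1 := h1 t' t'T l1; have {}h2 := h2 t' t'T l2.
have EX := EB (EB (hX _ t'T) (hX _ tT)) (EZ (t' - t) hz).
have EY := EB (EB (hY _ t'T) (hY _ tT)) (EZ (t' - t) hw).
have -> : X t' - Y t' - (X t - Y t) - (t' - t) *: (z - w) =
    (X t' - X t - (t' - t) *: z) - (Y t' - Y t - (t' - t) *: w).
  by rewrite scalerBr add_shuffle7.
by apply: (le_trans (pB EX EY)); apply: (le_trans (lerD h1 h2)); rewrite -mulrDl -splitr.
Qed.

Definition curve_continuous (T : R) (X : R -> V) := forall t, 0 <= t <= T -> forall e : R, 0 < e ->
  exists2 d : R, 0 < d & forall t', 0 <= t' <= T -> `|t' - t| <= d -> p (X t' - X t) <= e.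

Lemma curve_continuousB T X Y :
  (forall t, 0 <= t <= T -> E (X t)) -> (forall t, 0 <= t <= T -> E (Y t)) ->
  curve_continuous T X -> curve_continuous T Y -> curve_continuous T (fun t => X t - Y t).
Proof.
move=> hX hY cX cY t tT e e0; have e2 : 0 < e / 2 by rewrite divr_gt0.
have [d1 d10 h1] := cX t tT _ e2; have [d2 d20 h2] := cY t tT _ e2.
exists (Num.min d1 d2); first by rewrite lt_min d10.
move=> t' t'T; rewrite le_min => /andP[l1 l2].
have -> : X t' - Y t' - (X t - Y t) = (X t' - X t) - (Y t' - Y t) by exact: add_shuffle6.
apply: (le_trans (pB (EB (hX _ t'T) (hX _ tT)) (EB (hY _ t'T) (hY _ tT)))).
by rewrite [leRHS]splitr; apply: lerD; [exact: h1|exact: h2].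
Qed.

Lemma curve_derivative_continuous T X t z : (forall t, 0 <= t <= T -> E (X t)) -> E z ->
  0 <= t <= T -> curve_derivative T X t z -> forall e, 0 < e ->
  exists2 d, 0 < d & forall t', 0 <= t' <= T -> `|t' - t| <= d -> p (X t' - X t) <= e.
Proof.
move=> EX Ez tT h e e0; have [d d0 hd] := h 1 ltr01.
have q0 : 0 < 1 + p z by rewrite ltr_pwDl.
exists (Num.min d (e / (1 + p z))); first by rewrite lt_min d0 divr_gt0.
move=> t' t'T; rewrite le_min => /andP[t1 t2].
have hz : E ((t' - t) *: z) by exact: EZ.
have hX : E (X t' - X t) by apply: EB; exact: EX.
apply: (le_trans (seminorm_le_sub hX hz)); rewrite (pZ _ Ez).
have := hd t' t'T t1; move: t2; rewrite ler_pdivlMr//.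
by move: (`|t' - t|) (p z) (p _) => a b c; nra.
Qed.

(** Differentiable curves are locally bounded, and real induction plays the role of the
    compactness of [0, T]. *)
Lemma curve_bounded T X Z : 0 <= T -> (forall t, 0 <= t <= T -> E (X t)) ->
  (forall t, 0 <= t <= T -> E (Z t)) ->
  (forall t, 0 <= t <= T -> curve_derivative T X t (Z t)) ->
  exists2 M, 0 <= M & forall t, 0 <= t <= T -> p (X t) <= M.
Proof.
move=> T0 EX EZ' dX.
have cX t : 0 <= t <= T -> exists2 d, 0 < d & forall t', 0 <= t' <= T -> `|t' - t| <= d -> p (X t') <= p (X t) + 1.
  move=> tT; have [d d0 hd] := curve_derivative_continuous EX (EZ' t tT) tT (dX t tT) ltr01.
  exists d => // t' t'T t'd; apply: (le_trans (seminorm_le_sub (EX _ t'T) (EX _ tT))).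
  by rewrite lerD2l; exact: hd.
have TT : 0 <= T <= T by rewrite T0 lexx.
have [M hM] : exists M, forall t, 0 <= t <= T -> t <= T -> p (X t) <= M.
  apply: (@real_induction R T (fun t => exists M, forall t', 0 <= t' <= T -> t' <= t -> p (X t') <= M) T0 _ _ _ T TT).
  - exists (p (X 0)) => t' /andP[h1 _] h2.
    by have -> : t' = 0 by apply/eqP; rewrite eq_le h1 h2.
  - move=> t /andP[t0 tT] [M hM]; have tT' : 0 <= t <= T by rewrite t0 ltW.
    have [d d0 hd] := cX t tT'; exists d => // t' /andP[h1 h2] h3.
    exists (Num.max M (p (X t) + 1)) => r rT rt'; rewrite le_max.
    have [rt|tr] := leP r t; first by rewrite hM.
    apply/orP; right; apply: hd => //; rewrite ger0_norm ?subr_ge0; last exact: ltW.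
    by rewrite lerBlDl; exact: le_trans h2.
  - move=> t /andP[t0 tT] hM; have tT' : 0 <= t <= T by rewrite ltW.
    have [d d0 hd] := cX t tT'.
    pose t1 := Num.max 0 (t - d).
    have t1t : 0 <= t1 < t by rewrite le_max lexx/= gt_max t0 gtrBl.
    have [M hM1] := hM t1 t1t.
    exists (Num.max M (p (X t) + 1)) => r rT rt; rewrite le_max.
    have [rt1|t1r] := leP r t1; first by rewrite hM1.
    apply/orP; right; apply: hd => //; rewrite distrC ger0_norm ?subr_ge0//.
    by move: t1r; rewrite gt_max => /andP[_ h]; lra.
exists M; last by move=> t tT; apply: hM => //; case/andP: tT.
by apply: (le_trans (p_ge0 (X 0))); apply: hM => //; rewrite lexx.
Qed.

Section Field.
Variables (f : V -> V) (rho L : R).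
Hypotheses (L0 : 0 <= L) (fE : forall x, E x -> p x <= rho -> E (f x)).
Hypothesis fL : forall x y, E x -> E y -> p x <= rho -> p y <= rho -> p (f x - f y) <= L * p (x - y).

(** The distance [D t] stays below [(D 0 + eta) * expR ((L + 1) * t)] for every [eta > 0]:
    with the rate [L + 1] instead of [L], the comparison has enough room to absorb the
    error term of a difference quotient, so that it propagates by real induction. *)
Lemma gronwall T X Y : 0 <= T ->
  (forall t, 0 <= t <= T -> E (X t) /\ p (X t) <= rho) ->
  (forall t, 0 <= t <= T -> E (Y t) /\ p (Y t) <= rho) ->
  (forall t, 0 <= t <= T -> curve_derivative T X t (f (X t))) ->
  (forall t, 0 <= t <= T -> curve_derivative T Y t (f (Y t))) ->
  forall t, 0 <= t <= T -> p (X t - Y t) <= p (X 0 - Y 0) * expR ((L + 1) * t).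
Proof.
move=> T0 hX hY dX dY.
pose D t := p (X t - Y t).
have EXY t : 0 <= t <= T -> E (X t - Y t).
  by move=> tT; apply: EB; [case: (hX t tT)|case: (hY t tT)].
(* The distance [D] need not be differentiable; difference quotients suffice. *)
have dini t : 0 <= t <= T -> forall e, 0 < e -> exists2 d, 0 < d & forall t', 0 <= t' <= T ->
    `|t' - t| <= d -> D t' <= D t + `|t' - t| * (L * D t) + e * `|t' - t|.
  move=> tT e e0; have e2 : 0 < e / 2 by rewrite divr_gt0.
  have [d1 d10 h1] := dX t tT _ e2; have [d2 d20 h2] := dY t tT _ e2.
  exists (Num.min d1 d2); first by rewrite lt_min d10.
  move=> t' t'T; rewrite le_min => /andP[l1 l2].
  have {}h1 := h1 t' t'T l1; have {}h2 := h2 t' t'T l2.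
  have [EX pX] := hX t tT; have [EY pY] := hY t tT.
  have [EX' _] := hX t' t'T; have [EY' _] := hY t' t'T.
  have Ef := EB (fE EX pX) (fE EY pY).
  have E1 : E (X t' - X t - (t' - t) *: f (X t)) by apply: EB; [exact: EB|apply: EZ; exact: fE].
  have E2 : E (Y t' - Y t - (t' - t) *: f (Y t)) by apply: EB; [exact: EB|apply: EZ; exact: fE].
  move: E1 E2 h1 h2; set A := X t' - _ - _; set B := Y t' - _ - _ => E1 E2 h1 h2.
  have XE : X t' = A + (t' - t) *: f (X t) + X t by rewrite /A !subrK.
  have YE : Y t' = B + (t' - t) *: f (Y t) + Y t by rewrite /B !subrK.
  have -> : D t' = p ((X t - Y t) + (t' - t) *: (f (X t) - f (Y t)) + (A - B)).
    by rewrite /D XE YE scalerBr add_shuffle1.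
  have Ez := EZ (t' - t) Ef.
  apply: (le_trans (pD (ED (EXY t tT) Ez) (EB E1 E2))); apply: lerD.
    apply: (le_trans (pD (EXY t tT) Ez)); rewrite lerD2l (pZ _ Ef); apply: ler_wpM2l => //.
    exact: fL.
  apply: (le_trans (pB E1 E2)); apply: (le_trans (lerD h1 h2)).
  by rewrite -mulrDl -splitr.
move=> t tT; apply/ler_addgt0Pr => e e0.
have ex0 : 0 < expR ((L + 1) * T) by exact: expR_gt0.
pose eta := e / expR ((L + 1) * T); have eta0 : 0 < eta by rewrite divr_gt0.
pose phi t := (D 0 + eta) * expR ((L + 1) * t).
have D0 : 0 <= D 0 by exact: p_ge0.
have L1 : 0 <= L + 1 by rewrite addr_ge0.
have De : 0 < D 0 + eta by rewrite ltr_wpDl.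
have phi_eta r : 0 <= r -> eta <= phi r.
  move=> r0; rewrite /phi -[leLHS]mulr1; apply: ler_pM => //; first exact: ltW.
    by rewrite lerDr.
  by rewrite -[leLHS]expR0 ler_expR mulr_ge0.
have phi_mono r r' : r <= r' -> phi r <= phi r'.
  by move=> rr; rewrite /phi ler_pM2l// ler_expR ler_wpM2l.
have phi_step r d : 0 <= d -> phi r * (1 + (L + 1) * d) <= phi (r + d).
  move=> d0; rewrite /phi (mulrDr (L + 1) r d) expRD mulrA ler_wpM2l ?expR_ge1Dx//.
  by rewrite mulr_ge0 ?expR_ge0// ltW.
have Dphi : forall r, 0 <= r <= T -> D r <= phi r.
  apply: real_induction => //.
  - by rewrite /phi mulr0 expR0 mulr1 lerDl ltW.
  - move=> r /andP[r0 rT] Dr; have rT' : 0 <= r <= T by rewrite r0 ltW.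
    have [d d0 hd] := dini r rT' eta eta0; exists d => // r' /andP[rr' r'd] r'T.
    have q0 : 0 <= r' - r by rewrite subr_ge0.
    have rr : 0 <= r' <= T by rewrite (le_trans r0 rr').
    have := hd r' rr; rewrite (ger0_norm q0) lerBlDl => /(_ r'd) h; apply: (le_trans h).
    have := phi_step r _ q0; rewrite [r + _]addrC subrK; apply: le_trans.
    have h1 := phi_eta r r0; have Dr0 : 0 <= D r by exact: p_ge0.
    exact: dini_step.
  - move=> r /andP[r0 rT] hr; have rT' : 0 <= r <= T by rewrite ltW.
    apply/ler_addgt0Pr => k k0.
    have [d1 d10 h1] := curve_derivative_continuous (fun t h => (hX t h).1) (fE (hX r rT').1 (hX r rT').2) rT' (dX r rT') (divr_gt0 k0 (ltr0Sn R 1)).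
    have [d2 d20 h2] := curve_derivative_continuous (fun t h => (hY t h).1) (fE (hY r rT').1 (hY r rT').2) rT' (dY r rT') (divr_gt0 k0 (ltr0Sn R 1)).
    pose r' := Num.max 0 (Num.max (r - d1) (r - d2)).
    have r'r : 0 <= r' < r by rewrite le_max lexx/= !gt_max r0 !gtrBl d10.
    have /andP[r'0 r'l] := r'r.
    have r'T : 0 <= r' <= T by rewrite r'0 (le_trans (ltW r'l)).
    have m1 : r - d1 <= r' by rewrite !le_max lexx !orbT.
    have m2 : r - d2 <= r' by rewrite !le_max lexx !orbT.
    have rr' : 0 <= r - r' by rewrite subr_ge0 ltW.
    have n1 : `|r' - r| <= d1 by rewrite distrC (ger0_norm rr') lerBlDr -lerBlDl.
    have n2 : `|r' - r| <= d2 by rewrite distrC (ger0_norm rr') lerBlDr -lerBlDl.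
    have {}h1 := h1 r' r'T n1; have {}h2 := h2 r' r'T n2.
    have hD := hr r' r'r; have := phi_mono _ _ (ltW r'l).
    have [EX _] := hX r rT'; have [EY _] := hY r rT'.
    have [EX' _] := hX r' r'T; have [EY' _] := hY r' r'T.
    have : D r <= D r' + p (X r' - X r) + p (Y r' - Y r).
      have t1 := seminorm_tri EX EX' EY; rewrite (seminormBC EX EX') in t1.
      apply: (le_trans (le_trans t1 (lerD (lexx _) (seminorm_tri EX' EY' EY)))).
      by rewrite addrA [X in X + _ <= _]addrC.
    move: (p _) (p _) h1 h2 hD => a b; lra.
have := Dphi t tT; rewrite /phi => h; apply: (le_trans h); rewrite mulrDl lerD2l /eta mulrAC.
rewrite ler_pdivrMr//; apply: ler_wpM2l; first exact: ltW.
by rewrite ler_expR ler_wpM2l//; case/andP: tT.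
Qed.

Section Existence.
Variables (F T rho0 : R) (x0 : V).
Hypotheses (F0 : 0 <= F) (T0 : 0 < T) (LT : L * T <= 2^-1) (FT : rho0 + T * F <= rho).
Hypotheses (Ex0 : E x0) (px0 : p x0 <= rho0).
Hypothesis fF : forall x, E x -> p x <= rho -> p (f x) <= F.
Hypothesis complete : forall (x : nat -> V) (c : R), (forall n, E (x n)) ->
  (forall n, p (x n.+1 - x n) <= c * 2^-1 ^+ n) ->
  exists2 y, E y & p (x n - y) @[n --> \oo] --> 0.

Definition euler (h : R) (k : nat) : V := iter k (fun x => x + h *: f x) x0.

Let eulerS h k : euler h k.+1 = euler h k + h *: f (euler h k). Proof. by []. Qed.

Lemma euler_ball h k : 0 <= h -> k%:R * h <= T ->
  E (euler h k) /\ p (euler h k) <= rho0 + k%:R * h * F.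
Proof.
move=> h0; elim: k => [|k IH] kT; first by rewrite !mul0r addr0.
have kT' : k%:R * h <= T by apply: le_trans kT; rewrite ler_wpM2r// ler_nat.
have [Ek pk] := IH kT'.
have pr : p (euler h k) <= rho.
  by apply: (le_trans pk); apply: le_trans FT; rewrite lerD2l ler_wpM2r.
have Ef := fE Ek pr; rewrite eulerS; split; first by apply: ED => //; exact: EZ.
apply: (le_trans (pD Ek (EZ h Ef))); rewrite (pZ _ Ef) (ger0_norm h0).
rewrite -natr1 !mulrDl mul1r addrA; apply: lerD => //; apply: ler_wpM2l => //; exact: fF.
Qed.

Let euler_rho h k : 0 <= h -> k%:R * h <= T -> p (euler h k) <= rho.
Proof.
move=> h0 kT; have [_ h1] := euler_ball h0 kT; apply: (le_trans h1).
by apply: le_trans FT; rewrite lerD2l ler_wpM2r.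
Qed.

(** Along a polygon the field varies by at most [L * F] times the elapsed time, whence the
    quadratic deviation from the tangent. *)
Lemma euler_increment h j m : 0 <= h -> (j + m)%:R * h <= T ->
  p (euler h (j + m) - euler h j) <= m%:R * h * F /\
  p (euler h (j + m) - euler h j - (m%:R * h) *: f (euler h j)) <= L * F * (m%:R * h) ^+ 2.
Proof.
move=> h0; elim: m => [|m IH] mT.
  rewrite addn0 subrr mul0r scale0r subr0 -(scale0r x0) pZ// normr0 !mul0r.
  by rewrite expr0n/= mulr0.
have mT' : (j + m)%:R * h <= T by apply: le_trans mT; rewrite ler_wpM2r// ler_nat addnS.
have jT : j%:R * h <= T by apply: le_trans mT'; rewrite ler_wpM2r// ler_nat leq_addr.
have [Ej _] := euler_ball h0 jT; have [Em _] := euler_ball h0 mT'.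
have rj := euler_rho h0 jT; have rm := euler_rho h0 mT'.
have Efj := fE Ej rj; have Efm := fE Em rm.
have [IH1 IH2] := IH mT'; rewrite addnS eulerS -natr1 mulrDl mul1r; split.
  rewrite addrAC mulrDl; apply: (le_trans (pD (EB Em Ej) (EZ h Efm))); apply: lerD => //.
  by rewrite (pZ _ Efm) (ger0_norm h0); apply: ler_wpM2l => //; exact: fF.
have -> : euler h (j + m) + h *: f (euler h (j + m)) - euler h j - (m%:R * h + h) *: f (euler h j) =
   (euler h (j + m) - euler h j - (m%:R * h) *: f (euler h j)) + h *: (f (euler h (j + m)) - f (euler h j)).
  by rewrite scalerDl scalerBr add_shuffle2.
have E1 : E (euler h (j + m) - euler h j - (m%:R * h) *: f (euler h j)).
  by apply: EB; [exact: EB|exact: EZ].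
apply: (le_trans (pD E1 (EZ h (EB Efm Efj)))); rewrite (pZ _ (EB Efm Efj)) (ger0_norm h0).
have b : h * p (f (euler h (j + m)) - f (euler h j)) <= h * (L * (m%:R * h * F)).
  apply: ler_wpM2l => //; apply: (le_trans (fL Em Ej rm rj)); exact: ler_wpM2l.
apply: (le_trans (lerD IH2 b)).
have -> : L * F * (m%:R * h) ^+ 2 + h * (L * (m%:R * h * F)) = L * F * ((m%:R * h) ^+ 2 + m%:R * h * h) by ring.
apply: ler_wpM2l; first exact: mulr_ge0.
have mh : 0 <= m%:R * h by exact: mulr_ge0.
by move: (m%:R * h) mh => a a0; nra.
Qed.

(** Halving the step adds an error [L * F * h ^+ 2 / 4] at each step, and [L * T <= 2^-1]
    keeps the amplification of the accumulated error below the same amount. *)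
Lemma euler_refine h k : 0 <= h -> k%:R * h <= T ->
  p (euler (h / 2) k.*2 - euler h k) <= L * F / 2 * h * (k%:R * h).
Proof.
move=> h0; have h20 : 0 <= h / 2 by rewrite divr_ge0.
elim: k => [|k IH] kT.
  by rewrite /euler /= subrr -(scale0r x0) pZ// normr0 !mul0r mulr0.
have kT' : k%:R * h <= T by apply: le_trans kT; rewrite ler_wpM2r// ler_nat.
have dE (m : nat) : (k.*2 + m)%:R * (h / 2) = k%:R * h + m%:R * (h / 2).
  by rewrite natrD -mul2n natrM; field.
have kT0 : (k.*2 + 0)%:R * (h / 2) <= T by rewrite dE mul0r addr0.
have kT1 : (k.*2 + 1)%:R * (h / 2) <= T.
  have k1 : k.+1%:R = k%:R + 1 :> R by rewrite -natr1.
  by rewrite dE (le_trans _ kT)// k1 mulrDl lerD2l !mul1r ler_pdivrMr//; lra.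
rewrite addn0 in kT0; rewrite addn1 in kT1.
have [E0 _] := euler_ball h20 kT0; have [E1 _] := euler_ball h20 kT1; have [Ek _] := euler_ball h0 kT'.
have r0 := euler_rho h20 kT0; have r1 := euler_rho h20 kT1; have rk := euler_rho h0 kT'.
have F0' := fE E0 r0; have F1 := fE E1 r1; have Fk := fE Ek rk.
rewrite doubleS !eulerS -eulerS.
set a := euler (h / 2) k.*2 in E0 r0 F0' *; set b := euler h k in Ek rk Fk *.
set c := euler (h / 2) k.*2.+1 in E1 r1 F1 *.
have cE : c = a + (h / 2) *: f a by [].
have -> : c + (h / 2) *: f c - (b + h *: f b) =
    (a - b) + ((h / 2) *: (f a - f b) + (h / 2) *: (f c - f b)).
  have -> : h *: f b = (h / 2) *: f b + (h / 2) *: f b by rewrite -scalerDl -splitr.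
  by rewrite cE !scalerBr add_shuffle3.
have IHk := IH kT'; rewrite -/a -/b in IHk.
have pca : p (c - a) <= h / 2 * F.
  rewrite cE addrAC subrr add0r (pZ _ F0') (ger0_norm h20); apply: ler_wpM2l => //; exact: fF.
have b1 : p ((h / 2) *: (f a - f b)) <= h / 2 * (L * p (a - b)).
  by rewrite (pZ _ (EB F0' Fk)) (ger0_norm h20); apply: ler_wpM2l => //; exact: fL.
have b2 : p ((h / 2) *: (f c - f b)) <= h / 2 * (L * (h / 2 * F + p (a - b))).
  rewrite (pZ _ (EB F1 Fk)) (ger0_norm h20); apply: ler_wpM2l => //.
  apply: (le_trans (fL E1 Ek r1 rk)); apply: ler_wpM2l => //.
  by apply: (le_trans (seminorm_tri E1 E0 Ek)); rewrite lerD2r.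
have e1 := EZ (h / 2) (EB F0' Fk); have e2 := EZ (h / 2) (EB F1 Fk).
apply: (le_trans (pD (EB E0 Ek) (ED e1 e2))).
apply: (le_trans (lerD IHk (le_trans (pD e1 e2) (lerD b1 b2)))).
have kh : 0 <= k%:R * h by exact: mulr_ge0.
have Lk : L * (k%:R * h) <= 2^-1 by apply: le_trans LT; exact: ler_wpM2l.
have LF0 : 0 <= L * F by exact: mulr_ge0.
have step : h * L * p (a - b) <= h * L * (L * F / 2 * h * (k%:R * h)).
  by apply: ler_wpM2l => //; exact: mulr_ge0.
have -> : k.+1%:R * h = k%:R * h + h by rewrite -natr1 mulrDl mul1r.
have hLF : 0 <= L * F * h ^+ 2 by rewrite mulr_ge0// sqr_ge0.
move: step IHk kh Lk; move: (k%:R * h) (p (a - b)) => w d step IHk w0 Lw.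
have key : L * F * h ^+ 2 * (L * w) <= L * F * h ^+ 2 * 2^-1 by exact: ler_wpM2l.
have -> : L * F / 2 * h * w + (h / 2 * (L * d) + h / 2 * (L * (h / 2 * F + d))) =
  L * F / 2 * h * w + h * L * d + L * F * h ^+ 2 / 4 by field.
have -> : L * F / 2 * h * (w + h) = L * F / 2 * h * w + L * F * h ^+ 2 / 2 by field.
have st : h * L * (L * F / 2 * h * w) = L * F * h ^+ 2 * (L * w) / 2 by field.
by move: step; rewrite st; move: (h * L * d) (L * F * h ^+ 2) (L * w) key => q z y key step; nra.
Qed.

Let h_ (n : nat) : R := T / 2 ^+ n.
Let k_ (n : nat) (t : R) : nat := Num.trunc (t / h_ n).
Let X_ (n : nat) (t : R) : V := euler (h_ n) (k_ n t).

Let h_gt0 n : 0 < h_ n. Proof. by rewrite divr_gt0// exprn_gt0. Qed.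

Let h_half n : h_ n / 2 = h_ n.+1.
Proof.
have p0 : 2 ^+ n != 0 :> R by rewrite expf_neq0.
by rewrite /h_ exprS; move: (2 ^+ n) p0 => q q0; field.
Qed.

Let h_cvg : h_ n @[n --> \oo] --> 0.
Proof.
have -> : h_ = (fun n => T * 2^-1 ^+ n) by apply: funext => n; rewrite /h_ exprVn.
rewrite -[X in _ --> X](mulr0 T); apply: cvgM; first exact: cvg_cst.
by apply: cvg_expr; rewrite ger0_norm ?invr_ge0// invf_lt1// ltr1n.
Qed.

Let k_itv n t : 0 <= t -> (k_ n t)%:R * h_ n <= t < ((k_ n t).+1)%:R * h_ n.
Proof.
move=> t0; have q0 : 0 <= t / h_ n by rewrite divr_ge0// ltW.
have /andP[a b] := truncn_itv q0.
by rewrite -ler_pdivlMr// a/= -ltr_pdivrMr.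
Qed.

Let k_T n t : 0 <= t <= T -> (k_ n t)%:R * h_ n <= T.
Proof. by move=> /andP[t0 tT]; have /andP[a _] := k_itv n t0; exact: le_trans tT. Qed.

Let X_E n t : 0 <= t <= T -> E (X_ n t).
Proof. by move=> tT; case: (euler_ball (ltW (h_gt0 n)) (k_T n tT)). Qed.

Let X_rho n t : 0 <= t <= T -> p (X_ n t) <= rho.
Proof. by move=> tT; exact: (euler_rho (ltW (h_gt0 n)) (k_T n tT)). Qed.

Let X_cauchy t n : 0 <= t <= T -> p (X_ n.+1 t - X_ n t) <= T * F * 2^-1 ^+ n.
Proof.
move=> tT; have /andP[t0 tT'] := tT.
have hn := ltW (h_gt0 n); have hn1 := ltW (h_gt0 n.+1).
have /andP[a1 a2] := k_itv n t0; have /andP[b1 b2] := k_itv n.+1 t0.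
have d2 : (k_ n t).*2%:R * h_ n.+1 = (k_ n t)%:R * h_ n.
  by rewrite -h_half -mul2n natrM; field.
have kle : ((k_ n t).*2 <= k_ n.+1 t)%N.
  rewrite -ltnS -(ltr_nat R) -(ltr_pM2r (h_gt0 n.+1)) d2; exact: le_lt_trans b2.
have klt : (k_ n.+1 t <= (k_ n t).*2.+1)%N.
  rewrite -ltnS -(ltr_nat R) -(ltr_pM2r (h_gt0 n.+1)); apply: (le_lt_trans b1).
  by rewrite -doubleS (_ : _.*2%:R * _ = (k_ n t).+1%:R * h_ n)// -h_half -mul2n natrM; field.
set m := (k_ n.+1 t - (k_ n t).*2)%N; have mE : k_ n.+1 t = ((k_ n t).*2 + m)%N by rewrite subnKC.
have m1 : (m <= 1)%N by rewrite leq_subLR addn1.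
have kT1 := k_T n.+1 tT; have kT := k_T n tT.
have mT : ((k_ n t).*2 + m)%:R * h_ n.+1 <= T by rewrite -mE.
have [i1 _] := euler_increment hn1 mT.
have i2 := euler_refine hn kT; rewrite h_half in i2.
have kT2 : (k_ n t).*2%:R * h_ n.+1 <= T by rewrite d2.
have [E1 _] := euler_ball hn1 kT1; have [E2 _] := euler_ball hn1 kT2; have [E3 _] := euler_ball hn kT.
rewrite /X_; apply: (le_trans (seminorm_tri E1 E2 E3)); rewrite {1}mE.
have c1 : m%:R * h_ n.+1 * F <= h_ n / 2 * F.
  rewrite -h_half in hn1 *; apply: ler_wpM2r => //; rewrite -[leRHS]mul1r; apply: ler_wpM2r => //.
  by rewrite -[1]/(1%:R) ler_nat.
have c2 : L * F / 2 * h_ n * ((k_ n t)%:R * h_ n) <= h_ n / 2 * F.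
  have -> : L * F / 2 * h_ n * ((k_ n t)%:R * h_ n) = h_ n / 2 * F * (L * ((k_ n t)%:R * h_ n)) by ring.
  rewrite -[leRHS]mulr1; apply: ler_wpM2l; first by rewrite mulr_ge0// divr_ge0.
  apply: (@le_trans _ _ (L * T)); first exact: ler_wpM2l.
  by apply: (le_trans LT); rewrite invf_le1// ler1n.
apply: (le_trans (lerD (le_trans i1 c1) (le_trans i2 c2))).
by rewrite -mulrDl -splitr /h_ exprVn mulrAC.
Qed.

(** Picard-Lindelof by dyadic Euler polygons. Halving the step changes the polygon at a fixed
    time by a geometrically small amount, so completeness gives a limit, and the quadratic
    estimate of [euler_increment] passes to it and yields the derivative. *)
Lemma ode_existence : exists X, [/\ p (X 0 - x0) = 0,
  (forall t, 0 <= t <= T -> E (X t) /\ p (X t) <= rho) &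
  forall t, 0 <= t <= T -> curve_derivative T X t (f (X t))].
Proof.
have ex t : exists y, 0 <= t <= T -> E y /\ p (X_ n t - y) @[n --> \oo] --> 0.
  have [tT|tT] := boolP (0 <= t <= T); last by exists 0.
  have [y Ey cy] := complete (fun n => X_E n tT) (fun n => X_cauchy n tT).
  by exists y.
have [X hX] := choice ex.
have XE t : 0 <= t <= T -> E (X t) by move=> /hX[].
have Xc t : 0 <= t <= T -> p (X_ n t - X t) @[n --> \oo] --> 0 by move=> /hX[].
have Xrho t : 0 <= t <= T -> p (X t) <= rho.
  move=> tT; have c : rho + p (X_ n t - X t) @[n --> \oo] --> rho.
    by rewrite -[X in _ --> X]addr0; apply: cvgD; [exact: cvg_cst|exact: Xc].
  apply: (cvgr_to_ge c); apply: nearW => n.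
  apply: (le_trans (seminorm_le_sub (XE t tT) (X_E n tT))); rewrite seminormBC; [|exact: XE|exact: X_E].
  by rewrite lerD2r X_rho.
pose g n t := (k_ n t)%:R * h_ n.
have g_le n t : 0 <= t -> `|g n t - t| <= h_ n.
  move=> t0; have /andP[a1 a2] := k_itv n t0; rewrite distrC ger0_norm ?subr_ge0//.
  by rewrite lerBlDr -[h_ n]mul1r -mulrDl [1 + _]addrC natr1 ltW.
have g_cvg t : 0 <= t -> g n t @[n --> \oo] --> t.
  move=> t0; apply/cvgrPdist_le => e e0; have /cvgrPdist_le/(_ _ e0) := h_cvg.
  apply: filterS => n; rewrite sub0r normrN (gtr0_norm (h_gt0 n)) distrC.
  by move=> he; exact: le_trans (g_le n t t0) he.
(* The quadratic estimate for polygons, between mesh points that tend to [t] and [t']. *)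
have forward t t' : 0 <= t -> t <= t' -> t' <= T ->
    p (X t' - X t - (t' - t) *: f (X t)) <= L * F * (t' - t) ^+ 2.
  move=> t0 tt t'T.
  have h' : 0 <= t' <= T by rewrite (le_trans t0 tt).
  have h : 0 <= t <= T by rewrite t0 (le_trans tt).
  have c : p (X_ n t' - X t') + p (X_ n t - X t) + (L * F * (g n t' - g n t) ^+ 2 +
      (`|(g n t' - g n t) - (t' - t)| * F + (t' - t) * (L * p (X_ n t - X t)))) @[n --> \oo] -->
      (0 : R) + 0 + (L * F * (t' - t) ^+ 2 + (`|(t' - t) - (t' - t)| * F + (t' - t) * (L * 0))).
    have cg : g n t' - g n t @[n --> \oo] --> t' - t.
      by apply: cvgB; apply: g_cvg => //; case/andP: h'.
    apply: cvgD; first by apply: cvgD; exact: Xc.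
    apply: cvgD.
      apply: cvgM; first exact: cvg_cst.
      by under eq_fun do rewrite expr2; rewrite expr2; exact: cvgM.
    apply: cvgD.
      apply: cvgM; last exact: cvg_cst.
      by apply: cvg_norm; apply: cvgB => //; exact: cvg_cst.
    by apply: cvgM; [exact: cvg_cst|apply: cvgM; [exact: cvg_cst|exact: Xc]].
  rewrite !add0r subrr normr0 mul0r !mulr0 !addr0 in c.
  apply: (cvgr_to_ge c); apply: nearW => n.
  have E1 := X_E n h'; have E2 := X_E n h; have E3 := XE t' h'; have E4 := XE t h.
  have r2 := X_rho n h; have r4 := Xrho t h; have Ef2 := fE E2 r2; have Ef4 := fE E4 r4.
  have kk : (k_ n t <= k_ n t')%N by apply: le_truncn; rewrite ler_pM2r// invr_gt0.
  have mT : (k_ n t + (k_ n t' - k_ n t))%:R * h_ n <= T by rewrite subnKC//; exact: k_T.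
  have [_ i2] := euler_increment (ltW (h_gt0 n)) mT; rewrite subnKC// in i2.
  have wE : (k_ n t' - k_ n t)%:R * h_ n = g n t' - g n t by rewrite natrB// mulrBl.
  rewrite wE -/(X_ n t) -/(X_ n t') in i2.
  set x' := X_ n t' in E1 i2 *; set x := X_ n t in E2 r2 Ef2 i2 *; set w := g n t' - g n t in i2 *.
  have -> : X t' - X t - (t' - t) *: f (X t) =
     - (x' - X t') + (x - X t) + ((x' - x - w *: f x) + ((w - (t' - t)) *: f x + (t' - t) *: (f x - f (X t)))).
    by rewrite (scalerBl w) scalerBr -add_shuffle4.
  have Ew : E (x' - x - w *: f x) by apply: EB; [exact: EB|exact: EZ].
  have Ea : E ((w - (t' - t)) *: f x) by exact: EZ.
  have Eb : E ((t' - t) *: (f x - f (X t))) by apply: EZ; exact: EB.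
  have Ec := EB E1 E3; have Ed := EB E2 E4.
  apply: (le_trans (pD (ED (EN Ec) Ed) (ED Ew (ED Ea Eb)))); apply: lerD.
    by apply: (le_trans (pD (EN Ec) Ed)); rewrite (pN Ec).
  apply: (le_trans (pD Ew (ED Ea Eb))); apply: lerD => //.
  apply: (le_trans (pD Ea Eb)); apply: lerD.
    by rewrite (pZ _ Ef2); apply: ler_wpM2l => //; exact: fF.
  rewrite (pZ _ (EB Ef2 Ef4)) ger0_norm ?subr_ge0//; apply: ler_wpM2l; first by rewrite subr_ge0.
  exact: fL.
exists X; split.
- have T00 : 0 <= (0 : R) <= T by rewrite lexx ltW.
  have c0 : p (X_ n 0 - X 0) @[n --> \oo] --> p (x0 - X 0).
    have X0 n : X_ n 0 = x0 by rewrite /X_ /k_ mul0r truncn0.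
    by under eq_fun do rewrite X0; exact: cvg_cst.
  rewrite seminormBC//; last exact: XE.
  exact: cvg_unique c0 (Xc 0 T00).
- by move=> t tT; split; [exact: XE|exact: Xrho].
move=> t tT e e0; have /andP[t0 tT'] := tT.
have LF : 0 <= L * F by exact: mulr_ge0.
pose G := 2 * (L * F) + L * (L * F) * T.
have G0 : 0 <= G by rewrite addr_ge0// !mulr_ge0// ltW.
exists (e / (G + 1)); first by rewrite divr_gt0// ltr_wpDl.
move=> t' t'T; rewrite ler_pdivlMr ?ltr_wpDl// => hd.
have /andP[t'0 t'T'] := t'T.
have [tt|tt] := leP t t'.
  apply: (le_trans (forward t t' t0 tt t'T')); rewrite ger0_norm ?subr_ge0// in hd *.
  have q0 : 0 <= t' - t by rewrite subr_ge0.
  rewrite expr2 mulrA; apply: ler_wpM2r => //; apply: le_trans hd; rewrite mulrC; apply: ler_wpM2l => //.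
  rewrite /G; have : 0 <= L * (L * F) * T by rewrite !mulr_ge0// ltW.
  by move: (L * F) LF => z z0; move: (_ * T) => y; lra.
have tt' := ltW tt; have fw := forward t' t t'0 tt' tT'.
have q0 : 0 <= t - t' by rewrite subr_ge0.
rewrite distrC (ger0_norm q0) in hd *.
set q := t - t' in q0 hd fw *.
have E1 := XE t tT; have E2 := XE t' t'T; have r1 := Xrho t tT; have r2 := Xrho t' t'T.
have Ef1 := fE E1 r1; have Ef2 := fE E2 r2.
have Eq : E (X t - X t' - q *: f (X t')) by apply: EB; [exact: EB|exact: EZ].
have XX : p (X t - X t') <= L * F * q ^+ 2 + q * F.
  have := seminorm_le_sub (EB E1 E2) (EZ q Ef2); rewrite (pZ _ Ef2) (ger0_norm q0) => h.
  apply: (le_trans h); rewrite addrC; apply: lerD => //; apply: ler_wpM2l => //; exact: fF.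
have -> : X t' - X t - (t' - t) *: f (X t) = - (X t - X t' - q *: f (X t')) + q *: (f (X t) - f (X t')).
  by rewrite -(opprB t t') scaleNr opprK -/q scalerBr -add_shuffle5.
apply: (le_trans (pD (EN Eq) (EZ q (EB Ef1 Ef2)))); rewrite (pN Eq) (pZ _ (EB Ef1 Ef2)) (ger0_norm q0).
have b : q * p (f (X t) - f (X t')) <= q * (L * (L * F * q ^+ 2 + q * F)).
  by apply: ler_wpM2l => //; apply: (le_trans (fL E1 E2 r1 r2)); exact: ler_wpM2l.
apply: (le_trans (lerD fw b)).
have qT : q <= T by rewrite /q; lra.
have -> : L * F * q ^+ 2 + q * (L * (L * F * q ^+ 2 + q * F)) = q * (2 * (L * F) + L * (L * F) * q) * q by ring.
apply: ler_wpM2r => //; apply: le_trans hd; apply: ler_wpM2l => //.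
apply: (@le_trans _ _ G); last by rewrite lerDl.
by rewrite lerD2l; apply: ler_wpM2l => //; exact: mulr_ge0.
Qed.

End Existence.
End Field.
End SeminormedODE.

(** * The normed space H^s and the nonlocal operator *)

HB.lock Definition hnorm {R : realType} (s : R) (v : R -> R) : R := fine (Hs_norm s v).

Lemma hnormE {R : realType} (s : R) v : hnorm s v = fine (Hs_norm s v).
Proof. by rewrite hnorm.unlock. Qed.

Section SobolevNorm.
Context {R : realType}.
Local Notation mu := (@lebesgue_measure R).
Variable s : R.
Local Notation hnorm := (hnorm s).
Hypothesis s0 : 0 <= s.
Implicit Types (u v w : R -> R).
Let wS := weight_ws (R := R) s.

Lemma hnorm_ge0 v : 0 <= hnorm v.
Proof. by rewrite hnormE; apply: fine_ge0; exact: poweR_ge0. Qed.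

Lemma Hs_L2 v : Hs s v -> L2 v.
Proof. by move=> /HsP[]. Qed.

Lemma Hs_normK v : Hs s v -> Hs_norm s v = (hnorm v)%:E.
Proof. by move=> [_ h]; rewrite hnormE fineK// ge0_fin_numE ?poweR_ge0. Qed.

Lemma hsK v : Hs s v -> hs s v = (hnorm v ^+ 2)%:E.
Proof.
move=> hv; have [vL hf] := (HsP s v).1 hv.
have h0 : (0 <= hs s v)%E by exact: hsq_ge0.
have E : (hs s v)%E = (fine (hs s v))%:E by rewrite fineK// ge0_fin_numE.
rewrite E hnormE Hs_normE E poweR_EFin/= -powR_mulrn ?powR_ge0// -powRrM mulVf// powRr1//.
exact: fine_ge0.
Qed.

Lemma Hs_of_le u v (c : R) : Hs s v -> L2 u -> (hs s u <= (c ^+ 2)%:E * hs s v)%E -> 0 <= c ->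
  Hs s u /\ hnorm u <= c * hnorm v.
Proof.
move=> hv uL h c0; rewrite (hsK hv) -EFinM -exprMn in h.
have hu : Hs s u by apply/HsP; split => //; apply: (le_lt_trans h); rewrite ltry.
split => //; rewrite (hsK hu) lee_fin in h.
by move: h; rewrite ler_sqr ?nnegrE ?mulr_ge0 ?hnorm_ge0.
Qed.

Lemma Hs_ball u (M : R) : 0 <= M -> (Hs s u /\ hnorm u <= M) <-> hs_ball s (M ^+ 2) u.
Proof.
move=> M0; split => [[hu uM]|[uL h]].
  by split; [exact: Hs_L2|rewrite (hsK hu) lee_fin ler_sqr ?nnegrE ?hnorm_ge0].
have hu : Hs s u by apply/HsP; split => //; apply: (le_lt_trans h); rewrite ltry.
by split => //; move: h; rewrite (hsK hu) lee_fin ler_sqr ?nnegrE ?hnorm_ge0.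
Qed.

Lemma HsD u v : Hs s u -> Hs s v -> Hs s (fun x => u x + v x) /\
  hnorm (fun x => u x + v x) <= hnorm u + hnorm v.
Proof.
move=> hu hv; have uL := Hs_L2 hu; have vL := Hs_L2 hv.
have h : (Hs_norm s (fun x => u x + v x)%R <= (hnorm u + hnorm v)%:E)%E.
  have -> : (hnorm u + hnorm v)%:E = (Hs_norm s u + Hs_norm s v)%E.
    by rewrite EFinD; congr (_ + _)%E; apply: esym; exact: Hs_normK.
  rewrite !Hs_normE (hsqE wS (L2D uL vL) (is_fourierL2D uL vL (fourierL2P uL) (fourierL2P vL))).
  exact: wsq_triangle wS (mC_fourierL2 uL) (mC_fourierL2 vL).
have hw : Hs s (fun x => u x + v x).
  by split; [apply/LfunL2; exact: L2D|apply: (le_lt_trans h); rewrite ltry].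
by split => //; rewrite -lee_fin -(Hs_normK hw).
Qed.

Lemma HsZ (c : R) u : Hs s u -> Hs s (fun x => c * u x) /\ hnorm (fun x => c * u x) = `|c| * hnorm u.
Proof.
move=> hu; have uL := Hs_L2 hu; have E := hsqZ c wS uL; rewrite (hsK hu) -EFinM in E.
have hw : Hs s (fun x => c * u x) by apply/HsP; split; [exact: L2Z|rewrite E ltry].
split => //; apply/eqP; rewrite -(eqrXn2 (n := 2)) ?mulr_ge0 ?hnorm_ge0//.
by move: E; rewrite (hsK hw) => -[->]; rewrite exprMn real_normK ?num_real.
Qed.

Lemma HsB u v : Hs s u -> Hs s v -> Hs s (fun x => u x - v x).
Proof.
move=> hu hv; have [h _] := HsZ (-1) hv; have [] := HsD hu h.
by under eq_fun do rewrite mulN1r.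
Qed.

Lemma hnorm_tri u v w : Hs s u -> Hs s v -> Hs s w ->
  hnorm (fun x => u x - w x) <= hnorm (fun x => u x - v x) + hnorm (fun x => v x - w x).
Proof.
move=> hu hv hw; have [_] := HsD (HsB hu hv) (HsB hv hw).
by rewrite (_ : (fun x => u x - v x + (v x - w x)) = (fun x => u x - w x))//; apply: funext => x; ring.
Qed.

Lemma hnorm_nsq u : Hs s u -> (nsq u <= (hnorm u ^+ 2)%:E)%E.
Proof.
move=> hu; have uL := Hs_L2 hu; rewrite -(hsK hu); apply: le_trans (hs_le s0 uL); exact: hs0_nsq.
Qed.

Lemma hnorm_eq0 u v : Hs s u -> Hs s v -> hnorm (fun x => u x - v x) = 0 -> ae_eq mu setT u v.
Proof.
move=> hu hv h; have := hnorm_nsq (HsB hu hv); rewrite h expr0n/= => h0.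
have [mB _] := L2B (Hs_L2 hu) (Hs_L2 hv).
have z : nsq (fun x => u x - v x) = 0%E by apply/eqP; rewrite eq_le h0 nsq_ge0.
by apply: (ae_impl (nsq_eq0 mB z)) => x hx _; apply/eqP; rewrite -subr_eq0; apply/eqP; exact: hx.
Qed.

Lemma hnorm_ae u v : L2 u -> L2 v -> ae_eq mu setT u v -> hnorm (fun x => u x - v x) = 0.
Proof.
move=> uL vL uv; suff z : hs s (fun x => u x - v x) = 0%E by rewrite hnormE Hs_normE z poweR0r ?invr_eq0.
rewrite -(hsq_zero wS); apply: (hsq_ae wS (L2B uL vL) (L2_0 (R := R))).
by apply: (ae_impl uv) => x hx _; rewrite hx// subrr.
Qed.

(** A Cauchy sequence converges in L^2, and lower semicontinuity of the norm turns the Cauchy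
    bounds into bounds on the distance to the limit. *)
Lemma hnorm_complete (v : nat -> R -> R) (c : R) : (forall n, Hs s (v n)) ->
  (forall n, hnorm (fun x => v n.+1 x - v n x) <= c * 2^-1 ^+ n) ->
  exists2 w, Hs s w & hnorm (fun x => v n x - w x) @[n --> \oo] --> 0.
Proof.
move=> hv hc; have vL n := Hs_L2 (hv n).
have c0 : 0 <= c by have := hc 0%N; rewrite expr0 mulr1; apply: le_trans; exact: hnorm_ge0.
have far n k : hnorm (fun x => v (n + k)%N x - v n x) <= 2 * c * 2^-1 ^+ n.
  suff : hnorm (fun x => v (n + k)%N x - v n x) <= 2 * c * 2^-1 ^+ n - 2 * c * 2^-1 ^+ (n + k).
    move=> h; apply: (le_trans h); rewrite gerBl !mulr_ge0// exprn_ge0// invr_ge0//.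
  elim: k => [|k IH].
    rewrite addn0 subrr (_ : (fun x => _) = (fun=> 0)); last by apply: funext => x; rewrite subrr.
    have [_ h] := HsZ 0 (hv 0%N); rewrite normr0 mul0r in h; rewrite -[leRHS]h.
    have -> : (fun x => 0 * v 0%N x) = (fun=> 0) by apply: funext => x; rewrite mul0r.
    exact: lexx.
  rewrite addnS; apply: (le_trans (hnorm_tri (hv _) (hv (n + k)%N) (hv n))).
  apply: (le_trans (lerD (hc _) IH)); rewrite exprS.
  by move: (2^-1 ^+ (n + k)) => q; lra.
have e2 : 2^-1 ^+ n @[n --> \oo] --> (0 : R).
  by apply: cvg_expr; rewrite ger0_norm ?invr_ge0// invf_lt1// ltr1n.
have [e e0|w wL cw] := L2_complete vL.
  have e0' : 0 < e by [].
  have cq : (2 * c * 2^-1 ^+ n) ^+ 2 @[n --> \oo] --> (0 : R).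
    rewrite -[X in _ --> X](mulr0 (0 : R)).
    have -> : (fun n => (2 * c * 2^-1 ^+ n) ^+ 2) = (fun n => (2 * c * 2^-1 ^+ n) * (2 * c * 2^-1 ^+ n)).
      by apply: funext => n; rewrite expr2.
    by apply: cvgM; rewrite -[X in _ --> X](mulr0 (2 * c)); apply: cvgM => //; exact: cvg_cst.
  have e4 : 0 < e / 4 by rewrite divr_gt0.
  have /cvgrPdist_le/(_ _ e4)[N _ hN] := cq.
  have near_N m : (N <= m)%N -> (nsq (fun x => v m x - v N x)%R <= (e / 4)%:E)%E.
    move=> Nm; apply: (le_trans (hnorm_nsq (HsB (hv m) (hv N)))); rewrite lee_fin.
    have := hN N (leqnn N); rewrite sub0r normrN ger0_norm ?sqr_ge0// => h; apply: le_trans h.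
    rewrite ler_sqr ?nnegrE ?hnorm_ge0//; first by rewrite -(subnKC Nm); exact: far.
    by rewrite !mulr_ge0// exprn_ge0// invr_ge0.
  exists N => m n Nm Nn; have mv k : measurable_fun setT (v k) by case: (vL k).
  apply: (le_trans (nsq_tri (mv m) (mv N) (mv n))); rewrite [X in (_ + _ * X)%E]nsqB.
  rewrite (_ : e = 2 * (e / 4) + 2 * (e / 4)); last by field.
  by apply: lee_sum2; apply: lee_scale => //; exact: near_N.
have close n : Hs s (fun x => v n x - w x) /\ hnorm (fun x => v n x - w x) <= 2 * c * 2^-1 ^+ n.
  have q0 : 0 <= 2 * c * 2^-1 ^+ n by rewrite !mulr_ge0// exprn_ge0// invr_ge0.
  apply/(Hs_ball _ q0); split; first exact: L2B.
  rewrite (hsqB_sym wS (vL n) wL).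
  apply: (hsq_lsc (vn := fun k x => v (n + k)%N x - v n x) wS (L2B wL (vL n))).
  - by move=> k; exact: L2B.
  - have E k : (fun x => v (n + k)%N x - v n x - (w x - v n x)) = (fun x => v (n + k)%N x - w x).
      by apply: funext => x; ring.
    under eq_fun do rewrite E.
    by have := cw; rewrite -(cvg_shiftn n); under eq_fun do rewrite addnC.
  - by move=> k; apply: ((Hs_ball _ q0).1 _).2; split; [exact: HsB|exact: far].
exists w.
  have := HsB (hv 0%N) (close 0%N).1.
  by rewrite (_ : (fun x => _) = w)//; apply: funext => x; ring.
apply: (@squeeze_cvgr _ _ _ _ (fun=> 0) (fun n => 2 * c * 2^-1 ^+ n)).
- by apply: nearW => n; rewrite hnorm_ge0; case: (close n).
- exact: cvg_cst.
- by rewrite -[X in _ --> X](mulr0 (2 * c)); apply: cvgM => //; exact: cvg_cst.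
Qed.

End SobolevNorm.

Section NonlocalOperator.
Context {R : realType}.
Local Notation mu := (@lebesgue_measure R).
Local Notation conv := (@Defs.conv R).
Variables (s : R) (b : R -> R) (C : R).
Hypotheses (s2 : 2^-1 < s) (C0 : 0 <= C) (b1 : L1 b).
Hypothesis bC : forall xi, (xi ^+ 2) ^+ 2 * sqnormc (fourier b xi) <= C ^+ 2.
Let s0 : 0 <= s. Proof. by apply: le_trans (ltW s2); rewrite invr_ge0. Qed.
Let wS := weight_ws (R := R) s.

(** A representative of the weak second derivative of [conv b h]; its transform determines
    it almost everywhere. *)
Definition conv_dd (h : R -> R) : R -> R :=
  xget (fun=> 0) [set v | [/\ L2 v, is_fourierL2 v (fun xi => conv_symbol b xi * fourierL2 h xi) &
    is_weak_derive 2 (conv b h) v]].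

Lemma conv_ddP h : Hs s h -> [/\ L2 (conv_dd h),
  is_fourierL2 (conv_dd h) (fun xi => conv_symbol b xi * fourierL2 h xi) &
  is_weak_derive 2 (conv b h) (conv_dd h)].
Proof.
move=> hh; have hL := Hs_L2 hh; have A0 : 0 <= hnorm s h ^+ 2 by exact: sqr_ge0.
have hA : (hs s h <= (hnorm s h ^+ 2)%:E)%E by rewrite hsK.
have K0 : 0 <= sup_bound s (hnorm s h ^+ 2).
  by rewrite /sup_bound !addr_ge0//; apply: Rintegral_ge0 => x _; exact: powR_ge0.
have [v vL [v1 v2]] := second_derivative_conv b1 bC K0 hL (embedding s2 hL hA).
have ex : [set v | [/\ L2 v, is_fourierL2 v (fun xi => conv_symbol b xi * fourierL2 h xi) &
    is_weak_derive 2 (conv b h) v]] v by [].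
exact: (xgetI (fun=> 0) ex).
Qed.

(** The symbol is bounded by [C], and the weights are the same on both sides. *)
Lemma conv_dd_lipschitz h h' : Hs s h -> Hs s h' ->
  hnorm s (fun x => conv_dd h x - conv_dd h' x) <= C * hnorm s (fun x => h x - h' x).
Proof.
move=> hh hh'; have [vL vF _] := conv_ddP hh; have [vL' vF' _] := conv_ddP hh'.
have hL := Hs_L2 hh; have hL' := Hs_L2 hh'; have msym := mC_conv_symbol b1.
suff le : (hs s (fun x => conv_dd h x - conv_dd h' x)%R <= (C ^+ 2)%:E * hs s (fun x => h x - h' x)%R)%E.
  by have [] := Hs_of_le (HsB hh hh') (L2B vL vL') le C0.
rewrite (hsqE wS (L2B vL vL') (is_fourierL2B vL vL' vF vF')).
have FB := is_fourierL2B hL hL' (fourierL2P hL) (fourierL2P hL').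
rewrite (hsqE wS (L2B hL hL') FB).
apply: wsq_le => //.
- by apply: mCB; apply: mCM => //; exact: mC_fourierL2.
- exact: is_fourierL2_mC FB.
- exact: sqr_ge0.
apply: aeW => xi; rewrite -mulrBr sqnormcM mulrCA; apply: ler_wpM2r.
  by rewrite mulr_ge0 ?sqnormc_ge0//; case: wS.
by rewrite /conv_symbol sqnormcM sqnormcC sqrrN; exact: bC.
Qed.

Lemma Hs_conv_dd h : Hs s h -> Hs s (conv_dd h).
Proof.
move=> hh; have [vL vF _] := conv_ddP hh; have hL := Hs_L2 hh; have msym := mC_conv_symbol b1.
suff le : (hs s (conv_dd h) <= (C ^+ 2)%:E * hs s h)%E by have [] := Hs_of_le hh vL le C0.
rewrite (hsqE wS vL vF); apply: wsq_le => //.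
- by apply: mCM => //; exact: mC_fourierL2.
- exact: mC_fourierL2.
- exact: sqr_ge0.
apply: aeW => xi; rewrite sqnormcM mulrCA; apply: ler_wpM2r.
  by rewrite mulr_ge0 ?sqnormc_ge0//; case: wS.
by rewrite /conv_symbol sqnormcM sqnormcC sqrrN; exact: bC.
Qed.

End NonlocalOperator.

(** The only place where [2 <= r] enters: two derivatives are compensated by the decay of the
    kernel, so that the nonlocal operator loses no regularity. *)
Lemma kernel_decay (R : realType) (b : R -> R) (C r : R) : 2 <= r -> 0 < C ->
  (forall xi, 0 <= fourier b xi <= (C * (1 + xi ^+ 2) `^ (- r / 2))%:C) ->
  forall xi, (xi ^+ 2) ^+ 2 * sqnormc (fourier b xi) <= C ^+ 2.
Proof.
move=> r2 C0 hb xi; have := hb xi; case: (fourier b xi) => p q.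
rewrite !lecE /= => /andP[/andP[/eqP q0 p0] /andP[_ pC]].
rewrite /sqnormc /= q0 expr0n/= addr0 -exprMn.
have x0 : 0 <= xi ^+ 2 by exact: sqr_ge0.
have x1 : 1 <= 1 + xi ^+ 2 by exact: one_le_1sqr.
have C0' := ltW C0; rewrite ler_sqr ?nnegrE //; last exact: mulr_ge0.
apply: (@le_trans _ _ ((1 + xi ^+ 2) * (C * (1 + xi ^+ 2) `^ (-1)))).
  apply: ler_pM => //; first by rewrite lerDr.
  apply: (le_trans pC); apply: ler_wpM2l; first exact: ltW.
  by rewrite ler_powR//; lra.
rewrite powRN powRr1 ?(le_trans ler01 x1)// mulrCA mulfV ?mulr1// gt_eqF//.
exact: lt_le_trans x1.
Qed.

(** * Curves in a product of Sobolev spaces *)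

Lemma finite_radius (R : realType) (J : finType) (P : J -> R -> Prop) :
  (forall j d d', d' <= d -> P j d -> P j d') -> (forall j, exists2 d : R, 0 < d & P j d) ->
  exists2 d : R, 0 < d & forall j, P j d.
Proof.
move=> mono ex; have [d hd] := choice (fun j => let: ex_intro2 d h1 h2 := ex j in ex_intro _ d (conj h1 h2)).
exists (\big[Num.min/1]_j d j); first by apply: lt_bigmin => // j _; case: (hd j).
by move=> j; apply: mono (hd j).2; exact: bigmin_le_cond.
Qed.

Lemma sum_bool_pair (V : nmodType) (I : finType) (F : bool * I -> V) :
  \sum_j F j = \sum_i (F (false, i) + F (true, i)).
Proof.
rewrite (eq_bigr (fun j => F (j.1, j.2))); last by case.
by rewrite -(pair_bigA _ (fun b i => F (b, i))) /= big_bool /= -big_split; apply: eq_bigr => i _; exact: addrC.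
Qed.

Lemma nbhs_closed_ball (R : realType) (t : R) (Q : R -> Prop) :
  (\forall t' \near t, Q t') <-> exists2 d : R, 0 < d & forall t', `|t' - t| <= d -> Q t'.
Proof.
split=> [/nbhs_ballP[d /= d0 hd]|[d d0 hd]].
  exists (d / 2); first by rewrite divr_gt0.
  move=> t' h; apply: hd; rewrite /ball/= distrC; apply: (le_lt_trans h).
  by rewrite ltr_pdivrMr// mulr_natr mulr2n ltrDl.
apply/nbhs_ballP; exists d => //= t'; rewrite /ball/= distrC => h.
by apply: hd; exact: ltW.
Qed.

Section HsConvergence.
Context {R : realType}.
Variable s : R.
Implicit Types (T t : R) (u v : R -> R -> R).

Lemma Hs_cvg0P (F : set_system R) (FF : Filter F) u : (\forall t \near F, Hs s (u t)) ->
  (Hs_norm s (u t) @[t --> F] --> 0%E) <->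
  (forall e : R, 0 < e -> \forall t \near F, hnorm s (u t) <= e).
Proof.
move=> uF; split=> [/fine_cvgP[_ /cvgrPdist_le h] e e0|h].
  apply: filterS (h e e0) => t; rewrite sub0r normrN /= -hnormE ger0_norm//; exact: hnorm_ge0.
apply/fine_cvgP; split.
  by apply: filterS uF => t /Hs_normK ->.
apply/cvgrPdist_le => e e0; apply: filterS (h e e0) => t.
by rewrite sub0r normrN /= -hnormE ger0_norm//; exact: hnorm_ge0.
Qed.

Lemma Hs_continuousP T u : (forall t, 0 <= t <= T -> Hs s (u t)) ->
  Hs_continuous s T u <-> forall t, 0 <= t <= T -> forall e : R, 0 < e -> exists2 d : R, 0 < d &
    forall t', 0 <= t' <= T -> `|t' - t| <= d -> hnorm s (fun x => u t' x - u t x) <= e.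
Proof.
move=> hu; pose w t t' x := u t' x - u t x.
have H t : 0 <= t <= T -> \forall t' \near within `[0, T] (nbhs t), Hs s (w t t').
  move=> tT; apply: (@nearW _ (nbhs t)) => t' /=; rewrite in_itv/= => t'T.
  by apply: HsB; exact: hu.
split=> h t tT.
  have tT' : t \in `[0, T] by rewrite in_itv.
  have /(Hs_cvg0P _ (H t tT)) {}h := h t tT'; move=> e e0.
  have [d d0 hd] := (nbhs_closed_ball _ _).1 (h e e0); exists d => // t' t'T t'd.
  by apply: (hd t' t'd); rewrite /= in_itv.
rewrite in_itv/= in tT; apply/(Hs_cvg0P _ (H t tT)) => e e0.
have [d d0 hd] := h t tT e e0; apply/nbhs_closed_ball; exists d => // t' t'd.
by rewrite /= in_itv/= => t'T; exact: hd.
Qed.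

(** The same derivative without division, including [t' = t]. *)
Lemma Hs_is_deriveP T u v : (forall t, 0 <= t <= T -> Hs s (u t)) ->
  (forall t, 0 <= t <= T -> Hs s (v t)) ->
  Hs_is_derive s T u v <-> forall t, 0 <= t <= T -> forall e : R, 0 < e -> exists2 d : R, 0 < d &
    forall t', 0 <= t' <= T -> `|t' - t| <= d ->
      hnorm s (fun x => u t' x - u t x - (t' - t) * v t x) <= e * `|t' - t|.
Proof.
move=> hu hv; pose w t t' x := (t' - t)^-1 * (u t' x - u t x) - v t x.
have Hw t t' : 0 <= t <= T -> 0 <= t' <= T -> Hs s (w t t').
  move=> tT t'T; apply: HsB; last exact: hv.
  by have [] := HsZ (t' - t)^-1 (HsB (hu _ t'T) (hu _ tT)).
have H t : 0 <= t <= T -> \forall t' \near within `[0, T] t^', Hs s (w t t').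
  move=> tT; apply: (@nearW _ (nbhs t)) => t' _ /=; rewrite in_itv/= => t'T.
  exact: Hw.
have E t t' : 0 <= t <= T -> 0 <= t' <= T -> t' != t ->
    hnorm s (fun x => u t' x - u t x - (t' - t) * v t x) = `|t' - t| * hnorm s (w t t').
  move=> tT t'T tt; have [_ <-] := HsZ (t' - t) (Hw t t' tT t'T); congr hnorm.
  by apply: funext => x; rewrite /w mulrBr mulrA mulfV ?subr_eq0// mul1r.
split=> h t tT.
  have tT' : t \in `[0, T] by rewrite in_itv.
  have /(Hs_cvg0P _ (H t tT)) {}h := h t tT'; move=> e e0.
  have [d d0 hd] := (nbhs_closed_ball _ _).1 (h e e0); exists d => // t' t'T t'd.
  have [->|tt] := eqVneq t' t.
    have -> : (fun x => u t x - u t x - (t - t) * v t x) = (fun x => 0 * u t x).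
      by apply: funext => x; rewrite !subrr !mul0r subrr.
    by have [_ ->] := HsZ 0 (hu _ tT); rewrite subrr normr0 mul0r mulr0.
  rewrite (E _ _ tT t'T tt) mulrC; apply: ler_wpM2r => //.
  by apply: (hd t' t'd tt); rewrite /= in_itv.
rewrite in_itv/= in tT; apply/(Hs_cvg0P _ (H t tT)) => e e0.
have [d d0 hd] := h t tT e e0; apply/nbhs_closed_ball; exists d => // t' t'd.
rewrite /= in_itv/= => tt t'T; have := hd t' t'T t'd; rewrite (E _ _ tT t'T tt) mulrC ler_pM2r//.
by rewrite normr_gt0 subr_eq0.
Qed.

End HsConvergence.

HB.lock Definition snorm {R : realType} (s : R) (z : (bool * 'I_2)%type -> R -> R) : R :=
  \sum_j hnorm s (z j).

Section StateSpace.
Context {R : realType}.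
Variable s : R.
Hypothesis s0 : 0 <= s.
Local Notation state := ((bool * 'I_2)%type -> R -> R).
Implicit Types (z w : state) (t T : R).

Definition in_Hs z := forall j, Hs s (z j).
Local Notation snorm := (snorm s).

Lemma in_HsD z w : in_Hs z -> in_Hs w -> in_Hs (z + w).
Proof. by move=> hz hw j; have [] := HsD (hz j) (hw j). Qed.

Lemma in_HsZ (a : R) z : in_Hs z -> in_Hs (a *: z).
Proof. by move=> hz j; have [] := HsZ a (hz j). Qed.

Lemma in_HsB z w : in_Hs z -> in_Hs w -> in_Hs (z - w).
Proof. by move=> hz hw j; exact: HsB (hz j) (hw j). Qed.

Lemma snorm_ge0 z : 0 <= snorm z.
Proof. by rewrite snorm.unlock; apply: sumr_ge0 => j _; exact: hnorm_ge0. Qed.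

Lemma snormD z w : in_Hs z -> in_Hs w -> snorm (z + w) <= snorm z + snorm w.
Proof.
by move=> hz hw; rewrite snorm.unlock -big_split; apply: ler_sum => j _; have [] := HsD (hz j) (hw j).
Qed.

Lemma snormZ (a : R) z : in_Hs z -> snorm (a *: z) = `|a| * snorm z.
Proof.
by move=> hz; rewrite snorm.unlock mulr_sumr; apply: eq_bigr => j _; have [] := HsZ a (hz j).
Qed.

Lemma snormBC z w : in_Hs z -> in_Hs w -> snorm (z - w) = snorm (w - z).
Proof. exact: (seminormBC in_HsD in_HsZ snormZ). Qed.

Lemma snorm_tri x z w : in_Hs x -> in_Hs z -> in_Hs w -> snorm (x - w) <= snorm (x - z) + snorm (z - w).
Proof. exact: (seminorm_tri in_HsD in_HsZ snormD). Qed.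

Lemma snorm_le_sub z w : in_Hs z -> in_Hs w -> snorm z <= snorm w + snorm (z - w).
Proof. exact: (seminorm_le_sub in_HsD in_HsZ snormD). Qed.

Lemma snormE z : snorm z = \sum_i (hnorm s (z (false, i)) + hnorm s (z (true, i))).
Proof. by rewrite snorm.unlock sum_bool_pair. Qed.

Lemma snorm_null z : (forall j, hnorm s (z j) = 0) -> snorm z = 0.
Proof. by move=> h; rewrite snorm.unlock big1. Qed.

Lemma hnorm_le_snorm z j : hnorm s (z j) <= snorm z.
Proof.
rewrite snorm.unlock (bigD1 j)//= lerDl; apply: sumr_ge0 => k _; exact: hnorm_ge0.
Qed.

Lemma snorm_le z (e : R) : (forall j, hnorm s (z j) <= e) -> snorm z <= 4 * e.
Proof.
move=> h; rewrite snorm.unlock; apply: (le_trans (ler_sum _ (fun j _ => h j))).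
by rewrite sumr_const card_prod card_bool card_ord /= mulr_natl.
Qed.

Lemma snorm_eq0 z w : in_Hs z -> in_Hs w -> snorm (z - w) = 0 ->
  forall j, ae_eq lebesgue_measure setT (z j) (w j).
Proof.
move=> hz hw h j; apply: (hnorm_eq0 s0 (hz j) (hw j)).
by apply/eqP; rewrite eq_le hnorm_ge0 andbT -h; exact: (hnorm_le_snorm (z - w) j).
Qed.

Lemma snorm_complete (z : nat -> state) (c : R) : (forall n, in_Hs (z n)) ->
  (forall n, snorm (z n.+1 - z n) <= c * 2^-1 ^+ n) ->
  exists2 w, in_Hs w & snorm (z n - w) @[n --> \oo] --> 0.
Proof.
move=> hz hc.
have ex j : exists y, Hs s y /\ hnorm s (fun x => z n j x - y x) @[n --> \oo] --> 0.
  have [n|y hy cy] := @hnorm_complete _ _ s0 (fun n => z n j) c (fun n => hz n j).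
    by apply: le_trans (hc n); exact: (hnorm_le_snorm (z n.+1 - z n) j).
  by exists y.
have [w hw] := choice ex; exists w; first by move=> j; case: (hw j).
have -> : (fun n => snorm (z n - w)) = (fun n => \sum_j hnorm s (fun x => z n j x - w j x)).
  by apply: funext => n; rewrite snorm.unlock.
rewrite -[X in _ --> X](_ : \sum_(j : bool * 'I_2) (0 : R) = 0); last by rewrite big1.
by apply: cvg_big => [|j _]; [exact: add_continuous|case: (hw j)].
Qed.

Lemma curve_derivativeP T (X : R -> state) t z :
  curve_derivative snorm T X t z <-> forall j, forall e : R, 0 < e -> exists2 d : R, 0 < d &
    forall t', 0 <= t' <= T -> `|t' - t| <= d ->
      hnorm s (fun x => X t' j x - X t j x - (t' - t) * z j x) <= e * `|t' - t|.
Proof.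
split=> [h j e e0|h e e0].
  have [d d0 hd] := h e e0; exists d => // t' t'T t'd; apply: le_trans (hd t' t'T t'd).
  exact: (hnorm_le_snorm (X t' - X t - (t' - t) *: z) j).
have e4 : 0 < e / 4 by rewrite divr_gt0.
have [|d d0 hd] := @finite_radius R _ _ _ (fun j => h j _ e4).
  by move=> j d d' dd hd t' t'T t'd; apply: hd => //; exact: le_trans dd.
exists d => // t' t'T t'd.
rewrite (_ : e * _ = 4 * (e / 4 * `|t' - t|)); last by move: (`|_|) => q; field.
by apply: snorm_le => j; exact: hd.
Qed.

Lemma curve_continuousP T (X : R -> state) : curve_continuous snorm T X <->
  forall j t, 0 <= t <= T -> forall e : R, 0 < e -> exists2 d : R, 0 < d &
    forall t', 0 <= t' <= T -> `|t' - t| <= d -> hnorm s (fun x => X t' j x - X t j x) <= e.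
Proof.
split=> [h j t tT e e0|h t tT e e0].
  have [d d0 hd] := h t tT e e0; exists d => // t' t'T t'd; apply: le_trans (hd t' t'T t'd).
  exact: (hnorm_le_snorm (X t' - X t) j).
have e4 : 0 < e / 4 by rewrite divr_gt0.
have [|d d0 hd] := @finite_radius R _ _ _ (fun j => h j t tT _ e4).
  by move=> j d d' dd hd t' t'T t'd; apply: hd => //; exact: le_trans dd.
exists d => // t' t'T t'd.
rewrite (_ : e = 4 * (e / 4)); last by field.
by apply: snorm_le => j; exact: hd.
Qed.

(** The state of a second-order system consists of positions (first component
    [false]) and velocities ([true]). *)
Definition phase_curve (u v : 'I_2 -> R -> R -> R) : R -> state :=
  fun t j => if j.1 then v j.2 t else u j.2 t.

Lemma phase_curve_derivative T (u ut utt : 'I_2 -> R -> R -> R) :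
  (forall i, C2_Hs s T (u i) (ut i) (utt i)) ->
  [/\ forall t, 0 <= t <= T -> in_Hs (phase_curve u ut t),
      forall t, 0 <= t <= T -> in_Hs (phase_curve ut utt t),
      forall t, 0 <= t <= T ->
        curve_derivative snorm T (phase_curve u ut) t (phase_curve ut utt t) &
      curve_continuous snorm T (phase_curve ut utt)].
Proof.
move=> hC.
have hu i t : 0 <= t <= T -> [/\ Hs s (u i t), Hs s (ut i t) & Hs s (utt i t)].
  by move=> tT; have [h _ _ _] := hC i; apply: h; rewrite in_itv.
have u1 i t (tT : 0 <= t <= T) : Hs s (u i t) by case: (hu i t tT).
have u2 i t (tT : 0 <= t <= T) : Hs s (ut i t) by case: (hu i t tT).
have u3 i t (tT : 0 <= t <= T) : Hs s (utt i t) by case: (hu i t tT).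
have d1 i := (Hs_is_deriveP (u1 i) (u2 i)).1 (let: And4 _ h _ _ := hC i in h).
have d2 i := (Hs_is_deriveP (u2 i) (u3 i)).1 (let: And4 _ _ h _ := hC i in h).
have c3 i := (Hs_continuousP (u3 i)).1 (let: And4 _ _ _ h := hC i in h).
have e1 : forall t, 0 <= t <= T -> in_Hs (phase_curve u ut t).
  by move=> t tT [[] i]; rewrite /phase_curve/=; [exact: u2|exact: u1].
have e2 : forall t, 0 <= t <= T -> in_Hs (phase_curve ut utt t).
  by move=> t tT [[] i]; rewrite /phase_curve/=; [exact: u3|exact: u2].
have dX : forall t, 0 <= t <= T ->
    curve_derivative snorm T (phase_curve u ut) t (phase_curve ut utt t).
  by move=> t tT; apply/curve_derivativeP => -[[] i]; [exact: d2|exact: d1].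
split=> //; apply/curve_continuousP => -[[] i] t tT e e0; rewrite /phase_curve/=; first exact: c3.
have [d d0 hd] := curve_derivative_continuous in_HsD in_HsZ snorm_ge0 snormD snormZ e1 (e2 t tT) tT (dX t tT) e0.
exists d => // t' t'T t'd; apply: le_trans (hd t' t'T t'd).
exact: (hnorm_le_snorm (phase_curve u ut t' - phase_curve u ut t) (true, i)).
Qed.

Lemma C2_Hs_of_curve T (X Z : R -> state) : (forall t, 0 <= t <= T -> in_Hs (X t)) ->
  (forall t, 0 <= t <= T -> in_Hs (Z t)) ->
  (forall t i, Z t (false, i) = X t (true, i)) ->
  (forall t, 0 <= t <= T -> curve_derivative snorm T X t (Z t)) -> curve_continuous snorm T Z ->
  forall i, C2_Hs s T (fun t => X t (false, i)) (fun t => X t (true, i)) (fun t => Z t (true, i)).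
Proof.
move=> hX hZ ZX dX cZ i; split.
- by move=> t; rewrite in_itv/= => tT; split; [exact: hX|exact: hX|exact: hZ].
- apply/Hs_is_deriveP => [t tT|t tT|t tT]; [exact: hX|exact: hX|].
  by have := (curve_derivativeP _ _ _ _).1 (dX t tT) (false, i); rewrite ZX.
- apply/Hs_is_deriveP => [t tT|t tT|t tT]; [exact: hX|exact: hZ|].
  exact: (curve_derivativeP _ _ _ _).1 (dX t tT) (true, i).
- by apply/Hs_continuousP => [t tT|]; [exact: hZ|exact: (curve_continuousP _ _).1 cZ (true, i)].
Qed.

End StateSpace.

(** * Well-posedness *)

Section CauchyProblem.
Context {R : realType}.
Variables (s : R) (C : 'I_2 -> R) (beta : 'I_2 -> R -> R) (g : 'I_2 -> R * R -> R).
Hypotheses (s2 : 2^-1 < s) (C0 : forall i, 0 <= C i) (b1 : forall i, L1 (beta i)).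
Hypothesis bC : forall i xi, (xi ^+ 2) ^+ 2 * sqnormc (fourier (beta i) xi) <= C i ^+ 2.
Hypotheses (gS : forall i, smooth2 (g i)) (g0 : forall i, g i (0, 0) = 0).
Let s0 : 0 <= s. Proof. by apply: le_trans (ltW s2); rewrite invr_ge0. Qed.
Local Notation state := ((bool * 'I_2)%type -> R -> R).
Implicit Types (z w : state) (t T : R).
Local Notation E := (@in_Hs R s).
Local Notation p := (@snorm R s).

Definition forcing (i : 'I_2) z : R -> R :=
  fun x => z (false, i) x + g i (z (false, 0) x, z (false, 1) x).

Lemma state_ball z (M : R) j : 0 <= M -> E z -> p z <= M -> hs_ball s (M ^+ 2) (z j).
Proof.
move=> M0 hz zM; apply/(Hs_ball _ _ M0); split => //.
by apply: le_trans zM; exact: hnorm_le_snorm.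
Qed.

Lemma forcing_Hs i z : E z -> Hs s (forcing i z).
Proof.
move=> hz; have M0 := snorm_ge0 s z; have ball j := state_ball j M0 hz (lexx _).
have [K K0 hK] := composition s2 (gS i) (sqr_ge0 (p z)).
have zz := hs_ball0 s (sqr_ge0 (p z)).
have gL := comp_L2 s2 (gS i) (ball (false, 0)) (ball (false, 1)) zz zz.
have gK := hK _ _ (ball (false, 0)) (ball (false, 1)).
have gH : Hs s (fun x => g i (z (false, 0) x, z (false, 1) x) - g i (0, 0)).
  by apply/HsP; split => //; apply: (le_lt_trans gK); rewrite ltry.
have [h _] := HsD (hz (false, i)) gH.
by move: h; congr (Hs s _); apply: funext => x; rewrite g0 subr0.
Qed.

Lemma forcing_lipschitz i (rho : R) : 0 <= rho -> exists2 L : R, 0 <= L & forall z w,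
  E z -> E w -> p z <= rho -> p w <= rho ->
  hnorm s (fun x => forcing i z x - forcing i w x) <= L * p (z - w).
Proof.
move=> r0; have [L L0 hL] := comp_lipschitz_self s2 (composition s2) (gS i) (sqr_ge0 rho).
exists (1 + Num.sqrt L * 2); first by rewrite addr_ge0// mulr_ge0// sqrtr_ge0.
move=> z w hz hw zr wr; have bz j := state_ball j r0 hz zr; have bw j := state_ball j r0 hw wr.
pose G x := g i (z (false, 0) x, z (false, 1) x) - g i (w (false, 0) x, w (false, 1) x).
pose d := p (z - w); have d0 : 0 <= d by exact: snorm_ge0.
have M0 : 0 <= Num.sqrt L * 2 * d by rewrite !mulr_ge0// sqrtr_ge0.
have dj j : (hs s (fun x => z j x - w j x)%R <= (d ^+ 2)%:E)%E.
  rewrite (hsK (HsB (hz j) (hw j))) lee_fin ler_sqr ?nnegrE ?hnorm_ge0//.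
  exact: (hnorm_le_snorm s (z - w) j).
have hG : hs_ball s ((Num.sqrt L * 2 * d) ^+ 2) G.
  split.
    exact: (comp_L2 s2 (gS i) (bz (false, 0)) (bz (false, 1)) (bw (false, 0)) (bw (false, 1))).
  apply: (le_trans (hL _ _ _ _ (bz (false, 0)) (bz (false, 1)) (bw (false, 0)) (bw (false, 1)))).
  apply: (@le_trans _ _ (L%:E * (d ^+ 2 + d ^+ 2)%:E)%E).
    by apply: lee_wpmul2l; rewrite ?lee_fin// EFinD; apply: leeD; exact: dj.
  rewrite -EFinM lee_fin !exprMn sqr_sqrtr//.
  by have := mulr_ge0 L0 (sqr_ge0 d); move: (d ^+ 2) => q; lra.
have [GH Gn] := (Hs_ball _ _ M0).2 hG.
have [_ h] := HsD (HsB (hz (false, i)) (hw (false, i))) GH.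
rewrite (_ : (fun x => forcing i z x - forcing i w x) =
    (fun x => z (false, i) x - w (false, i) x + G x)); last first.
  by apply: funext => x; rewrite /forcing /G; ring.
apply: (le_trans h); rewrite mulrDl mul1r; apply: lerD => //.
exact: (hnorm_le_snorm s (z - w) (false, i)).
Qed.

(** The system in first-order form, for the state made of positions and velocities. *)
Definition field z : state :=
  fun j => if j.1 then conv_dd (beta j.2) (forcing j.2 z) else z (true, j.2).

Lemma field_Hs z : E z -> E (field z).
Proof.
move=> hz [[] i]; rewrite /field/=; last exact: hz.
exact: (Hs_conv_dd s2 (C0 i) (b1 i) (bC i) (forcing_Hs i hz)).
Qed.

(** Velocities enter linearly; in the other components the Lipschitz bound for composition
    is followed by the bounded operator [conv_dd]. *)
Lemma field_lipschitz (rho : R) : 0 <= rho -> exists2 L : R, 0 <= L & forall z w,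
  E z -> E w -> p z <= rho -> p w <= rho -> p (field z - field w) <= L * p (z - w).
Proof.
move=> r0.
have [L hL] := choice (fun i => let: ex_intro2 d h1 h2 := forcing_lipschitz i r0 in ex_intro _ d (conj h1 h2)).
have S0 i : 0 <= C i * L i by rewrite mulr_ge0//; case: (hL i).
pose K := 1 + \sum_i C i * L i.
have K0 : 0 <= K by rewrite addr_ge0//; apply: sumr_ge0.
exists (4 * K); first by rewrite mulr_ge0.
move=> z w hz hw zr wr; rewrite -mulrA; apply: snorm_le => -[[] i].
  apply: (le_trans (conv_dd_lipschitz s2 (C0 i) (b1 i) (bC i) (forcing_Hs i hz) (forcing_Hs i hw))).
  apply: (le_trans (ler_wpM2l (C0 i) ((hL i).2 z w hz hw zr wr))).
  rewrite mulrA; apply: ler_wpM2r; first exact: snorm_ge0.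
  by rewrite /K (bigD1 i)//= addrCA lerDl addr_ge0//; apply: sumr_ge0.
apply: (le_trans (hnorm_le_snorm s (z - w) (true, i))).
rewrite -[leLHS]mul1r; apply: ler_wpM2r; first exact: snorm_ge0.
by rewrite lerDl; apply: sumr_ge0.
Qed.

Definition flow T (X : R -> state) := (forall t, 0 <= t <= T -> E (X t)) /\
  forall t, 0 <= t <= T -> curve_derivative p T X t (field (X t)).

Lemma flow_bounded T X : 0 <= T -> flow T X ->
  exists2 M : R, 0 <= M & forall t, 0 <= t <= T -> p (X t) <= M.
Proof.
move=> T0 [hX dX].
exact: (curve_bounded (@in_HsD R s) (@in_HsZ R s) (@snorm_ge0 R s) (@snormD R s) (@snormZ R s) T0 hX
  (fun t tT => field_Hs (hX t tT)) dX).
Qed.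

Lemma flow_gronwall (rho L : R) T X Y : 0 <= T -> 0 <= L ->
  (forall z w, E z -> E w -> p z <= rho -> p w <= rho -> p (field z - field w) <= L * p (z - w)) ->
  flow T X -> flow T Y ->
  (forall t, 0 <= t <= T -> p (X t) <= rho) -> (forall t, 0 <= t <= T -> p (Y t) <= rho) ->
  forall t, 0 <= t <= T -> p (X t - Y t) <= p (X 0 - Y 0) * expR ((L + 1) * t).
Proof.
move=> T0 L0 fL [hX dX] [hY dY] rX rY.
apply: (gronwall (@in_HsD R s) (@in_HsZ R s) (@snorm_ge0 R s) (@snormD R s) (@snormZ R s) L0
  (fun z hz _ => field_Hs hz) fL T0 _ _ dX dY) => t tT; split; auto.
Qed.

(** No bound is assumed on the two curves: continuity on [0, T] bounds each, and then the field
    is Lipschitz on a ball containing both. *)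
Lemma flow_unique T X Y : 0 <= T -> flow T X -> flow T Y -> p (X 0 - Y 0) = 0 ->
  forall t, 0 <= t <= T -> p (X t - Y t) = 0.
Proof.
move=> T0 fX fY XY0 t tT.
have [M M0 hM] := flow_bounded T0 fX; have [N N0 hN] := flow_bounded T0 fY.
have r0 : 0 <= Num.max M N by rewrite le_max M0.
have [L L0 hL] := field_lipschitz r0.
have := flow_gronwall T0 L0 hL fX fY; rewrite XY0 => h.
apply/eqP; rewrite eq_le snorm_ge0 andbT -[leRHS](mul0r (expR ((L + 1) * t))); apply: h => // r rT.
  by rewrite le_max hM.
by rewrite le_max hN ?orbT.
Qed.

(** [L * T <= 1/2] and [T * F <= 1], where [F] bounds the field on the ball of radius
    [rho + 1]: a curve starting in the ball of radius [rho] cannot leave the larger one.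
    The time [T] depends only on [rho], which gives a uniform time near a datum. *)
Lemma flow_exists (rho : R) : 0 <= rho -> exists2 T : R, 0 < T & forall z, E z -> p z <= rho ->
  exists X, [/\ flow T X, p (X 0 - z) = 0 & forall t, 0 <= t <= T -> p (X t) <= rho + 1].
Proof.
move=> r0; have r1 : 0 <= rho + 1 by rewrite addr_ge0.
have [L L0 hL] := field_lipschitz r1.
have E0 z : E z -> E (0 : state) by move=> hz; have := in_HsZ 0 hz; rewrite scale0r.
have p0 z : E z -> p (0 : state) = 0 by move=> hz; rewrite -(scale0r z) snormZ// normr0 mul0r.
pose F := p (field 0) + L * (rho + 1).
have F0 : 0 <= F by rewrite addr_ge0 ?snorm_ge0// mulr_ge0.
have L1 : 0 < 2 * L + 1 by rewrite ltr_wpDl// mulr_ge0.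
have F1 : 0 < F + 1 by rewrite ltr_wpDl.
exists (Num.min (2 * L + 1)^-1 (F + 1)^-1); first by rewrite lt_min !invr_gt0 L1.
set T := Num.min _ _; move=> z hz zr.
have T0 : 0 < T by rewrite lt_min !invr_gt0 L1.
have LT : L * T <= 2^-1.
  apply: (@le_trans _ _ (L * (2 * L + 1)^-1)); first by apply: ler_wpM2l => //; rewrite ge_min lexx.
  by rewrite ler_pdivrMr//; lra.
have FT : rho + T * F <= rho + 1.
  rewrite lerD2l; apply: (@le_trans _ _ ((F + 1)^-1 * F)).
    by apply: ler_wpM2r => //; rewrite ge_min lexx orbT.
  by rewrite mulrC ler_pdivrMr// mul1r lerDl.
have fF w : E w -> p w <= rho + 1 -> p (field w) <= F.
  move=> hw wr; have h0 := E0 _ hz; apply: (le_trans (snorm_le_sub (field_Hs hw) (field_Hs h0))).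
  rewrite lerD2l; apply: (le_trans (hL _ _ hw h0 wr _)); first by rewrite (p0 _ hz).
  by rewrite subr0; exact: ler_wpM2l.
have [X [X0 XE dX]] := ode_existence (@in_HsD R s) (@in_HsZ R s) (@snormD R s) (@snormZ R s) L0
  (fun z hz _ => field_Hs hz) hL F0 T0 LT FT hz zr fF (@snorm_complete R s s0).
exists X; exact: (And3 (conj (fun t tT => (XE t tT).1) dX) X0 (fun t tT => (XE t tT).2)).
Qed.

Lemma field_curve_continuous T X : 0 <= T -> flow T X -> curve_continuous p T (fun t => field (X t)).
Proof.
move=> T0 fX; have [M M0 hM] := flow_bounded T0 fX; have [L L0 hL] := field_lipschitz M0.
case: (fX) => hX dX t tT e e0; have L1 : 0 < L + 1 by rewrite ltr_wpDl.
have [d d0 hd] := curve_derivative_continuous (@in_HsD R s) (@in_HsZ R s) (@snorm_ge0 R s)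
  (@snormD R s) (@snormZ R s) hX (field_Hs (hX t tT)) tT (dX t tT) (divr_gt0 e0 L1).
exists d => // t' t'T t'd; apply: (le_trans (hL _ _ (hX _ t'T) (hX _ tT) (hM _ t'T) (hM _ tT))).
have := hd t' t'T t'd; rewrite ler_pdivlMr// => h; apply: le_trans h.
by rewrite mulrC; apply: ler_wpM2l; [exact: snorm_ge0|rewrite lerDl].
Qed.

Definition data_state (phi psi : 'I_2 -> R -> R) : state :=
  fun j => if j.1 then psi j.2 else phi j.2.

Lemma data_state_Hs phi psi : Hs_data s phi psi -> E (data_state phi psi).
Proof. by move=> h [[] i]; rewrite /data_state/=; case: (h i). Qed.

Lemma data_distE phi psi phi' psi' : Hs_data s phi psi -> Hs_data s phi' psi' ->
  data_dist s phi psi phi' psi' = (p (data_state phi' psi' - data_state phi psi))%:E.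
Proof.
move=> h h'; rewrite snormE -sumEFin; apply: eq_bigr => i _; have [a b] := h i; have [a' b'] := h' i.
have e1 : Hs_norm s (phi' i \- phi i) =
  (hnorm s ((data_state phi' psi' - data_state phi psi) (false, i)))%:E := Hs_normK (HsB a' a).
have e2 : Hs_norm s (psi' i \- psi i) =
  (hnorm s ((data_state phi' psi' - data_state phi psi) (true, i)))%:E := Hs_normK (HsB b' b).
by rewrite e1 e2.
Qed.

Lemma flow_solution T X phi psi : 0 <= T -> flow T X -> Hs_data s phi psi ->
  p (X 0 - data_state phi psi) = 0 ->
  is_solution s T beta g phi psi (fun i t => X t (false, i)).
Proof.
move=> T0 fX hd X0; have [hX dX] := fX.
have TT : 0 <= (0 : R) <= T by rewrite lexx.
have e0 := snorm_eq0 s0 (hX 0 TT) (data_state_Hs hd) X0.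
exists (fun i t => X t (true, i)), (fun i t => field (X t) (true, i)) => i; split.
- have hZ t : 0 <= t <= T -> E (field (X t)) by move=> /hX; exact: field_Hs.
  exact: (C2_Hs_of_curve hX hZ (fun _ _ => erefl) dX (field_curve_continuous T0 fX)).
- exact: (e0 (false, i)).
- exact: (e0 (true, i)).
move=> t; rewrite in_itv/= => /andP[t0 tT]; have tT' : 0 <= t <= T by rewrite ltW.
by have [_ _] := conv_ddP s2 (b1 i) (bC i) (forcing_Hs i (hX t tT')).
Qed.

(** The equation holds in the weak sense for [t > 0] only. There [utt] is the field by
    uniqueness of weak derivatives, and at [t = 0] by continuity of both. *)
Lemma solution_flow T phi psi u : 0 < T -> Hs_data s phi psi -> is_solution s T beta g phi psi u ->
  exists X, [/\ flow T X, p (X 0 - data_state phi psi) = 0 & forall i t, X t (false, i) = u i t].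
Proof.
move=> T0 hd [ut [utt hs]].
have [hX hZ dX cZ] := phase_curve_derivative (fun i => let: And4 h _ _ _ := hs i in h).
set X := phase_curve u ut in hX dX; set Z := phase_curve ut utt in hZ dX cZ.
have TT : 0 <= (0 : R) <= T by rewrite lexx ltW.
have hf t : 0 <= t <= T -> E (field (X t)) by move=> tT; apply: field_Hs; exact: hX.
have null z w : E z -> E w -> (forall j, ae_eq lebesgue_measure setT (z j) (w j)) -> p (z - w) = 0.
  move=> hz hw zw; apply: snorm_null => j.
  exact: (hnorm_ae s (Hs_L2 (hz j)) (Hs_L2 (hw j)) (zw j)).
have pos t : 0 < t <= T -> p (Z t - field (X t)) = 0.
  move=> /andP[t0 tT]; have tT' : 0 <= t <= T by rewrite ltW.
  apply: null => [||[[] i]]; [exact: hZ|exact: hf| |exact: aeW].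
  have [_ _ wd1] := conv_ddP s2 (b1 i) (bC i) (forcing_Hs i (hX t tT')).
  have [_ _ _ /(_ t)] := hs i; rewrite in_itv/= t0 tT => /(_ isT) wd2.
  exact: (weak_derive_unique wd2 wd1 (Hs_L2 (hZ t tT' (true, i))) (Hs_L2 (hf t tT' (true, i)))).
have [M M0 hM] := curve_bounded (@in_HsD R s) (@in_HsZ R s) (@snorm_ge0 R s) (@snormD R s)
  (@snormZ R s) (ltW T0) hX hZ dX.
have [L L0 hL] := field_lipschitz M0.
have zero : p (Z 0 - field (X 0)) = 0.
  apply/eqP; rewrite eq_le snorm_ge0 andbT; apply/ler_addgt0Pr => e e0; rewrite add0r.
  have L1 : 0 < L + 1 by rewrite ltr_wpDl.
  have e2 : 0 < e / 2 by rewrite divr_gt0.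
  have [d1 d10 h1] := cZ 0 TT _ e2.
  have [d2 d20 h2] := curve_derivative_continuous (@in_HsD R s) (@in_HsZ R s) (@snorm_ge0 R s)
    (@snormD R s) (@snormZ R s) hX (hZ 0 TT) TT (dX 0 TT) (divr_gt0 e2 L1).
  pose t := Num.min T (Num.min d1 d2).
  have t0 : 0 < t by rewrite !lt_min T0 d10.
  have tT : t <= T by rewrite ge_min lexx.
  have tT' : 0 <= t <= T by rewrite ltW.
  have td1 : `|t - 0| <= d1 by rewrite subr0 gtr0_norm// !ge_min lexx !orbT.
  have td2 : `|t - 0| <= d2 by rewrite subr0 gtr0_norm// !ge_min lexx !orbT.
  have {}h1 := h1 t tT' td1; have {}h2 := h2 t tT' td2.
  apply: (le_trans (snorm_tri (hZ _ TT) (hZ _ tT') (hf _ TT))).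
  rewrite (snormBC (hZ _ TT) (hZ _ tT')) [leRHS]splitr; apply: lerD => //.
  apply: (le_trans (snorm_tri (hZ _ tT') (hf _ tT') (hf _ TT))).
  rewrite pos ?t0// add0r; apply: (le_trans (hL _ _ (hX _ tT') (hX _ TT) (hM _ tT') (hM _ TT))).
  move: h2; rewrite ler_pdivlMr// => h; apply: le_trans h.
  by rewrite mulrC; apply: ler_wpM2l; [exact: snorm_ge0|rewrite lerDl].
exists X; split => //.
  split=> // t tT; apply: (curve_derivative_eq (@in_HsD R s) (@in_HsZ R s) (@snormD R s) (@snormZ R s) tT hX (hZ t tT) (hf t tT) _ (dX t tT)).
  have [->//|t0] := eqVneq t 0; apply: pos.
  by case/andP: tT => t0' ->; rewrite lt_neqAle eq_sym t0 t0'.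
apply: null; [exact: hX|exact: data_state_Hs|].
by case=> [[] i]; case: (hs i).
Qed.

(** Gronwall controls positions and velocities, and the Lipschitz field then controls the
    second derivatives. *)
Lemma flow_C2_dependence (rho L : R) T X Y (e : R) i : 0 <= T -> 0 <= L ->
  (forall z w, E z -> E w -> p z <= rho -> p w <= rho -> p (field z - field w) <= L * p (z - w)) ->
  flow T X -> flow T Y ->
  (forall t, 0 <= t <= T -> p (X t) <= rho) -> (forall t, 0 <= t <= T -> p (Y t) <= rho) ->
  (L + 2) * (p (Y 0 - X 0) * expR ((L + 1) * T)) <= e ->
  C2_Hs_norm_le s T (fun t => Y t (false, i) \- X t (false, i)) e.
Proof.
move=> T0 L0 hL fX fY rX rY he.
have hX := fX.1; have dX := fX.2; have hY := fY.1; have dY := fY.2.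
have hfX t (tT : 0 <= t <= T) := field_Hs (hX t tT).
have hfY t (tT : 0 <= t <= T) := field_Hs (hY t tT).
exists (fun t => (Y t - X t) (true, i)), (fun t => (field (Y t) - field (X t)) (true, i)); split.
  apply: (@C2_Hs_of_curve _ s T (fun t => Y t - X t) (fun t => field (Y t) - field (X t))).
  - by move=> t tT; exact: in_HsB (hY t tT) (hX t tT).
  - by move=> t tT; exact: in_HsB (hfY t tT) (hfX t tT).
  - by [].
  - move=> t tT.
    exact: (curve_derivativeB (@in_HsD R s) (@in_HsZ R s) (@snormD R s) (@snormZ R s) tT hY hX (hfY t tT) (hfX t tT) (dY t tT) (dX t tT)).
  - exact: (curve_continuousB (@in_HsD R s) (@in_HsZ R s) (@snormD R s) (@snormZ R s) hfY hfX (field_curve_continuous T0 fY) (field_curve_continuous T0 fX)).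
move=> t; rewrite in_itv/= => tT.
have gr := flow_gronwall T0 L0 hL fY fX rY rX tT.
have gT : p (Y t - X t) <= p (Y 0 - X 0) * expR ((L + 1) * T).
  apply: (le_trans gr); apply: ler_wpM2l; first exact: snorm_ge0.
  by rewrite ler_expR; apply: ler_wpM2l; [rewrite addr_ge0|case/andP: tT].
have hW := in_HsB (hY t tT) (hX t tT); have hV := in_HsB (hfY t tT) (hfX t tT).
have fl := hL _ _ (hY t tT) (hX t tT) (rY t tT) (rX t tT).
have n1 := hnorm_le_snorm s (Y t - X t) (false, i).
have n2 := hnorm_le_snorm s (Y t - X t) (true, i).
have n3 := hnorm_le_snorm s (field (Y t) - field (X t)) (true, i).
have -> : (Y t (false, i) \- X t (false, i)) = (Y t - X t) (false, i) by [].
rewrite (Hs_normK (hW (false, i))) (Hs_normK (hW (true, i))) (Hs_normK (hV (true, i))).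
rewrite -!EFinD lee_fin; apply: le_trans he.
apply: (@le_trans _ _ ((L + 2) * p (Y t - X t))); last by apply: ler_wpM2l => //; rewrite addr_ge0.
apply: (le_trans (lerD (lerD n1 n2) (le_trans n3 fl))).
by move: (p (Y t - X t)) => q; lra.
Qed.

(** The field is only locally Lipschitz, so dependence on the data needs a common bound
    for all solutions with nearby data: by uniqueness each of them is the one built by
    [flow_exists], which stays in a fixed ball. *)
Lemma local_well_posedness phi psi : Hs_data s phi psi ->
  exists2 T : R, 0 < T & well_posed s T beta g phi psi.
Proof.
move=> hd; have Ez := data_state_Hs hd; set z0 := data_state phi psi in Ez.
have r0 : 0 <= p z0 + 1 by rewrite addr_ge0// snorm_ge0.
have [T T0 hT] := flow_exists r0; exists T => //; exists 1 => // phi1 psi1 hd1.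
rewrite (data_distE hd hd1) lte_fin -/z0 => near1; have T0' := ltW T0.
have TT : 0 <= (0 : R) <= T by rewrite lexx.
have Ez1 := data_state_Hs hd1; set z1 := data_state phi1 psi1 in Ez1 near1 *.
have z1r : p z1 < p z0 + 1 by apply: (le_lt_trans (snorm_le_sub Ez1 Ez)); rewrite ltrD2l.
have bound X z : E z -> p z <= p z0 + 1 -> flow T X -> p (X 0 - z) = 0 ->
    forall t, 0 <= t <= T -> p (X t) <= p z0 + 1 + 1.
  move=> hz zr fX X0 t tT; have [Y [fY Y0 rY]] := hT z hz zr.
  have hX := fX.1; have hY := fY.1.
  have XY0 : p (X 0 - Y 0) = 0.
    apply/eqP; rewrite eq_le snorm_ge0 andbT.
    by apply: (le_trans (snorm_tri (hX 0 TT) hz (hY 0 TT))); rewrite X0 add0r (snormBC hz (hY 0 TT)) Y0.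
  have := snorm_le_sub (hX t tT) (hY t tT); rewrite (flow_unique T0' fX fY XY0 tT) addr0.
  by move=> h; apply: (le_trans h); exact: rY.
split.
- have [X [fX X0 _]] := hT z1 Ez1 (ltW z1r).
  by exists (fun i t => X t (false, i)); exact: flow_solution.
- move=> u v hu hv i t; rewrite in_itv/= => tT.
  have [X [fX X0 Xu]] := solution_flow T0 hd1 hu; have [Y [fY Y0 Yv]] := solution_flow T0 hd1 hv.
  have hX := fX.1; have hY := fY.1.
  have XY0 : p (X 0 - Y 0) = 0.
    apply/eqP; rewrite eq_le snorm_ge0 andbT.
    by apply: (le_trans (snorm_tri (hX 0 TT) Ez1 (hY 0 TT))); rewrite X0 add0r (snormBC Ez1 (hY 0 TT)) Y0.
  rewrite -Xu -Yv.
  exact: (snorm_eq0 s0 (hX t tT) (hY t tT) (flow_unique T0' fX fY XY0 tT)).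
move=> e e0; have [L L0 hL] := field_lipschitz (addr_ge0 r0 ler01).
pose K := (L + 2) * expR ((L + 1) * T).
have K0 : 0 < K by rewrite mulr_gt0 ?expR_gt0// ltr_wpDl.
exists (Num.min (p z0 + 1 - p z1) (e / K)); first by rewrite lt_min subr_gt0 z1r divr_gt0.
move=> phi2 psi2 u v hd2; rewrite (data_distE hd1 hd2) lte_fin -/z1 lt_min => /andP[near2 near3] hu hv i.
have Ez2 := data_state_Hs hd2; set z2 := data_state phi2 psi2 in Ez2 near2 near3 *.
have z2r : p z2 <= p z0 + 1.
  by have := snorm_le_sub Ez2 Ez1; move: near2; move: (p _) (p _) (p _) (p _) => a b c d; lra.
have [X [fX X0 Xu]] := solution_flow T0 hd1 hu; have [Y [fY Y0 Yv]] := solution_flow T0 hd2 hv.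
have -> : (fun t => v i t \- u i t) = (fun t => Y t (false, i) \- X t (false, i)).
  by apply: funext => t; rewrite Xu Yv.
apply: (flow_C2_dependence i T0' L0 hL fX fY (bound X z1 Ez1 (ltW z1r) fX X0) (bound Y z2 Ez2 z2r fY Y0)).
have hX0 := fX.1 0 TT; have hY0 := fY.1 0 TT.
have d0 : p (Y 0 - X 0) <= p (z2 - z1).
  apply: (le_trans (snorm_tri hY0 Ez2 hX0)); rewrite Y0 add0r.
  by apply: (le_trans (snorm_tri Ez2 Ez1 hX0)); rewrite (snormBC Ez1 hX0) X0 addr0.
have -> : (L + 2) * (p (Y 0 - X 0) * expR ((L + 1) * T)) = p (Y 0 - X 0) * K by rewrite /K; ring.
move: near3; rewrite ltr_pdivlMr// => /ltW; apply: le_trans.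
by apply: ler_wpM2r => //; exact: ltW.
Qed.

End CauchyProblem.

Theorem theorem2p4 (R : realType) (s : R) (r C : 'I_2 -> R)
    (beta : 'I_2 -> R -> R) (g : 'I_2 -> R * R -> R) (phi psi : 'I_2 -> R -> R)
    (hs : 1 / 2 < s)
    (hr : forall i, 2 <= r i)
    (hC : forall i, 0 < C i)
    (hbeta_int : forall i,
       (@lebesgue_measure R).-integrable setT (EFin \o beta i))
    (hbeta : forall i (xi : R),
       0 <= fourier (beta i) xi <= (C i * (1 + xi ^+ 2) `^ (- r i / 2))%:C)
    (hg_smooth : forall i, smooth2 (g i))
    (hg0 : forall i, g i (0, 0) = 0)
    (hg_exact : forall p, 'D_(0, 1) (g 0) p = 'D_(1, 0) (g 1) p)
    (hphi : forall i, Hs s (phi i))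
    (hpsi : forall i, Hs s (psi i)) :
  exists2 T : R, 0 < T & well_posed s T beta g phi psi.
Proof.
have s2 : 2^-1 < s by move: hs; rewrite div1r.
apply: (local_well_posedness s2 (fun i => ltW (hC i)) hbeta_int _ hg_smooth hg0).
  by move=> i xi; exact: kernel_decay (hr i) (hC i) (hbeta i) xi.
by move=> i; split.
Qed.
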